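(* Consider the setting and asymptotic regime described in the context. Let $\lambda_1,\ldots,\lambda_T$ be the eigenvalues of $\frac1T\Sigma^{\top}\Sigma$ and define $\mu_n=\frac1T\sum_{i=1}^T\boldsymbol\delta_{\lambda_i}$ (with $\boldsymbol\delta_x$ the Dirac mass at $x$). Then, for every bounded continuous function $f$, with probability one, $$\int f\,d\mu_n-\int f\,d\bar\mu_n\to 0\quad\text{as } n\to\infty,$$ where $\bar\mu_n$ is the measure defined through its Stieltjes transform $m_{\bar\mu_n}(z)\equiv\int(t-z)^{-1}d\bar\mu_n(t)$ given, for $z\in\{w\in\mathbb{C}:\Im[w]>0\}$, by $$m_{\bar\mu_n}(z)=\frac1T\operatorname{tr}\left(\frac nT\frac{\Phi}{1+\delta_z}-zI_T\right)^{-1}$$ with $\delta_z$ the unique solution in $\{w\in\mathbb{C}:\Im[w]>0\}$ of $$\delta_z=\frac1T\operatorname{tr}\Phi\left(\frac nT\frac{\Phi}{1+\delta_z}-zI_T\right)^{-1}.$$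
   Context: Setting. $\varphi:\mathbb{R}\to\mathbb{R}$ is $\lambda_\varphi$-Lipschitz and $\sigma:\mathbb{R}\to\mathbb{R}$ is $\lambda_\sigma$-Lipschitz; both are applied entry-wise to vectors and matrices. $W=\varphi(\tilde W)\in\mathbb{R}^{n\times p}$, where $\tilde W\in\mathbb{R}^{n\times p}$ has i.i.d. $\mathcal N(0,1)$ entries (for all $n$ these are defined on a common probability space). $X\in\mathbb{R}^{p\times T}$ is deterministic. $\Sigma=\sigma(WX)\in\mathbb{R}^{n\times T}$. The matrix $\Phi\in\mathbb{R}^{T\times T}$ is $\Phi=\mathbb{E}[\sigma(w^{\top}X)^{\top}\sigma(w^{\top}X)]$, where $w=\varphi(\tilde w)\in\mathbb{R}^p$, $\tilde w\sim\mathcal N(0,I_p)$. Asymptotic regime. $n\to\infty$, with $p=p(n)$, $T=T(n)$, $X=X_n$ such that $0<\liminf_n\min\{p/n,T/n\}\le\limsup_n\max\{p/n,T/n\}<\infty$ and $\limsup_n\|X\|<\infty$ (operator norm), while $\sigma,\varphi$ (with $\lambda_\sigma,\lambda_\varphi>0$) are kept fixed.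
   Formalization: When Φ = 0 (for example σ ≡ 0) the equation for δ_z has only the solution 0, which is not in the open upper half-plane; in that case alone δ_z = 0 is accepted, so that the limiting measure is the Dirac mass at 0. *)

(* Defs.v *)
(* MathComp-Analysis; complex numbers are R[i] from mathcomp-real-closed. *)
From HB Require Import structures.
From mathcomp Require Import all_boot all_order all_algebra.
From mathcomp Require Import complex.
From mathcomp Require Import all_classical all_reals all_analysis.
Set Implicit Arguments.
Unset Strict Implicit.
Unset Printing Implicit Defensive.
Import Order.TTheory GRing.Theory Num.Theory.
Import numFieldNormedType.Exports.

Local Open Scope classical_set_scope.
Local Open Scope ring_scope.

Section gaussian_families.
Context d (Omega : measurableType d) (R : realType) (P : probability Omega R).

Definition mutually_independent (I : finType) (Y : I -> {RV P >-> R}) : Prop :=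
  forall (J : {set I}) (A : I -> set R),
    (forall i, i \in J -> measurable (A i)) ->
    P (\bigcap_(i in [set` J]) (Y i @^-1` A i)) =
    (\prod_(i in J) P (Y i @^-1` A i))%E.

Definition iid_std_normal (I : finType) (Y : I -> {RV P >-> R}) : Prop :=
  mutually_independent Y /\
  forall (i : I) (A : set R), measurable A ->
    distribution P (Y i) A = normal_prob 0 1 A.

End gaussian_families.

Section operator_norm.
Context {R : realType}.

Definition l2norm (n : nat) (v : 'cV[R]_n) : R :=
  Num.sqrt (\sum_i v i ord0 ^+ 2).

(* The norm `|A| of the library is the largest absolute value of an entry;
   this is the norm of A as an operator between Euclidean spaces. *)
Definition opnorm (m n : nat) (A : 'M[R]_(m, n)) : R :=
  sup [set l2norm (A *m v) | v in [set v : 'cV[R]_n | l2norm v <= 1]].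

End operator_norm.

Section feature_matrices.
Context d (Omega : measurableType d) (R : realType) (P : probability Omega R).

(* Sigma = sigma(W X), with W = phi(G), in which G collects the entries of the
   Gaussian matrix. *)
Definition feature_mx (sigma phi : R -> R) (n p T : nat) (X : 'M[R]_(p, T))
    (G : 'I_n * 'I_p -> {RV P >-> R}) (w : Omega) : 'M[R]_(n, T) :=
  map_mx sigma (map_mx phi (\matrix_(i, j) G (i, j) w) *m X).

Definition feature_row (sigma phi : R -> R) (p T : nat) (X : 'M[R]_(p, T))
    (g : 'I_p -> {RV P >-> R}) (w : Omega) : 'rV[R]_T :=
  map_mx sigma ((map_mx phi (\col_i g i w))^T *m X).

Definition feature_Phi (sigma phi : R -> R) (p T : nat) (X : 'M[R]_(p, T))
    (g : 'I_p -> {RV P >-> R}) : 'M[R]_T :=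
  \matrix_(i, j) fine 'E_P[fun w =>
    ((feature_row sigma phi X g w)^T *m feature_row sigma phi X g w) i j].

End feature_matrices.

Section spectral_measures.
Context {R : realType}.

Definition gram_mx (n T : nat) (S : 'M[R]_(n, T)) : 'M[R]_T :=
  T%:R^-1 *: (S^T *m S).

(* The entries of s are the eigenvalues of A, listed with multiplicity. *)
Definition is_spectrum (T : nat) (A : 'M[R]_T) (s : T.-tuple R) : Prop :=
  char_poly A = \prod_(x <- s) ('X - x%:P).

Definition esd (T : nat) (s : T.-tuple R) : {measure set R -> \bar R} :=
  mscale (T%:R^-1)%:nng (msum (fun k => \d_(nth (0 : R) s k)) T).

Definition stieltjes (mu : {measure set R -> \bar R}) (z : R[i]) : R[i] :=
  Complex (\int[mu]_t complex.Re ((Complex t 0 - z)^-1))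
          (\int[mu]_t complex.Im ((Complex t 0 - z)^-1)).

Definition Qbar (n T : nat) (Phi : 'M[R]_T) (z delta : R[i]) : 'M[R[i]]_T :=
  invmx ((n%:R / T%:R / (1 + delta)) *: map_mx (real_complex R) Phi - z%:M).

(* delta lies in the open upper half-plane and solves the fixed-point equation.
   If Phi = 0 the equation reads delta = 0, which is not in the open half-plane;
   that solution is then accepted. *)
Definition is_delta (n T : nat) (Phi : 'M[R]_T) (z delta : R[i]) : Prop :=
  (Phi != 0 -> 0 < complex.Im delta) /\
  delta = T%:R^-1 * \tr (map_mx (real_complex R) Phi *m Qbar n Phi z delta).

Definition is_mubar (n T : nat) (Phi : 'M[R]_T)
    (mu : {measure set R -> \bar R}) : Prop :=
  forall z : R[i], 0 < complex.Im z ->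
    exists2 delta : R[i], is_delta n Phi z delta &
      stieltjes mu z = T%:R^-1 * \tr (Qbar n Phi z delta).

End spectral_measures.

(* Main.v *)
Require Import Defs.
From HB Require Import structures.
From mathcomp Require Import all_boot all_order all_algebra.
From mathcomp Require Import complex.
From mathcomp Require Import spectral sesquilinear.
From mathcomp Require Import all_classical all_reals all_analysis.
From mathcomp Require Import measurable_realfun.
From mathcomp Require Import ring lra.
Set Implicit Arguments.
Unset Strict Implicit.
Unset Printing Implicit Defensive.
Import Order.TTheory GRing.Theory Num.Theory.
Import numFieldNormedType.Exports.

Local Open Scope classical_set_scope.
Local Open Scope ring_scope.

(** The measure [mubar n] is the weak limit of the atomic measures whose
    Stieltjes transforms come from iterating the fixed-point equation for delta
    from 0: each iterate is a finite sum of a_j/(l_j - z), because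
    1/(k/(1 + sum a_j/(l_j - z)) - z) is a corner of the resolvent of the
    rank-one perturbation of diag(0, l) by (sqrt k, sqrt a_j).

    The random side is handled at real points z = -s < 0 only. Write
    Q = (S^T S/T + s)^-1, where S has the centred rows of Sigma. The Gaussian
    Poincare inequality (Efron-Stein plus the one-dimensional case) shows that
    quadratic forms v^T A v of a centred row concentrate at tr(A Phi0), where
    Phi0 is the covariance, with the Lipschitz constant lsigma lphi |X|
    independent of n. Leave-one-out identities then show that
    alpha = E tr(Phi0 Q)/T nearly solves the fixed-point equation, which is
    stable; recentring, and replacing Phi0 by Phi, are rank-one perturbations
    that change traces of resolvents by O(1/s). Efron-Stein applied twice bounds the
    fourth moment of tr Q/T - E tr Q/T by O(n^-2), hence almost sure convergence
    of the resolvent integrals at s = 1 + i/(N+1). Partial fractions turn these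
    into polynomials in 1/(1 + t), and Weierstrass together with tightness
    gives all bounded continuous functions. *)

(** * Integrals against finite measures *)

(** Two obstacles shape the argument. The features are not centred, so [Phi] may have operator norm
    of order T (already when X = 0 and sigma 0 is nonzero), and estimates in its norm would not be
    uniform. The covariance has norm at most 8 (lsigma lphi K)^2, with K a bound for the norm of X;
    so the analysis is done for it and transferred by rank-one comparisons. Second, the complex
    equation is delicate near the real axis. At z = -s every quantity is nonnegative, all
    denominators 1 + x are at least 1, resolvents have norm at most 1/s, and stability is
    elementary: the difference quotient of the right-hand side f is at most f(a)/(1 + a), about a/(1
    + a) < 1 near a fixed point. The complex equation serves only to characterise [mubar n]; one
    sequence of atomic measures, read in the upper half-plane and at -s, links both without analytic
    continuation. Real s suffices because all measures live on [0, +oo[, where u = 1/(1 + t) is a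
    coordinate with values in ]0, 1]. The fourth moment is needed since differences of order 1/n for
    each row give a variance bound of order 1/n, which is not summable. *)

Notation rintegrable mu f := (mu.-integrable [set: _] (EFin \o f)).

Section finite_expectation.
Context d (T : measurableType d) (R : realType).
Variable mu : {finite_measure set T -> \bar R}.
Implicit Types f g : T -> R.

Lemma rintegrable_measurable f : rintegrable mu f -> measurable_fun setT f.
Proof. by move=> /measurable_int/measurable_EFinP. Qed.

Lemma rintegrable_bounded f (M : R) : measurable_fun setT f ->
  (forall x, `|f x| <= M) -> rintegrable mu f.
Proof.
move=> mf fM; apply: measurable_bounded_integrable => //.
  by rewrite -ge0_fin_numE // fin_num_measure.
exists M; split; first by rewrite num_real.
by move=> M' MM' x _ /=; rewrite (le_trans (fM x)) // ltW.
Qed.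

Lemma rintegrable_le f g : measurable_fun setT f ->
  (forall x, `|f x| <= g x) -> rintegrable mu g -> rintegrable mu f.
Proof.
move=> mf fg ig; apply: (le_integrable _ _ _ ig) => //; first exact/measurable_EFinP.
by move=> x _ /=; rewrite lee_fin (le_trans (fg x)) // ler_norm.
Qed.

Lemma rintegrable_cst c : rintegrable mu (fun=> c).
Proof. exact: finite_measure_integrable_cst. Qed.

Lemma rintegrableD f g : rintegrable mu f -> rintegrable mu g ->
  rintegrable mu (fun x => f x + g x).
Proof. by move=> hf hg; have := integrableD measurableT hf hg. Qed.

Lemma rintegrableB f g : rintegrable mu f -> rintegrable mu g ->
  rintegrable mu (fun x => f x - g x).
Proof. by move=> hf hg; have := integrableB measurableT hf hg. Qed.

Lemma rintegrableZ c f : rintegrable mu f -> rintegrable mu (fun x => c * f x).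
Proof. by move=> hf; have := integrableZl measurableT c hf. Qed.

Lemma rintegrable_norm f : rintegrable mu f -> rintegrable mu (fun x => `|f x|).
Proof. by move=> hf; have := integrable_norm hf. Qed.

Lemma rintegrable_sum I (s : seq I) (F : I -> T -> R) :
  (forall i, rintegrable mu (F i)) -> rintegrable mu (fun x => \sum_(i <- s) F i x).
Proof.
move=> h; elim: s => [|i s IH].
  by under eq_fun do rewrite big_nil; exact: rintegrable_cst.
by under eq_fun do rewrite big_cons; exact: rintegrableD.
Qed.

Lemma RintD f g : rintegrable mu f -> rintegrable mu g ->
  \int[mu]_x (f x + g x) = \int[mu]_x f x + \int[mu]_x g x.
Proof. by move=> hf hg; rewrite RintegralD. Qed.

Lemma RintB f g : rintegrable mu f -> rintegrable mu g ->
  \int[mu]_x (f x - g x) = \int[mu]_x f x - \int[mu]_x g x.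
Proof. by move=> hf hg; rewrite RintegralB. Qed.

Lemma RintZ c f : rintegrable mu f -> \int[mu]_x (c * f x) = c * \int[mu]_x f x.
Proof. by move=> hf; rewrite RintegralZl. Qed.

Lemma Rint_sum I (s : seq I) (F : I -> T -> R) : (forall i, rintegrable mu (F i)) ->
  \int[mu]_x (\sum_(i <- s) F i x) = \sum_(i <- s) \int[mu]_x F i x.
Proof.
move=> h; elim: s => [|i s IH].
  under eq_Rintegral do rewrite big_nil.
  by rewrite big_nil Rintegral_cst // mul0r.
under eq_Rintegral do rewrite big_cons.
by rewrite RintD //= ?IH ?big_cons //; exact: rintegrable_sum.
Qed.

Lemma Rint_le f g : rintegrable mu f -> rintegrable mu g ->
  (forall x, f x <= g x) -> \int[mu]_x f x <= \int[mu]_x g x.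
Proof. by move=> hf hg h; apply: le_Rintegral. Qed.

Lemma Rint_ge0 f : (forall x, 0 <= f x) -> 0 <= \int[mu]_x f x.
Proof. by move=> h; apply: Rintegral_ge0. Qed.

Lemma Rint_norm f : rintegrable mu f -> `|\int[mu]_x f x| <= \int[mu]_x `|f x|.
Proof. by move=> hf; apply: le_normr_Rintegral. Qed.

Lemma EFin_Rint f : rintegrable mu f -> (\int[mu]_x f x)%:E = (\int[mu]_x (f x)%:E)%E.
Proof. by move=> hf; rewrite fineK //; exact: integrable_fin_num. Qed.

Definition sqintegrable f := measurable_fun setT f /\ rintegrable mu (fun x => f x ^+ 2).

Lemma sqintegrableM f g : sqintegrable f -> sqintegrable g ->
  rintegrable mu (fun x => f x * g x).
Proof.
move=> [mf hf] [mg hg].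
apply: (rintegrable_le _ _ (rintegrableD hf hg)); first exact: measurable_funM.
move=> x; rewrite normrM -(real_normK (num_real (f x))) -(real_normK (num_real (g x))).
have := sqr_ge0 (`|f x| - `|g x|); have := normr_ge0 (f x); have := normr_ge0 (g x).
move: `|f x| `|g x| => a b; nra.
Qed.

Lemma sqintegrable_cst c : sqintegrable (fun=> c).
Proof. by split; [exact: measurable_cst|exact: rintegrable_cst]. Qed.

Lemma sqintegrable_int f : sqintegrable f -> rintegrable mu f.
Proof.
move=> hf; have := sqintegrableM hf (sqintegrable_cst 1).
by under eq_fun do rewrite mulr1.
Qed.

Lemma sqintegrableD f g : sqintegrable f -> sqintegrable g ->
  sqintegrable (fun x => f x + g x).
Proof.
move=> hf hg; have hfg := sqintegrableM hf hg; case: hf hg => mf hf [mg hg].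
split; first exact: measurable_funD.
under eq_fun do rewrite sqrrD mulr2n.
by do !apply: rintegrableD.
Qed.

Lemma sqintegrableZ c f : sqintegrable f -> sqintegrable (fun x => c * f x).
Proof.
move=> [mf hf]; split; first exact: measurable_funM.
under eq_fun do rewrite exprMn.
exact: rintegrableZ.
Qed.

Lemma sqintegrableB f g : sqintegrable f -> sqintegrable g ->
  sqintegrable (fun x => f x - g x).
Proof.
move=> hf /(sqintegrableZ (-1)) hg; have := sqintegrableD hf hg.
by under eq_fun do rewrite mulN1r.
Qed.

Lemma sqintegrable_sum I (s : seq I) (F : I -> T -> R) :
  (forall i, sqintegrable (F i)) -> sqintegrable (fun x => \sum_(i <- s) F i x).
Proof.
move=> h; elim: s => [|i s IH].
  by under eq_fun do rewrite big_nil; exact: sqintegrable_cst.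
by under eq_fun do rewrite big_cons; exact: sqintegrableD.
Qed.

Lemma sqintegrable_bounded f (M : R) : measurable_fun setT f ->
  (forall x, `|f x| <= M) -> sqintegrable f.
Proof.
move=> mf fM; split => //; apply: (@rintegrable_bounded _ (M ^+ 2)).
  exact: measurable_funX.
by move=> x; rewrite normrX ler_sqr ?nnegrE // (le_trans _ (fM x)).
Qed.

Lemma sqintegrable_le f g : measurable_fun setT f ->
  (forall x, `|f x| <= g x) -> sqintegrable g -> sqintegrable f.
Proof.
move=> mf fg [mg hg]; split => //; apply: (rintegrable_le _ _ hg).
  exact: measurable_funX.
by move=> x; rewrite normrX ler_sqr ?nnegrE // (le_trans _ (fg x)).
Qed.

End finite_expectation.

Section expectation.
Context d (T : measurableType d) (R : realType) (P : probability T R).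
Implicit Types f g : T -> R.

Lemma Rint_cst (c : R) : \int[P]_x c = c.
Proof.
rewrite Rintegral_cst //; have E : P [set: T] = 1%E := probability_setT P.
by transitivity (c * fine (P [set: T])); [by []|rewrite E /= mulr1].
Qed.

Lemma Rint_sqr_le f : sqintegrable P f -> (\int[P]_x f x) ^+ 2 <= \int[P]_x (f x ^+ 2).
Proof.
move=> hf; set m := \int[P]_x f x.
have hi := sqintegrable_int hf; case: hf => mf hf.
have := @Rint_ge0 _ _ _ P (fun x => (f x - m) ^+ 2) (fun=> sqr_ge0 _).
under eq_Rintegral do rewrite sqrrB mulr2n.
have h1 : rintegrable P (fun x => f x * m + f x * m).
  by apply: rintegrableD; under eq_fun do rewrite mulrC; exact: rintegrableZ.
have h0 : rintegrable P (fun=> m ^+ 2) by exact: rintegrable_cst.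
rewrite RintD //; last exact: rintegrableB.
rewrite RintB // RintD; try by under eq_fun do rewrite mulrC; exact: rintegrableZ.
under [X in _ - (X + _)]eq_Rintegral do rewrite mulrC.
under [X in _ - (_ + X)]eq_Rintegral do rewrite mulrC.
by rewrite RintZ // Rint_cst -/m; nra.
Qed.

Lemma Rint_norm_le_sqrt f (K : R) : sqintegrable P f -> \int[P]_x (f x ^+ 2) <= K ->
  \int[P]_x `|f x| <= Num.sqrt K.
Proof.
move=> hf hK; have K0 : 0 <= K by apply: le_trans hK; apply: Rint_ge0 => x; exact: sqr_ge0.
have I0 : 0 <= \int[P]_x `|f x| by exact: Rint_ge0.
rewrite -(ger0_norm I0) -sqrtr_sqr ler_sqrt //; apply: le_trans hK.
have hn : sqintegrable P (fun x => `|f x|).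
  case: hf => mf hf; split; first exact: measurableT_comp.
  by under eq_fun do rewrite real_normK ?num_real //.
apply: le_trans (Rint_sqr_le hn) _.
by under eq_Rintegral do rewrite real_normK ?num_real //.
Qed.

End expectation.

(** * Spectral theorem and atomic Stieltjes transforms *)

Section spectral_theorem.
Local Open Scope sesquilinear_scope.
Context {R : rcfType}.
Implicit Types (n : nat).
Local Notation C := R[i].
Local Notation toC := (real_complex R).

Definition psdmx n (A : 'M[R]_n) :=
  A^T = A /\ forall v : 'cV[R]_n, 0 <= (v^T *m A *m v) 0 0.

(** [A] is hermitian over [R[i]], so the unitary [V] is complex; only the eigenvalues are real. They
    are nonnegative since the i-th one is x^T A x + y^T A y, where x and y are the real and
    imaginary parts of row i of [V]. *)
Lemma psdmx_spectral n (A : 'M[R]_n) : psdmx A ->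
  exists (V : 'M[C]_n) (e : 'I_n -> R), [/\ V *m V^t* = 1%:M,
    (forall i, 0 <= e i) & map_mx toC A = V^t* *m diag_mx (\row_i toC (e i)) *m V].
Proof.
move=> [symA posA]; set B := map_mx toC A.
have hB : B \is hermsymmx.
  apply: realsym_hermsym.
    apply/is_hermitianmxP; rewrite expr0 scale1r map_mx_id //.
    by rewrite /B map_trmx symA.
  by apply/mxOverP => i j; rewrite mxE; apply/complex_realP; exists (A i j).
have /hermitian_normalmx/orthomx_spectralP := hB.
set V := spectralmx B; set D := spectral_diag B => Beq.
have Vu : V \is unitarymx := spectral_unitarymx B.
have VV : V *m V^t* = 1%:M by apply/unitarymxP.
rewrite invmx_unitary // in Beq.
have /mxOverP Dr := hermitian_spectral_diag_real hB.
have De i : D 0 i = toC (complex.Re (D 0 i)) by rewrite RRe_real.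
exists V, (fun i => complex.Re (D 0 i)); split => //; last first.
  rewrite {1}Beq; congr (_ *m diag_mx _ *m _).
  by apply/rowP => i; rewrite mxE -De.
move=> i.
have E : V *m B *m V^t* = diag_mx D.
  rewrite Beq !mulmxA VV mul1mx -mulmxA VV mulmx1 //.
have := congr1 (fun M : matrix _ n n => complex.Re (M i i)) E.
rewrite /= [in RHS]mxE eqxx mulr1n => <-.
pose x := \col_j complex.Re (V i j); pose y := \col_j complex.Im (V i j).
suff -> : complex.Re ((V *m B *m V^t*) i i) =
   (x^T *m A *m x) 0 0 + (y^T *m A *m y) 0 0 by rewrite addr_ge0 // posA.
rewrite !mxE raddf_sum -big_split /=; apply: eq_bigr => k _.
rewrite !mxE /= !mulr_suml !raddf_sum -big_split /=; apply: eq_bigr => l _.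
rewrite !mxE /=; case: (V i l) => a b; case: (V i k) => a' b' /=.
by rewrite !mulr0 !subr0; ring.
Qed.

Section resolvent.
Local Open Scope sesquilinear_scope.
Variables (n : nat) (A : 'M[R]_n) (V : 'M[C]_n) (e : 'I_n -> R).
Hypothesis VV : V *m V^t* = 1%:M.
Hypothesis AE : map_mx toC A = V^t* *m diag_mx (\row_i toC (e i)) *m V.

Let VV' : V^t* *m V = 1%:M. Proof. exact/mulmx1C/VV. Qed.

Lemma spectral_affineE (a z : C) : a *: map_mx toC A - z%:M =
  V^t* *m diag_mx (\row_i (a * toC (e i) - z)) *m V.
Proof.
have -> : diag_mx (\row_i (a * toC (e i) - z)) =
    a *: diag_mx (\row_i toC (e i)) - z%:M.
  apply/matrixP => i j; rewrite !mxE; case: eqVneq => [->|] /=.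
    by rewrite !mulr1n.
  by rewrite !mulr0n mulr0 subr0.
rewrite mulmxBr mulmxBl -scalemxAr -scalemxAl -AE; congr (_ - _).
by rewrite scalar_mxC -mulmxA VV' mulmx1.
Qed.

Lemma spectral_unitmx (a z : C) : (forall i, a * toC (e i) - z != 0) ->
  a *: map_mx toC A - z%:M \in unitmx /\
  invmx (a *: map_mx toC A - z%:M) =
  V^t* *m diag_mx (\row_i (a * toC (e i) - z)^-1) *m V.
Proof.
move=> nz; set B := V^t* *m diag_mx (\row_i _^-1) *m V.
have E : (a *: map_mx toC A - z%:M) *m B = 1%:M.
  rewrite spectral_affineE /B !mulmxA -[_ *m V *m V^t*]mulmxA VV mulmx1.
  rewrite -[V^t* *m _ *m diag_mx _]mulmxA mulmx_diag.
  rewrite (_ : (\row_i _) = const_mx 1) ?diag_const_mx ?mulmx1 ?VV' //.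
  by apply/rowP => i; rewrite !mxE divff.
have [U _] := mulmx1_unit E; split => //.
by rewrite -[B]mul1mx -(mulVmx U) -mulmxA E mulmx1.
Qed.

Lemma spectral_trace_resolvent (a z : C) : (forall i, a * toC (e i) - z != 0) ->
  \tr (invmx (a *: map_mx toC A - z%:M)) = \sum_i (a * toC (e i) - z)^-1.
Proof.
move=> /spectral_unitmx[_ ->]; rewrite mxtrace_mulC mulmxA VV mul1mx.
by rewrite mxtrace_diag; apply: eq_bigr => i _; rewrite mxE.
Qed.

Lemma spectral_trace_mul_resolvent (a z : C) :
  (forall i, a * toC (e i) - z != 0) ->
  \tr (map_mx toC A *m invmx (a *: map_mx toC A - z%:M)) =
  \sum_i toC (e i) * (a * toC (e i) - z)^-1.
Proof.
move=> /spectral_unitmx[_ ->]; rewrite AE !mulmxA -[_ *m V *m V^t*]mulmxA VV mulmx1.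
rewrite mxtrace_mulC !mulmxA VV mul1mx mulmx_diag mxtrace_diag.
by apply: eq_bigr => i _; rewrite !mxE.
Qed.

Lemma spectral_char_poly : char_poly A = \prod_i ('X - (e i)%:P).
Proof.
apply: (map_poly_inj toC); rewrite map_char_poly AE.
rewrite rmorph_prod /=.
transitivity (char_poly (diag_mx (\row_i toC (e i)))).
  rewrite /char_poly /char_poly_mx !map_mxM /=.
  set W := map_mx polyC V; set W' := map_mx polyC (V^t*).
  have WW : W' *m W = 1%:M by rewrite -map_mxM VV' map_mx1.
  have {1}-> : 'X%:M = W' *m 'X%:M *m W by rewrite -mulmxA -scalar_mxC mulmxA WW mul1mx.
  rewrite -mulmxBl -mulmxBr !det_mulmx mulrAC -det_mulmx WW det1 mul1r.
  by [].

rewrite /char_poly (_ : char_poly_mx _ = diag_mx (\row_i ('X - (toC (e i))%:P))).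
  by rewrite det_diag; apply: eq_bigr => i _; rewrite mxE rmorphB /= map_polyX map_polyC.
apply/matrixP => i j; rewrite !mxE; case: eqVneq => [->|] //=.
by rewrite mulr0n subr0.
Qed.

Lemma spectral_neq0 : A != 0 -> (forall i, 0 <= e i) -> exists i, 0 < e i.
Proof.
move=> A0 e0; apply/existsP; apply: contraNT A0; rewrite negb_exists => /forallP h.
apply/eqP; suff : map_mx toC A = 0.
  move=> A0; apply/matrixP => i j; apply: (@complexI R).
  by have := congr1 (fun M : matrix _ n n => M i j) A0; rewrite !mxE.
rewrite AE (_ : \row_i toC (e i) = 0).
  by rewrite (_ : diag_mx 0 = 0) ?mulmx0 ?mul0mx //; apply/matrixP => i j; rewrite !mxE mul0rn.
apply/rowP => i; rewrite !mxE; have := h i; rewrite -leNgt => ei.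
by have /eqP -> : e i == 0 by rewrite eq_le ei e0.
Qed.

(** The squared moduli of column i of [V] are the masses of the spectral measure at the i-th basis
    vector; a diagonal entry of a resolvent thus becomes an atomic Stieltjes transform. *)
Lemma spectral_diag_entry i (f : 'I_n -> C) :
  (V^t* *m diag_mx (\row_j f j) *m V) i i =
  \sum_j toC (complex.Re (V j i) ^+ 2 + complex.Im (V j i) ^+ 2) * f j.
Proof.
rewrite mxE; apply: eq_bigr => j _; rewrite mxE (bigD1 j) //= big1 ?addr0.
  rewrite !mxE eqxx mulr1n mulrAC; congr (_ * _).
  case: (V j i) => x y /=.
  by apply/eqP; rewrite eq_complex /=; apply/andP; split; apply/eqP; rewrite ?mulr0; ring.
by move=> k kj; rewrite !mxE (negPf kj) mulr0n mulr0.
Qed.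

End resolvent.

(** With nonnegative atoms, the atomic formulas hold off [0, +oo[. This one condition covers the
    upper half-plane and the negative reals, the two places where they are read later. *)
Definition off_axis (z : C) := forall t : R, 0 <= t -> toC t - z != 0.

Lemma rank_one_psdmx n (D u : 'I_n -> R) : (forall i, 0 <= D i) ->
  psdmx (\matrix_(i, j) (D i *+ (i == j) + u i * u j)).
Proof.
move=> D0; split.
  apply/matrixP => i j; rewrite !mxE eq_sym (mulrC (u j)); congr (_ + _).
  by case: eqVneq => // ->.
move=> v.
have -> : (v^T *m \matrix_(i, j) (D i *+ (i == j) + u i * u j) *m v) 0 0 =
   \sum_i D i * v i 0 ^+ 2 + (\sum_i u i * v i 0) ^+ 2.
  rewrite mxE; under eq_bigr => j _.
    rewrite !mxE; under eq_bigr => i _ do rewrite !mxE mulrDr.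
    rewrite big_split /= (bigD1 j) //= big1 ?addr0; last first.
      by move=> i ij; rewrite (negPf ij) mulr0n mulr0.
    rewrite eqxx mulr1n mulrDl.
    over.
  rewrite big_split /= ; congr (_ + _); last first.
    rewrite expr2 mulr_sumr; apply: eq_bigr => j _.
    rewrite !mulr_suml; apply: eq_bigr => i _; ring.
  by apply: eq_bigr => j _; rewrite !expr2; ring.
rewrite addr_ge0 ?sqr_ge0 // sumr_ge0 // => i _.
by rewrite mulr_ge0 // sqr_ge0.
Qed.

(** The diagonal entry i of the resolvent of diag(D) + u u^T is computed twice: spectrally, with
    masses [w] and atoms [m], and by the Sherman-Morrison formula. Mass 1 and mean D_i + u_i^2 are
    the entries (i, i) of the identity and of the matrix itself. *)
Lemma rank_one_spectral n (D u : 'I_n -> R) : (forall i, 0 <= D i) ->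
  (forall z, off_axis z -> 1 + \sum_j toC (u j) ^+ 2 / (toC (D j) - z) != 0) /\
  forall i, exists w m : 'I_n -> R, [/\ forall j, 0 <= w j, forall j, 0 <= m j,
    \sum_j w j = 1, \sum_j w j * m j = D i + u i ^+ 2 &
    forall z, off_axis z -> \sum_j toC (w j) / (toC (m j) - z) =
      (toC (D i) - z)^-1 - (toC (u i) / (toC (D i) - z)) ^+ 2 /
      (1 + \sum_j toC (u j) ^+ 2 / (toC (D j) - z))].
Proof.
move=> D0; have psdM := rank_one_psdmx u D0; set M := (\matrix_(i, j) _) in psdM.
have [V [e [VV e0 ME]]] := psdmx_spectral psdM.
have main z : off_axis z -> let q := \sum_j toC (u j) ^+ 2 / (toC (D j) - z) in
    1 + q != 0 /\ forall i, invmx (1 *: map_mx toC M - z%:M) i i =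
      (toC (D i) - z)^-1 - (toC (u i) / (toC (D i) - z)) ^+ 2 / (1 + q).
  move=> zoff q.
  have [|Munit _] := spectral_unitmx VV ME (a := 1) (z := z).
    by move=> i; rewrite mul1r; exact: zoff.
  set N := 1 *: map_mx toC M - z%:M in Munit *.
  pose U : 'cV[C]_n := \col_i toC (u i).
  pose S := diag_mx (\row_i (toC (D i) - z)^-1).
  pose S' := diag_mx (\row_i (toC (D i) - z)).
  have NE : N = S' + U *m U^T.
    apply/matrixP => i j; rewrite /N scale1r !mxE big_ord1 !mxE !raddfD /= rmorphM.
    rewrite raddfMn /= addrAC; congr (_ + _).
    by case: eqVneq => [->|]; rewrite ?mulr1n ?mulr0n ?subr0.
  have SS' : S' *m S = 1%:M.
    rewrite mulmx_diag (_ : (\row_i _) = const_mx 1) ?diag_const_mx //.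
    by apply/rowP => i; rewrite !mxE divff // zoff.
  have UU : U^T *m S *m U = q%:M.
    apply/matrixP => i j; rewrite !ord1 mxE [in RHS]mxE eqxx mulr1n.
    apply: eq_bigr => k _; rewrite mul_mx_diag !mxE expr2; ring.
  have NSU : N *m (S *m U) = (1 + q) *: U.
    rewrite NE mulmxDl mulmxA SS' mul1mx -!mulmxA [U^T *m _]mulmxA UU mul_mx_scalar.
    by rewrite scalerDl scale1r.
  (* If 1 + q vanished, [N] would kill [S *m U], so U = 0, hence q = 0 and 1 = 0. *)
  have q1 : 1 + q != 0.
    apply/eqP => q0; have /eqP : S *m U = 0.
      by rewrite -[LHS]mul1mx -(mulVmx Munit) -mulmxA NSU q0 scale0r mulmx0.
    move=> /eqP SU0; have U0 : U = 0 by rewrite -[U]mul1mx -SS' -mulmxA SU0 mulmx0.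
    move: q0; rewrite /q big1 ?addr0 => [/eqP|j _]; first by rewrite oner_eq0.
    have := congr1 (fun X : 'cV_n => X j 0) U0; rewrite !mxE => ->.
    by rewrite expr0n mul0r.
  split => // i.
  have XU : invmx N *m U = (1 + q)^-1 *: (S *m U).
    apply: (can_inj (mulKmx Munit)); rewrite mulmxA mulmxV // mul1mx -scalemxAr NSU.
    by rewrite scalerA mulVf // scale1r.
  have -> : invmx N = S - (1 + q)^-1 *: (S *m U) *m (U^T *m S).
    rewrite -[LHS]mulmx1 -SS' mulmxA (_ : S' = N - U *m U^T).
      by rewrite mulmxBr mulVmx // mulmxBl mul1mx mulmxA XU -!scalemxAl !mulmxA.
    by rewrite NE addrK.
  rewrite !mxE eqxx mulr1n big_ord1 mul_diag_mx mul_mx_diag !mxE; congr (_ - _).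
  by rewrite expr2; ring.
split=> [z zoff|i]; first by have [] := main z zoff.
exists (fun j => complex.Re (V j i) ^+ 2 + complex.Im (V j i) ^+ 2), e.
split => //.
- by move=> j; rewrite addr_ge0 ?sqr_ge0.
- apply: (@complexI R); rewrite rmorph1 rmorph_sum /=.
  have := spectral_diag_entry V i (fun=> 1).
  rewrite (_ : (\row_j 1) = const_mx 1) ?diag_const_mx ?mulmx1; last first.
    by apply/rowP => j; rewrite !mxE.
  rewrite (mulmx1C VV) mxE eqxx mulr1n => ->.
  by apply: eq_bigr => j _; rewrite mulr1.
- apply: (@complexI R); rewrite rmorph_sum /=.
  have := spectral_diag_entry V i (fun j => toC (e j)); rewrite -ME !mxE eqxx mulr1n.
  by rewrite -expr2 => ->; apply: eq_bigr => j _; rewrite rmorphM.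
move=> z zoff; have [_ <-] := main z zoff.
have [|_ ->] := spectral_unitmx VV ME (a := 1) (z := z).
  by move=> j; rewrite mul1r zoff.
rewrite spectral_diag_entry; apply: eq_bigr => j _; by rewrite mul1r.
Qed.

(** Index [ord0] is the corner. Mass and mean are recorded because the Helly selection needs
    tightness, and the mean [c] does not depend on the atoms one starts from. *)
Lemma atomic_step k (a l : 'I_k -> R) (c : R) :
  (forall i, 0 <= a i) -> (forall i, 0 <= l i) -> 0 <= c ->
  exists b m : 'I_k.+1 -> R, [/\ forall j, 0 <= b j, forall j, 0 <= m j,
    \sum_j b j = 1, \sum_j b j * m j = c &
    forall z, off_axis z -> let q := \sum_j toC (a j) / (toC (l j) - z) in
      1 + q != 0 /\
      \sum_j toC (b j) / (toC (m j) - z) = (toC c / (1 + q) - z)^-1].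
Proof.
move=> a0 l0 c0.
have sq x : 0 <= x -> toC (Num.sqrt x) ^+ 2 = toC x.
  by move=> x0; rewrite -rmorphXn /= sqr_sqrtr.
pose D (i : 'I_k.+1) := if unlift ord0 i is Some j then l j else 0.
pose u (i : 'I_k.+1) := if unlift ord0 i is Some j then Num.sqrt (a j) else Num.sqrt c.
have [|H1 H2] := rank_one_spectral (D := D) u.
  by move=> i; rewrite /D; case: unliftP.
(* The perturbation without the corner coordinate is considered only for the nonvanishing of 1 +
   q. *)
have [H3 _] := rank_one_spectral (fun j => Num.sqrt (a j)) l0.
have [b [m [b0 m0 sb sbm E]]] := H2 ord0.
exists b, m; split => //.
  by rewrite sbm /D /u !unlift_none add0r sqr_sqrtr.
move=> z zoff q; have := H1 z zoff; have := H3 z zoff.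
have -> : \sum_j toC (Num.sqrt (a j)) ^+ 2 / (toC (l j) - z) = q.
  by apply: eq_bigr => j _; rewrite sq.
rewrite (E z zoff) big_ord_recl /D /u unlift_none sq // rmorph0 sub0r.
under eq_bigr => j _ do rewrite liftK sq //.
rewrite -/q.
move=> q1 q2; split => //.
have z0 : z != 0 by have := zoff 0 (lexx _); rewrite rmorph0 sub0r oppr_eq0.
have sc : toC (Num.sqrt c) ^+ 2 = toC c by exact: sq.
rewrite expr_div_n sc.
have q3 : toC c - z * (1 + q) != 0.
  apply: contraNneq q2 => h; apply/eqP; apply: (mulfI z0); rewrite mulr0.
  by rewrite -[RHS]oppr0 -h; field; rewrite ?oppr_eq0 ?z0.
field.
by apply/and3P; split=> //; rewrite mulNr; exact: q3.
Qed.

End spectral_theorem.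

(** * The complex fixed-point equation *)

(** Lagrange's identity: twice the gap is the double sum of the squared 2 x 2 minors. *)
Lemma cauchy_schwarz_sum (R : realFieldType) (I : finType) (x y : I -> R) :
  (\sum_i x i * y i) ^+ 2 <= (\sum_i x i ^+ 2) * (\sum_i y i ^+ 2).
Proof.
rewrite -subr_ge0 -(pmulr_rge0 _ (ltr0n R 2)).
suff -> : 2%:R * ((\sum_i x i ^+ 2) * (\sum_i y i ^+ 2) - (\sum_i x i * y i) ^+ 2) =
    \sum_i \sum_j (x i * y j - x j * y i) ^+ 2.
  by do 2!(apply: sumr_ge0 => ? _); rewrite sqr_ge0.
have E1 : \sum_i \sum_j x i ^+ 2 * y j ^+ 2 = (\sum_i x i ^+ 2) * (\sum_i y i ^+ 2).
  by rewrite mulr_suml; apply: eq_bigr => i _; rewrite mulr_sumr.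
have E2 : \sum_i \sum_j x i * y i * (x j * y j) = (\sum_i x i * y i) ^+ 2.
  by rewrite expr2 mulr_suml; apply: eq_bigr => i _; rewrite mulr_sumr.
have E3 : \sum_i \sum_j x j ^+ 2 * y i ^+ 2 = (\sum_i x i ^+ 2) * (\sum_i y i ^+ 2).
  by rewrite exchange_big E1.
rewrite mulrBr (_ : 2%:R * _ = \sum_i \sum_j x i ^+ 2 * y j ^+ 2 +
   \sum_i \sum_j x j ^+ 2 * y i ^+ 2); last by rewrite E1 E3; ring.
rewrite -E2 mulr_sumr -big_split -sumrB; apply: eq_bigr => i _ /=.
rewrite mulr_sumr -big_split -sumrB; apply: eq_bigr => j _ /=; ring.
Qed.

Lemma cvg_norm_sub (R : realType) (u : R^nat) (l : R) :
  u @ \oo --> l -> `|u n - l| @[n --> \oo] --> 0.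
Proof.
move=> h; have := cvg_norm (cvgB h (cvg_cst l)).
by rewrite subrr normr0; apply.
Qed.

Lemma cvg_geometric_telescope (R : realType) (v : R^nat) (c r : R) :
  0 <= c -> 0 <= r < 1 -> (forall n, `|v n.+1 - v n| <= c * r ^+ n) ->
  exists l : R, v @ \oo --> l.
Proof.
move=> c0 /andP[r0 r1] h.
have cv : cvgn (series (telescope v)).
  apply: normed_cvg; apply: (@series_le_cvg _ _ (geometric c r)).
  - by move=> n /=.
  - by move=> n /=; rewrite mulr_ge0 // exprn_ge0.
  - by move=> n /=; exact: h.
  - by apply: is_cvg_geometric_series; rewrite ger0_norm.
exists (v 0%N + limn (series (telescope v))).
have E : v = cst (v 0%N) \+ series (telescope v).
  by apply/funext => n; rewrite {1}eq_sum_telescope.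
by rewrite {1}E; apply: cvgD => //; exact: cvg_cst.
Qed.

Section upper_half_plane.
Context {R : realType}.
Local Notation C := R[i].
Local Notation toC := (real_complex R).
Local Notation Re := (@complex.Re R).
Local Notation Im := (@complex.Im R).
Local Notation normc := Normc.normc.
Implicit Types (z delta x : C).

Lemma normc_sq x : normc x ^+ 2 = Re x ^+ 2 + Im x ^+ 2.
Proof. by case: x => a b /=; rewrite sqr_sqrtr // addr_ge0 ?sqr_ge0. Qed.

Lemma normc_ge0 x : 0 <= normc x.
Proof. by case: x => a b /=; rewrite sqrtr_ge0. Qed.

Lemma normc_gt0 x : x != 0 -> 0 < normc x.
Proof.
by move=> x0; rewrite lt_def normc_ge0 andbT; apply: contraNneq x0 => /Normc.eq0_normc ->.
Qed.

Lemma Im_le_normc x : `|Im x| <= normc x.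
Proof. by case: x => a b /=; rewrite -sqrtr_sqr ler_sqrt ?lerDr ?sqr_ge0 // addr_ge0 ?sqr_ge0. Qed.

Lemma Re_le_normc x : `|Re x| <= normc x.
Proof. by case: x => a b /=; rewrite -sqrtr_sqr ler_sqrt ?lerDl ?sqr_ge0 // addr_ge0 ?sqr_ge0. Qed.

Lemma ImV x : Im x^-1 = - Im x / normc x ^+ 2.
Proof. by rewrite normc_sq; case: x => a b /=; rewrite mulNr. Qed.

Lemma Im_toCM (t : R) x : Im (toC t * x) = t * Im x.
Proof. by case: x => a b /=; rewrite mul0r addr0. Qed.

Lemma normc_toC (t : R) : normc (toC t) = `|t|.
Proof. by rewrite /= expr0n addr0 sqrtr_sqr. Qed.

Lemma normc_sum (I : finType) (F : I -> C) : normc (\sum_i F i) <= \sum_i normc (F i).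
Proof.
elim/big_ind2: _ => [|a b c d ab cd|//]; first by rewrite Normc.normc0.
by rewrite (le_trans (le_normcD _ _)) // lerD.
Qed.

Lemma Im_sum (I : finType) (F : I -> C) : Im (\sum_i F i) = \sum_i Im (F i).
Proof. by elim/big_ind2: _ => // x1 [? ?] y1 [? ?] /= -> ->. Qed.

Lemma off_axis_Im z : 0 < Im z -> off_axis z.
Proof.
move=> y0 t _; apply/eqP => h.
by have := congr1 Im h; rewrite raddfB /= sub0r => /eqP; rewrite oppr_eq0 gt_eqF.
Qed.

(** A closed version of what the Stieltjes transform of a positive measure on [0, +oo[ satisfies.
    The second inequality gives Im (z (1 + delta)) >= Im z, which keeps 1 + delta away from 0. Being
    non-strict, both inequalities admit the starting point 0 and survive limits. *)
Definition half_plane_dom z delta := 0 <= Im delta /\ 0 <= Im (z * delta).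

Section fixed_point.
Variables (N : nat) (k : 'I_N -> R) (z : C).
Hypotheses (k0 : forall i, 0 <= k i) (y0 : 0 < Im z).

(** With [k i] = (n/T) e_i for the eigenvalues e_i of Phi, [res_sum] is the right-hand side of the
    equation for delta when the weights are e_i/T, and, at the solution, the Stieltjes transform of
    mubar when they are 1/T. *)
Definition res_fun i delta := (toC (k i) / (1 + delta) - z)^-1.
Definition res_sum (w : 'I_N -> R) delta := \sum_i toC (w i) * res_fun i delta.
Local Notation y := (Im z).
Local Notation D := (half_plane_dom z).

Lemma Im1D delta : Im (1 + delta) = Im delta.
Proof. by case: delta => a b /=; rewrite add0r. Qed.

Let z0 : 0 < normc z.
Proof. by rewrite normc_gt0 //; apply: contraTneq y0 => ->; rewrite ltxx. Qed.

Let gt0_1D delta : 0 < Im delta -> 1 + delta != 0.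
Proof. by move=> d0; apply/eqP => /(congr1 Im); rewrite Im1D /= => E; rewrite E ltxx in d0. Qed.

Let D_Im delta : D delta -> y <= Im (z * (1 + delta)).
Proof. by move=> [_ h]; rewrite mulrDr mulr1 raddfD /= lerDl. Qed.

Lemma D_neq0 delta : D delta -> 1 + delta != 0.
Proof.
move=> /D_Im; apply: contraTneq => ->; rewrite mulr0 /= -ltNge //.
Qed.

Lemma D_normc delta : D delta -> (normc (1 + delta))^-1 <= normc z / y.
Proof.
move=> Dd; have n0 := normc_gt0 (D_neq0 Dd).
rewrite -div1r ler_pdivrMr // mulrAC ler_pdivlMr // mul1r -Normc.normcM.
by apply: (le_trans (D_Im Dd)); apply: le_trans (ler_norm _) (Im_le_normc _).
Qed.

Lemma res_den_Im i delta : Im (toC (k i) / (1 + delta) - z) =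
  - (k i * Im delta / normc (1 + delta) ^+ 2 + y).
Proof. by rewrite raddfB /= Im_toCM ImV Im1D; lra. Qed.

Local Notation adm delta := (0 <= Im delta).

Lemma res_den_normc i delta : adm delta ->
  y <= normc (toC (k i) / (1 + delta) - z).
Proof.
move=> d0; apply: le_trans (Im_le_normc _); rewrite res_den_Im normrN.
rewrite ger0_norm ?lerDr ?addr_ge0 ?(ltW y0) // mulr_ge0 ?invr_ge0 ?sqr_ge0 ?mulr_ge0 //.
Qed.

Lemma res_den_neq0 i delta : adm delta -> toC (k i) / (1 + delta) - z != 0.
Proof.
move=> /(res_den_normc i); apply: contraTneq => ->; by rewrite Normc.normc0 -ltNge.
Qed.

Lemma res_fun_normc i delta : adm delta -> normc (res_fun i delta) <= y^-1.
Proof.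
move=> d0; rewrite Normc.normcV lef_pV2 ?res_den_normc // posrE //.
exact/normc_gt0/res_den_neq0.
Qed.

Lemma res_fun_Im i delta : adm delta -> Im (res_fun i delta) =
  normc (res_fun i delta) ^+ 2 * (k i * Im delta / normc (1 + delta) ^+ 2 + y).
Proof.
move=> d0; rewrite /res_fun ImV res_den_Im opprK Normc.normcV exprVn mulrC.
by [].
Qed.

Let K := \sum_i k i.
Let kappa := (K * (normc z / y) + normc z)^-1.

Let K0 : 0 <= K. Proof. exact: sumr_ge0. Qed.
Let kappa0 : 0 < kappa.
Proof.
by rewrite invr_gt0 ltr_wpDl // mulr_ge0 // mulr_ge0 ?invr_ge0 ?(ltW y0) ?(ltW z0).
Qed.

Lemma res_fun_lb i delta : D delta -> kappa <= normc (res_fun i delta).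
Proof.
move=> Dd; have d0 : adm delta by case: Dd.
rewrite Normc.normcV lef_pV2 ?posrE ?normc_gt0 ?res_den_neq0 //; last first.
  by rewrite -invr_gt0.
apply: le_trans (le_normcD _ _) _; rewrite normcN lerD //.
rewrite Normc.normcM normc_toC ger0_norm // Normc.normcV.
apply: ler_pM => //; rewrite ?invr_ge0 ?normc_ge0 //; last exact: D_normc.
by rewrite /K (bigD1 i) //= lerDl sumr_ge0.
Qed.

(** The first sum, [coef] below, also controls differences in [res_sum_contract]. At a fixed point
    with positive imaginary part the identity forces [coef] < 1 as soon as some weight is positive,
    and this makes the solution unique. *)
Lemma res_sum_Im w delta : adm delta -> Im (res_sum w delta) =
  (\sum_i w i * k i * (normc (res_fun i delta) / normc (1 + delta)) ^+ 2) * Im delta +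
  y * \sum_i w i * normc (res_fun i delta) ^+ 2.
Proof.
move=> d0; rewrite Im_sum mulr_suml mulr_sumr -big_split; apply: eq_bigr => i _ /=.
rewrite Im_toCM res_fun_Im // expr_div_n; ring.
Qed.

Lemma res_sumB w delta delta' : adm delta -> adm delta' ->
  1 + delta != 0 -> 1 + delta' != 0 ->
  normc (res_sum w delta - res_sum w delta') <= normc (delta - delta') *
  \sum_i `|w i| * k i * ((normc (res_fun i delta) / normc (1 + delta)) *
     (normc (res_fun i delta') / normc (1 + delta'))).
Proof.
move=> d0 d0' n0 n0'.
have -> : res_sum w delta - res_sum w delta' = (delta - delta') *
  \sum_i toC (w i) * toC (k i) * (res_fun i delta / (1 + delta) *
   (res_fun i delta' / (1 + delta'))).
  rewrite /res_sum -sumrB mulr_sumr; apply: eq_bigr => i _.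
  have := res_den_neq0 i d0; have := res_den_neq0 i d0'; rewrite /res_fun.
  move=> h h'.
  rewrite -mulrBr mulrCA -!mulrA; congr (_ * _).
  set u := _ / (1 + delta) - z in h' *; set u' := _ / (1 + delta') - z in h *.
  have -> : u^-1 - u'^-1 = u^-1 * u'^-1 * (u' - u).
    by field; rewrite h h'.
  have -> : u' - u = toC (k i) * (delta - delta') / ((1 + delta) * (1 + delta')).
    by rewrite /u /u'; field; rewrite n0 n0'.
  by rewrite invfM; ring.
rewrite Normc.normcM ler_wpM2l ?normc_ge0 //.
apply: le_trans (normc_sum _) _; apply: ler_sum => i _.
by rewrite !Normc.normcM !Normc.normcV !normc_toC (ger0_norm (k0 i)).
Qed.

(** Cauchy-Schwarz splits the mixed sum of [res_sumB] so that each factor involves a single point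
    and can be compared with the imaginary part of its image. *)
Lemma res_sum_contract w delta delta' : (forall i, 0 <= w i) ->
  adm delta -> adm delta' -> 1 + delta != 0 -> 1 + delta' != 0 ->
  normc (res_sum w delta - res_sum w delta') ^+ 2 <= normc (delta - delta') ^+ 2 *
  ((\sum_i w i * k i * (normc (res_fun i delta) / normc (1 + delta)) ^+ 2) *
   (\sum_i w i * k i * (normc (res_fun i delta') / normc (1 + delta')) ^+ 2)).
Proof.
move=> w0 d0 d0' n0 n0'.
have s0 i : Num.sqrt (w i * k i) ^+ 2 = w i * k i by rewrite sqr_sqrtr // mulr_ge0.
set A := fun i => Num.sqrt (w i * k i) * (normc (res_fun i delta) / normc (1 + delta)).
set B := fun i => Num.sqrt (w i * k i) * (normc (res_fun i delta') / normc (1 + delta')).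
have := cauchy_schwarz_sum A B => CS.
have := res_sumB w d0 d0' n0 n0'.
have -> : \sum_i `|w i| * k i * ((normc (res_fun i delta) / normc (1 + delta)) *
     (normc (res_fun i delta') / normc (1 + delta'))) = \sum_i A i * B i.
  by apply: eq_bigr => i _; rewrite /A /B (ger0_norm (w0 i)) [RHS]mulrACA -expr2 s0.
move=> h.
have h2 : normc (res_sum w delta - res_sum w delta') ^+ 2 <=
    (normc (delta - delta') * \sum_i A i * B i) ^+ 2.
  by rewrite ler_sqr // nnegrE ?normc_ge0 // (le_trans _ h) // normc_ge0.
apply: (le_trans h2); rewrite exprMn ler_wpM2l ?sqr_ge0 // (le_trans CS) //.
by rewrite le_eqVlt; apply/orP; left; apply/eqP; congr (_ * _);
  apply: eq_bigr => i _; rewrite exprMn s0.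
Qed.

Lemma res_fun_zIm i delta : D delta -> 0 <= Im (z * res_fun i delta).
Proof.
move=> Dd; have d1 := D_neq0 Dd; have zn0 : z != 0.
  by apply: contraTneq y0 => ->; rewrite ltxx.
have -> : z * res_fun i delta = ((toC (k i) / (z * (1 + delta))) - 1)^-1.
  rewrite /res_fun -[z in LHS]invrK -invfM; congr (_^-1).
  by field; rewrite zn0 d1.
rewrite ImV mulr_ge0 ?invr_ge0 ?sqr_ge0 //.
rewrite raddfB /= subr0 Im_toCM ImV -mulrN mulNr opprK mulr_ge0 // mulr_ge0 ?invr_ge0 ?sqr_ge0 //.
exact: le_trans (ltW y0) (D_Im Dd).
Qed.

Section iteration.
Variable w : 'I_N -> R.
Hypothesis w0 : forall i, 0 <= w i.
Local Notation W := (\sum_i w i).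
Let W0 : 0 <= W. Proof. exact: sumr_ge0. Qed.

Lemma D_res_sum delta : D delta -> D (res_sum w delta).
Proof.
move=> Dd; have d0 : adm delta by case: Dd.
split; last first.
  rewrite mulr_sumr Im_sum sumr_ge0 // => i _.
  by rewrite mulrCA Im_toCM mulr_ge0 // res_fun_zIm.
rewrite res_sum_Im // addr_ge0 //.
  apply: mulr_ge0 => //; apply: sumr_ge0 => i _.
  by rewrite mulr_ge0 ?sqr_ge0 // mulr_ge0.
rewrite mulr_ge0 ?(ltW y0) // sumr_ge0 // => i _.
by rewrite mulr_ge0 ?sqr_ge0.
Qed.

Lemma res_sum_lb delta : D delta -> y * kappa ^+ 2 * W <=
  y * \sum_i w i * normc (res_fun i delta) ^+ 2.
Proof.
move=> Dd; rewrite -mulrA ler_pM2l // mulr_sumr; apply: ler_sum => i _.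
rewrite mulrC ler_wpM2l // ler_sqr ?nnegrE ?normc_ge0 ?(ltW kappa0) //.
exact: res_fun_lb.
Qed.

Lemma res_sum_ub delta : adm delta -> normc (res_sum w delta) <= W / y.
Proof.
move=> d0; apply: le_trans (normc_sum _) _; rewrite mulr_suml; apply: ler_sum => i _.
by rewrite Normc.normcM normc_toC ger0_norm // ler_wpM2l // res_fun_normc.
Qed.

Let coef delta := \sum_i w i * k i * (normc (res_fun i delta) / normc (1 + delta)) ^+ 2.
Let coef0 delta : 0 <= coef delta.
Proof. by apply: sumr_ge0 => i _; rewrite mulr_ge0 ?sqr_ge0 // mulr_ge0. Qed.

Let eta := (y * kappa) ^+ 2.

Let eta1 : 0 < eta <= 1.
Proof.
rewrite /eta exprn_gt0 ?mulr_gt0 //= expr_le1 ?mulr_ge0 ?(ltW y0) ?(ltW kappa0) //.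
rewrite /kappa ler_pdivrMr ?mul1r; last by rewrite -invr_gt0.
have : y <= normc z := le_trans (ler_norm _) (Im_le_normc _).
move=> /le_trans; apply; rewrite lerDr mulr_ge0 // mulr_ge0 ?invr_ge0 ?(ltW y0) ?(ltW z0) //.
Qed.

(** By [res_sum_Im] the gap Im (res_sum) - coef Im delta is at least y kappa^2 W, while Im (res_sum)
    is at most W / y; the ratio is [eta] = (y kappa)^2. Together with [res_sum_contract], this
    contracts |u - v|^2 / (Im u Im v) uniformly, a form of hyperbolic distance. *)
Lemma coef_Im delta : D delta -> coef delta * Im delta <= (1 - eta) * Im (res_sum w delta).
Proof.
move=> Dd; have d0 : adm delta by case: Dd.
rewrite mulrBl mul1r lerBrDr.
rewrite [leRHS]res_sum_Im // -/(coef _) lerD2l.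
apply: le_trans (res_sum_lb Dd).
have : Im (res_sum w delta) <= W / y.
  by apply: le_trans (ler_norm _) _; apply: le_trans (Im_le_normc _) (res_sum_ub d0).
rewrite -(ler_pM2l (proj1 (andP eta1))) => /le_trans; apply.
rewrite /eta le_eqVlt; apply/orP; left; apply/eqP; field.
by rewrite gt_eqF.
Qed.

Lemma res_sum_unique delta delta' : 0 < W -> 0 < Im delta -> 0 < Im delta' ->
  delta = res_sum w delta -> delta' = res_sum w delta' -> delta = delta'.
Proof.
move=> W1 d0 d0' E E'.
have lt1 x : 0 < Im x -> x = res_sum w x -> coef x < 1.
  move=> x0 Ex; rewrite -(ltr_pM2r x0) mul1r [X in _ < Im X]Ex res_sum_Im; last exact: ltW.
  rewrite -/(coef x).
  rewrite ltrDl.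
  have [j wj] : exists j, 0 < w j.
    apply/existsP; apply: contraTT W1 => /existsPn h; rewrite -leNgt.
    by apply: sumr_le0 => i _; rewrite leNgt.
  rewrite mulr_gt0 // (bigD1 j) //= ltr_wpDr //.
    by apply: sumr_ge0 => i _; rewrite mulr_ge0 ?sqr_ge0.
  by rewrite mulr_gt0 // exprn_gt0 // normc_gt0 // invr_eq0 res_den_neq0 // ltW.
have := res_sum_contract w0 (ltW d0) (ltW d0') (gt0_1D d0) (gt0_1D d0').
rewrite -E -E' -/(coef delta) -/(coef delta') => h.
apply/eqP; rewrite -subr_eq0; apply: contraT => nz.
have n0 : 0 < normc (delta - delta') by exact: normc_gt0.
have : coef delta * coef delta' < 1.
  by rewrite mulr_ilt1 // lt1.
have n1 : 0 < normc (delta - delta') ^+ 2 by rewrite exprn_gt0.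
by rewrite -(ltr_pM2l n1) mulr1 => /(le_lt_trans h); rewrite ltxx.
Qed.

Lemma res_sum_lip v : exists2 B, 0 <= B & forall delta delta', D delta -> D delta' ->
  normc (res_sum v delta - res_sum v delta') <= B * normc (delta - delta').
Proof.
exists (\sum_i `|v i| * k i * ((y^-1 * (normc z / y)) * (y^-1 * (normc z / y)))).
  apply: sumr_ge0 => i _; rewrite mulr_ge0 ?mulr_ge0 ?invr_ge0 ?normc_ge0 ?(ltW y0) //.
move=> delta delta' Dd Dd'.
have [d0 _] := Dd; have [d0' _] := Dd'.
have := res_sumB v d0 d0' (D_neq0 Dd) (D_neq0 Dd') => /le_trans; apply.
rewrite mulrC ler_wpM2r ?normc_ge0 //; apply: ler_sum => i _.
rewrite ler_wpM2l ?mulr_ge0 //.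
have H x : D x -> 0 <= normc (res_fun i x) / normc (1 + x) <= y^-1 * (normc z / y).
  move=> Dx; rewrite mulr_ge0 ?invr_ge0 ?normc_ge0 //=.
  apply: ler_pM; rewrite ?invr_ge0 ?normc_ge0 ?D_normc //; apply: res_fun_normc.
  by case: Dx.
have /andP[? ?] := H _ Dd; have /andP[? ?] := H _ Dd'.
exact: ler_pM.
Qed.

Definition res_iter m := iter m (res_sum w) 0.

Lemma D_res_iter m : D (res_iter m).
Proof.
elim: m => [|m IH]; last exact: D_res_sum.
by rewrite /half_plane_dom mulr0 /=.
Qed.

Lemma res_iter_cvg : exists delta, [/\ D delta, (0 < W -> 0 < Im delta),
  delta = res_sum w delta & normc (res_iter m - delta) @[m --> \oo] --> 0].
Proof.
(* W = 0 corresponds to Phi = 0: the iteration is constant and the solution 0 lies on the real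
   axis. *)
have [W1|W1] := eqVneq W 0.
  have wE i : w i = 0 by apply/eqP; move/eqP: W1; rewrite psumr_eq0 // => /allP; apply; rewrite mem_index_enum.
  have F0 x : res_sum w x = 0.
    by apply: big1 => i _; rewrite wE rmorph0 mul0r.
  exists 0; split=> //; first exact: (D_res_iter 0).
    by rewrite W1 ltxx.
  rewrite (_ : (fun m => _) = cst 0); first exact: cvg_cst.
  apply/funext => m; rewrite (_ : res_iter m = 0) ?subr0 ?Normc.normc0 //.
  by case: m => [//|m]; exact: F0.
have {}W1 : 0 < W by rewrite lt_def W1.
(* The start 0 is on the real axis; from the first iterate on, imaginary parts are at least [h0], so
   that dividing by them is harmless. *)
pose u m := res_iter m.+1.
pose h0 := y * kappa ^+ 2 * W.
have h00 : 0 < h0 by rewrite mulr_gt0 // mulr_gt0 // exprn_gt0.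
have Du m : D (u m) := D_res_iter m.+1.
have uadm m : adm (u m) by case: (Du m).
have uh m : h0 <= Im (u m).
  rewrite /u /res_iter iterS res_sum_Im; last by case: (D_res_iter m).
  apply: (le_trans (res_sum_lb (D_res_iter m))); rewrite lerDr mulr_ge0 //.
    exact: coef0.
  by case: (D_res_iter m).
have uub m : Im (u m) <= W / y.
  apply: le_trans (ler_norm _) _; apply: le_trans (Im_le_normc _) _.
  by rewrite /u /res_iter iterS; apply: res_sum_ub; case: (D_res_iter m).
pose E := normc (u 1%N - u 0%N) / h0.
have E0 : 0 <= E by rewrite mulr_ge0 ?normc_ge0 ?invr_ge0 ?(ltW h00).
pose r := 1 - eta.
have r01 : 0 <= r < 1 by rewrite /r; case/andP: eta1 => ? ?; apply/andP; split; lra.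
have [r0 r1] := andP r01.
(* Each step multiplies by two values of [coef], and [coef_Im] trades each product coef Im for [r]
   times the next imaginary part. [E] is chosen for the base case, where both imaginary parts are at
   least [h0]. *)
have key m : normc (u m.+1 - u m) ^+ 2 <= (E * r ^+ m) ^+ 2 * (Im (u m.+1) * Im (u m)).
  elim: m => [|m IH].
    rewrite expr0 mulr1 /E expr_div_n -mulrA ler_peMr ?sqr_ge0 // mulrC.
    rewrite ler_pdivlMr ?exprn_gt0 // mul1r expr2 ler_pM ?uh //; exact: ltW.
  have := res_sum_contract w0 (uadm m.+1) (uadm m) (D_neq0 (Du m.+1)) (D_neq0 (Du m)).
  rewrite -/(coef _) -/(coef _) => /le_trans; apply.
  apply: le_trans (ler_wpM2r _ IH) _; first by rewrite mulr_ge0 // coef0.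
  have c1 := coef_Im (Du m.+1); have c0 := coef_Im (Du m).
  have -> : (E * r ^+ m) ^+ 2 * (Im (u m.+1) * Im (u m)) * (coef (u m.+1) * coef (u m)) =
    (E * r ^+ m) ^+ 2 * ((coef (u m.+1) * Im (u m.+1)) * (coef (u m) * Im (u m))) by ring.
  have -> : (E * r ^+ m.+1) ^+ 2 * (Im (u m.+2) * Im (u m.+1)) =
    (E * r ^+ m) ^+ 2 * ((r * Im (u m.+2)) * (r * Im (u m.+1))) by rewrite (exprS r m); ring.
  rewrite ler_wpM2l ?sqr_ge0 // ler_pM // mulr_ge0 ?coef0 //.
have bnd m : normc (u m.+1 - u m) <= E * (W / y) * r ^+ m.
  have Wy : 0 <= W / y by rewrite mulr_ge0 // invr_ge0 ltW.
  have e0 : 0 <= E * (W / y) * r ^+ m by rewrite mulr_ge0 ?exprn_ge0 // mulr_ge0.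
  rewrite -ler_sqr ?nnegrE ?normc_ge0 //; apply: (le_trans (key m)).
  rewrite (_ : (E * (W / y) * r ^+ m) ^+ 2 = (E * r ^+ m) ^+ 2 * ((W / y) * (W / y))).
    by rewrite ler_wpM2l ?sqr_ge0 // ler_pM.
  by ring.
have Wy : 0 <= W / y by rewrite mulr_ge0 // invr_ge0 ltW.
have EW : 0 <= E * (W / y) by rewrite mulr_ge0.
have [a ca] : exists l : R, (Re \o u) m @[m --> \oo] --> l.
  apply: (cvg_geometric_telescope EW r01) => m.
  rewrite -raddfB; exact: le_trans (Re_le_normc _) (bnd m).
have [b cb] : exists l : R, (Im \o u) m @[m --> \oo] --> l.
  apply: (cvg_geometric_telescope EW r01) => m.
  rewrite -raddfB; exact: le_trans (Im_le_normc _) (bnd m).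
pose delta := Complex a b.
have cu : normc (u m - delta) @[m --> \oo] --> 0.
  apply: (@squeeze_cvgr _ _ _ _ (cst 0) (fun m => `|Re (u m) - a| + `|Im (u m) - b|)).
  - near=> m; rewrite normc_ge0 /=.
    case: (u m) => c d /=.
    rewrite -ler_sqr ?nnegrE ?sqrtr_ge0 ?addr_ge0 // sqr_sqrtr ?addr_ge0 ?sqr_ge0 //.
    rewrite [leRHS]sqrrD !real_normK ?num_real // lerD2r lerDl mulrn_wge0 //.
  - exact: cvg_cst.
  - by rewrite -[X in _ --> X](addr0 0); apply: cvgD; exact: cvg_norm_sub.
have Dd : 0 <= Im delta /\ 0 <= Im (z * delta) /\ h0 <= Im delta.
  have hb : h0 <= b.
    by apply: (cvgr_to_ge cb); near=> m; exact: uh.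
  split; first exact: le_trans (ltW h00) hb.
  split => //.
  have cz : (fun m => Im (z * u m)) @ \oo --> Im (z * delta).
    rewrite (_ : (fun m => _) = fun m => Re z * Im (u m) + Im z * Re (u m)); last first.
      by apply/funext => m; case: (z) (u m) => ? ? [? ?] /=.
    rewrite (_ : Im (z * delta) = Re z * b + Im z * a); last by case: (z).
    by apply: cvgD; apply: cvgM => //; exact: cvg_cst.
  apply: (cvgr_to_ge cz); near=> m.
  by case: (Du m).
have {}Dd : D delta /\ 0 < Im delta.
  by case: Dd => ? [? hb]; split; [split|exact: lt_le_trans h00 hb].
case: Dd => Dd d0.
have [B B0 lip] := res_sum_lip w.
exists delta; split => //; last first.
- by rewrite -(cvg_shiftS (fun m => normc (res_iter m - delta))).
- have hle : normc (delta - res_sum w delta) <= 0.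
    suff : (fun m => normc (u m.+1 - delta) + B * normc (u m - delta)) @ \oo --> (0 : R).
      move=> /cvgr_to_ge; apply; near=> m.
      have -> : delta - res_sum w delta =
        - (u m.+1 - delta) + (res_sum w (u m) - res_sum w delta).
        rewrite /u /res_iter [iter m.+2 _ _]iterS; ring.
      apply: le_trans (le_normcD _ _) _; rewrite normcN lerD2l.
      exact: lip.
    rewrite -[X in _ --> X](addr0 0); apply: cvgD.
      by rewrite (cvg_shiftS (fun m => normc (u m - delta))).
    rewrite -[X in _ --> X](mulr0 B); apply: cvgM => //; exact: cvg_cst.
  apply/eqP; rewrite -subr_eq0; apply/eqP/Normc.eq0_normc/eqP.
  by rewrite eq_le hle normc_ge0.
Unshelve. all: by end_near.
Qed.

End iteration.
End fixed_point.
End upper_half_plane.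

(** * Helly selection *)

Section helly.
Context {R : realType}.
Variables (N : nat -> nat) (b m : forall k, 'I_(N k) -> R) (M : R).
Local Arguments b : clear implicits.
Local Arguments m : clear implicits.
Hypotheses (b_ge0 : forall k i, 0 <= b k i) (m_ge0 : forall k i, 0 <= m k i).
Hypotheses (b_sum : forall k, \sum_i b k i = 1).
Hypotheses (bm_sum : forall k, \sum_i b k i * m k i <= M).

Let Fk k (x : R) := \sum_i b k i * ((m k i <= x)%R)%:R.

Let Fk_nd k (x y : R) : x <= y -> Fk k x <= Fk k y.
Proof.
move=> xy; apply: ler_sum => i _; rewrite ler_wpM2l // ler_nat.
by case: (leP (m k i) x) => // /le_trans/(_ xy) ->.
Qed.

Let Fk_ge0 k (x : R) : 0 <= Fk k x.
Proof. by apply: sumr_ge0 => i _; rewrite mulr_ge0. Qed.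

Let Fk_le1 k (x : R) : Fk k x <= 1.
Proof.
rewrite -(b_sum k); apply: ler_sum => i _.
by rewrite ler_piMr // lern1 leq_b1.
Qed.

Let Fk_neg k (x : R) : x < 0 -> Fk k x = 0.
Proof.
move=> x0; apply: big1 => i _; rewrite (_ : (_ <= _) = false) ?mulr0 //.
by apply/negbTE; rewrite -ltNge (lt_le_trans x0).
Qed.

Let Fk_tail k (x : R) : 0 < x -> 1 - Fk k x <= M / x.
Proof.
move=> x0; rewrite ler_pdivlMr // (le_trans _ (bm_sum k)) //.
rewrite -(b_sum k) -sumrB mulr_suml; apply: ler_sum => i _.
case: (leP (m k i) x) => h; first by rewrite mulr1 subrr mul0r mulr_ge0.
by rewrite mulr0 subr0 ler_wpM2l // ltW.
Qed.

(** An ultrafilter finer than [\oo] replaces the extraction of subsequences: along it the bounded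
    values [Fk k x] converge for every real x at once. *)
Let exU : exists U : set_system nat, UltraFilter U /\ \oo `<=` U.
Proof. exact: ultraFilterLemma. Qed.
Let U := sval (cid exU).
Let Uultra : UltraFilter U. Proof. by rewrite /U; case: cid => ? []. Qed.
Let Uoo : \oo `<=` U. Proof. by rewrite /U; case: cid => ? []. Qed.
Let Uproper : ProperFilter U. Proof. exact: ultra_proper. Qed.
Existing Instance Uproper.

Let exFU (x : R) : exists l : R, 0 <= l <= 1 /\ Fk k x @[k --> U] --> l.
Proof.
have C := @segment_compact R 0 1.
have PF : ProperFilter (Fk k x @[k --> U]) by exact: fmap_proper_filter.
have [] := C (Fk k x @[k --> U]) PF.
  rewrite nbhs_simpl; apply: (@filterE _ U) => k.
  by rewrite /= in_itv /=; apply/andP; split; [exact: Fk_ge0|exact: Fk_le1].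
move=> l [l01 cl]; exists l; split; first by move: l01; rewrite /= in_itv.
move=> A Al; have := @in_ultra_setVsetC _ U [set k | A (Fk k x)] Uultra.
case=> // h; have := cl [set t | ~ A t] A h Al.
by case=> t [].
Qed.

Let FU (x : R) := sval (cid (exFU x)).
Let FU01 (x : R) : 0 <= FU x <= 1. Proof. by rewrite /FU; case: cid => ? []. Qed.
Let FU_cvg (x : R) : Fk k x @[k --> U] --> FU x.
Proof. by rewrite /FU; case: cid => ? []. Qed.
Local Arguments FU_cvg : clear implicits.

Let FU_nd (x y : R) : x <= y -> FU x <= FU y.
Proof.
move=> xy; rewrite -subr_ge0.
have : (fun k => Fk k y - Fk k x) @ U --> FU y - FU x by exact: cvgB.
by move=> /cvgr_to_ge; apply; apply: filterE => k; rewrite subr_ge0; exact: Fk_nd.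
Qed.

Let FU_neg (x : R) : x < 0 -> FU x = 0.
Proof.
move=> x0; apply/eqP; rewrite eq_le; apply/andP; split.
  by have := FU_cvg x => /cvgr_to_le; apply; apply: filterE => k; rewrite Fk_neg.
by case/andP: (FU01 x).
Qed.

Let FU_tail (x : R) : 0 < x -> 1 - FU x <= M / x.
Proof.
move=> x0; have : (fun k => 1 - Fk k x) @ U --> 1 - FU x.
  by apply: cvgB => //; exact: cvg_cst.
by move=> /cvgr_to_le; apply; apply: filterE => k; exact: Fk_tail.
Qed.

(** The ultralimit [FU] may fail to be right-continuous. This regularisation is right-continuous and
    interlaced with it: F x <= FU y for x < y, and FU x <= F x. *)
Definition helly_cdf (x : R) := inf [set FU y | y in [set y | x < y]].
Local Notation F := helly_cdf.

Let has_infF (x : R) : has_inf [set FU y | y in [set y | x < y]].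
Proof.
split; first by exists (FU (x + 1)), (x + 1) => //=; rewrite ltrDl.
by exists 0 => _ [y _ <-]; case/andP: (FU01 y).
Qed.

Let F_le (x y : R) : x < y -> F x <= FU y.
Proof. by move=> xy; apply: ge_inf; [case: (has_infF x)|exists y]. Qed.

Let F_ge (x : R) : FU x <= F x.
Proof.
apply: lb_le_inf; first by case: (has_infF x).
by move=> _ [y /= xy <-]; apply: FU_nd; exact: ltW.
Qed.

Lemma helly_cdf_nd : {homo F : x y / x <= y}.
Proof.
move=> x y; rewrite le_eqVlt => /predU1P[->//|xy].
by apply: le_trans (F_le xy) (F_ge y).
Qed.

Lemma helly_cdf_rc : right_continuous F.
Proof.
move=> x; apply/cvgrPdist_lt => e e0.
have [_ [y /= xy <-] yF] := inf_adherent e0 (has_infF x).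
near=> t.
have xt : x <= t by near: t; exact: nbhs_right_ge.
have ty : t < y by near: t; exact: nbhs_right_lt.
rewrite distrC ger0_norm ?subr_ge0; last exact: helly_cdf_nd.
by rewrite ltrBlDl (le_lt_trans (F_le ty)) // addrC.
Unshelve. all: by end_near. Qed.

Let F_neg (x : R) : x < 0 -> F x = 0.
Proof.
move=> x0; apply/eqP; rewrite eq_le (le_trans _ (F_ge x)) ?andbT; last by case/andP: (FU01 x).
have x2 : x / 2 < 0 by rewrite pmulr_llt0 // invr_gt0.
by rewrite -(FU_neg x2) F_le //; lra.
Qed.

Let F_le1 (x : R) : F x <= 1.
Proof. by apply: le_trans (@F_le x (x + 1) _) _; rewrite ?ltrDl //; case/andP: (FU01 (x + 1)). Qed.

Lemma helly_cdf_Ny : F @ -oo --> (0 : R).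
Proof.
apply: cvg_near_cst; near=> x; apply: F_neg; near: x; exact: nbhs_ninfty_lt.
Unshelve. all: by end_near. Qed.

Let M0 : 0 <= M.
Proof. by apply: le_trans (bm_sum 0); apply: sumr_ge0 => i _; rewrite mulr_ge0. Qed.

Lemma helly_cdf_y : F @ +oo --> (1 : R).
Proof.
apply/cvgrPdist_le => e e0; near=> x.
have x0 : 0 < x by near: x; exact: nbhs_pinfty_gt.
rewrite ger0_norm ?subr_ge0 //.
apply: (@le_trans _ _ (M / x)).
  by apply: le_trans _ (FU_tail x0); rewrite lerD2l lerN2 F_ge.
rewrite ler_pdivrMr // mulrC -ler_pdivrMr //; near: x; exact: nbhs_pinfty_ge.
Unshelve. all: by end_near. Qed.

HB.instance Definition _ := isCumulative.Build R _ R F helly_cdf_nd helly_cdf_rc.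
HB.instance Definition _ := isCumulativeBounded.Build R 0 1 F helly_cdf_Ny helly_cdf_y.

Let idR : measurableTypeR R -> R := idfun.
Let measurable_idR : measurable_fun setT idR.
Proof. by move=> _ A mA; rewrite setTI. Qed.
HB.instance Definition _ := @isMeasurableFun.Build _ _ _ _ idR measurable_idR.

(* [measurableTypeR R] and [R] have the same measurable sets but different displays *)
Definition helly_measure : probability R R :=
  distribution (lebesgue_stieltjes_measure F) (idR : {RV (lebesgue_stieltjes_measure F) >-> R}).

Let helly_measure_le x : helly_measure `]-oo, x]%classic = (F x)%:E.
Proof.
by have := @cdf_lebesgue_stieltjes_id R (F : cumulativeBounded 0 1) x; rewrite /helly_measure /cdf /distribution /pushforward !preimage_id.
Qed.

Let Rint_gt (x : R) : \int[helly_measure]_t ((x < t)%R)%:R = 1 - F x.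
Proof.
under eq_Rintegral.
  move=> t _; rewrite (_ : (x < t)%R%:R = \1_(~` `]-oo, x]) t); last first.
    by rewrite indicE in_setC mem_setE in_itv /= -ltNge.
  over.
rewrite /Rintegral integral_indic ?setIT //; last exact: measurableC.
rewrite [X in fine X](_ : _ = (1 - F x)%:E) //.
have := probability_setC helly_measure (measurable_itv `]-oo, x]).
by rewrite helly_measure_le -EFinB.
Qed.

Section grid.
Variables (g : R -> R) (K B h : R).
Hypotheses (gB : forall t, `|g t| <= B) (gK : forall s t, `|g s - g t| <= K * `|s - t|).
Hypotheses (h0 : 0 < h) (K0 : 0 <= K).

(** The grid starts at -h, where all distribution functions vanish, so nothing is lost to its left;
    the mass beyond the last node is bounded by the first moment. *)
Let x i : R := i%:R * h - h.
Let step n t := g (x 0) + \sum_(i < n) (g (x i.+1) - g (x i)) * ((x i.+1 < t)%R)%:R.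

Let x_lt i : x i < x i.+1.
Proof. by rewrite /x ltrD2r ltr_pM2r // ltr_nat. Qed.

Let stepE n t : exists y, [/\ step n t = g y, (t <= x 0 -> y = x 0),
  (x n < t -> y = x n) & (x 0 < t -> t <= x n -> `|t - y| <= h)].
Proof.
elim: n => [|n [y [E y0 yn yh]]].
  exists (x 0); rewrite /step big_ord0 addr0; split => // h1 h2.
  by have := lt_le_trans h1 h2; rewrite ltxx.
have x0n j : x 0 <= x j by elim: j => // j IH; apply: le_trans IH (ltW (x_lt j)).
have En : step n.+1 t = step n t + (g (x n.+1) - g (x n)) * ((x n.+1 < t)%R)%:R.
  by rewrite /step big_ord_recr /= addrA.
case: (ltP (x n.+1) t) => nt in En *.
  exists (x n.+1); split => //.
  - rewrite En E mulr1 yn ?subrKC //; exact: lt_trans (x_lt n) nt.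
  - by move=> t0; have := le_lt_trans (le_trans t0 (x0n n.+1)) nt; rewrite ltxx.
rewrite mulr0 addr0 in En.
exists y; split => //; first by rewrite En.
move=> t0 _; case: (leP t (x n)) => tn; first exact: yh.
rewrite yn // ger0_norm ?subr_ge0 ?(ltW tn) // (le_trans (lerB nt (lexx _))) //.
by rewrite /x -natr1; lra.
Qed.

Let step_err n t :
  `|g t - step n t| <= K * h + 2 * B * (1 - ((x 0 < t)%R)%:R + ((x n < t)%R)%:R).
Proof.
have B0 : 0 <= B by exact: le_trans (normr_ge0 _) (gB 0).
have [y [-> _ yn yh]] := stepE n t.
have d2 : `|g t - g y| <= 2 * B.
  by apply: le_trans (ler_normB _ _) _; have := gB t; have := gB y; lra.
have Kh : 0 <= K * h by rewrite mulr_ge0 // ltW.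
case: (ltP (x 0) t) => t0; last first.
  by rewrite subr0 (le_trans d2) // -[leLHS]mulr1 ler_wpDl // ler_wpM2l ?mulr_ge0 // lerDl.
case: (ltP (x n) t) => tn; first by rewrite subrr add0r mulr1 (le_trans d2) // lerDr.
rewrite subrr addr0 mulr0 addr0; apply: le_trans (gK _ _) _.
by rewrite ler_wpM2l // yh.
Qed.

Hypothesis mg : measurable_fun setT g.

Let Fk_gt k (t : R) : \sum_i b k i * ((t < m k i)%R)%:R = 1 - Fk k t.
Proof.
rewrite -[X in _ = X - _](b_sum k) -sumrB; apply: eq_bigr => i _; rewrite ltNge.
by case: (_ <= _); rewrite ?mulr1 ?mulr0 ?subrr ?subr0.
Qed.

Let x00 : x 0 < 0. Proof. by rewrite /x mul0r sub0r oppr_lt0. Qed.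

Let sum_gt (f : R -> R) n := g (x 0) + \sum_(i < n) (g (x i.+1) - g (x i)) * (1 - f (x i.+1)).

Let atomic_err k n : 0 < x n ->
  `|\sum_i b k i * g (m k i) - sum_gt (Fk k) n| <= K * h + 2 * B * (M / x n).
Proof.
move=> xn0.
have B0 : 0 <= B by exact: le_trans (normr_ge0 _) (gB 0).
have -> : sum_gt (Fk k) n = \sum_i b k i * step n (m k i).
  rewrite /step; under [RHS]eq_bigr do rewrite mulrDr mulr_sumr.
  rewrite big_split /= -mulr_suml b_sum mul1r; congr (_ + _).
  rewrite exchange_big /=; apply: eq_bigr => j _.
  by rewrite -Fk_gt mulr_sumr; apply: eq_bigr => i _; rewrite mulrCA.
rewrite -sumrB; apply: le_trans (ler_norm_sum _ _ _) _.
apply: (@le_trans _ _ (\sum_i b k i * (K * h + 2 * B * (1 - ((x 0 < m k i)%R)%:R + ((x n < m k i)%R)%:R)))).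
  apply: ler_sum => i _; rewrite -mulrBr normrM ger0_norm // ler_wpM2l //.
rewrite (eq_bigr (fun i => b k i * (K * h) + 2 * B * (b k i -
  b k i * ((x 0 < m k i)%R)%:R + b k i * ((x n < m k i)%R)%:R))); last by move=> i _; ring.
rewrite big_split /= -mulr_suml b_sum mul1r lerD2l -mulr_sumr ler_wpM2l ?mulr_ge0 //.
rewrite big_split /= sumrB b_sum !Fk_gt Fk_neg // subr0 subrr add0r.
exact: Fk_tail.
Qed.

Let measure_err n : 0 < x n ->
  `|\int[helly_measure]_t g t - sum_gt F n| <= K * h + 2 * B * (M / x n).
Proof.
move=> xn0.
have B0 : 0 <= B by exact: le_trans (normr_ge0 _) (gB 0).
have mgt (t : R) : measurable_fun setT (fun u : R => ((t < u)%R)%:R : R).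
  rewrite (_ : (fun u : R => ((t < u)%R)%:R : R) = \1_(~` `]-oo, t])); last first.
    by apply/funext => u; rewrite indicE in_setC mem_setE in_itv /= -ltNge.
  by apply: measurable_indic; exact: measurableC.
have igt (t : R) : rintegrable helly_measure (fun u : R => ((t < u)%R)%:R : R).
  apply: (@rintegrable_bounded _ _ _ _ _ 1); first exact: mgt.
  by move=> u; rewrite normr_nat lern1 leq_b1.
have ig : rintegrable helly_measure g by apply: (@rintegrable_bounded _ _ _ _ _ B).
have istep : rintegrable helly_measure (step n).
  apply: rintegrableD; first exact: rintegrable_cst.
  by apply: rintegrable_sum => i; apply: rintegrableZ.
have -> : sum_gt F n = \int[helly_measure]_t step n t.
  rewrite RintD; [|exact: rintegrable_cst|]; last first.
    by apply: rintegrable_sum => i; apply: rintegrableZ.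
  rewrite Rint_cst Rint_sum; last by move=> i; apply: rintegrableZ.
  by congr (_ + _); apply: eq_bigr => i _; rewrite RintZ // Rint_gt.
rewrite -RintB //; apply: le_trans (Rint_norm _) _; first exact: rintegrableB.
have ib : rintegrable helly_measure
    (fun t : R => (1 - ((x 0 < t)%R)%:R + ((x n < t)%R)%:R) : R).
  by apply: rintegrableD => //; apply: rintegrableB => //; exact: rintegrable_cst.
apply: (@le_trans _ _ (\int[helly_measure]_t
   (K * h + 2 * B * (1 - ((x 0 < t)%R)%:R + ((x n < t)%R)%:R)))).
  apply: Rint_le; last by move=> t; exact: step_err.
    by apply: rintegrable_norm; exact: rintegrableB.
  by apply: rintegrableD; [exact: rintegrable_cst|exact: rintegrableZ].
rewrite RintD; [|exact: rintegrable_cst|exact: rintegrableZ].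
rewrite Rint_cst lerD2l RintZ // ler_wpM2l ?mulr_ge0 //.
rewrite RintD //; last by apply: rintegrableB => //; exact: rintegrable_cst.
rewrite RintB //; last exact: rintegrable_cst.
rewrite Rint_cst !Rint_gt F_neg // subr0 subrr add0r.
by apply: le_trans _ (FU_tail xn0); rewrite lerD2l lerN2 F_ge.
Qed.

Lemma helly_err L n : \sum_i b k i * g (m k i) @[k --> \oo] --> L -> 0 < x n ->
  `|\int[helly_measure]_t g t - L| <= 3 * K * h + 4 * B * (M / x n).
Proof.
move=> cL xn0.
have cLU : \sum_i b k i * g (m k i) @[k --> U] --> L.
  by apply: cvg_trans cL; apply: cvg_app.
have csum : sum_gt (Fk k) n @[k --> U] --> sum_gt FU n.
  apply: cvgD; first exact: cvg_cst.
  apply: cvg_big => [|i _]; first by move=> ?; exact: add_continuous.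
  apply: cvgM; first exact: cvg_cst.
  by apply: cvgB; [exact: cvg_cst|exact: FU_cvg].
have e1 : `|L - sum_gt FU n| <= K * h + 2 * B * (M / x n).
  have : `|\sum_i b k i * g (m k i) - sum_gt (Fk k) n| @[k --> U] --> `|L - sum_gt FU n|.
    by apply: cvg_norm; exact: cvgB.
  move=> /cvgr_to_le; apply.
  by apply: filterE => k; exact: atomic_err.
have e2 := measure_err xn0.
(* By interlacing, F at a node lies between [FU] at that node and at the next one, so the errors
   telescope to at most 1 even if F jumps at the nodes. *)
have e3 : `|sum_gt F n - sum_gt FU n| <= K * h.
  rewrite /sum_gt opprD addrACA subrr add0r -sumrB.
  apply: le_trans (ler_norm_sum _ _ _) _.
  apply: (@le_trans _ _ (\sum_(i < n) K * h * (FU (x i.+2) - FU (x i.+1)))).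
    apply: ler_sum => i _; rewrite -mulrBr normrM; apply: ler_pM => //.
      apply: le_trans (gK _ _) _; rewrite ler_wpM2l // ger0_norm ?subr_ge0 ?(ltW (x_lt _)) //.
      by rewrite /x -natr1; lra.
    rewrite (_ : 1 - F (x i.+1) - (1 - FU (x i.+1)) = FU (x i.+1) - F (x i.+1)); last by ring.
    rewrite distrC ger0_norm ?subr_ge0 //.
    by rewrite lerD2r F_le.
  rewrite -mulr_sumr ler_piMr ?mulr_ge0 ?(ltW h0) //.
  rewrite -(big_mkord xpredT (fun i => FU (x i.+2) - FU (x i.+1))).
  rewrite (telescope_sumr (fun i => FU (x i.+1))) //.
  by have /andP[] := FU01 (x n.+1); have /andP[] := FU01 (x 1); lra.
rewrite (_ : _ - L = (\int[helly_measure]_t g t - sum_gt F n) +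
  (sum_gt F n - sum_gt FU n) - (L - sum_gt FU n)); last by ring.
apply: le_trans (ler_normB _ _) _.
apply: le_trans (lerD (ler_normD _ _) (lexx _)) _.
move: e1 e2 e3; move: (`|L - _|) (`|_ - sum_gt F n|) (`|sum_gt F n - _|) => a1 a2 a3.
lra.
Qed.

End grid.

Lemma helly_integral (g : R -> R) (K B L : R) : measurable_fun setT g ->
  (forall t, `|g t| <= B) -> (forall s t, `|g s - g t| <= K * `|s - t|) -> 0 <= K ->
  \sum_i b k i * g (m k i) @[k --> \oo] --> L ->
  \int[helly_measure]_t g t = L.
Proof.
move=> mg gB gK K0 cL; apply/eqP; rewrite -subr_eq0 -normr_le0.
apply/ler_addgt0Pl => e e0; rewrite addr0.
pose c := 3 * K + 4 * B * M.
have B0 : 0 <= B by exact: le_trans (normr_ge0 _) (gB 0).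
have c0 : 0 <= c by rewrite addr_ge0 ?mulr_ge0.
have [j jc] : exists j : nat, c / e < j.+1%:R.
  by exists (Num.truncn (c / e)); rewrite truncnS_gt.
(* With mesh 1/(j+1), node number (j+1)^2 + 1 is at j + 1, so both error terms are multiples of
   1/(j+1). *)
pose h : R := j.+1%:R^-1.
have h0 : 0 < h by rewrite invr_gt0.
have xE : (j.+1 * j.+1).+1%:R * h - h = j.+1%:R.
  have : (j.+1%:R : R) != 0 by rewrite pnatr_eq0.
  rewrite -[(_ * _).+1%:R]natr1 natrM /h; move: (j.+1%:R) => J J0.
  by rewrite mulrDl mulfK // mul1r addrK.
have := @helly_err g K B h gB gK h0 K0 mg L (j.+1 * j.+1).+1 cL; rewrite xE.
move=> /(_ (ltr0Sn _ _))/le_trans; apply.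
rewrite (_ : _ + _ = c / j.+1%:R); last by rewrite /c /h; ring.
by rewrite ler_pdivrMr // mulrC -ler_pdivrMr // ltW.
Qed.

Lemma helly_neg : helly_measure `]-oo, 0[%classic = 0%E.
Proof.
have -> : `]-oo, 0[%classic = \bigcup_n `]-oo, - n.+1%:R^-1 : R]%classic.
  apply/seteqP; split => [t /= | t [n _] /=]; rewrite !in_itv /= => t0; last first.
    by rewrite (le_lt_trans t0) // oppr_lt0.
  exists (Num.truncn (- t)^-1) => //=; rewrite in_itv /= lerNr.
  rewrite -[leRHS]invrK lef_pV2 ?posrE ?invr_gt0 ?oppr_gt0 // ltW //.
  by rewrite truncnS_gt.
apply/eqP; rewrite eq_le measure_ge0 andbT.
pose A n := `]-oo, - n.+1%:R^-1 : R]%classic.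
have mA n : measurable (A n) by exact: measurable_itv.
have le1 : (helly_measure (\bigcup_n A n) <= \sum_(n <oo) helly_measure (A n))%E.
  apply: measure_sigma_subadditive => //; exact: bigcupT_measurable.
rewrite (le_trans le1) //.
rewrite eseries0 // => n _ _.
by rewrite helly_measure_le F_neg // oppr_lt0.
Qed.
End helly.

(** * Stieltjes inversion *)

Lemma Rint_bounded_cvg d (T : measurableType d) (R : realType)
    (mu : {finite_measure set T -> \bar R}) (f_ : nat -> T -> R) (f : T -> R) (M : R) :
  (forall n, measurable_fun setT (f_ n)) -> (forall n x, `|f_ n x| <= M) ->
  measurable_fun setT f ->
  (forall x, f_ n x @[n --> \oo] --> f x) ->
  \int[mu]_x f_ n x @[n --> \oo] --> \int[mu]_x f x.
Proof.
move=> mf_ fM mf cf.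
have [] := @dominated_convergence _ _ _ mu setT measurableT (fun n x => (f_ n x)%:E)
  (EFin \o f) (EFin \o cst M).
- by move=> n; exact/measurable_EFinP.
- exact/measurable_EFinP.
- by apply: aeW => x _; apply: cvg_EFin; [near=> n|exact: cf].
- exact: rintegrable_cst.
- by apply: aeW => x n _; rewrite lee_fin.
move=> i1 _ c1.
have -> : \int[mu]_x f x = fine (\int[mu]_x (f x)%:E)%E by [].
apply: fine_cvg; rewrite fineK //.
exact: integrable_fin_num.
Unshelve. all: by end_near. Qed.

Section stieltjes_inversion.
Context {R : realType}.
Implicit Types (t x y a b : R).

(** The imaginary part of 1/(t - (x + iy)), that is, pi times the Poisson kernel of the
    half-plane. *)
Definition poisson y x t : R := y / ((t - x) ^+ 2 + y ^+ 2).

Lemma poisson_ge0 y x t : 0 <= y -> 0 <= poisson y x t.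
Proof. by move=> y0; rewrite /poisson mulr_ge0 // invr_ge0 addr_ge0 ?sqr_ge0. Qed.

Lemma poisson_le y x t : 0 < y -> poisson y x t <= y^-1.
Proof.
move=> y0; rewrite /poisson ler_pdivrMr ?ltr_wpDl ?sqr_ge0 ?exprn_gt0 //.
by rewrite mulrDr expr2 [y^-1 * (y * y)]mulrA mulVf ?gt_eqF // mul1r lerDr mulr_ge0 ?sqr_ge0 // invr_ge0 ltW.
Qed.

Lemma is_derive_poisson y x t : 0 < y ->
  is_derive x (1 : R) (fun x => atan ((x - t) / y)) (poisson y x t).
Proof.
move=> y0.
apply: is_derive_eq.
rewrite !scaler0 add0r subr0 /GRing.scale /= mulr1 /poisson.
have h : (t - x) ^+ 2 + y ^+ 2 != 0 by rewrite gt_eqF // ltr_wpDl ?sqr_ge0 // exprn_gt0.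
by field; rewrite (gt_eqF y0) h.
Qed.

Lemma continuous_poisson y x : 0 < y -> continuous (poisson y x).
Proof.
move=> y0 t; apply: cvgM; first exact: cvg_cst.
apply: cvgV; first by rewrite gt_eqF // ltr_wpDl ?sqr_ge0 // exprn_gt0.
apply: cvgD; last exact: cvg_cst.
by rewrite expr2; apply: cvgM; apply: cvgB; [exact: cvg_id|exact: cvg_cst|exact: cvg_id|exact: cvg_cst].
Qed.

Lemma poissonC y x t : poisson y x t = poisson y t x.
Proof. by rewrite /poisson -(opprB x t) sqrrN. Qed.

Lemma measurable_poisson2 y : 0 < y ->
  measurable_fun setT (fun p : R * R => poisson y p.1 p.2).
Proof.
move=> y0; rewrite (_ : (fun p => _) = poisson y 0 \o (fun p : R * R => p.2 - p.1)).
  apply: measurableT_comp; last exact: measurable_funB.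
  by apply: continuous_measurable_fun; exact: continuous_poisson.
by apply/funext => p; rewrite /poisson /= subr0.
Qed.

Lemma integral_poisson y a b t : 0 < y -> a < b ->
  (\int[lebesgue_measure]_(x in `[a, b]) (poisson y x t)%:E =
   (atan ((b - t) / y) - atan ((a - t) / y))%:E)%E.
Proof.
move=> y0 ab; have D x := is_derive_poisson x t y0.
rewrite (@continuous_FTC2 _ _ (fun x => atan ((x - t) / y)) a b ab) ?EFinB //.
- apply: continuous_subspaceT => x.
  rewrite (_ : (poisson y)^~ t = poisson y t); first exact: continuous_poisson.
  by apply/funext => u; exact: poissonC.
- have C x : {for x, continuous (fun x => atan ((x - t) / y))}.
    apply: differentiable_continuous; apply/derivable1_diffP.
    by case: (D x).
  split; first by move=> x _; case: (D x).
    by apply: cvg_at_right_filter; exact: C.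
  by apply: cvg_at_left_filter; exact: C.
- by move=> x _; rewrite derive1E; case: (D x).
Qed.

Let atan_diff y a b t : R := atan ((b - t) / y) - atan ((a - t) / y).

Let atan_diff_bound y a b t : 0 < y -> a < b -> `|atan_diff y a b t| <= pi.
Proof.
move=> y0 ab; have := atan_gtNpi2 ((b - t) / y); have := atan_ltpi2 ((b - t) / y).
have := atan_gtNpi2 ((a - t) / y); have := atan_ltpi2 ((a - t) / y).
rewrite /atan_diff ler_norml; move: (atan _) (atan _) => u v ? ? ? ?; apply/andP; split; lra.
Qed.

Let measurable_atan_diff y a b : 0 < y -> measurable_fun setT (atan_diff y a b).
Proof.
move=> y0; apply: continuous_measurable_fun => t.
have C c : {for t, continuous (fun t : R => atan ((c - t) / y))}.
  apply: (@continuous_comp _ _ _ (fun t : R => (c - t) / y) atan); last exact: continuous_atan.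
  by apply: cvgM; [apply: cvgB; [exact: cvg_cst|exact: cvg_id]|exact: cvg_cst].
by apply: cvgB; exact: C.
Qed.

Let rint_poisson (nu : {finite_measure set R -> \bar R}) y x : 0 < y ->
  rintegrable nu (poisson y x).
Proof.
move=> y0; apply: (@rintegrable_bounded _ _ _ _ _ y^-1).
  by apply: continuous_measurable_fun; exact: continuous_poisson.
by move=> t; rewrite ger0_norm ?poisson_ge0 ?(ltW y0) // poisson_le.
Qed.

(** Integrating the kernel over x in [a, b] first leaves a difference of arctangents in t, which
    tends to pi on ]a, b[, to pi/2 at the endpoints and to 0 elsewhere as y decreases to 0. *)
Lemma poisson_tonelli (nu : {finite_measure set R -> \bar R}) y a b : 0 < y -> a < b ->
  ((\int[nu]_t atan_diff y a b t)%:E =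
  \int[lebesgue_measure]_(x in `[a, b]) (\int[nu]_t poisson y x t)%:E)%E.
Proof.
move=> y0 ab; rewrite EFin_Rint; last first.
  apply: (@rintegrable_bounded _ _ _ _ _ pi); first exact: measurable_atan_diff.
  by move=> t; exact: atan_diff_bound.
under eq_integral do rewrite -integral_poisson //.
transitivity (\int[lebesgue_measure]_(x in `[a, b]) \int[nu]_t (poisson y x t)%:E)%E; last first.
  by apply: eq_integral => x _; rewrite EFin_Rint //; exact: rint_poisson.
rewrite [RHS]integral_mkcond; under eq_integral do rewrite integral_mkcond.
pose f (p : R * R) := (poisson y p.1 p.2 * \1_(`[a, b]) p.1)%:E.
have mf : measurable_fun setT f.
  apply/measurable_EFinP; apply: measurable_funM; first exact: measurable_poisson2.
  by apply: measurableT_comp => //; exact: measurable_indic.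
have f0 p : (0 <= f p)%E.
  by rewrite lee_fin mulr_ge0 // poisson_ge0 // ltW.
transitivity (\int[nu]_t \int[lebesgue_measure]_x f (x, t))%E.
  apply: eq_integral => t _; apply: eq_integral => x _.
  rewrite /f /= patchE indicE; case: ifPn => xab; first by rewrite mulr1.
  by rewrite mulr0.
rewrite -(@fubini_tonelli _ _ _ _ R lebesgue_measure nu f mf f0); apply: eq_integral => x _.
rewrite patchE /f /= indicE; case: ifPn => xab.
  by apply: eq_integral => t _; rewrite mulr1.
by rewrite integral0_eq // => t _; rewrite mulr0.
Qed.

Let yn n : R := n.+1%:R^-1.
Let yn0 n : 0 < yn n. Proof. by rewrite invr_gt0. Qed.
Let yn_cvg : yn @ \oo --> 0. Proof. exact: cvg_harmonic. Qed.

Let atan_scale_cvg (c : R) : atan (c / yn n) @[n --> \oo] --> pi / 2 * Num.sg c.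
Proof.
have pos (u : R) : 0 < u -> atan (u / yn n) @[n --> \oo] --> pi / 2.
  move=> u0; apply: (@cvg_comp _ _ _ (fun n => u / yn n) atan _ (pinfty_nbhs R) _ _ (@cvgy_atan R)).
  rewrite /yn; under eq_fun do rewrite invrK.
  suff h : u * n.+1%:R @[n --> \oo] --> pinfty_nbhs R by exact: h.
  apply/cvgryPge => A; near=> n; rewrite mulrC -ler_pdivrMr //.
  apply: (@le_trans _ _ n%:R); last by rewrite ler_nat.
  by near: n; exact: nbhs_infty_ger.
case: (sgrP c) => [->|c0|c0].
- by rewrite mulr0; under eq_fun do rewrite mul0r atan0; exact: cvg_cst.
- by rewrite mulr1; exact: pos.
rewrite mulrN1 -[c]opprK; under eq_fun do rewrite mulNr atanN.
by apply: cvgN; apply: pos; rewrite oppr_gt0.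
Unshelve. all: by end_near. Qed.

Let point_cvg a t : yn n * poisson (yn n) a t @[n --> \oo] --> (\1_[set a] t : R).
Proof.
rewrite indicE; case: (eqVneq t a) => [->|ta].
  have E n : yn n * poisson (yn n) a a = 1.
    by rewrite /poisson subrr; have n0 := yn0 n; field; rewrite gt_eqF.
  rewrite mem_set //=; under eq_fun do rewrite E; exact: cvg_cst.
rewrite memNset /=; last by move/eqP; rewrite (negPf ta).
rewrite (_ : 0%:R = 0 * (0 / ((t - a) ^+ 2 + 0 ^+ 2))); last by rewrite mul0r.
apply: cvgM => //; apply: cvgM => //; apply: cvgV.
  by rewrite expr0n addr0 sqrf_eq0 subr_eq0.
apply: cvgD; first exact: cvg_cst.
by rewrite !expr2; apply: cvgM.
Qed.

Lemma poisson_unique (mu nu : {finite_measure set R -> \bar R}) :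
  (forall x y, 0 < y -> \int[mu]_t poisson y x t = \int[nu]_t poisson y x t) ->
  forall A, measurable A -> mu A = nu A.
Proof.
move=> h.
have E1 a b n : a < b -> \int[mu]_t atan_diff (yn n) a b t = \int[nu]_t atan_diff (yn n) a b t.
  move=> ab; suff : (\int[mu]_t atan_diff (yn n) a b t)%:E = (\int[nu]_t atan_diff (yn n) a b t)%:E.
    by case.
  by rewrite !poisson_tonelli //; apply: eq_integral => x _; rewrite h.
have mi (rho : {finite_measure set R -> \bar R}) (A : set R) : measurable A ->
    \int[rho]_t \1_A t = fine (rho A).
  by move=> mA; rewrite /Rintegral integral_indic // setIT.
have ii (rho : {finite_measure set R -> \bar R}) (A : set R) : measurable A ->
    rintegrable rho (\1_A : R -> R).
  move=> mA; apply: (@rintegrable_bounded _ _ _ _ _ 1); first exact: measurable_indic.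
  by move=> t; rewrite indicE normr_nat lern1 leq_b1.
(* Atoms are recovered separately, from y times the kernel: the arctangent limit gives the endpoints
   only half weight. *)
have P1 a : fine (mu [set a]) = fine (nu [set a]).
  have C (rho : {finite_measure set R -> \bar R}) :
      \int[rho]_t (yn n * poisson (yn n) a t) @[n --> \oo] --> fine (rho [set a]).
    rewrite -mi //; apply: (@Rint_bounded_cvg _ _ _ _ _ _ 1).
    - move=> n; apply: measurable_funM => //; apply: continuous_measurable_fun.
      exact: continuous_poisson.
    - move=> n t; have n0 := ltW (yn0 n).
      rewrite ger0_norm; last by rewrite mulr_ge0 // poisson_ge0.
      by rewrite -(@divff _ (yn n)) ?gt_eqF // ler_wpM2l ?poisson_le // ltW.
    - exact: measurable_indic.
    - exact: point_cvg.
  apply: (cvg_unique _ (C mu)) => //.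
  rewrite (_ : (fun n => _) = fun n => \int[nu]_t (yn n * poisson (yn n) a t)); first exact: C.
  apply/funext => n; rewrite (RintZ _ (@rint_poisson mu (yn n) a (yn0 n))).
  by rewrite (RintZ _ (@rint_poisson nu (yn n) a (yn0 n))) h.
have P2 a b : a < b -> fine (mu `]a, b[%classic) = fine (nu `]a, b[%classic).
  move=> ab.
  pose g t : R := pi * \1_(`]a, b[%classic) t + (pi / 2) * (\1_[set a] t + \1_[set b] t).
  have C (rho : {finite_measure set R -> \bar R}) :
      \int[rho]_t (atan_diff (yn n) a b t) @[n --> \oo] --> \int[rho]_t g t.
    apply: (@Rint_bounded_cvg _ _ _ _ _ _ pi).
    - by move=> n; exact: measurable_atan_diff.
    - by move=> n t; exact: atan_diff_bound.
    - apply: measurable_funD; (apply: measurable_funM; first exact: measurable_cst).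
        by apply: measurable_indic; exact: measurable_itv.
      by apply: measurable_funD; exact: measurable_indic.
    - move=> t.
      have -> : g t = pi / 2 * Num.sg (b - t) - pi / 2 * Num.sg (a - t).
        have sgB (u v : R) : Num.sg (u - v) = ((v < u)%R)%:R - ((u < v)%R)%:R.
          case: (ltgtP u v) => [uv|uv|->].
          - by rewrite ltr0_sg ?subr_lt0 // sub0r.
          - by rewrite gtr0_sg ?subr_gt0 // subr0.
          - by rewrite subrr sgr0 subrr.
        rewrite !sgB /g !indicE mem_setE in_itv /= !classical_sets.in_set1.
        by case: (ltgtP a t) => at_; case: (ltgtP t b) => tb /=; lra.
      by apply: cvgB; exact: atan_scale_cvg.
  have G (rho : {finite_measure set R -> \bar R}) : \int[rho]_t g t =
     pi * fine (rho `]a, b[%classic) + pi / 2 * (fine (rho [set a]) + fine (rho [set b])).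
    have i2 : rintegrable rho (fun t => (\1_[set a] t + \1_[set b] t) : R).
      by apply: rintegrableD; exact: ii.
    rewrite RintD; [|apply: rintegrableZ; exact: ii|exact: rintegrableZ].
    by rewrite !RintZ ?RintD ?mi //; exact: ii.
  have : \int[mu]_t g t = \int[nu]_t g t.
    apply: (cvg_unique _ (C mu)) => //.
    rewrite (_ : (fun n => _) = fun n => \int[nu]_t (atan_diff (yn n) a b t)); first exact: C.
    by apply/funext => n; rewrite E1.
  rewrite !G !P1 => hh; apply: (@mulfI _ (pi : R)); first by rewrite gt_eqF // pi_gt0.
  exact: addIr hh.
have fm (A : set R) : measurable A -> fine (mu A) = fine (nu A) -> mu A = nu A.
  by move=> mA hh; rewrite -(fineK (fin_num_measure mu A mA)) hh fineK // fin_num_measure.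
have P3 a b : mu `]a, b]%classic = nu `]a, b]%classic.
  case: (ltP a b) => ab; last by rewrite set_itv_ge ?measure0 // bnd_simp -leNgt.
  rewrite -(@setUitv1 _ R (BRight a) b true) ?bnd_simp // !measureU //; last 2 first.
  - by apply/seteqP; split => // x [] /=; rewrite in_itv /= => /andP[_ xb] xb'; rewrite xb' ltxx in xb.
  - by apply/seteqP; split => // x [] /=; rewrite in_itv /= => /andP[_ xb] xb'; rewrite xb' ltxx in xb.
  have e1 : mu `]a, b[%classic = nu `]a, b[%classic by apply: fm => //; exact: P2.
  have e2 : mu [set b] = nu [set b] by apply: fm => //; exact: P1.
  exact: (congr2 adde e1 e2).
move=> A mA.
apply: (measure_unique (@ocitv R) (fun n => `]- n%:R, n%:R]%classic)) => //.
- exact: ocitvI.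
- by move=> n; exact: is_ocitv.
- apply/seteqP; split => // x _; exists (Num.truncn `|x|).+1 => //=.
  have := truncnS_gt `|x|; rewrite in_itv /= ltr_norml => /andP[-> /ltW ->] //.
- by move=> _ [[a b] _ <-]; exact: P3.
- by move=> n; rewrite -ge0_fin_numE // fin_num_measure.
Qed.

End stieltjes_inversion.

(** * Weak convergence from resolvents *)

Section bernstein.
Context {R : realType}.
Implicit Types (phi : nat -> R) (u : R) (g : R -> R).

(** At u in [0, 1], the value is the expectation of phi at a binomial (n, u) variable. The recursion
    conditions on one trial, so mean and variance follow by induction without binomial
    coefficients. *)
Fixpoint bernstein n phi : {poly R} :=
  if n is m.+1 then 'X * bernstein m (phi \o succn) + (1 - 'X) * bernstein m phi
  else (phi 0)%:P.

Lemma bernsteinS n phi u : (bernstein n.+1 phi).[u] =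
  u * (bernstein n (phi \o succn)).[u] + (1 - u) * (bernstein n phi).[u].
Proof. by rewrite /= !hornerE. Qed.

Lemma bernsteinD n phi psi (c : R) u : (bernstein n (fun k => phi k + c * psi k)).[u] =
  (bernstein n phi).[u] + c * (bernstein n psi).[u].
Proof.
elim: n phi psi => [|n IH] phi psi; first by rewrite /= !hornerE.
by rewrite !bernsteinS (IH phi psi) (IH (phi \o succn) (psi \o succn)); ring.
Qed.

Lemma bernstein_cst n (c : R) u : (bernstein n (fun=> c)).[u] = c.
Proof.
elim: n => [|n IH]; first by rewrite /= hornerE.
by rewrite bernsteinS (_ : (fun=> c) \o succn = fun=> c) // IH; ring.
Qed.

Lemma bernstein_ext n phi psi : phi =1 psi -> bernstein n phi = bernstein n psi.
Proof. by move=> /funext ->. Qed.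

Lemma bernstein_le n phi psi u : 0 <= u <= 1 -> (forall k, (k <= n)%N -> phi k <= psi k) ->
  (bernstein n phi).[u] <= (bernstein n psi).[u].
Proof.
move=> /andP[u0 u1]; elim: n phi psi => [|n IH] phi psi h.
  by rewrite /= !hornerE h.
rewrite !bernsteinS lerD // ler_wpM2l ?subr_ge0 //.
  by apply: IH => k kn; exact: h.
by apply: IH => k kn; apply: h; exact: leqW.
Qed.

Lemma bernstein_linear n u : (bernstein n (fun k => k%:R - n%:R * u)).[u] = 0.
Proof.
elim: n => [|n IH]; first by rewrite /= hornerE mul0r subr0.
rewrite bernsteinS (@bernstein_ext _ ((fun k => k%:R - n.+1%:R * u) \o succn)
  (fun k => (k%:R - n%:R * u) + (1 - u) * 1)); last first.
  by move=> k /=; rewrite -!natr1; ring.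
rewrite (@bernstein_ext _ (fun k => k%:R - n.+1%:R * u)
  (fun k => (k%:R - n%:R * u) + (- u) * 1)); last by move=> k; rewrite -natr1; ring.
rewrite !bernsteinD IH bernstein_cst; ring.
Qed.

Lemma bernstein_variance n u :
  (bernstein n (fun k => (k%:R - n%:R * u) ^+ 2)).[u] = n%:R * (u * (1 - u)).
Proof.
elim: n => [|n IH]; first by rewrite /= hornerE !mul0r subr0 expr0n.
rewrite bernsteinS (@bernstein_ext _ ((fun k => (k%:R - n.+1%:R * u) ^+ 2) \o succn)
  (fun k => ((k%:R - n%:R * u) ^+ 2 + (2 * (1 - u)) * (k%:R - n%:R * u)) + (1 - u) ^+ 2 * 1)); last first.
  by move=> k /=; rewrite -!natr1; ring.
rewrite (@bernstein_ext _ (fun k => (k%:R - n.+1%:R * u) ^+ 2)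
  (fun k => ((k%:R - n%:R * u) ^+ 2 + (- (2 * u)) * (k%:R - n%:R * u)) + u ^+ 2 * 1)); last first.
  by move=> k /=; rewrite -!natr1; ring.
by rewrite !bernsteinD IH !bernstein_linear bernstein_cst -natr1; ring.
Qed.

(** Bernstein's proof. Either k/n is within d of u and uniform continuity gives e/2, or 2 M <= c
    (k/n - u)^2; on averaging, the variance, at most 1/n, turns the second term into c/n <= e/2. *)
Lemma weierstrass g (e : R) : continuous g -> 0 < e ->
  exists p : {poly R}, forall u, 0 <= u <= 1 -> `|g u - p.[u]| <= e.
Proof.
move=> cg e0.
have [d d0 hd] : exists2 d : R, 0 < d & forall u v : R, 0 <= u <= 1 ->
    `|u - v| < d -> `|g u - g v| <= e / 2.
  have /compact_near_coveringP/near_covering_withinP := @segment_compact R 0 1.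
  move=> /(_ R 0^'+ (fun i x => forall v, `|x - v| < i -> `|g x - g v| <= e / 2) _).
  case=> [x _|d /= d0 h].
    have e4 : 0 < e / 4 by rewrite divr_gt0.
    have /cvgrPdist_lt/(_ _ e4)[d /= d0 hx] := cg x.
    exists (ball x (d / 2), [set i | i < d / 2]).
      split; first by apply: nbhsx_ballx; rewrite divr_gt0.
      by apply: nbhs_right_lt; rewrite divr_gt0.
    case=> x' i [/= bx id2] _ v vi.
    have h1 : `|g x - g x'| < e / 4.
      by apply: hx; apply: (lt_le_trans bx); rewrite ler_pdivrMr // ler_peMr // ?ler1n // ltW.
    have h2 : `|g x - g v| < e / 4.
      apply: hx; rewrite /ball_ /= -(subrKA x').
      rewrite (le_lt_trans (ler_normD _ _)) // (splitr d) ltrD //.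
      exact: lt_trans vi id2.
    rewrite -(subrKA (g x)) (le_trans (ler_normD _ _)) // distrC (splitr (e / 2)).
    by apply: lerD; apply: ltW; rewrite -mulrA -invfM -natrM.
  exists (d / 2); first by rewrite divr_gt0.
  move=> u v u01 uv; apply: (h (d / 2)) => //=.
  - by rewrite sub0r normrN gtr0_norm ?divr_gt0 // ltr_pdivrMr // ltr_pMr // ltr1n.
  - by rewrite divr_gt0.
have [M M0 hM] : exists2 M : R, 0 <= M & forall u : R, 0 <= u <= 1 -> `|g u| <= M.
  have [c c01 hc] := @EVT_max R (fun u => `|g u|) 0 1 ler01 (continuous_subspaceT (fun x => cvg_norm (cg x))).
  by exists `|g c| => // u u01; apply: hc; rewrite in_itv.
pose c := 2 * M / d ^+ 2.
have c0 : 0 <= c by rewrite mulr_ge0 ?invr_ge0 ?sqr_ge0 ?mulr_ge0.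
pose n := (Num.truncn (2 * c / e)).+1.
have n0 : 0 < n%:R :> R by rewrite ltr0n.
pose p := bernstein n (fun k => g (k%:R / n%:R)).
exists p => u u01.
have key k : (k <= n)%N -> `|g u - g (k%:R / n%:R)| <= e / 2 + c * (k%:R / n%:R - u) ^+ 2.
  move=> kn; have k01 : 0 <= (k%:R / n%:R : R) <= 1.
    by rewrite divr_ge0 //= ler_pdivrMr // mul1r ler_nat.
  case: (ltP `|u - k%:R / n%:R| d) => h.
    by rewrite (le_trans (hd _ _ u01 h)) // lerDl mulr_ge0 ?sqr_ge0.
  apply: (@le_trans _ _ (2 * M)).
    by rewrite (le_trans (ler_normB _ _)) // mulrDl mul1r lerD // hM.
  apply: (@le_trans _ _ (c * (k%:R / n%:R - u) ^+ 2)); last by rewrite lerDr divr_ge0 // ltW.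
  rewrite /c mulrAC ler_pdivlMr ?exprn_gt0 // ler_wpM2l ?mulr_ge0 //.
  by rewrite -[leRHS]real_normK ?num_real // distrC ler_sqr ?nnegrE // ltW.
have var : (bernstein n (fun k => (k%:R / n%:R - u) ^+ 2)).[u] <= n%:R^-1.
  rewrite (@bernstein_ext _ _ (fun k => 0 + n%:R ^- 2 * (k%:R - n%:R * u) ^+ 2)).
    rewrite bernsteinD bernstein_cst add0r bernstein_variance expr2 invfM mulrA mulrVK ?unitfE ?gt_eqF //.
    rewrite ler_piMr ?invr_ge0 ?ltW //; case/andP: u01 => ? ?; nra.
  by move=> k; rewrite add0r; field; rewrite gt_eqF.
have bnd : (bernstein n (fun k => e / 2 + c * (k%:R / n%:R - u) ^+ 2)).[u] <= e.
  rewrite bernsteinD bernstein_cst.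
  have : c * n%:R^-1 <= e / 2.
    rewrite ler_pdivrMr // mulrC -ler_pdivrMr ?divr_gt0 // ltW //.
    rewrite (_ : c / (e / 2) = 2 * c / e) ?truncnS_gt //.
    by field; rewrite gt_eqF.
  have := ler_wpM2l c0 var; lra.
set B := (bernstein n _).[u] in bnd.
have L1 : g u <= p.[u] + 1 * B.
  rewrite -[leLHS](bernstein_cst n _ u) -bernsteinD; apply: bernstein_le => // k /key.
  by rewrite mul1r ler_norml => /andP[]; lra.
have L2 : p.[u] <= g u + 1 * B.
  rewrite -[X in X + _](bernstein_cst n _ u) -bernsteinD; apply: bernstein_le => // k /key.
  by rewrite mul1r ler_norml => /andP[]; lra.
by rewrite ler_norml; apply/andP; split; lra.
Qed.

End bernstein.

(** * From resolvents at countably many points to bounded continuous functions *)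

Section weak_convergence.
Context {R : realType}.
Implicit Types (f g : R -> R) (s t : R).

Definition bmeas f := measurable_fun setT f /\ exists M : R, forall t, `|f t| <= M.

(** Covers the empirical and the deterministic integrals alike. Monotonicity is tested on t >= 0
    only, which encodes that the underlying measure is carried by [0, +oo[. *)
Definition prob_functional (E : (R -> R) -> R) :=
  [/\ forall c f g, bmeas f -> bmeas g -> E (fun t => f t + c * g t) = E f + c * E g,
      forall f g, bmeas f -> bmeas g -> (forall t, 0 <= t -> f t <= g t) -> E f <= E g &
      E (fun=> 1) = 1].

(** The absolute value gives a bounded continuous function on the whole line that equals 1/(s + t)
    on [0, +oo[, where all measures considered live. *)
Definition resolvent s t := (s + `|t|)^-1.

Lemma bmeas_cst (c : R) : bmeas (fun=> c).
Proof. by split; [exact: measurable_cst|exists `|c|]. Qed.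

Lemma bmeasD c f g : bmeas f -> bmeas g -> bmeas (fun t => f t + c * g t).
Proof.
move=> [mf [M fM]] [mg [M' gM']]; split.
  by apply: measurable_funD => //; apply: measurable_funM.
exists (M + `|c| * M') => t; rewrite (le_trans (ler_normD _ _)) // lerD // normrM.
by rewrite ler_wpM2l.
Qed.

Lemma bmeasM f g : bmeas f -> bmeas g -> bmeas (fun t => f t * g t).
Proof.
move=> [mf [M fM]] [mg [M' gM']]; split; first exact: measurable_funM.
by exists (M * M') => t; rewrite normrM ler_pM.
Qed.

Lemma resolvent_gt0 s t : 0 < s -> 0 < resolvent s t.
Proof. by move=> s0; rewrite invr_gt0 ltr_wpDr. Qed.

Lemma resolvent_le s t : 0 < s -> resolvent s t <= s^-1.
Proof. by move=> s0; rewrite lef_pV2 ?posrE ?ltr_wpDr // lerDl. Qed.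

Lemma continuous_resolvent s : 0 < s -> continuous (resolvent s).
Proof.
move=> s0 t; apply: cvgV; first by rewrite gt_eqF // ltr_wpDr.
by apply: cvgD; [exact: cvg_cst|exact: cvg_norm].
Qed.

Lemma bmeas_resolvent s : 0 < s -> bmeas (resolvent s).
Proof.
move=> s0; split; first by apply: continuous_measurable_fun; exact: continuous_resolvent.
by exists s^-1 => t; rewrite gtr0_norm ?resolvent_gt0 // resolvent_le.
Qed.

Lemma resolventB s s' t : 0 < s -> 0 < s' ->
  resolvent s t - resolvent s' t = (s' - s) * (resolvent s t * resolvent s' t).
Proof.
move=> s0 s'0; rewrite /resolvent; field.
by rewrite !gt_eqF // ltr_wpDr.
Qed.

Variables E F : nat -> (R -> R) -> R.
Hypotheses (pE : forall n, prob_functional (E n)) (pF : forall n, prob_functional (F n)).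

Definition agree f := bmeas f /\ (E n f - F n f) @[n --> \oo] --> 0.

Lemma agreeD c f g : agree f -> agree g -> agree (fun t => f t + c * g t).
Proof.
move=> [bf cf] [bg cg]; split; first exact: bmeasD.
rewrite (_ : (fun n => _) = fun n => (E n f - F n f) + c * (E n g - F n g)).
  rewrite -[X in _ --> X](addr0 0) -[X in _ --> 0 + X](mulr0 c).
  by apply: cvgD => //; apply: cvgM => //; exact: cvg_cst.
by apply/funext => n; case: (pE n) => h1 _ _; case: (pF n) => h2 _ _; rewrite h1 // h2 //; ring.
Qed.

Lemma agree_cst (c : R) : agree (fun=> c).
Proof.
have agree1 : agree (fun=> 1).
  split; first exact: bmeas_cst.
  have -> : (fun n => E n (fun=> 1) - F n (fun=> 1)) = cst 0; last exact: cvg_cst.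
  by apply/funext => n; have [_ _ ->] := pE n; have [_ _ ->] := pF n; rewrite subrr.
have := agreeD (c - 1) agree1 agree1.
by congr agree; apply/funext => t; ring.
Qed.

Lemma functional_close (G : (R -> R) -> R) f g (e : R) : prob_functional G ->
  bmeas f -> bmeas g -> (forall t, 0 <= t -> `|f t - g t| <= e) -> `|G f - G g| <= e.
Proof.
move=> [Gl Gm G1] bf bg h.
have B c : bmeas (fun t => g t + c * 1) by apply: bmeasD => //; exact: bmeas_cst.
have Gc c : G (fun t => g t + c * 1) = G g + c by rewrite Gl ?G1 ?mulr1 //; exact: bmeas_cst.
rewrite ler_norml; apply/andP; split.
  rewrite lerBrDl -[leLHS]Gc; apply: Gm => // t t0.
  by rewrite mulr1; have := h t t0; rewrite ler_norml => /andP[]; lra.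
rewrite lerBlDl -[leRHS]Gc; apply: Gm => // t t0.
by rewrite mulr1; have := h t t0; rewrite ler_norml => /andP[]; lra.
Qed.

Lemma functional_dom (G : (R -> R) -> R) f g k : prob_functional G ->
  bmeas f -> bmeas g -> bmeas k -> (forall t, 0 <= t -> `|f t - g t| <= k t) ->
  `|G f - G g| <= G k.
Proof.
move=> [Gl Gm _] bf bg bk h.
have B c : bmeas (fun t => g t + c * k t) by exact: bmeasD.
rewrite ler_norml; apply/andP; split.
  have : G (fun t => g t + -1 * k t) <= G f.
    by apply: Gm => // t t0; have := h t t0; rewrite ler_norml => /andP[]; lra.
  by rewrite Gl //; lra.
have : G f <= G (fun t => g t + 1 * k t).
  by apply: Gm => // t t0; have := h t t0; rewrite ler_norml => /andP[]; lra.
by rewrite Gl //; lra.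
Qed.

Lemma agree_lim f : bmeas f -> (forall e, 0 < e -> exists2 g, agree g &
  \forall n \near \oo, `|E n f - E n g| <= e /\ `|F n f - F n g| <= e) -> agree f.
Proof.
move=> bf h; split => //; apply/cvgrPdist_le => e e0.
have [|g [bg /cvgrPdist_le cg] nfg] := h (e / 4); first by rewrite divr_gt0.
have e2 : 0 < e / 2 by rewrite divr_gt0.
near=> n.
have h1 : `|0 - (E n g - F n g)| <= e / 2 by near: n; exact: cg.
have [h2 h3] : `|E n f - E n g| <= e / 4 /\ `|F n f - F n g| <= e / 4 by near: n.
move: h1 h2 h3; rewrite !ler_norml => /andP[? ?] /andP[? ?] /andP[? ?].
by apply/andP; split; lra.
Unshelve. all: by end_near. Qed.

Lemma agree_unif f : bmeas f -> (forall e, 0 < e -> exists2 g, agree g &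
  forall t, 0 <= t -> `|f t - g t| <= e) -> agree f.
Proof.
move=> bf h; apply: agree_lim => // e e0; have [g ag fg] := h e e0.
exists g => //; apply: nearW => n; have [bg _] := ag.
by split; apply: functional_close.
Qed.

Hypothesis agree_res : forall i N : nat,
  (E n (resolvent (1 + i%:R / N.+1%:R)) - F n (resolvent (1 + i%:R / N.+1%:R)))
    @[n --> \oo] --> 0.

Let s_ N i : R := 1 + i%:R / N.+1%:R.
Let s_ge1 N i : 1 <= s_ N i. Proof. by rewrite lerDl. Qed.
Let s_gt0 N i : 0 < s_ N i. Proof. exact: lt_le_trans (s_ge1 N i). Qed.

Let W N j k t := \prod_(i < k) resolvent (s_ N (j + i)) t.

(** Partial fractions: since the nodes are distinct, the product of the two outer factors is a
    multiple of their difference, so a product of length k + 2 is a multiple of the difference of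
    two products of length k + 1. *)
Let agree_W N j k : agree (W N j k.+1).
Proof.
elim: k j => [|k IH] j.
  rewrite (_ : W N j 1 = resolvent (s_ N j)).
    by split; [exact: bmeas_resolvent|exact: agree_res].
  by apply/funext => t; rewrite /W big_ord1 addn0.
(* [agreeD] forms f + c g; taking g = f and the coefficient C - 1 scales f by C = (N+1)/(k+1). *)
have := agreeD (N.+1%:R / k.+1%:R - 1) (agreeD (-1) (IH j) (IH j.+1))
  (agreeD (-1) (IH j) (IH j.+1)).
congr agree; apply/funext => t.
rewrite /W [X in X + _ = _]addrC -/(W N j k.+1 t).
pose P := \prod_(i < k) resolvent (s_ N (j.+1 + i)) t.
have E1 : \prod_(i < k.+1) resolvent (s_ N (j + i)) t = resolvent (s_ N j) t * P.
  rewrite big_ord_recl addn0; congr (_ * _); apply: eq_bigr => i _.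
  by rewrite /= /bump add1n addnS.
have E2 : \prod_(i < k.+1) resolvent (s_ N (j.+1 + i)) t = P * resolvent (s_ N (j.+1 + k)) t.
  by rewrite big_ord_recr.
have E3 : \prod_(i < k.+2) resolvent (s_ N (j + i)) t =
   P * (resolvent (s_ N j) t * resolvent (s_ N (j.+1 + k)) t).
  rewrite big_ord_recr /= E1 addnS addSn; ring.
have := resolventB t (s_gt0 N j) (s_gt0 N (j.+1 + k)).
rewrite /W E1 E2 E3.
have -> : s_ N (j.+1 + k) - s_ N j = k.+1%:R / N.+1%:R.
  by rewrite /s_ addSn -addnS natrD; field; rewrite addrC natr1 pnatr_eq0.
set a := resolvent _ t; set b := resolvent _ t => h.
have -> : a * b = N.+1%:R / k.+1%:R * (a - b).
  rewrite h mulrA -[X in _ = X * _]mulrA [X in _ = _ * X * _]mulrA mulVf ?pnatr_eq0 // mul1r divff ?pnatr_eq0 //.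
  by rewrite mul1r.
ring.
Qed.

(** A power has a repeated node, so it is reached as a uniform limit of products with nodes 1/(N+1)
    apart. For exponent k + 1, exchanging the factors one by one costs at most (k+1)/(N+1) each. *)
Let agree_pow k : agree (fun t => resolvent 1 t ^+ k).
Proof.
have bp : bmeas (fun t => resolvent 1 t ^+ k).
  elim: k => [|k IH].
    by under eq_fun do rewrite expr0; exact: bmeas_cst.
  by under eq_fun do rewrite exprS; apply: bmeasM => //; exact: bmeas_resolvent.
case: k bp => [|k] bp; first by under eq_fun do rewrite expr0; exact: agree_cst.
apply: agree_unif => // e e0.
pose N := Num.truncn ((k.+1 * k.+1)%:R / e).
exists (W N 0 k.+1); first exact: agree_W.
move=> t _.
have r01 s : 1 <= s -> 0 <= resolvent s t <= 1.
  move=> s1; have s0 : 0 < s by exact: lt_le_trans s1.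
  by rewrite ltW ?resolvent_gt0 // (le_trans (resolvent_le _ s0)) // invf_le1.
have rd i : (i <= k.+1)%N -> `|resolvent 1 t - resolvent (s_ N i) t| <= k.+1%:R / N.+1%:R.
  move=> ik; rewrite resolventB // /s_ addrC addKr normrM.
  have /andP[? ?] := r01 1 (lexx _); have /andP[? ?] := r01 _ (s_ge1 N i).
  rewrite [X in X * _]ger0_norm ?divr_ge0 // [X in _ * X]ger0_norm ?mulr_ge0 //.
  rewrite -[leRHS]mulr1 ler_pM ?divr_ge0 ?mulr_ge0 ?mulr_ile1 //.
  by rewrite ler_wpM2r // ler_nat.
have : forall m, (m <= k.+1)%N -> `|resolvent 1 t ^+ m - W N 0 m t| <= m%:R * (k.+1%:R / N.+1%:R).
  elim=> [|m IH] mk; first by rewrite /W big_ord0 expr0 subrr normr0 mul0r.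
  rewrite /W big_ord_recr /= -/(W N 0 m t) exprSr.
  have -> : resolvent 1 t ^+ m * resolvent 1 t - W N 0 m t * resolvent (s_ N (0 + m)) t =
    (resolvent 1 t ^+ m - W N 0 m t) * resolvent 1 t +
    W N 0 m t * (resolvent 1 t - resolvent (s_ N m) t) by rewrite add0n; ring.
  rewrite (le_trans (ler_normD _ _)) // !normrM -natr1 mulrDl mul1r lerD //.
    have /andP[r0 r1] := r01 1 (lexx _); rewrite (ger0_norm r0).
    by rewrite -[leRHS]mulr1 ler_pM // IH // ltnW.
  rewrite -[leRHS]mul1r ler_pM //; last by apply: rd; exact: ltnW.
  rewrite normr_prod prodr_ile1 // => i _.
  by have /andP[r0 r1] := r01 _ (s_ge1 N (0 + i)); rewrite normr_ge0 ger0_norm.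
move=> /(_ k.+1 (leqnn _))/le_trans; apply.
rewrite mulrA -natrM ler_pdivrMr // mulrC -ler_pdivrMr // ltW //.
exact: truncnS_gt.
Qed.

Let agree_poly (p : {poly R}) : agree (fun t => p.[resolvent 1 t]).
Proof.
under eq_fun do rewrite horner_coef.
elim: (size p) => [|m IH]; first by under eq_fun do rewrite big_ord0; exact: agree_cst.
by under eq_fun do rewrite big_ord_recr /=; apply: agreeD.
Qed.

(** In the coordinate u = 1/(1 + t), [f] on [0, K] is a continuous function of u >= [kap], extended
    by a constant below so that Weierstrass applies on [0, 1]. For t > K the error is at most e/4 +
    2 M, and 2 M <= 4 M t/(K + t); the functional takes t/(K + t) to 1 - K G(resolvent K), which is
    small by tightness. *)
Theorem weak_convergence_of_resolvents f :
  (forall e : R, 0 < e -> exists i : nat, \forall n \near \oo,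
     1 - (1 + i%:R) * F n (resolvent (1 + i%:R)) <= e) ->
  continuous f -> (exists M : R, forall t, `|f t| <= M) ->
  (E n f - F n f) @[n --> \oo] --> 0.
Proof.
move=> tight cf [M fM].
have bf : bmeas f by split; [exact: continuous_measurable_fun|exists M].
have M0 : 0 <= M by exact: le_trans (normr_ge0 _) (fM 0).
suff : agree f by case.
apply: agree_lim => // e e0.
pose e' := e / (4 * (8 * M + 1)).
have d0 : 0 < 8 * M + 1 by rewrite ltr_wpDl // mulr_ge0.
have e'0 : 0 < e' by rewrite divr_gt0 // mulr_gt0.
have Me' : 4 * M * (2 * e') <= e / 4.
  have -> : e / 4 = e' * (8 * M + 1) by rewrite /e'; field; rewrite gt_eqF.
  by move: e'0 M0; nra.
have [i ti] := tight e' e'0; set K : R := 1 + i%:R in ti.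
have K0 : 0 < K by rewrite ltr_wpDr.
pose kap := (1 + K)^-1.
have kap0 : 0 < kap by rewrite invr_gt0 ltr_wpDl // ltW.
pose g u := f ((Num.max u kap)^-1 - 1).
have mx0 u : 0 < Num.max u kap by rewrite lt_max kap0 orbT.
have cg : continuous g.
  move=> u; apply: (@continuous_comp _ _ _ (fun u => (Num.max u kap)^-1 - 1) f); last exact: cf.
  apply: cvgB; last exact: cvg_cst.
  apply: cvgV; first by rewrite gt_eqF.
  by apply: (@continuous_max _ _ (fun u => u) (fun=> kap)); [exact: cvg_id|exact: cvg_cst].
have [p hp] := @weierstrass R g (e / 4) cg (divr_gt0 e0 (ltr0n _ 4)).
exists (fun t => p.[resolvent 1 t]); first exact: agree_poly.
have [bh _] := agree_poly p.
pose k t := (fun=> e / 4 + 4 * M) t + (- (4 * M * K)) * resolvent K t.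
have bk : bmeas k by apply: bmeasD; [exact: bmeas_cst|exact: bmeas_resolvent].
have fk t : 0 <= t -> `|f t - p.[resolvent 1 t]| <= k t.
  move=> t0; have u01 : 0 <= resolvent 1 t <= 1.
    by rewrite ltW ?resolvent_gt0 //= -[leRHS]invr1 resolvent_le.
  have h1 := hp _ u01.
  have Kt0 : 0 < K + t by rewrite ltr_wpDr.
  have kE : k t = e / 4 + 4 * M * (t / (K + t)).
    by rewrite /k /resolvent ger0_norm //; field; rewrite gt_eqF.
  case: (leP t K) => tK.
    have -> : f t = g (resolvent 1 t).
      rewrite /g max_l /resolvent; first by rewrite invrK ger0_norm // addrC addKr.
      by rewrite lef_pV2 ?posrE ?ltr_wpDr // ?ger0_norm // ?lerD2l // ltW.
    rewrite kE (le_trans h1) // lerDl; apply: mulr_ge0; first exact: mulr_ge0.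
    by apply: divr_ge0 => //; exact: ltW.
  rewrite -(subrKA (g (resolvent 1 t))) (le_trans (ler_normD _ _)) // addrC kE lerD //.
  apply: (@le_trans _ _ (2 * M)).
    by rewrite (le_trans (ler_normB _ _)) // mulrDl mul1r lerD // fM.
  rewrite (_ : 2 * M = 4 * M * 2^-1); last by field.
  rewrite ler_wpM2l ?mulr_ge0 // ler_pdivlMr //; lra.
have Gk (G : (R -> R) -> R) : prob_functional G -> G k = e / 4 + 4 * M * (1 - K * G (resolvent K)).
  case=> Gl Gm G1; rewrite Gl; [|exact: bmeas_cst|exact: bmeas_resolvent].
  have -> : G (fun=> e / 4 + 4 * M) = e / 4 + 4 * M.
    have := Gl (e / 4 + 4 * M - 1) _ _ (bmeas_cst 1) (bmeas_cst 1); rewrite G1.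
    have -> : (fun _ : R => 1 + (e / 4 + 4 * M - 1) * 1) = (fun=> e / 4 + 4 * M).
      by apply/funext => t; ring.
    by move=> ->; ring.
  ring.
have := agree_res i 0; rewrite divr1 -/K => /cvgrPdist_le ar.
have eK : 0 < e' / K by rewrite divr_gt0.
near=> n.
have n1 : 1 - K * F n (resolvent K) <= e' by near: n.
have n2 : `|0 - (E n (resolvent K) - F n (resolvent K))| <= e' / K by near: n; exact: ar.
(* Tightness is assumed for [F] and passes to [E] through the agreement of the two functionals at K
   = 1 + i, the node i of the grid with N = 0. *)
have n3 : 1 - K * E n (resolvent K) <= 2 * e'.
  move: n2; rewrite sub0r normrN ler_norml => /andP[+ _].
  rewrite -(ler_pM2l K0) mulrN mulrCA divff ?gt_eqF // mulr1 mulrBr; lra.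
have bnd (G : (R -> R) -> R) : prob_functional G -> 1 - K * G (resolvent K) <= 2 * e' ->
    `|G f - G (fun t => p.[resolvent 1 t])| <= e.
  move=> pG hG; apply: le_trans (functional_dom pG bf bh bk fk) _; rewrite Gk //.
  have : 4 * M * (1 - K * G (resolvent K)) <= 4 * M * (2 * e').
    by rewrite ler_wpM2l // mulr_ge0.
  lra.
by split; apply: bnd => //; lra.
Unshelve. all: by end_near. Qed.

End weak_convergence.

(** * Families of independent Gaussian variables *)

Definition cylinders (R : realType) (I : finType) : set (set (I -> R)) :=
  [set [set x | forall i, B i (x i)] | B in [set B : I -> set R | forall i, measurable (B i)]].

Notation family R I := (g_sigma_algebraType (@cylinders R I)).

Section families.
Context {R : realType}.

Lemma measurable_coord (I : finType) (i : I) : measurable_fun [set: family R I] (fun x : family R I => x i).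
Proof.
move=> _ A mA; rewrite setTI; apply: sub_sigma_algebra.
exists (fun j => if j == i then A else setT).
  by move=> j; case: ifP.
apply/seteqP; split => x /= => [/(_ i)|xA j]; first by rewrite eqxx.
by case: eqP => // ->.
Qed.

Lemma measurable_family d (T : measurableType d) (I : finType) (Y : T -> family R I) :
  (forall i, measurable_fun setT (fun w => Y w i)) -> measurable_fun setT Y.
Proof.
move=> mY; have H := @measurability _ _ T (family R I) setT Y (@cylinders R I) erefl.
apply: H.
move=> _ [_ [B mB <-] <-]; rewrite setTI.
rewrite (_ : _ @^-1` _ = \bigcap_(i in [set: I]) ((fun w => Y w i) @^-1` B i)).
  apply: fin_bigcap_measurable => // i _.
  by rewrite -[X in measurable X]setTI; apply: mY.
apply/seteqP; split => [w /= h i _|w /= h i]; [exact: h|exact: (h i)].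
Qed.

Local Notation gauss := (normal_prob (0 : R) (1 : R)).

(** Only boxes over the full index set are tested; factors [setT] recover subfamilies. With plain
    functions, reindexed and juxtaposed families carry no further structure. *)
Definition iid_normal d (T : measurableType d) (P : probability T R) (I : finType)
    (Y : I -> T -> R) :=
  (forall i, measurable_fun setT (Y i)) /\
  forall A : I -> set R, (forall i, measurable (A i)) ->
    P [set w | forall i, A i (Y i w)] = (\prod_i gauss (A i))%E.

Definition tuple_of d (T : measurableType d) (I : finType) (Y : I -> T -> R) (w : T) : family R I :=
  fun i => Y i w.

Section law.
Context d (T : measurableType d) (P : probability T R)
  d' (T' : measurableType d') (P' : probability T' R).
Variables (I : finType) (Y : I -> T -> R) (Y' : I -> T' -> R).
Hypotheses (hY : iid_normal P Y) (hY' : iid_normal P' Y').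

Let mY : measurable_fun setT (tuple_of Y).
Proof. by apply: measurable_family => i; case: hY => h _; exact: h. Qed.
Let mY' : measurable_fun setT (tuple_of Y').
Proof. by apply: measurable_family => i; case: hY' => h _; exact: h. Qed.

Let tY := tuple_of Y.
Let tY' := tuple_of Y'.
HB.instance Definition _ := @isMeasurableFun.Build _ _ _ _ tY mY.
HB.instance Definition _ := @isMeasurableFun.Build _ _ _ _ tY' mY'.

Let law_eq (A : set (family R I)) : measurable A ->
  distribution P (tY : {mfun T >-> family R I}) A =
  distribution P' (tY' : {mfun T' >-> family R I}) A.
Proof.
have H := @measure_unique _ R (family R I) (@cylinders R I) (fun _ => setT) erefl.
move: A; apply: H.
- move=> _ _ [B mB <-] [B' mB' <-]; exists (fun i => B i `&` B' i).
    by move=> i; exact: measurableI.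
  by apply/seteqP; split => [x /= h|x /= [h h'] i]; [split=> i; case: (h i)|split].
- by move=> _; exists (fun _ => setT) => //; apply/seteqP; split.
- by apply/seteqP; split => // x _; exists 0%N.
- move=> _ [B mB <-]; rewrite /distribution /pushforward.
  by case: hY => _ /(_ B mB) E; case: hY' => _ /(_ B mB) E'; exact: (etrans E (esym E')).
- by move=> _; apply: (le_lt_trans (probability_le1 _ _)) => //; exact: ltry.
Qed.

Lemma law_ge0 (f : family R I -> \bar R) : measurable_fun setT f -> (forall x, 0 <= f x)%E ->
  (\int[P]_w f (tuple_of Y w) = \int[P']_w f (tuple_of Y' w))%E.
Proof.
move=> mf f0.
have := ge0_integral_distribution (tY : {RV P >-> family R I}) mf f0.
have := ge0_integral_distribution (tY' : {RV P' >-> family R I}) mf f0.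
move=> /= <- <-; apply: eq_measure_integral => A mA _; exact: law_eq.
Qed.

Lemma law_int (f : family R I -> \bar R) : measurable_fun setT f ->
  (\int[P]_w f (tuple_of Y w) = \int[P']_w f (tuple_of Y' w))%E.
Proof.
move=> mf; rewrite integralE [RHS]integralE; congr (_ - _)%E.
  have := @law_ge0 (f^\+)%E (measurable_funepos mf) (funepos_ge0 f).
  by rewrite (funepos_comp f (tuple_of Y)) (funepos_comp f (tuple_of Y')).
have := @law_ge0 (f^\-)%E (measurable_funeneg mf) (funeneg_ge0 f).
by rewrite (funeneg_comp f (tuple_of Y)) (funeneg_comp f (tuple_of Y')).
Qed.

Lemma law_Rint (f : family R I -> R) : measurable_fun setT f ->
  \int[P]_w f (tuple_of Y w) = \int[P']_w f (tuple_of Y' w).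
Proof. by move=> mf; congr fine; apply: (law_int (f := EFin \o f)); exact/measurable_EFinP. Qed.

Lemma law_rintegrable (f : family R I -> R) : measurable_fun setT f ->
  rintegrable P' (fun w => f (tuple_of Y' w)) -> rintegrable P (fun w => f (tuple_of Y w)).
Proof.
move=> mf /integrableP[_ h]; apply/integrableP; split.
  by apply/measurable_EFinP; exact: (measurableT_comp mf mY).
apply: le_lt_trans h; rewrite le_eqVlt; apply/orP; left; apply/eqP.
apply: (law_ge0 (f := fun x => `|(f x)%:E|%E)) => //.
by apply: measurableT_comp => //; exact/measurable_EFinP.
Qed.

End law.

(** A box for the subfamily is completed by the whole line outside the image of [h]. For a
    permutation [h], this is exchangeability. *)
Lemma iid_normal_inj d (T : measurableType d) (P : probability T R) (I K : finType)
  (Y : I -> T -> R) (h : K -> I) : injective h -> iid_normal P Y ->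
  iid_normal P (fun k => Y (h k)).
Proof.
move=> hi [mY iY]; split=> [k|A mA]; first exact: mY.
pose A' i := if [pick k | h k == i] is Some k then A k else setT.
have A'h k : A' (h k) = A k.
  by rewrite /A'; case: pickP => [k' /eqP/hi -> //|/(_ k)]; rewrite eqxx.
have mA' i : measurable (A' i) by rewrite /A'; case: pickP.
have -> : [set w | forall k, A k (Y (h k) w)] = [set w | forall i, A' i (Y i w)].
  apply/seteqP; split => w /= H => [i|k]; last by rewrite -A'h.
  by rewrite /A'; case: pickP => // k /eqP <-.
rewrite iY // (bigID (mem (codom h))) /= [X in (_ * X)%E]big1 ?mule1; last first.
  move=> i ih; rewrite /A'; case: pickP => [k /eqP e|_]; last exact: probability_setT.
  by rewrite -e codom_f in ih.
rewrite -big_uniq /=; last by rewrite map_inj_uniq ?enum_uniq.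
by rewrite big_map enumT; apply: eq_bigr => k _; rewrite A'h.
Qed.

Section mix.
Context d (T : measurableType d) (P : probability T R)
  d' (T' : measurableType d') (P' : probability T' R).
Variables (I I' : finType) (Y : I -> T -> R) (Y' : I' -> T' -> R).
Hypotheses (hY : iid_normal P Y) (hY' : iid_normal P' Y').

(** Two independent families side by side on the product space. Followed by an injective reindexing,
    this is the device behind every resampling below. *)
Definition mix (k : I + I') (w : T * T') : R :=
  match k with inl i => Y i w.1 | inr i => Y' i w.2 end.

Lemma iid_normal_mix : iid_normal (P \x P')%E mix.
Proof.
case: hY hY' => mY iY [mY' iY']; split.
  move=> [i|i]; first exact: (measurableT_comp (mY i) measurable_fst).
  exact: (measurableT_comp (mY' i) measurable_snd).
move=> A mA.
have -> : [set w | forall k, A k (mix k w)] =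
   [set w | forall i, A (inl i) (Y i w)] `*` [set w | forall i, A (inr i) (Y' i w)].
  apply/seteqP; split => [[w w'] /= h|[w w'] /= [h h'] k].
    by split=> i; [exact: (h (inl i))|exact: (h (inr i))].
  by case: k => i; [exact: h|exact: h'].
have m d0 (T0 : measurableType d0) (K : finType) (Z : K -> T0 -> R) (B : K -> set R) :
    (forall k, measurable_fun setT (Z k)) -> (forall k, measurable (B k)) ->
    measurable [set w | forall k, B k (Z k w)].
  move=> mZ mB; rewrite (_ : mkset _ = \bigcap_(k in [set: K]) (Z k @^-1` B k)).
    apply: fin_bigcap_measurable => // k _.
    by rewrite -[X in measurable X]setTI; apply: mZ.
  by apply/seteqP; split => [w /= h k _|w /= h k]; [exact: h|exact: (h k)].
have E := @product_measure1E _ _ T T' R P P' _ _ (m _ _ _ _ _ mY (fun i => mA (inl i)))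
   (m _ _ _ _ _ mY' (fun i => mA (inr i))).
apply: (etrans E); rewrite [RHS]big_sumType.
by apply: (congr2 mule); [exact: (iY (fun i => A (inl i)))|exact: (iY' (fun i => A (inr i)))].
Qed.

End mix.
End families.

(** * The Efron-Stein inequality *)

Section product_integral.
Context {R : realType} d (T : measurableType d) (P : probability T R)
  d' (T' : measurableType d') (P' : probability T' R).

Lemma rintegrable_prod (f : T -> R) (g : T' -> R) : rintegrable P f -> rintegrable P' g ->
  rintegrable (P \x P')%E (fun w => f w.1 * g w.2).
Proof.
move=> hf hg.
have mf := rintegrable_measurable hf; have mg := rintegrable_measurable hg.
apply/integrable12ltyP.
  apply/measurable_EFinP; apply: measurable_funM.
    exact: (measurableT_comp mf measurable_fst).
  exact: (measurableT_comp mg measurable_snd).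
have E x : (\int[P']_y `|(f x * g y)%:E| = `|f x|%:E * \int[P']_y `|(g y)%:E|)%E.
  under eq_integral do rewrite EFinM abseM.
  rewrite ge0_integralZl //.
  by apply: measurableT_comp => //; exact/measurable_EFinP.
under eq_integral do rewrite E.
have mnf : measurable_fun setT (fun x => `|f x|%:E).
  by apply/measurable_EFinP; exact: measurableT_comp.
rewrite ge0_integralZr //; last exact: integral_ge0.
have /integrableP[_ h] := hf; have /integrableP[_ h'] := hg.
by apply: lte_mul_pinfty => //; [exact: integral_ge0|rewrite ge0_fin_numE //; exact: integral_ge0].
Qed.

Lemma Rint_prod (f : T -> R) (g : T' -> R) : rintegrable P f -> rintegrable P' g ->
  \int[(P \x P')%E]_w (f w.1 * g w.2) = (\int[P]_x f x) * (\int[P']_y g y).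
Proof.
move=> hf hg; have hfg := rintegrable_prod hf hg.
have I12 := integral12_prod_meas1 hfg.
apply: EFin_inj.
transitivity (\int[(P \x P')%E]_w (f w.1 * g w.2)%:E)%E.
  by rewrite /Rintegral fineK //; apply: (integrable_fin_num _ hfg).
have I12' : (\int[P]_x \int[P']_y (f x * g y)%:E = \int[(P \x P')%E]_w (f w.1 * g w.2)%:E)%E.
  exact: I12.
rewrite -I12'.
under eq_integral.
  move=> x _; rewrite -EFin_Rint; last exact: rintegrableZ.
  rewrite RintZ //; over.
rewrite -EFin_Rint; last by under eq_fun do rewrite mulrC; exact: rintegrableZ.
under eq_Rintegral do rewrite mulrC.
by rewrite RintZ // mulrC.
Qed.

End product_integral.

Section efron_stein.
Context {R : realType} d (T : measurableType d) (P : probability T R).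
Variables (I : finType) (Y : I -> T -> R) (n : nat) (b : I -> 'I_n).
Hypothesis hY : iid_normal P Y.

Lemma measurable_reindex (J K : finType) (h : K -> J) :
  measurable_fun [set: family R J] (fun x : family R J => (x \o h) : family R K).
Proof. by apply: measurable_family => k; exact: measurable_coord. Qed.

Let PP : probability (T * T)%type R := (P \x P)%E.
Let Z := mix Y Y.
Let hZ : iid_normal PP Z. Proof. exact: iid_normal_mix. Qed.

(** [sw k] exchanges block k with its independent copy, [th k] all blocks below k; both preserve the
    joint law. *)
Let sw (k : nat) (s : I + I) : I + I := match s with
  | inl i => if b i == k :> nat then inr i else inl i
  | inr i => if b i == k :> nat then inl i else inr i end.
Let th (k : nat) (s : I + I) : I + I := match s with
  | inl i => if (b i < k)%N then inr i else inl i
  | inr i => if (b i < k)%N then inl i else inr i end.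
Let swK k : involutive (sw k).
Proof. by case=> i /=; case: (boolP (_ == _)) => //= h; rewrite ?h ?(negPf h). Qed.
Let thK k : involutive (th k).
Proof. by case=> i /=; case: (boolP (_ < _)%N) => //= h; rewrite ?h ?(negPf h). Qed.

Let inl_inj : injective (@inl I I). Proof. by move=> ? ? []. Qed.

Let law_sub (J : finType) (h : J -> I + I) (G : family R J -> R) (Y' : J -> T -> R) :
  injective h -> iid_normal P Y' -> measurable_fun setT G ->
  \int[PP]_w G (tuple_of Z w \o h) = \int[P]_w G (tuple_of Y' w).
Proof. by move=> hi hY' mG; exact: (law_Rint (iid_normal_inj hi hZ) hY' mG). Qed.

Let law_perm (h : I + I -> I + I) (G : family R (I + I)%type -> R) :
  injective h -> measurable_fun setT G ->
  \int[PP]_w G (tuple_of Z w \o h) = \int[PP]_w G (tuple_of Z w).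
Proof. by move=> hi mG; exact: (law_Rint (iid_normal_inj hi hZ) hZ mG). Qed.

Let sq_sub (h : I -> I + I) (G : family R I -> R) : injective h -> measurable_fun setT G ->
  sqintegrable P (fun w => G (tuple_of Y w)) ->
  sqintegrable PP (fun w => G (tuple_of Z w \o h)).
Proof.
move=> hi mG [_ hG]; have iidh := iid_normal_inj hi hZ; split.
  by apply: (measurableT_comp mG); apply: measurable_family => i; have [m _] := iidh; exact: m.
have mG2 : measurable_fun setT (fun x => G x ^+ 2) by exact: measurable_funX.
exact: (law_rintegrable iidh hY mG2 hG).
Qed.

(** [b] sorts the coordinates into blocks: single coordinates for the Poincare inequality, whole
    rows for the resolvent. With [A k] the function F after replacing the first k blocks by the
    copy, the variance is E[A_0 (A_0 - A_n)], which telescopes. Exchanging block k turns each term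
    into one half of E[(A_0 - B_k)(A_k - A_(k+1))], which is at most one half of E[(A_0 - B_k)^2]
    because both factors have the same second moment. Inserting f_k, which does not see block k,
    bounds E[(A_0 - B_k)^2] by 4 E[(F - f_k)^2]; hence the factor 2. *)
Lemma efron_stein (F : family R I -> R) (f : 'I_n -> family R I -> R) :
  measurable_fun setT F -> sqintegrable P (fun w => F (tuple_of Y w)) ->
  (forall k, measurable_fun setT (f k)) ->
  (forall k, sqintegrable P (fun w => f k (tuple_of Y w))) ->
  (forall k x y, (forall i, b i != k -> x i = y i) -> f k x = f k y) ->
  \int[P]_w (F (tuple_of Y w) - \int[P]_w' F (tuple_of Y w')) ^+ 2 <=
  2 * \sum_k \int[P]_w (F (tuple_of Y w) - f k (tuple_of Y w)) ^+ 2.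
Proof.
move=> mF sF mf sf indep; set m := \int[P]_w' F (tuple_of Y w').
pose A k (z : family R (I + I)%type) := F (z \o th k \o inl).
pose B k (z : family R (I + I)%type) := F (z \o sw k \o inl).
have inj_th k : injective (th k \o inl) := inj_comp (inv_inj (thK k)) inl_inj.
have inj_sw k : injective (sw k \o inl) := inj_comp (inv_inj (swK k)) inl_inj.
have mA k : measurable_fun setT (A k) := measurableT_comp mF (measurable_reindex (th k \o inl)).
have mB k : measurable_fun setT (B k) := measurableT_comp mF (measurable_reindex (sw k \o inl)).
have sA k : sqintegrable PP (fun w => A k (tuple_of Z w)) := sq_sub (inj_th k) mF sF.
have sB k : sqintegrable PP (fun w => B k (tuple_of Z w)) := sq_sub (inj_sw k) mF sF.
have A0 z : A 0 z = F (z \o inl) by congr F; apply/funext => i.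
have An z : A n z = F (z \o inr).
  by congr F; apply/funext => i; rewrite /= ltn_ord.
have A_sw k z : A k (z \o sw k) = A k.+1 z.
  congr F; apply/funext => i; rewrite /= [in RHS]ltnS.
  by case: (ltngtP (b i) k) => h /=; rewrite ?h ?eqxx ?(gtn_eqF h) ?(ltn_eqF h).
have A_sw' k z : A k.+1 (z \o sw k) = A k z.
  rewrite -{2}[z](_ : z \o sw k \o sw k = z) ?A_sw //.
  by apply/funext => s; rewrite /= swK.
have A_th k z : A 0 (z \o th k) = A k z by rewrite A0.
have B_th k z : B k (z \o th k) = A k.+1 z.
  congr F; apply/funext => i; rewrite /= [in RHS]ltnS.
  by case: (ltngtP (b i) k) => h /=; rewrite ?h ?ltnn ?(ltn_eqF h) //= ltnNge ltnW.
have B_sw k z : A 0 (z \o sw k) = B k z by rewrite A0.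
have step : forall k : 'I_n, \int[PP]_w (A 0 (tuple_of Z w) * (A k (tuple_of Z w) - A k.+1 (tuple_of Z w)))
   <= 2 * \int[P]_w (F (tuple_of Y w) - f k (tuple_of Y w)) ^+ 2.
  move=> k; set X := \int[_]_w _.
  have i1 : rintegrable PP (fun w => A 0 (tuple_of Z w) * (A k (tuple_of Z w) - A k.+1 (tuple_of Z w))).
    by apply: sqintegrableM => //; exact: sqintegrableB.
  have i2 : rintegrable PP (fun w => B k (tuple_of Z w) * (A k.+1 (tuple_of Z w) - A k (tuple_of Z w))).
    by apply: sqintegrableM => //; exact: sqintegrableB.
  have X2 : X = \int[PP]_w (B k (tuple_of Z w) * (A k.+1 (tuple_of Z w) - A k (tuple_of Z w))).
    rewrite /X -(law_perm (h := sw k) (G := fun z => A 0 z * (A k z - A k.+1 z))).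
    - by apply: eq_Rintegral => w _; rewrite A_sw A_sw' B_sw.
    - exact: inv_inj.
    - by apply: measurable_funM => //; exact: measurable_funB.
  pose V := \int[PP]_w (A 0 (tuple_of Z w) - B k (tuple_of Z w)) ^+ 2.
  have V2 : \int[PP]_w (A k (tuple_of Z w) - A k.+1 (tuple_of Z w)) ^+ 2 = V.
    rewrite /V -(law_perm (h := th k) (G := fun z => (A 0 z - B k z) ^+ 2)).
    - by apply: eq_Rintegral => w _; rewrite A_th B_th.
    - exact: inv_inj.
    - by apply: measurable_funX; exact: measurable_funB.
  have [_ iV] := sqintegrableB (sA 0) (sB k).
  have [_ iV2] := sqintegrableB (sA k) (sA k.+1).
  have XV : X + X <= V.
    rewrite {2}X2 /X -RintD //.
    have -> : V = 2^-1 * V + 2^-1 * V by field.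
    rewrite -{2}V2 /V -!RintZ // -RintD; [|exact: rintegrableZ|exact: rintegrableZ].
    apply: Rint_le => [||w]; [exact: rintegrableD|by apply: rintegrableD; exact: rintegrableZ|].
    move: (A 0 _) (A k _) (A k.+1 _) (B k _) => a0 ak ak1 bk.
    have := sqr_ge0 ((a0 - bk) - (ak - ak1)); nra.
  pose W := \int[P]_w (F (tuple_of Y w) - f k (tuple_of Y w)) ^+ 2.
  pose D (x : family R I) := (F x - f k x) ^+ 2.
  have mD : measurable_fun setT D by apply: measurable_funX; exact: measurable_funB.
  have [_ iD] := sqintegrableB sF (sf k).
  have W1 : \int[PP]_w D (tuple_of Z w \o inl) = W by exact: law_sub.
  have W2 : \int[PP]_w D (tuple_of Z w \o (sw k \o inl)) = W by exact: law_sub.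
  have iD1 : rintegrable PP (fun w => D (tuple_of Z w \o inl)).
    by have [] := sq_sub inl_inj (measurable_funB mF (mf k)) (sqintegrableB sF (sf k)).
  have iD2 : rintegrable PP (fun w => D (tuple_of Z w \o (sw k \o inl))).
    by have [] := sq_sub (inj_sw k) (measurable_funB mF (mf k)) (sqintegrableB sF (sf k)).
  have VW : V <= 4 * W.
    have -> : 4 * W = 2 * W + 2 * W by ring.
    rewrite -{1}W1 -W2 /V -!RintZ // -RintD; [|exact: rintegrableZ|exact: rintegrableZ].
    apply: Rint_le => [||w] //; first by apply: rintegrableD; exact: rintegrableZ.
    rewrite A0 /B /D; have -> : f k (tuple_of Z w \o (sw k \o inl)) = f k (tuple_of Z w \o inl).
      apply: indep => i bik; rewrite /=; case: eqP => // /ord_inj e; by rewrite e eqxx in bik.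
    move: (F _) (F _) (f k _) => u v x.
    by have := sqr_ge0 ((u - x) + (v - x)); nra.
  rewrite -/W; lra.
have i0 k : rintegrable PP (fun w => A 0 (tuple_of Z w) * A k (tuple_of Z w)).
  exact: sqintegrableM.
have tel : \int[PP]_w (A 0 (tuple_of Z w) * A 0 (tuple_of Z w)) -
    \int[PP]_w (A 0 (tuple_of Z w) * A n (tuple_of Z w)) <=
    2 * \sum_k \int[P]_w (F (tuple_of Y w) - f k (tuple_of Y w)) ^+ 2.
  rewrite -opprB -(telescope_sumr (fun k => \int[PP]_w (A 0 (tuple_of Z w) * A k (tuple_of Z w)))) //.
  rewrite big_mkord -sumrN mulr_sumr; apply: ler_sum => k _; rewrite opprB.
  apply: le_trans (step k); rewrite -RintB //.
  by rewrite le_eqVlt; apply/orP; left; apply/eqP; apply: eq_Rintegral => w _; rewrite mulrBr.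
apply: le_trans tel; have iF := sqintegrable_int sF.
have -> : \int[PP]_w (A 0 (tuple_of Z w) * A n (tuple_of Z w)) = m * m.
  rewrite -(Rint_prod iF iF); apply: eq_Rintegral => w _; rewrite A0 An; congr (F _ * F _).
have -> : \int[PP]_w (A 0 (tuple_of Z w) * A 0 (tuple_of Z w)) = \int[P]_w F (tuple_of Y w) ^+ 2.
  rewrite -(law_sub (h := inl) (G := fun x => F x ^+ 2) inl_inj hY); last exact: measurable_funX.
  by apply: eq_Rintegral => w _; rewrite A0 expr2.
have [mFY iF2] := sF.
have E w : (F (tuple_of Y w) - m) ^+ 2 = (F (tuple_of Y w) ^+ 2 + (- (2 * m)) * F (tuple_of Y w)) + m ^+ 2.
  by ring.
under eq_Rintegral do rewrite E.
rewrite RintD; [|by apply: rintegrableD => //; exact: rintegrableZ|exact: rintegrable_cst].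
rewrite RintD //; last exact: rintegrableZ.
rewrite RintZ // Rint_cst -/m.
by rewrite le_eqVlt; apply/orP; left; apply/eqP; ring.
Qed.

End efron_stein.

(** * The one-dimensional Gaussian Poincare inequality *)

Section density.
Local Open Scope ereal_scope.
Context d (T : measurableType d) (R : realType).
Variables (m P : {measure set T -> \bar R}) (p : T -> R).
Hypotheses (mp : measurable_fun setT p) (p0 : forall x, (0 <= p x)%R).
Hypothesis Pp : forall A, measurable A -> P A = \int[m]_(x in A) (p x)%:E.

Import HBNNSimple.

Let density_nnsfun (h : {nnsfun T >-> R}) :
  \int[P]_x (h x)%:E = \int[m]_x ((h x)%:E * (p x)%:E).
Proof.
under [LHS]eq_integral do rewrite fimfunE -fsumEFin//.
rewrite [LHS]ge0_integral_fsum//; last 2 first.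
  - by move=> r; exact/measurable_EFinP/measurableT_comp.
  - by move=> n x _; rewrite EFinM nnfun_muleindic_ge0.
under [RHS]eq_integral.
  move=> x xD; rewrite fimfunE -fsumEFin// muleC ge0_mule_fsumr; last first.
    by move=> r; rewrite EFinM nnfun_muleindic_ge0.
  over.
rewrite [RHS]ge0_integral_fsum//; last 2 first.
  - move=> r; apply: emeasurable_funM; first exact/measurable_EFinP.
    by apply/measurable_EFinP; apply/measurableT_comp.
  - move=> n x _; apply: mule_ge0; first by rewrite lee_fin.
    by rewrite EFinM nnfun_muleindic_ge0.
apply: eq_fsbigr => r _.
rewrite integralZl_indic_nnsfun // integral_indic // setIT.
have [r0|r0] := ltP r 0%R.
  have E0 : h @^-1` [set r] = set0.
    apply/seteqP; split=> // x /= hx; have : (0 <= h x)%R by [].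
    by rewrite hx leNgt r0.
  rewrite E0 measure0 mule0 integral0_eq // => x _.
  by rewrite indic0 mulr0 mule0.
rewrite Pp //.
rewrite integral_mkcond -ge0_integralZl //.
- apply: eq_integral => x _; rewrite patchE indicE.
  by case: ifPn => _; rewrite ?mule0 ?mulr1 ?mulr0 ?mule0 // muleC.
- apply/(measurable_restrictT _ _).1 => //; exact/measurable_EFinP/measurable_funTS.
- by move=> x _; apply: erestrict_ge0 => y _; rewrite lee_fin.
Qed.

Lemma ge0_integral_density (f : T -> \bar R) : measurable_fun setT f ->
  (forall x, 0 <= f x) -> \int[P]_x f x = \int[m]_x (f x * (p x)%:E).
Proof.
move=> mf f0; pose f_ := nnsfun_approx measurableT mf.
transitivity (limn (fun n => \int[P]_x (f_ n x)%:E)).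
  rewrite -monotone_convergence//=.
  - apply: eq_integral => x /[!inE] xD; apply/esym/cvg_lim => //=.
    by apply: cvg_nnsfun_approx => // y _; exact: f0.
  - by move=> n; apply: measurableT_comp => //; exact: measurable_funTS.
  - by move=> n x _; rewrite lee_fin.
  - by move=> x _ a b ab; rewrite lee_fin//; exact/lefP/nd_nnsfun_approx.
transitivity (limn (fun n => \int[m]_x ((f_ n x)%:E * (p x)%:E))).
  by congr (limn _); apply/funext => n /=; rewrite density_nnsfun.
rewrite -monotone_convergence//=.
- apply: eq_integral => x /[!inE] xD; apply/cvg_lim => //.
  apply: cvgeZr => //; apply: cvg_nnsfun_approx => // y _; exact: f0.
- move=> n; apply: emeasurable_funM; last exact/measurable_EFinP.
  by apply: measurableT_comp => //; exact: measurable_funTS.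
- by move=> n x _; rewrite mule_ge0 // lee_fin.
- move=> x _ a b ab; rewrite lee_pmul // ?lee_fin //; exact/lefP/nd_nnsfun_approx.
Qed.

End density.

Section gauss_poincare.
Context {R : realType}.
Local Notation gauss := (normal_prob (0 : R) (1 : R)).
Local Notation pdf := (normal_pdf (0 : R) (1 : R)).
Local Notation leb := (@lebesgue_measure R).

Lemma pdfE t : pdf t = normal_peak 1 * expR (- t ^+ 2 / 2).
Proof. by rewrite normal_pdfE ?oner_eq0 //= /normal_fun subr0 expr1n. Qed.

Lemma ge0_integral_gauss (f : R -> \bar R) : measurable_fun setT f ->
  (forall x, 0 <= f x)%E -> (\int[gauss]_x f x = \int[leb]_x (f x * (pdf x)%:E))%E.
Proof.
move=> mf f0; apply: ge0_integral_density => //; first exact: measurable_normal_pdf.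
by move=> x; exact: normal_pdf_ge0.
Qed.

Lemma is_derive_pdf (t : R) : is_derive t (1 : R) pdf (- (t * pdf t)).
Proof.
rewrite (_ : pdf = fun t => normal_peak 1 * expR (- t ^+ 2 / 2)); last by apply/funext => u; exact: pdfE.
apply: is_derive_eq.
by rewrite !scaler0 add0r /GRing.scale /=; field.
Qed.

Let cont_pdf : continuous pdf. Proof. by apply: continuous_normal_pdf; rewrite oner_eq0. Qed.

Let pdf0 (t : R) : 0 <= pdf t. Proof. exact: normal_pdf_ge0. Qed.

Let pdf_even (t : R) : pdf (- t) = pdf t.
Proof. by rewrite !pdfE sqrrN. Qed.

Lemma normal_pdf_cvgy : pdf t @[t --> +oo%R] --> (0 : R).
Proof.
rewrite (_ : pdf = fun t => normal_peak 1 * expR (- t ^+ 2 / 2)); last by apply/funext => u; exact: pdfE.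
rewrite -[X in _ --> X](mulr0 (normal_peak 1)); apply: cvgM; first exact: cvg_cst.
apply: (@squeeze_cvgr _ _ _ _ (cst 0) (fun t : R => expR (- (t - 2^-1)))).
- near=> t; rewrite expR_ge0 /= ler_expR.
  have := sqr_ge0 (t - 1); lra.
- exact: cvg_cst.
- apply: (@cvg_comp _ _ _ (fun t : R => t - 2^-1) (fun u => expR (- u)) _ (pinfty_nbhs R)).
    apply/cvgryPge => A; near=> t; rewrite lerBrDr; near: t; apply: nbhs_pinfty_ge; exact: num_real.
  exact: (@cvgr_expR R).
Unshelve. all: by end_near. Qed.

Lemma integral_tail (s : R) : 0 <= s ->
  (\int[leb]_(t in `[s, +oo[) (t * pdf t)%:E = (pdf s)%:E)%E.
Proof.
move=> s0.
rewrite (@ge0_continuous_FTC2y _ (fun t => t * pdf t) (fun t => - pdf t) s 0).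
- by rewrite sub0e -EFinN opprK.
- by move=> x sx; rewrite mulr_ge0 // (le_trans s0).
- by apply: continuous_subspaceT => t; apply: cvgM; [exact: cvg_id|exact: cont_pdf].
- by rewrite -[X in _ --> X]oppr0; apply: cvgN; exact: normal_pdf_cvgy.
- by move=> x _; apply: derivableN; case: (is_derive_pdf x).
- by apply: cvg_at_right_filter; apply: cvgN; exact: cont_pdf.
- move=> x _; rewrite derive1E; have D := is_derive_pdf x.
  by rewrite deriveN; [case: D => _ ->; rewrite opprK|case: D].
Qed.

Lemma sqr_increment_le (h h' : R -> R) (t : R) : (forall x, is_derive x (1 : R) h (h' x)) ->
  continuous h' -> 0 <= t ->
  (((h t - h 0) ^+ 2)%:E <= t%:E * \int[leb]_(x in `[0%R, t]) ((h' x) ^+ 2)%:E)%E.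
Proof.
move=> dh ch; rewrite le_eqVlt => /predU1P[<-|t0].
  by rewrite subrr expr0n /= mule_ge0 // integral_ge0 // => x _; rewrite lee_fin sqr_ge0.
have ci (f : R -> R) : continuous f -> leb.-integrable `[0, t] (EFin \o f).
  move=> cf; apply: continuous_compact_integrable; first exact: segment_compact.
  exact: continuous_subspaceT.
have ch2 : continuous (fun x => h' x ^+ 2).
  by move=> x; apply: (@continuous_comp _ _ _ h' (fun u : R => u ^+ 2)); [exact: ch|exact: exprn_continuous].
have ftc : \int[leb]_(x in `[0, t]) h' x = h t - h 0.
  rewrite /Rintegral (@continuous_FTC2 _ h' h) //.
  - exact: continuous_subspaceT.
  - have C x : {for x, continuous h}.
      by apply: differentiable_continuous; apply/derivable1_diffP; case: (dh x).
    split; first by move=> x _; case: (dh x).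
      by apply: cvg_at_right_filter; exact: C.
    by apply: cvg_at_left_filter; exact: C.
  - by move=> x _; rewrite derive1E; case: (dh x).
pose J := \int[leb]_(x in `[0, t]) (h' x ^+ 2).
have JE : (\int[leb]_(x in `[0%R, t]) ((h' x) ^+ 2)%:E)%E = J%:E.
  by rewrite fineK //; apply: integrable_fin_num => //; exact: (ci _ ch2).
rewrite JE -EFinM lee_fin.
(* The mean slope: expanding the integral of (h' - c)^2 >= 0 gives the Cauchy-Schwarz inequality. *)
pose c := (h t - h 0) / t.
have : 0 <= \int[leb]_(x in `[0, t]) (h' x - c) ^+ 2.
  by apply: Rintegral_ge0 => x _; exact: sqr_ge0.
have -> : \int[leb]_(x in `[0, t]) (h' x - c) ^+ 2 = J - (2 * c) * (h t - h 0) + c ^+ 2 * t.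
  transitivity (\int[leb]_(x in `[0, t]) (h' x ^+ 2 - (2 * c) * h' x + c ^+ 2)).
    by apply: eq_Rintegral => x _; ring.
  have i1 := ci _ ch2; have i2 := ci _ ch.
  have i3 : leb.-integrable `[0, t] (EFin \o (fun x => (2 * c) * h' x)).
    by apply: (integrableZl _ (2 * c) i2).
  have i4 : leb.-integrable `[0, t] (EFin \o (fun x => h' x ^+ 2 - (2 * c) * h' x)).
    by apply: (integrableB _ i1 i3).
  have i5 : leb.-integrable `[0, t] (EFin \o (fun x : R => c ^+ 2)).
    by apply: ci => x; exact: cvg_cst.
  rewrite RintegralD // RintegralB // RintegralZl // ftc; congr (_ + _).
  rewrite Rintegral_cst //; congr (_ * _); rewrite [X in fine X](_ : _ = t%:E) //.
  by have := lebesgue_measure_itv `[0, t]%R; rewrite /= lte_fin t0 sube0.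
rewrite /c; move: (h t - h 0) => u.
have -> : J - 2 * (u / t) * u + (u / t) ^+ 2 * t = (t * J - u ^+ 2) / t.
  by field; rewrite gt_eqF.
by rewrite pmulr_lge0 ?invr_gt0 // subr_ge0.
Qed.

(** Tonelli: for fixed x, the integral of t pdf(t) over t >= x is pdf x by [integral_tail], so
    integrating the bound of [sqr_increment_le] returns the Gaussian integral with constant 1. *)
Let half (k : R -> R) : continuous k -> (forall x, 0 <= k x) ->
  measurable_fun (`[0%R, +oo[%classic : set (measurableTypeR R)) (fun t : R => t%:E * (\int[leb]_(x in `[0%R, t]) (k x)%:E) * (pdf t)%:E)%E /\
  (\int[leb]_(t in `[0%R, +oo[) (t%:E * (\int[leb]_(x in `[0%R, t]) (k x)%:E) * (pdf t)%:E) =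
   \int[leb]_(x in `[0%R, +oo[) (k x * pdf x)%:E)%E.
Proof.
move=> ck k0.
pose f (p : R * R) := (k p.1 * \1_(`[0%R, +oo[) p.1 * (p.2 * pdf p.2) * ((p.1 <= p.2)%R)%:R)%:E.
have f0 p : (0 <= f p)%E.
  rewrite lee_fin /f indicE mem_setE in_itv /= andbT.
  case: (leP 0 p.1) => p1; last by rewrite mulr0 !mul0r.
  case: (leP p.1 p.2) => p12; last by rewrite mulr0.
  by rewrite !mulr1 mulr_ge0 // mulr_ge0 // (le_trans p1).
have mf : measurable_fun setT f.
  apply/measurable_EFinP; apply: measurable_funM; last first.
    rewrite (_ : (fun p : R * R => _) = (fun p => if (p.1 <= p.2)%R then 1 else 0 : R)).
      by apply: measurable_fun_ifT => //; exact: measurable_fun_ler.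
    by apply/funext => p; case: ifP.
  apply: measurable_funM.
    apply: measurable_funM; first exact: (measurableT_comp (continuous_measurable_fun ck) measurable_fst).
    exact: (measurableT_comp (measurable_indic (measurable_itv _)) measurable_fst).
  apply: measurable_funM => //.
  exact: (measurableT_comp (continuous_measurable_fun cont_pdf) measurable_snd).
have T := @fubini_tonelli _ _ _ _ R leb leb f mf f0.
have E1 : (\int[leb]_x \int[leb]_t f (x, t) = \int[leb]_(x in `[0%R, +oo[) (k x * pdf x)%:E)%E.
  rewrite [RHS]integral_mkcond; apply: eq_integral => x _; rewrite patchE /f /= indicE.
  case: ifPn => x0 /=; last first.
    by rewrite integral0_eq // => t _; rewrite mulr0 !mul0r.
  move: x0; rewrite mem_setE in_itv /= andbT => x0.
  rewrite EFinM -integral_tail // -ge0_integralZl //; last 3 first.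
  - by apply/measurable_EFinP/measurable_funTS; apply: measurable_funM => //; exact: continuous_measurable_fun.
  - by move=> t; rewrite /= in_itv /= andbT => xt; rewrite lee_fin mulr_ge0 // (le_trans x0).
  - by rewrite lee_fin.
  rewrite [RHS]integral_mkcond; apply: eq_integral => t _; rewrite patchE mem_setE in_itv /= andbT.
  by case: ifP => _; rewrite ?mulr1 ?mulr0 // -EFinM.
have E2 t : 0 <= t ->
    (\int[leb]_x f (x, t) = t%:E * (\int[leb]_(x in `[0%R, t]) (k x)%:E) * (pdf t)%:E)%E.
  move=> t0; rewrite muleAC -EFinM -ge0_integralZl //; last 3 first.
  - by apply/measurable_EFinP/measurable_funTS; exact: continuous_measurable_fun.
  - by move=> x _; rewrite lee_fin.
  - by rewrite lee_fin mulr_ge0.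
  rewrite [RHS]integral_mkcond; apply: eq_integral => x _; rewrite patchE /f indicE /= !mem_setE !in_itv /= andbT.
  case: (leP 0 x) => x0 /=; last by rewrite mulr0 !mul0r.
  by case: (leP x t) => xt; rewrite ?mulr1 ?mulr0 // -EFinM mulrC.
split.
  have mG : measurable_fun setT (fun t => \int[leb]_x f (x, t))%E.
    exact: (@measurable_fun_fubini_tonelli_G _ _ _ _ R leb f mf f0).
  apply: (eq_measurable_fun (fun t => \int[leb]_x f (x, t))%E).
    by move=> t; rewrite mem_setE in_itv /= andbT => t0; rewrite E2.
  exact: measurable_funTS.
rewrite -E1 T [LHS]integral_mkcond; apply: eq_integral => t _; rewrite patchE mem_setE in_itv /= andbT.
case: (leP 0 t) => t0; first by rewrite /fubini_G E2.
rewrite /fubini_G integral0_eq // => x _; rewrite /f indicE /= mem_setE in_itv /= andbT.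
case: (leP 0 x) => x0; last by rewrite mulr0 !mul0r.
by rewrite leNgt (lt_le_trans t0) // mulr0.
Qed.

(** The increment is taken from h 0 instead of the mean of h. This is stronger, and later h 0 is a
    value that does not depend on the resampled coordinate. In extended reals the inequality can
    itself be used to prove integrability, as for the moments below. *)
Lemma gauss_poincare (h h' : R -> R) : (forall x, is_derive x (1 : R) h (h' x)) ->
  continuous h' ->
  (\int[gauss]_t ((h t - h 0) ^+ 2)%:E <= \int[gauss]_t ((h' t) ^+ 2)%:E)%E.
Proof.
move=> dh ch.
have chh (g g' : R -> R) : (forall x, is_derive x (1 : R) g (g' x)) -> continuous g.
  by move=> dg x; apply: differentiable_continuous; apply/derivable1_diffP; case: (dg x).
have csq (g : R -> R) : continuous g -> continuous (fun x => g x ^+ 2).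
  by move=> cg x; apply: (@continuous_comp _ _ _ g (fun u : R => u ^+ 2)); [exact: cg|exact: exprn_continuous].
have cdiff (g g' : R -> R) : (forall x, is_derive x (1 : R) g (g' x)) ->
    continuous (fun x => (g x - g 0) ^+ 2).
  by move=> dg; apply: csq => x; apply: cvgB; [exact: (chh _ _ dg)|exact: cvg_cst].
have H (g g' : R -> R) : (forall x, is_derive x (1 : R) g (g' x)) -> continuous g' ->
    (\int[leb]_(t in `[0%R, +oo[) ((g t - g 0) ^+ 2 * pdf t)%:E <=
     \int[leb]_(t in `[0%R, +oo[) ((g' t) ^+ 2 * pdf t)%:E)%E.
  move=> dg cg; have [mh <-] := half (csq _ cg) (fun=> sqr_ge0 _).
  apply: ge0_le_integral => //.
  - by move=> t _; rewrite lee_fin mulr_ge0 ?sqr_ge0.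
  - apply/measurable_EFinP/measurable_funTS/measurable_funM.
      by apply: continuous_measurable_fun; exact: cdiff dg.
    exact: continuous_measurable_fun.
  - move=> t; rewrite /= in_itv /= andbT => t0; rewrite EFinM.
    by apply: lee_wpmul2r; [rewrite lee_fin|exact: (sqr_increment_le dg cg t0)].
have S (f : R -> R) : continuous f -> (forall x, 0 <= f x) ->
    (\int[gauss]_t (f t)%:E = \int[leb]_(t in `[0%R, +oo[) (f t * pdf t)%:E +
      \int[leb]_(t in `[0%R, +oo[) (f (- t)%R * pdf t)%:E)%E.
  move=> cf f0.
  have cfp : continuous (fun t => f t * pdf t).
    by move=> t; apply: cvgM; [exact: cf|exact: cont_pdf].
  have mfp : measurable_fun setT (fun t => (f t * pdf t)%:E).
    by apply/measurable_EFinP; exact: continuous_measurable_fun.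
  rewrite ge0_integral_gauss; last 2 first.
  - by apply/measurable_EFinP; exact: continuous_measurable_fun.
  - by move=> x; rewrite lee_fin.
  under eq_integral do rewrite -EFinM.
  have -> : (\int[leb]_(t in `[0%R, +oo[) (f (- t)%R * pdf t)%:E =
     \int[leb]_(t in `]-oo, 0%R]) (f t * pdf t)%:E)%E.
    have := @ge0_integration_by_substitutionNy R (fun t => f t * pdf t) 0.
    rewrite oppr0 => ->.
    + by apply: eq_integral => t _; rewrite /= pdf_even.
    + exact: continuous_subspaceT.
    + by move=> x _; rewrite mulr_ge0.
  rewrite addeC -integral_itv_bndo_bndc; last exact: measurable_funTS.
  rewrite -ge0_integral_setU //=.
  - rewrite (_ : _ `|` _ = setT) //; apply/seteqP; split=> x //= _. rewrite !in_itv /= andbT.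
    by case: (ltP x 0) => ?; [left|right].
  - exact: measurable_funTS.
  - by move=> x _; rewrite lee_fin mulr_ge0.
  - apply/disj_setPLR => x /=; rewrite !in_itv /= andbT => x0; apply/negP.
    by rewrite -ltNge.
rewrite !S; [|exact: csq|by move=> x; exact: sqr_ge0|exact: cdiff dh|by move=> x; exact: sqr_ge0].
apply: leeD; first exact: H.
(* The left half-line is the right one for the reflected function t |-> h (- t). *)
have dN x : is_derive x (1 : R) (fun t => h (- t)) (- h' (- x)).
  have := @is_derive1_comp R h (fun t => - t) x (h' (- x)) (- 1) (dh (- x)) _.
  rewrite mulrN1; apply; exact: is_deriveNid.
have cN : continuous (fun x => - h' (- x)).
  by move=> x; apply: cvgN; apply: (@continuous_comp _ _ _ (fun t : R => - t) h'); [exact: opp_continuous|exact: ch].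
have := H _ _ dN cN; rewrite oppr0.
by under [X in (_ <= X)%E -> _]eq_integral do rewrite sqrrN.
Qed.

Let is_derive_sqr (x : R) : is_derive x (1 : R) (fun t : R => t ^+ 2) (2 * x).
Proof. by apply: is_derive_eq; rewrite /GRing.scale /=; ring. Qed.

Lemma gauss_moment2 : (\int[gauss]_t (t ^+ 2)%:E <= 1%:E)%E.
Proof.
have c1 : continuous (fun _ : R => 1 : R) by exact: (@cst_continuous R R).
have := @gauss_poincare id (fun=> 1) (fun x => is_derive_id x 1) c1.
under eq_integral do rewrite subr0.
under [X in (_ <= X)%E -> _]eq_integral do rewrite expr1n.
by rewrite integral_cst // mul1e => /le_trans; apply; exact: probability_le1.
Qed.

(** The inequality for t^2, whose derivative is 2 t; the value 4 only serves for finiteness. *)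
Lemma gauss_moment4 : (\int[gauss]_t ((t ^+ 2) ^+ 2)%:E <= 4%:E)%E.
Proof.
have := @gauss_poincare (fun t => t ^+ 2) (fun x => 2 * x) is_derive_sqr (@mulrl_continuous _ 2).
under eq_integral do rewrite expr0n subr0.
under [X in (_ <= X)%E -> _]eq_integral do rewrite exprMn EFinM.
rewrite ge0_integralZl //; last 2 first.
- by apply/measurable_EFinP; exact: measurable_funX.
- by move=> x _; rewrite lee_fin sqr_ge0.
move=> /le_trans; apply; apply: (le_trans (lee_wpmul2l _ gauss_moment2)).
  by rewrite lee_fin sqr_ge0.
by rewrite -EFinM lee_fin; lra.
Qed.

End gauss_poincare.

(** * Gaussian Poincare inequality for families *)

Section quartic.
Context d (T : measurableType d) (R : realType) (P : probability T R).
Implicit Types f g : T -> R.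

(** Finite fourth moments: preserved by sums and Lipschitz maps, and sufficient for quadratic forms
    to be square integrable. *)
Definition quartic f := measurable_fun setT f /\ sqintegrable P (fun x => f x ^+ 2).

Lemma quartic_le f g : measurable_fun setT f -> (forall x, `|f x| <= g x) ->
  quartic g -> quartic f.
Proof.
move=> mf fg [mg hg]; split => //; apply: sqintegrable_le hg; first exact: measurable_funX.
move=> x; rewrite normrX; have := fg x; have := normr_ge0 (f x).
by move=> h0 h1; rewrite ler_sqr // nnegrE // (le_trans h0).
Qed.

Lemma quartic_cst (c : R) : quartic (fun=> c).
Proof. by split; [exact: measurable_cst|exact: sqintegrable_cst]. Qed.

Lemma quartic_norm f : quartic f -> quartic (fun x => `|f x|).
Proof.
move=> [mf hf]; split; first exact: measurableT_comp.
by under eq_fun do rewrite real_normK ?num_real //.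
Qed.

Lemma quarticZ (c : R) f : quartic f -> quartic (fun x => c * f x).
Proof.
move=> [mf hf]; split; first exact: measurable_funM.
by under eq_fun do rewrite exprMn; exact: sqintegrableZ.
Qed.

Lemma quarticD f g : quartic f -> quartic g -> quartic (fun x => f x + g x).
Proof.
move=> [mf hf] [mg hg]; split; first exact: measurable_funD.
apply: (sqintegrable_le _ _ (sqintegrableD (sqintegrableZ 2 hf) (sqintegrableZ 2 hg))).
  by apply: measurable_funX; exact: measurable_funD.
move=> x; rewrite ger0_norm ?sqr_ge0 //; have := sqr_ge0 (f x - g x); nra.
Qed.

Lemma quarticB f g : quartic f -> quartic g -> quartic (fun x => f x - g x).
Proof.
move=> hf /(quarticZ (-1)) hg; have := quarticD hf hg.
by under eq_fun do rewrite mulN1r.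
Qed.

Lemma quartic_sum I (s : seq I) (F : I -> T -> R) :
  (forall i, quartic (F i)) -> quartic (fun x => \sum_(i <- s) F i x).
Proof.
move=> h; elim: s => [|i s IH].
  by under eq_fun do rewrite big_nil; exact: quartic_cst.
by under eq_fun do rewrite big_cons; exact: quarticD.
Qed.

Lemma quarticM f g : quartic f -> quartic g -> sqintegrable P (fun x => f x * g x).
Proof.
move=> [mf hf] [mg hg]; apply: (sqintegrable_le _ _ (sqintegrableD hf hg)).
  exact: measurable_funM.
move=> x; rewrite ler_norml; have := sqr_ge0 (f x - g x); have := sqr_ge0 (f x + g x).
have := sqr_ge0 (f x); have := sqr_ge0 (g x) => *; apply/andP; split; nra.
Qed.

Lemma quartic_sqintegrable f : quartic f -> sqintegrable P f.
Proof.
by move=> hf; have := quarticM hf (quartic_cst 1); under eq_fun do rewrite mulr1.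
Qed.

End quartic.

(** * Smoothing of Lipschitz functions *)

Section smoothing.
Context {R : realType}.
Local Notation leb := (@lebesgue_measure R).

Lemma antiderivative_half (f : R -> R) : continuous f -> (forall x, x <= 0 -> f x = 0) ->
  exists G : R -> R, forall x : R, is_derive x (1 : R) G (f x).
Proof.
move=> cf f0; exists (fun x => \int[leb]_(t in `]-oo, x]) f t) => x.
have xu : x < x + 1 by rewrite ltrDl.
have [||//|d1 d2] := @continuous_FTC1 R f (BInfty _ true) x (x + 1) xu.
- apply/integrable_mkcond => //.
  rewrite (_ : _ \_ _ = (EFin \o f) \_ `[0, x + 1]).
    apply/(integrable_mkcond _ _).1 => //.
    apply: continuous_compact_integrable; first exact: segment_compact.
    exact: continuous_subspaceT.
  apply/funext => t; rewrite !patchE !mem_setE !in_itv /=.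
  by case: (leP 0 t) => t0 /=; [|rewrite (f0 _ (ltW t0)); case: (t <= x + 1)].
- exact: ltNyr.
- exact: cf.
- by split => //; rewrite -derive1E d2.
Qed.

(** f - f 0 is split into the parts carried by the two half-lines, the left one reflected, so that
    each vanishes on the left and can be integrated from -oo; f 0 x is added back. *)
Lemma antiderivative (f : R -> R) : continuous f ->
  exists G : R -> R, forall x : R, is_derive x (1 : R) G (f x).
Proof.
move=> cf.
have cmax : continuous (fun t : R => Num.max t 0) by move=> t; apply: continuous_max => //; exact: cvg_cst.
have [|x x0|G1 h1] := @antiderivative_half (fun t => f (Num.max t 0) - f 0).
- move=> t; apply: cvgB; last exact: cvg_cst.
  by apply: (@continuous_comp _ _ _ (fun t : R => Num.max t 0) f); [exact: cmax|exact: cf].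
- by rewrite max_r // subrr.
have [|x x0|G2 h2] := @antiderivative_half (fun t => f (- Num.max t 0) - f 0).
- move=> t; apply: cvgB; last exact: cvg_cst.
  apply: (@continuous_comp _ _ _ (fun t : R => - Num.max t 0) f); last exact: cf.
  by apply: cvgN; exact: cmax.
- by rewrite max_r // oppr0 subrr.
exists (fun x => G1 x - G2 (- x) + f 0 * x) => x.
have D1 := h1 x.
have D2 : is_derive x (1 : R) (fun t => G2 (- t)) (- (f (- Num.max (- x) 0) - f 0)).
  have := @is_derive1_comp R G2 (fun t => - t) x _ (- 1) (h2 (- x)) _.
  by rewrite mulrN1; apply; exact: is_deriveNid.
apply: is_derive_eq; rewrite /GRing.scale /= mulr1.
case: (leP 0 x) => x0.
  have -> : Num.max (- x) 0 = 0 by apply: max_r; rewrite oppr_le0.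
  by rewrite oppr0; ring.
have -> : Num.max (- x) 0 = - x by apply: max_l; rewrite oppr_ge0 ltW.
by rewrite !opprK; ring.
Qed.

Lemma lipschitz_continuous (l : R) (f : R -> R) : (forall x y : R, `|f x - f y| <= l * `|x - y|) ->
  continuous f.
Proof.
move=> fl x; apply/cvgrPdist_le => /= e e0.
have l0 : 0 <= l by have := fl 1 0; rewrite subr0 normr1 mulr1; apply: le_trans.
near=> t; apply: (le_trans (fl _ _)).
have : `|x - t| <= e / (l + 1).
  near: t; have /cvgrPdist_le : t @[t --> x] --> x by exact: cvg_id.
  by apply; rewrite divr_gt0 //; lra.
rewrite ler_pdivlMr; last lra.
have := normr_ge0 (x - t); nra.
Unshelve. all: by end_near. Qed.

(** [g] is the average of f over [x - e, x + e]. Its derivative is a symmetric difference quotient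
    of f, continuous and bounded by [l]; the distance to f comes from the mean value theorem for the
    antiderivative. *)
Lemma lipschitz_smoothing (l : R) (f : R -> R) (e : R) : 0 < e ->
  (forall x y : R, `|f x - f y| <= l * `|x - y|) ->
  exists g g' : R -> R, [/\ forall x : R, is_derive x (1 : R) g (g' x), continuous g',
    forall x : R, `|g x - f x| <= l * e & forall x : R, `|g' x| <= l].
Proof.
move=> e0 fl; have cf := lipschitz_continuous fl; have [G dG] := antiderivative cf.
have l0 : 0 <= l by have := fl 1 0; rewrite subr0 normr1 mulr1; apply: le_trans.
have dsh (a x : R) : is_derive x (1 : R) (fun t => G (t + a)) (f (x + a)).
  have := @is_derive1_comp R G (fun t => t + a) x _ 1 (dG (x + a)) _.
  rewrite mulr1; apply; apply: is_derive_eq; first by rewrite addr0.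
exists (fun x => (2 * e)^-1 * (G (x + e) - G (x - e))),
  (fun x => (2 * e)^-1 * (f (x + e) - f (x - e))); split.
- move=> x; have D1 := dsh e x; have D2 := dsh (- e) x.
  by apply: is_derive_eq; rewrite /GRing.scale /= ; ring.
- move=> x; apply: cvgMr; apply: cvgB.
    by apply: (@continuous_comp _ _ _ (fun t : R => t + e) f); [apply: cvgD; [exact: cvg_id|exact: cvg_cst]|exact: cf].
  by apply: (@continuous_comp _ _ _ (fun t : R => t - e) f); [apply: cvgB; [exact: cvg_id|exact: cvg_cst]|exact: cf].
- move=> x.
  have [c + ->] : exists2 c : R, c \in `](x - e), (x + e)[ & G (x + e) - G (x - e) = f c * (x + e - (x - e)).
    have xe : x - e < x + e by lra.
    apply: (MVT xe (fun t _ => dG t)).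
    apply: continuous_subspaceT => t; apply: differentiable_continuous; apply/derivable1_diffP.
    by case: (dG t).
  rewrite in_itv /= => /andP[c1 c2].
  have -> : (2 * e)^-1 * (f c * (x + e - (x - e))) = f c by field; rewrite gt_eqF.
  apply: (le_trans (fl _ _)); rewrite ler_wpM2l // ler_norml; apply/andP; split; lra.
- move=> x; rewrite normrM ger0_norm ?invr_ge0; last lra.
  rewrite mulrC ler_pdivrMr; last lra.
  apply: (le_trans (fl _ _)); rewrite (_ : x + e - (x - e) = 2 * e); last ring.
  by rewrite ger0_norm //; lra.
Qed.

End smoothing.

(** * The Poincare inequality for functions of many independent Gaussian variables *)

Section family_poincare.
Context {R : realType} (I : finType).

Definition upd (x : family R I) (i : I) (t : R) : family R I :=
  fun j => if j == i then t else x j.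

Lemma upd_upd x i (s t : R) : upd (upd x i s) i t = upd x i t.
Proof. by apply/funext => j; rewrite /upd; case: eqP. Qed.

Lemma measurable_upd i (t : R) : measurable_fun [set: family R I] (fun x => upd x i t).
Proof.
apply: measurable_family => j; rewrite /upd; case: eqP => _; first exact: measurable_cst.
exact: measurable_coord.
Qed.

Context d (T : measurableType d) (P : probability T R) (Y : I -> T -> R).
Hypothesis hY : iid_normal P Y.

Local Notation gauss := (normal_prob (0 : R) (1 : R)).

Lemma resample_gauss (i : I) (G : family R I -> \bar R) : measurable_fun setT G ->
  (forall x, 0 <= G x)%E ->
  (\int[P]_w G (tuple_of Y w) = \int[P]_w \int[gauss]_t G (upd (tuple_of Y w) i t))%E /\
  measurable_fun setT (fun w => \int[gauss]_t G (upd (tuple_of Y w) i t))%E.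
Proof.
move=> mG G0.
pose V (_ : unit) (t : R) := t.
have hV : iid_normal gauss V.
  split=> [i0|A mA]; first exact: measurable_id.
  rewrite (_ : [set w | _] = A tt); first by rewrite (bigD1 tt) //= big1 ?mule1 // => -[].
  by apply/seteqP; split => [t /(_ tt)//|t At []].
pose h (j : I) : unit + I := if j == i then inl tt else inr j.
have hi : injective h.
  by move=> a b; rewrite /h; case: eqP => [->|_]; case: eqP => [->|_] // [].
have hZ := iid_normal_inj hi (iid_normal_mix hV hY).
pose Gz (z : R * T) := G (upd (tuple_of Y z.2) i z.1).
have GzE z : G (tuple_of (fun k => mix V Y (h k)) z) = Gz z.
  by congr G; apply/funext => j; rewrite /tuple_of /upd /h; case: eqP.
have mGz : measurable_fun setT Gz.
  rewrite -(funext GzE); apply: (measurableT_comp mG); apply: measurable_family => j.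
  by have [m _] := hZ; exact: m.
have Gz0 z : (0 <= Gz z)%E by exact: G0.
split.
  rewrite (law_ge0 hY hZ mG G0).
  transitivity (\int[(gauss \x P)%E]_z Gz z)%E; first by apply: eq_integral => z _; exact: GzE.
  exact: (@fubini_tonelli2 _ _ _ _ R gauss P Gz mGz Gz0).
exact: (@measurable_fun_fubini_tonelli_G _ _ _ _ R gauss Gz mGz Gz0).
Qed.

Lemma coordinate_poincare (i : I) (F D : family R I -> R) :
  measurable_fun setT F -> measurable_fun setT D ->
  (forall x (t : R), is_derive t (1 : R) (fun t => F (upd x i t)) (D (upd x i t))) ->
  (forall x, continuous (fun t => D (upd x i t))) ->
  (\int[P]_w ((F (tuple_of Y w) - F (upd (tuple_of Y w) i 0)) ^+ 2)%:E <=
   \int[P]_w ((D (tuple_of Y w)) ^+ 2)%:E)%E.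
Proof.
move=> mF mD dF cD.
pose G x := ((F x - F (upd x i 0)) ^+ 2)%:E.
pose H x := ((D x) ^+ 2)%:E.
have mG : measurable_fun setT G.
  apply/measurable_EFinP; apply: measurable_funX; apply: measurable_funB => //.
  exact: (measurableT_comp mF (measurable_upd i 0)).
have mH : measurable_fun setT H by apply/measurable_EFinP; exact: measurable_funX.
have G0 x : (0 <= G x)%E by rewrite lee_fin sqr_ge0.
have H0 x : (0 <= H x)%E by rewrite lee_fin sqr_ge0.
have [EG mG'] := resample_gauss i mG G0; have [EH mH'] := resample_gauss i mH H0.
rewrite -/(G _) -/(H _) EG EH; apply: ge0_le_integral => //.
  by move=> w _; apply: integral_ge0.
move=> w _; apply: le_trans (gauss_poincare (dF (tuple_of Y w)) (cD (tuple_of Y w))).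
rewrite le_eqVlt; apply/orP; left; apply/eqP; apply: eq_integral => t _.
by rewrite /G upd_upd.
Qed.

(** Efron-Stein with one block per coordinate and f_i = F with coordinate i set to 0, which is
    admissible because it ignores that coordinate. *)
Lemma gaussian_poincare (F : family R I -> R) (D : I -> family R I -> R) :
  measurable_fun setT F -> (forall i, measurable_fun setT (D i)) ->
  (forall i x (t : R), is_derive t (1 : R) (fun t => F (upd x i t)) (D i (upd x i t))) ->
  (forall i x, continuous (fun t => D i (upd x i t))) ->
  sqintegrable P (fun w => F (tuple_of Y w)) ->
  (forall i, sqintegrable P (fun w => D i (tuple_of Y w))) ->
  \int[P]_w (F (tuple_of Y w) - \int[P]_w' F (tuple_of Y w')) ^+ 2 <=
  2 * \sum_i \int[P]_w (D i (tuple_of Y w)) ^+ 2.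
Proof.
move=> mF mD dF cD sF sD.
have mY : measurable_fun setT (tuple_of Y) by apply: measurable_family => i; have [m _] := hY; exact: m.
have mU i := measurableT_comp mF (measurable_upd i 0).
have le_i i := coordinate_poincare mF (mD i) (dF i) (cD i).
(* The increment is square integrable because of the coordinate inequality itself; by subtraction,
   so is [F] at the modified point. *)
have sqB i : sqintegrable P (fun w => F (tuple_of Y w) - F (upd (tuple_of Y w) i 0)).
  have mB : measurable_fun setT (fun w => F (tuple_of Y w) - F (upd (tuple_of Y w) i 0)).
    exact: (measurable_funB (measurableT_comp mF mY) (measurableT_comp (mU i) mY)).
  split => //; apply/integrableP; split.
    by apply/measurable_EFinP; exact: measurable_funX.
  have [_ /integrableP[_]] := sD i.
  under eq_integral do rewrite /= ger0_norm ?sqr_ge0 //.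
  under [X in _ -> (X < _)%E]eq_integral do rewrite /= ger0_norm ?sqr_ge0 //.
  exact: le_lt_trans.
have sU i : sqintegrable P (fun w => F (upd (tuple_of Y w) i 0)).
  have := sqintegrableB sF (sqB i); under eq_fun do rewrite subKr; by [].
apply: (le_trans (@efron_stein R _ T P I Y #|I| enum_rank hY F
  (fun k x => F (upd x (enum_val k) 0)) mF sF (fun k => mU (enum_val k)) (fun k => sU (enum_val k)) _)).
  move=> k x y xy; congr F; apply/funext => j; rewrite /upd; case: eqP => // jk; apply: xy.
  by apply/eqP => e; apply: jk; rewrite -e enum_rankK.
rewrite ler_pM2l //; rewrite (reindex enum_rank) /=; last first.
  by exists enum_val => k _; [exact: enum_rankK|exact: enum_valK].
apply: ler_sum => i _; rewrite enum_rankK -lee_fin !EFin_Rint.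
- exact (le_i i).
- by have [] := sD i.
- by have [] := sqB i.
Qed.

End family_poincare.

(** * Resolvents and rank-one updates *)

Section dot_product.
Context {R : realType}.

Definition dotv n (u v : 'cV[R]_n) : R := (u^T *m v) 0 0.

Lemma dotvE n (u v : 'cV[R]_n) : dotv u v = \sum_i u i 0 * v i 0.
Proof. by rewrite /dotv mxE; apply: eq_bigr => i _; rewrite mxE. Qed.

Lemma dotvC n (u v : 'cV[R]_n) : dotv u v = dotv v u.
Proof. by rewrite !dotvE; apply: eq_bigr => i _; rewrite mulrC. Qed.

Lemma dotvDl n (u v w : 'cV[R]_n) : dotv (u + v) w = dotv u w + dotv v w.
Proof. by rewrite /dotv linearD /= mulmxDl mxE. Qed.

Lemma dotvDr n (u v w : 'cV[R]_n) : dotv u (v + w) = dotv u v + dotv u w.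
Proof. by rewrite /dotv mulmxDr mxE. Qed.

Lemma dotvZl n (a : R) (u v : 'cV[R]_n) : dotv (a *: u) v = a * dotv u v.
Proof. by rewrite /dotv linearZ /= -scalemxAl mxE. Qed.

Lemma dotvZr n (a : R) (u v : 'cV[R]_n) : dotv u (a *: v) = a * dotv u v.
Proof. by rewrite /dotv -scalemxAr mxE. Qed.

Lemma dotv0l n (u : 'cV[R]_n) : dotv 0 u = 0.
Proof. by rewrite dotvE big1 // => i _; rewrite mxE mul0r. Qed.

Lemma dotv_mulmx m n (A : 'M[R]_(m, n)) u v : dotv u (A *m v) = dotv (A^T *m u) v.
Proof. by rewrite /dotv trmx_mul trmxK mulmxA. Qed.

Lemma dotv_ge0 n (u : 'cV[R]_n) : 0 <= dotv u u.
Proof. by rewrite dotvE; apply: sumr_ge0 => i _; rewrite -expr2 sqr_ge0. Qed.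

Lemma dotv_eq0 n (u : 'cV[R]_n) : dotv u u = 0 -> u = 0.
Proof.
rewrite dotvE => /eqP; rewrite psumr_eq0 => [/allP h|i _]; last by rewrite -expr2 sqr_ge0.
apply/colP => i; rewrite mxE; have := h i (mem_index_enum i).
by rewrite /= mulf_eq0 orbb => /eqP.
Qed.

Lemma dotv_cauchy_schwarz n (u v : 'cV[R]_n) : dotv u v ^+ 2 <= dotv u u * dotv v v.
Proof.
rewrite !dotvE; have := cauchy_schwarz_sum (fun i => u i 0) (fun i => v i 0).
by under [X in X * _]eq_bigr do rewrite expr2; under [X in _ * X]eq_bigr do rewrite expr2.
Qed.

Lemma mxtrace_col_row n (u v : 'cV[R]_n) : \tr (u *m v^T) = dotv v u.
Proof. by rewrite mxtrace_mulC /mxtrace big_ord1. Qed.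

(** The operator norm is at most [nu], phrased with squared norms to avoid suprema and square
    roots. *)
Definition mbound m n (N : 'M[R]_(m, n)) (nu : R) :=
  0 <= nu /\ forall v, dotv (N *m v) (N *m v) <= nu ^+ 2 * dotv v v.

Lemma mbound_mul m n p (A : 'M[R]_(m, n)) (B : 'M[R]_(n, p)) (a b : R) :
  mbound A a -> mbound B b -> mbound (A *m B) (a * b).
Proof.
move=> [a0 hA] [b0 hB]; split=> [|v]; first exact: mulr_ge0.
rewrite -mulmxA exprMn -mulrA; apply: (le_trans (hA _)).
by rewrite ler_wpM2l ?sqr_ge0.
Qed.

Lemma mbound_tr m n (A : 'M[R]_(m, n)) (a : R) : mbound A a -> mbound A^T a.
Proof.
move=> [a0 hA]; split=> // v.
set w := A^T *m v; have E : dotv w w = dotv v (A *m w) by rewrite dotv_mulmx.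
have CS := dotv_cauchy_schwarz v (A *m w); rewrite -E in CS.
have := hA w; have := dotv_ge0 v; have := dotv_ge0 w.
rewrite le_eqVlt => /predU1P[<- v0 _|w0 v0 hw]; first by rewrite mulr_ge0 ?sqr_ge0.
have : dotv w w ^+ 2 <= dotv v v * (a ^+ 2 * dotv w w).
  by apply: (le_trans CS); rewrite ler_wpM2l.
by rewrite expr2 mulrA ler_pM2r // mulrC.
Qed.

Lemma mbound_le m n (A : 'M[R]_(m, n)) (a b : R) : a <= b -> mbound A a -> mbound A b.
Proof.
move=> ab [a0 hA]; split=> [|v]; first exact: le_trans ab.
by apply: (le_trans (hA v)); rewrite ler_wpM2r ?dotv_ge0 // ler_sqr // nnegrE (le_trans a0).
Qed.

Lemma mbound1 n : mbound (1%:M : 'M[R]_n) 1.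
Proof. by split=> // v; rewrite mul1mx expr1n mul1r. Qed.

Lemma mbound_dotv m n (A : 'M[R]_(m, n)) (a : R) u v : mbound A a ->
  `|dotv u (A *m v)| <= a * ((dotv u u + dotv v v) / 2).
Proof.
move=> [a0 hA]; have CS := dotv_cauchy_schwarz u (A *m v).
have u0 := dotv_ge0 u; have v0 := dotv_ge0 v.
rewrite -ler_sqr ?nnegrE //; last by rewrite mulr_ge0 // divr_ge0 // addr_ge0.
rewrite real_normK ?num_real //; apply: (le_trans CS).
apply: (@le_trans _ _ (dotv u u * (a ^+ 2 * dotv v v))); first by rewrite ler_wpM2l.
rewrite mulrCA exprMn; apply: ler_wpM2l; first exact: sqr_ge0.
by have := sqr_ge0 (dotv u u - dotv v v); rewrite !expr2; nra.
Qed.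

Lemma mbound_dotv_sq n (A : 'M[R]_n) (a : R) u : mbound A a ->
  `|dotv u (A *m u)| <= a * dotv u u.
Proof.
move=> h; apply: (le_trans (mbound_dotv u u h)).
by rewrite (_ : (dotv u u + dotv u u) / 2 = dotv u u) //; field.
Qed.

Let delta_dot n (i : 'I_n) : dotv (delta_mx i 0) (delta_mx i 0) = 1.
Proof.
rewrite dotvE (bigD1 i) //= big1 => [|j ji]; first by rewrite mxE !eqxx mulr1 addr0.
by rewrite !mxE (negPf ji) mul0r.
Qed.

Lemma mbound_frobenius m n (A : 'M[R]_(m, n)) (a : R) : mbound A a ->
  \sum_i \sum_j A i j ^+ 2 <= a ^+ 2 * n%:R.
Proof.
move=> [a0 hA]; rewrite exchange_big /=.
apply: (@le_trans _ _ (\sum_(j < n) a ^+ 2)); last first.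
  by rewrite sumr_const card_ord mulr_natr.
apply: ler_sum => j _; have := hA (delta_mx j 0).
rewrite delta_dot mulr1 -colE dotvE; apply: le_trans.
by rewrite le_eqVlt; apply/orP; left; apply/eqP; apply: eq_bigr => i _; rewrite !mxE expr2.
Qed.

Lemma mbound_trace n (A : 'M[R]_n) (a : R) : mbound A a -> `|\tr A| <= a * n%:R.
Proof.
move=> h; apply: (le_trans (ler_norm_sum _ _ _)).
rewrite mulr_natr -[X in _ *+ X]card_ord -sumr_const; apply: ler_sum => j _.
have := mbound_dotv_sq (delta_mx j 0) h; rewrite delta_dot mulr1 -colE.
rewrite dotvE (bigD1 j) //= big1 => [|i ij]; first by rewrite !mxE !eqxx mul1r addr0.
by rewrite !mxE (negPf ij) mul0r.
Qed.

End dot_product.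

Section resolvents.
Context {R : realType}.

Definition res n (Y : 'M[R]_n) (s : R) : 'M[R]_n := invmx (Y + s%:M).

Lemma psdmx_dotv n (Y : 'M[R]_n) v : psdmx Y -> 0 <= dotv v (Y *m v).
Proof. by move=> [_ h]; have := h v; rewrite /dotv mulmxA. Qed.

Variables (n : nat) (Y : 'M[R]_n) (s : R).
Hypotheses (hY : psdmx Y) (s0 : 0 < s).

Lemma res_unit : Y + s%:M \in unitmx.
Proof.
rewrite -unitmx_tr -row_free_unit; apply: inj_row_free => v hv.
pose u := v^T; have hu : (Y + s%:M) *m u = 0 by rewrite /u -[_ + _]trmxK -trmx_mul hv trmx0.
have : dotv u ((Y + s%:M) *m u) = 0 by rewrite hu dotvC dotv0l.
rewrite mulmxDl mul_scalar_mx dotvDr dotvZr => E.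
have Y0 := psdmx_dotv u hY; have u0 := dotv_ge0 u.
have su0 : 0 <= s * dotv u u by rewrite mulr_ge0 ?(ltW s0).
have /eqP : s * dotv u u = 0 by lra.
rewrite mulf_eq0 gt_eqF //= => /eqP.
by move/dotv_eq0 => e; rewrite -[v]trmxK -/u e trmx0.
Qed.

Lemma mul_res : (Y + s%:M) *m res Y s = 1%:M. Proof. exact: mulmxV res_unit. Qed.
Lemma res_mul : res Y s *m (Y + s%:M) = 1%:M. Proof. exact: mulVmx res_unit. Qed.

Lemma res_sym : (res Y s)^T = res Y s.
Proof. by rewrite /res trmx_inv linearD /= tr_scalar_mx; case: hY => ->. Qed.

Lemma res_dotv v : s * dotv (res Y s *m v) (res Y s *m v) <= dotv v (res Y s *m v).
Proof.
set q := res Y s *m v; have -> : v = (Y + s%:M) *m q by rewrite mulmxA mul_res mul1mx.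
rewrite dotvC mulmxDl mul_scalar_mx dotvDr dotvZr lerDr; exact: psdmx_dotv.
Qed.

Lemma res_mbound : mbound (res Y s) s^-1.
Proof.
split=> [|v]; first by rewrite invr_ge0 ltW.
have := res_dotv v; set q := res Y s *m v => h.
have CS := dotv_cauchy_schwarz v q; have v0 := dotv_ge0 v.
have := dotv_ge0 q; rewrite le_eqVlt => /predU1P[<-|q0].
  by rewrite mulr_ge0 ?sqr_ge0.
have h2 : (s * dotv q q) ^+ 2 <= dotv v v * dotv q q.
  by apply: le_trans CS; rewrite ler_sqr // nnegrE ?mulr_ge0 ?(ltW s0) ?(ltW q0) // (le_trans _ h) // mulr_ge0 ?(ltW s0) ?(ltW q0).
rewrite exprVn mulrC ler_pdivlMr ?exprn_gt0 //.
by move: h2; rewrite exprMn [dotv q q ^+ 2]expr2 mulrA ler_pM2r // mulrC.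
Qed.

End resolvents.

Section rank_one_update.
Context {R : realType} (n : nat) (K : 'M[R]_n) (a : 'cV[R]_n) (s tau : R).
Hypotheses (hK : psdmx K) (s0 : 0 < s) (t0 : 0 <= tau).

Local Notation Y := (K + tau *: (a *m a^T)).

Lemma psdmx_rank_one : psdmx Y.
Proof.
case: (hK) => symK _; split; first by rewrite linearD linearZ /= trmx_mul trmxK symK.
move=> v; rewrite -mulmxA -/(dotv v _) mulmxDl dotvDr addr_ge0 ?(psdmx_dotv v hK) //.
rewrite -scalemxAl dotvZr mulr_ge0 // -mulmxA dotv_mulmx.
by rewrite dotv_ge0.
Qed.

Let x := tau * dotv a (res K s *m a).

Lemma rank_one_ge0 : 0 <= x.
Proof.
rewrite mulr_ge0 //; apply: le_trans (res_dotv hK s0 a).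
by rewrite mulr_ge0 ?(ltW s0) // dotv_ge0.
Qed.

Lemma res_rank_one : res Y s *m a = (1 + x)^-1 *: (res K s *m a).
Proof.
have x0 := rank_one_ge0; have hY := psdmx_rank_one.
apply: (can_inj (mulKmx (res_unit hY s0))).
rewrite mulmxA mul_res // mul1mx -scalemxAr.
have -> : (Y + s%:M) *m (res K s *m a) = (1 + x) *: a.
  rewrite addrAC mulmxDl mulmxA mul_res // mul1mx scalerDl scale1r; congr (_ + _).
  rewrite -scalemxAl -mulmxA -scalerA; congr (_ *: _).
  by rewrite (mx11_scalar (_ *m (res K s *m a))) mul_mx_scalar.
by rewrite scalerA mulVf ?scale1r // gt_eqF // ltr_pwDl.
Qed.

Lemma res_rank_one_sub : res K s - res Y s = (tau / (1 + x)) *: (res K s *m a *m (res K s *m a)^T).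
Proof.
have hY := psdmx_rank_one.
have -> : res K s - res Y s = res Y s *m ((Y + s%:M) - (K + s%:M)) *m res K s.
  by rewrite mulmxBr res_mul // mulmxBl mul1mx -mulmxA mul_res // mulmx1.
have -> : (Y + s%:M) - (K + s%:M) = tau *: (a *m a^T).
  by rewrite opprD addrACA subrr addr0 addrAC subrr add0r.
rewrite -scalemxAr -scalemxAl mulmxA res_rank_one -!scalemxAl scalerA; congr (_ *: _).
by rewrite trmx_mul res_sym // -!mulmxA.
Qed.

(** With q = res K a, Sherman-Morrison gives the difference tau q^T N q / (1 + x). Since s |q|^2 <=
    a^T q, one has tau |q|^2 <= x / s, and x / (1 + x) < 1 makes the bound independent of the size
    of [a]. *)
Lemma trace_res_rank_one (N : 'M[R]_n) (nu : R) : mbound N nu ->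
  `|\tr (N *m res K s) - \tr (N *m res Y s)| <= nu / s.
Proof.
move=> hN; have x0 := rank_one_ge0; have [nu0 _] := hN.
rewrite -linearB /= -mulmxBr res_rank_one_sub -scalemxAr mxtraceZ mulmxA mxtrace_col_row.
set q := res K s *m a.
rewrite normrM ger0_norm ?divr_ge0 ?addr_ge0 //.
have h1 := mbound_dotv_sq q hN; have h2 := res_dotv hK s0 a; rewrite -/q in h2.
have : tau * (s * dotv q q) <= x by rewrite ler_wpM2l.
move: h1; set D := `|_| => h1 h3.
have x1 : 0 < 1 + x by rewrite ltr_pwDl.
rewrite ler_pdivlMr // [leLHS](_ : _ = tau * (s * D) / (1 + x)); last by ring.
rewrite ler_pdivrMr //.
have h4 : tau * (s * D) <= tau * (s * (nu * dotv q q)).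
  by rewrite ler_wpM2l // ler_wpM2l // (ltW s0).
have h5 : nu * (tau * (s * dotv q q)) <= nu * x by rewrite ler_wpM2l.
by apply: (le_trans h4); rewrite mulrDr mulr1; nra.
Qed.

End rank_one_update.

(** * Concentration of quadratic forms of features *)

Definition lip (R : realType) (l : R) (f : R -> R) := forall x y : R, `|f x - f y| <= l * `|x - y|.

Lemma continuous_bigsum (R : realType) (I : Type) (r : seq I) (f : I -> R -> R) :
  (forall i, continuous (f i)) -> continuous (fun t => \sum_(i <- r) f i t).
Proof.
move=> cf; elim: r => [|i r IH].
  rewrite (_ : (fun t => _) = fun=> 0) => [t|]; first exact: cvg_cst.
  by apply/funext => t; rewrite big_nil.
rewrite (_ : (fun t => _) = fun t => f i t + \sum_(j <- r) f j t) => [t|].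
  by apply: cvgD; [exact: cf|exact: IH].
by apply/funext => t; rewrite big_cons.
Qed.

Section features.
Context {R : realType} (p q : nat) (X : 'M[R]_(p, q)).
Implicit Types (sigma phi : R -> R) (A : 'M[R]_q) (k : 'I_q).

Definition preact phi (x : family R 'I_p) (k : 'I_q) : R := \sum_i phi (x i) * X i k.

Definition feat sigma phi (x : family R 'I_p) : 'cV[R]_q := \col_k sigma (preact phi x k).

(** The polynomial u^T v + v^T A v, with gradient [quadg]. Keeping the linear part lets one estimate
    serve twice: A = 0 bounds the covariance, u = 0 the variance of quadratic forms. *)
Definition quadf (u : 'cV[R]_q) (A : 'M[R]_q) (v : 'cV[R]_q) : R :=
  \sum_k (u k 0 * v k 0 + v k 0 * \sum_l A k l * v l 0).

Definition quadg (u : 'cV[R]_q) (A : 'M[R]_q) (v : 'cV[R]_q) : 'cV[R]_q :=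
  u + (A + A^T) *m v.

Lemma quadgE (u v : 'cV[R]_q) A k : quadg u A v k 0 = u k 0 + \sum_l (A k l + A l k) * v l 0.
Proof. by rewrite !mxE; congr (_ + _); apply: eq_bigr => l _; rewrite !mxE. Qed.

Lemma quadf_derive (u v d : 'cV[R]_q) A :
  \sum_k (u k 0 * d k 0 + (d k 0 * (\sum_l A k l * v l 0) + v k 0 * \sum_l A k l * d l 0)) =
  \sum_k quadg u A v k 0 * d k 0.
Proof.
rewrite big_split /= [X in _ + X]big_split /=.
have -> : \sum_k v k 0 * (\sum_l A k l * d l 0) = \sum_k d k 0 * (\sum_l A l k * v l 0).
  under eq_bigr do rewrite big_distrr /=; rewrite exchange_big /=.
  apply: eq_bigr => k _; rewrite big_distrr /=; apply: eq_bigr => l _; ring.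
rewrite -!big_split /=; apply: eq_bigr => k _; rewrite quadgE.
under [in RHS]eq_bigr do rewrite mulrDl.
by rewrite big_split /=; ring.
Qed.

Lemma measurable_preact phi k : continuous phi ->
  measurable_fun [set: family R 'I_p] (fun x : family R 'I_p => preact phi x k).
Proof.
move=> cphi; rewrite /preact; apply: measurable_sum => i; apply: measurable_funM => //.
exact: (measurableT_comp (continuous_measurable_fun cphi) (measurable_coord i)).
Qed.

Lemma measurable_feat sigma phi k : continuous sigma -> continuous phi ->
  measurable_fun [set: family R 'I_p] (fun x : family R 'I_p => feat sigma phi x k 0).
Proof.
move=> csigma cphi; rewrite (_ : (fun x => _) = sigma \o (fun x : family R 'I_p => preact phi x k)); last first.
  by apply/funext => x; rewrite mxE.
exact: (measurableT_comp (continuous_measurable_fun csigma) (measurable_preact k cphi)).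
Qed.

Lemma measurable_quadf d (T : measurableType d) (u : 'cV[R]_q) A (v : T -> 'cV[R]_q) :
  (forall k, measurable_fun setT (fun w => v w k 0)) -> measurable_fun setT (fun w => quadf u A (v w)).
Proof.
move=> mv; apply: measurable_sum => k; apply: measurable_funD; first exact: measurable_funM.
apply: measurable_funM => //; apply: measurable_sum => l; exact: measurable_funM.
Qed.

Lemma measurable_quadg d (T : measurableType d) (u : 'cV[R]_q) A (v : T -> 'cV[R]_q) k :
  (forall k, measurable_fun setT (fun w => v w k 0)) -> measurable_fun setT (fun w => quadg u A (v w) k 0).
Proof.
move=> mv; under eq_fun do rewrite quadgE; apply: measurable_funD => //.
apply: measurable_sum => l; exact: measurable_funM.
Qed.

Section quartic_features.
Context d (T : measurableType d) (P : probability T R).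

Lemma sqintegrable_quadf (u : 'cV[R]_q) A (v : T -> 'cV[R]_q) : (forall k, quartic P (fun w => v w k 0)) ->
  sqintegrable P (fun w => quadf u A (v w)).
Proof.
move=> hv; apply: sqintegrable_sum => k; apply: sqintegrableD.
  by apply: sqintegrableZ; exact: quartic_sqintegrable.
apply: quarticM => //; apply: quartic_sum => l; exact: quarticZ.
Qed.

Lemma quartic_quadg (u : 'cV[R]_q) A (v : T -> 'cV[R]_q) k : (forall k, quartic P (fun w => v w k 0)) ->
  quartic P (fun w => quadg u A (v w) k 0).
Proof.
move=> hv; under eq_fun do rewrite quadgE; apply: quarticD; first exact: quartic_cst.
by apply: quartic_sum => l; exact: quarticZ.
Qed.

Lemma rintegrable_dotv (v : T -> 'cV[R]_q) : (forall k, sqintegrable P (fun w => v w k 0)) ->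
  rintegrable P (fun w => dotv (v w) (v w)).
Proof.
move=> hv; under eq_fun do rewrite dotvE.
by apply: rintegrable_sum => k; exact: sqintegrableM.
Qed.

Variable Y : 'I_p -> T -> R.
Hypothesis hY : iid_normal P Y.

Lemma quartic_coord i : quartic P (Y i).
Proof.
have mY : measurable_fun setT (Y i) by have [m _] := hY; exact: m.
split => //; split; first exact: measurable_funX.
have hV : iid_normal (normal_prob (0 : R) 1) (fun (_ : 'I_1) (t : R) => t).
  split=> [i0|A mA]; first exact: measurable_id.
  rewrite (_ : [set w | _] = A 0); first by rewrite big_ord1.
  by apply/seteqP; split => [t /(_ 0)//|t At j]; rewrite ord1.
have hYi := @iid_normal_inj R _ T P 'I_p 'I_1 Y (fun=> i) (fun a b _ => etrans (ord1 a) (esym (ord1 b))) hY.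
apply/integrableP; split; first by apply/measurable_EFinP; do 2 apply: measurable_funX.
pose G (y : family R 'I_1) := (((y 0) ^+ 2) ^+ 2)%:E.
have mG : measurable_fun setT G.
  by apply/measurable_EFinP; do 2 apply: measurable_funX; exact: measurable_coord.
have G0 y : (0 <= G y)%E by rewrite lee_fin sqr_ge0.
have E := law_ge0 hYi hV mG G0.
under eq_integral do rewrite /= ger0_norm ?sqr_ge0 //.
apply: le_lt_trans (ltry 4); apply: le_trans gauss_moment4.
by rewrite le_eqVlt; apply/orP; left; apply/eqP; exact: E.
Qed.

Lemma quartic_lip (l : R) f (g : T -> R) : lip l f -> quartic P g -> quartic P (fun w => f (g w)).
Proof.
move=> fl hg; have [mg _] := hg.
have l0 : 0 <= l by have := fl 1 0; rewrite subr0 normr1 mulr1; apply: le_trans.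
apply: (quartic_le (g := fun w => `|f 0| + l * `|g w|)).
- exact: (measurableT_comp (continuous_measurable_fun (lipschitz_continuous fl)) mg).
- move=> x; have := fl (g x) 0; rewrite subr0 => h.
  by rewrite -[f (g x)](subrK (f 0)) addrC (le_trans (ler_normD _ _)) // lerD2l.
- by apply: quarticD; [exact: quartic_cst|apply: quarticZ; exact: quartic_norm].
Qed.

Lemma quartic_feat (ls lp : R) sigma phi (m : 'cV[R]_q) k : lip ls sigma -> lip lp phi ->
  quartic P (fun w => (feat sigma phi (tuple_of Y w) - m) k 0).
Proof.
move=> hs hp; under eq_fun do rewrite !mxE; apply: quarticB; last exact: quartic_cst.
apply: (quartic_lip hs); apply: quartic_sum => i; under eq_fun do rewrite mulrC.
by apply: quarticZ; apply: (quartic_lip hp); exact: quartic_coord.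
Qed.

End quartic_features.

Section smooth.
Variables (sigma sigma' phi phi' : R -> R) (ls lp K : R).
Hypotheses (ds : forall x : R, is_derive x (1 : R) sigma (sigma' x))
  (dp : forall x : R, is_derive x (1 : R) phi (phi' x)).
Hypotheses (cs : continuous sigma') (cp : continuous phi').
Hypotheses (bs : forall x : R, `|sigma' x| <= ls) (bp : forall x : R, `|phi' x| <= lp).
Hypothesis hX : mbound X K.

Let cont (f f' : R -> R) : (forall x : R, is_derive x (1 : R) f (f' x)) -> continuous f.
Proof.
move=> df x; apply: differentiable_continuous; apply/derivable1_diffP.
by case: (df x).
Qed.

Lemma derive_lip (f f' : R -> R) (l : R) : (forall x : R, is_derive x (1 : R) f (f' x)) ->
  (forall x : R, `|f' x| <= l) -> lip l f.
Proof.
move=> df fl; have step (x y : R) : x < y -> `|f y - f x| <= l * `|y - x|.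
  move=> xy; have := MVT xy (fun t _ => df t) (continuous_subspaceT (cont df)).
  by move=> [c _ ->]; rewrite normrM ler_wpM2r.
move=> x y; case: (ltgtP x y) => [xy|xy|->].
- by rewrite distrC [`|x - y|]distrC; exact: step.
- exact: step.
- by rewrite !subrr normr0 mulr0.
Qed.

Let y_upd (x : family R 'I_p) i t k : preact phi (upd x i t) k = phi t * X i k + \sum_(j | j != i) phi (x j) * X j k.
Proof.
rewrite /preact (bigD1 i) //= {1}/upd eqxx; congr (_ + _).
by apply: eq_bigr => j ji; rewrite /upd (negPf ji).
Qed.

Let dv (x : family R 'I_p) i (k : 'I_q) : R := sigma' (preact phi x k) * (phi' (x i) * X i k).

Let derive_v (x : family R 'I_p) i (m : 'cV[R]_q) (t : R) k :
  is_derive t (1 : R) (fun t => (feat sigma phi (upd x i t) - m) k 0) (dv (upd x i t) i k).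
Proof.
have -> : (fun t => (feat sigma phi (upd x i t) - m) k 0) =
   (fun t => sigma (phi t * X i k + \sum_(j | j != i) phi (x j) * X j k) - m k 0).
  by apply/funext => r; rewrite !mxE y_upd.
rewrite /dv y_upd {1}/upd eqxx.
set c := \sum_(j | _) _.
have D1 : is_derive t (1 : R) (fun t => phi t * X i k + c) (phi' t * X i k).
  have := dp t => ?; apply: is_derive_eq.
  by rewrite /GRing.scale /= addr0 mulr0 add0r mulrC.
have D2 := @is_derive1_comp R sigma (fun t => phi t * X i k + c) t _ _ (ds _) D1.
apply: is_derive_eq.
by rewrite subr0.
Qed.

Let D (u : 'cV[R]_q) A m i (x : family R 'I_p) := \sum_k quadg u A (feat sigma phi x - m) k 0 * dv x i k.

(** Chain rule: the derivative in the Gaussian coordinate i is phi'(x_i) times entry i of X z, where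
    z_k is the gradient component k times sigma' at the preactivation. The squared length involves X
    through its operator norm only, hence the dimension-free factor (ls lp K)^2. *)
Lemma feature_variance_smooth d (T : measurableType d) (P : probability T R)
    (Y : 'I_p -> T -> R) (u m : 'cV[R]_q) (A : 'M[R]_q) : iid_normal P Y ->
  forall v, v = (fun w => feat sigma phi (tuple_of Y w) - m) ->
  \int[P]_w (quadf u A (v w) - \int[P]_w' quadf u A (v w')) ^+ 2 <=
  2 * (ls * lp * K) ^+ 2 * \int[P]_w dotv (quadg u A (v w)) (quadg u A (v w)).
Proof.
move=> hY _ ->; pose W w := quadg u A (feat sigma phi (tuple_of Y w) - m).
have ls0 : 0 <= ls by apply: le_trans (bs 0).
have lp0 : 0 <= lp by apply: le_trans (bp 0).
have [K0 hK] := hX.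
have qv := quartic_feat hY m _ (derive_lip ds bs) (derive_lip dp bp).
have mv k : measurable_fun [set: family R 'I_p] (fun x : family R 'I_p => (feat sigma phi x - m) k 0).
  rewrite (_ : (fun x => _) = (fun x : family R 'I_p => feat sigma phi x k 0 - m k 0)); last first.
    by apply/funext => x; rewrite !mxE.
  apply: measurable_funB => //.
  exact: measurable_feat (cont ds) (cont dp).
have mdv i k : measurable_fun [set: family R 'I_p] (fun x : family R 'I_p => dv x i k).
  apply: measurable_funM.
    exact: (measurableT_comp (continuous_measurable_fun cs) (measurable_preact k (cont dp))).
  apply: measurable_funM => //.
  exact: (measurableT_comp (continuous_measurable_fun cp) (measurable_coord i)).
have mF : measurable_fun [set: family R 'I_p] (fun x : family R 'I_p => quadf u A (feat sigma phi x - m)).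
  exact: measurable_quadf.
have mD i : measurable_fun [set: family R 'I_p] (D u A m i).
  by apply: measurable_sum => k; apply: measurable_funM => //; exact: measurable_quadg.
have qW k := quartic_quadg u A k qv.
have bdv i k x : `|dv x i k| <= ls * (lp * `|X i k|).
  by rewrite !normrM ler_pM // ler_wpM2r.
have sD i : sqintegrable P (fun w => D u A m i (tuple_of Y w)).
  apply: sqintegrable_sum => k.
  apply: (sqintegrable_le (g := fun w => (ls * (lp * `|X i k|)) * `|W w k 0|)).
  - have mY : measurable_fun setT (tuple_of Y) by apply: measurable_family => j; have [mm _] := hY; exact: mm.
    apply: measurable_funM; first by have [] := qW k.
    exact: (measurableT_comp (mdv i k) mY).
  - by move=> w; rewrite normrM mulrC ler_wpM2r.
  - by apply: sqintegrableZ; apply: quartic_sqintegrable; exact: quartic_norm.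
have dF i x (t : R) : is_derive t (1 : R) (fun t => quadf u A (feat sigma phi (upd x i t) - m)) (D u A m i (upd x i t)).
  have dvt k := derive_v x i m t k.
  rewrite /D; pose dd : 'cV[R]_q := \col_k dv (upd x i t) i k.
  rewrite (eq_bigr (fun k => quadg u A (feat sigma phi (upd x i t) - m) k 0 * dd k 0)); last first.
    by move=> k _; rewrite [dd _ _]mxE.
  rewrite -quadf_derive /quadf.
  pose v k (t : R) := (feat sigma phi (upd x i t) - m) k 0.
  have dvv k : is_derive t (1 : R) (v k) (dd k 0) by rewrite mxE; exact: dvt.
  have S k : is_derive t (1 : R) (\sum_(l < q) (fun t => A k l * v l t)) (\sum_l A k l * dd l 0).
    apply: is_derive_sum => l; have := dvv l => ?; apply: is_derive_eq.
  have S2 k : is_derive t (1 : R) (fun t => u k 0 * v k t + v k t * \sum_l A k l * v l t)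
     (u k 0 * dd k 0 + (dd k 0 * (\sum_l A k l * v l t) + v k t * \sum_l A k l * dd l 0)).
    have := dvv k => ?; have := S k; rewrite (_ : \sum_(l < q) _ = fun t => \sum_l A k l * v l t); last first.
      by apply/funext => r; rewrite fct_sumE.
    move=> ?; apply: is_derive_eq; rewrite /GRing.scale /= ; ring.
  have := is_derive_sum S2; rewrite (_ : \sum_(k < q) _ = fun t => \sum_k (u k 0 * v k t + v k t * \sum_l A k l * v l t)) //.
  by apply/funext => r; rewrite fct_sumE.
have cD i x : continuous (fun t => D u A m i (upd x i t)).
  have cv k : continuous (fun t => (feat sigma phi (upd x i t) - m) k 0) := cont (fun t => derive_v x i m t k).
  apply: (@continuous_bigsum R _ _ (fun k t => quadg u A (feat sigma phi (upd x i t) - m) k 0 * dv (upd x i t) i k)) => k t.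
  apply: cvgM.
    rewrite quadgE; under eq_fun do rewrite quadgE.
    apply: cvgD; first exact: cvg_cst.
    apply: (@continuous_bigsum R _ _ (fun l t => (A k l + A l k) * (feat sigma phi (upd x i t) - m) l 0)) => l r.
    by apply: cvgM; [exact: cvg_cst|exact: cv].
  have E r : dv (upd x i r) i k = sigma' (phi r * X i k + \sum_(j | j != i) phi (x j) * X j k) * (phi' r * X i k).
    by rewrite /dv y_upd {1}/upd eqxx.
  rewrite E (funext E).
  apply: cvgM; last by apply: cvgM; [exact: cp|exact: cvg_cst].
  apply: (@continuous_comp _ _ _ (fun t => phi t * X i k + \sum_(j | j != i) phi (x j) * X j k) sigma'); last exact: cs.
  by apply: cvgD; [apply: cvgM; [exact: (cont dp)|exact: cvg_cst]|exact: cvg_cst].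
apply: (le_trans (gaussian_poincare hY mF mD dF cD (sqintegrable_quadf u A qv) sD)).
rewrite -mulrA ler_pM2l //.
have iD i : rintegrable P (fun w => D u A m i (tuple_of Y w) ^+ 2) by have [] := sD i.
have E1 := Rint_sum (index_enum 'I_p) iD; rewrite -E1.
have iW : rintegrable P (fun w => dotv (W w) (W w)).
  by apply: rintegrable_dotv => k; exact: quartic_sqintegrable.
rewrite -(RintZ _ iW); apply: Rint_le.
- exact: rintegrable_sum.
- exact: rintegrableZ.
move=> w; set x := tuple_of Y w; pose z : 'cV[R]_q := \col_k (W w k 0 * sigma' (preact phi x k)).
have Dz i : D u A m i x = phi' (x i) * (X *m z) i 0.
  rewrite /D mxE big_distrr; apply: eq_bigr => k _; rewrite /dv /= [z _ _]mxE -/(W w); ring.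
apply: (@le_trans _ _ (lp ^+ 2 * dotv (X *m z) (X *m z))).
  rewrite dotvE big_distrr; apply: ler_sum => i _; rewrite Dz exprMn -expr2 ler_wpM2r ?sqr_ge0 //.
  by rewrite -[phi' _ ^+ 2]real_normK ?num_real // ler_sqr ?nnegrE.
rewrite [(ls * lp * K) ^+ 2](_ : _ = lp ^+ 2 * (K ^+ 2 * ls ^+ 2)); last by ring.
rewrite -mulrA; apply: ler_wpM2l; first exact: sqr_ge0.
apply: (le_trans (hK z)); rewrite -mulrA; apply: ler_wpM2l; first exact: sqr_ge0.
rewrite !dotvE big_distrr; apply: ler_sum => k _; rewrite [z k 0]mxE -!expr2 exprMn mulrC ler_wpM2r ?sqr_ge0 //.
by rewrite -[sigma' _ ^+ 2]real_normK ?num_real // ler_sqr ?nnegrE.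
Qed.

End smooth.
End features.

Lemma Rint_variance_le d (T : measurableType d) (R : realType) (P : probability T R)
    (F : T -> R) (a : R) : sqintegrable P F ->
  \int[P]_w (F w - \int[P]_w' F w') ^+ 2 <= \int[P]_w (F w - a) ^+ 2.
Proof.
move=> hF; set m := \int[P]_w' F w'; have iF := sqintegrable_int hF.
have [_ i1] := sqintegrableB hF (sqintegrable_cst P a).
have E w : (F w - m) ^+ 2 = ((F w - a) ^+ 2 + (- 2 * (m - a)) * F w) + (m ^+ 2 - a ^+ 2) by ring.
under [leLHS]eq_Rintegral do rewrite E.
have i2 := rintegrableZ (- 2 * (m - a)) iF.
rewrite (RintD (rintegrableD i1 i2) (rintegrable_cst P _)) (RintD i1 i2) (RintZ _ iF) Rint_cst -/m.
have := sqr_ge0 (m - a); rewrite !expr2; nra.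
Qed.

Lemma psdmx_cauchy_schwarz (R : realType) n (M : 'M[R]_n) (u w : 'cV[R]_n) : psdmx M ->
  dotv u (M *m w) ^+ 2 <= dotv u (M *m u) * dotv w (M *m w).
Proof.
move=> hM; have [symM _] := hM.
set a := dotv u (M *m u); set b := dotv u (M *m w); set c := dotv w (M *m w).
have bs : dotv w (M *m u) = b by rewrite dotv_mulmx symM dotvC.
have H t : 0 <= a + 2 * t * b + t ^+ 2 * c.
  have := psdmx_dotv (u + t *: w) hM.
  rewrite mulmxDr -scalemxAr !dotvDl !dotvDr !dotvZl !dotvZr bs -/a -/b -/c.
  by rewrite (_ : a + _ + _ = a + 2 * t * b + t ^+ 2 * c) //; ring.
have a0 : 0 <= a := psdmx_dotv u hM.
have : 0 <= c := psdmx_dotv w hM.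
rewrite le_eqVlt => /predU1P[c0|c0].
  rewrite -c0 mulr0; have [->|b0] := eqVneq b 0; first by rewrite expr0n.
  (* With c = 0 the form is affine in t, and this t gives it the value -1. *)
  have := H (- (a + 1) / (2 * b)); rewrite -c0 mulr0 addr0.
  rewrite (_ : a + _ = -1); last by field.
  by rewrite lerNr oppr0 ler10.
have := H (- b / c); rewrite (_ : a + _ + _ = (a * c - b ^+ 2) / c); last by field; rewrite gt_eqF.
by rewrite pmulr_lge0 ?invr_gt0 // subr_ge0.
Qed.

(** Cauchy-Schwarz for the form of [M] at the pair (M u, u) bounds |M u|^4 by b |M u|^2 times b
    |u|^2. *)
Lemma psdmx_mbound (R : realType) n (M : 'M[R]_n) (b : R) : psdmx M -> 0 <= b ->
  (forall u, dotv u (M *m u) <= b * dotv u u) -> mbound M b.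
Proof.
move=> hM b0 h; split=> // u.
have := psdmx_cauchy_schwarz (M *m u) u hM; have [symM _] := hM.
have h1 := h (M *m u); have h2 := h u.
have e : dotv (M *m u) (M *m u) = dotv u (M *m (M *m u)) by rewrite [RHS]dotv_mulmx symM.
set D := dotv (M *m u) (M *m u) in h1 e *.
have := dotv_ge0 (M *m u); rewrite -/D le_eqVlt => /predU1P[<- _|D0].
  by rewrite mulr_ge0 ?sqr_ge0 ?dotv_ge0.
move=> h3; have : D ^+ 2 <= (b * D) * (b * dotv u u).
  apply: (le_trans h3); apply: ler_pM => //; exact: psdmx_dotv.
rewrite expr2 (_ : b * D * _ = D * (b ^+ 2 * dotv u u)); last by ring.
by rewrite ler_pM2l.
Qed.

(** * Stability of quadratic forms and their gradients under small changes of the vector *)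

Section perturbation.
Context {R : realType} (q : nat).
Implicit Types (u v : 'cV[R]_q) (A : 'M[R]_q).

Definition quadh u A v (eta : R) : R :=
  \sum_k (`|u k 0| + \sum_l `|A k l| * (`|v l 0| + `|v k 0| + eta)).

Lemma quadf_perturb u A v v' (eta : R) : 0 <= eta ->
  (forall k, `|v' k 0 - v k 0| <= eta) ->
  `|quadf u A v' - quadf u A v| <= eta * quadh u A v eta.
Proof.
move=> e0 h; rewrite -sumrB mulr_sumr; apply: (le_trans (ler_norm_sum _ _ _)); apply: ler_sum => k _.
have -> : u k 0 * v' k 0 + v' k 0 * (\sum_l A k l * v' l 0) - (u k 0 * v k 0 + v k 0 * (\sum_l A k l * v l 0)) =
   u k 0 * (v' k 0 - v k 0) + \sum_l A k l * (v' k 0 * v' l 0 - v k 0 * v l 0).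
  rewrite opprD addrACA -mulrBr; congr (_ + _).
  by rewrite !mulr_sumr -sumrB; apply: eq_bigr => l _; ring.
apply: (le_trans (ler_normD _ _)); rewrite [leRHS]mulrDr; apply: lerD.
  by rewrite normrM mulrC ler_wpM2r.
rewrite mulr_sumr; apply: (le_trans (ler_norm_sum _ _ _)); apply: ler_sum => l _.
rewrite normrM mulrCA; apply: ler_wpM2l => //.
have -> : v' k 0 * v' l 0 - v k 0 * v l 0 = (v' k 0 - v k 0) * (v' l 0 - v l 0 + v l 0) + v k 0 * (v' l 0 - v l 0) by ring.
apply: (le_trans (ler_normD _ _)); rewrite !normrM.
have h1 := h k; have h2 := h l; have n1 := normr_ge0 (v k 0).
have h3 : `|v' l 0 - v l 0 + v l 0| <= eta + `|v l 0| by apply: (le_trans (ler_normD _ _)); rewrite lerD2r.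
have p1 : `|v' k 0 - v k 0| * `|v' l 0 - v l 0 + v l 0| <= eta * (eta + `|v l 0|) by apply: ler_pM.
have p2 : `|v k 0| * `|v' l 0 - v l 0| <= `|v k 0| * eta by apply: ler_wpM2l.
by rewrite !mulrDr; nra.
Qed.

Lemma quadg_perturb u A v v' (eta : R) : 0 <= eta ->
  (forall k, `|v' k 0 - v k 0| <= eta) ->
  dotv (quadg u A v') (quadg u A v') <= 2 * dotv (quadg u A v) (quadg u A v) +
    2 * eta ^+ 2 * \sum_k (\sum_l `|A k l + A l k|) ^+ 2.
Proof.
move=> e0 h; rewrite !dotvE !mulr_sumr -big_split /=; apply: ler_sum => k _.
have : `|quadg u A v' k 0 - quadg u A v k 0| <= eta * \sum_l `|A k l + A l k|.
  rewrite !quadgE opprD addrACA subrr add0r -sumrB mulr_sumr.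
  apply: (le_trans (ler_norm_sum _ _ _)); apply: ler_sum => l _.
  by rewrite -mulrBr normrM mulrC ler_wpM2r.
set a := quadg u A v' k 0; set b := quadg u A v k 0; set g := \sum_l _ => hab.
have g0 : 0 <= g by apply: sumr_ge0.
have : (a - b) ^+ 2 <= (eta * g) ^+ 2.
  by rewrite -[leLHS]real_normK ?num_real // ler_sqr ?nnegrE // mulr_ge0.
have := sqr_ge0 (a - 2 * b); rewrite !expr2; nra.
Qed.

End perturbation.

Section feature_variance.
Context {R : realType} (p q : nat) (X : 'M[R]_(p, q)).
Context d (T : measurableType d) (P : probability T R) (Y : 'I_p -> T -> R).
Variables (sigma phi : R -> R) (ls lp K : R).
Hypotheses (hY : iid_normal P Y) (hs : lip ls sigma) (hp : lip lp phi) (hX : mbound X K).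

Let lip_ge0 (l : R) f : lip l f -> 0 <= l.
Proof. by move=> fl; have := fl 1 0; rewrite subr0 normr1 mulr1; apply: le_trans. Qed.

Local Notation v m w := (feat X sigma phi (tuple_of Y w) - m).
Local Notation L := (ls * lp * K).

(** sigma and phi are smoothed at scale e, the smooth case is applied, and e tends to 0; [M]
    collects error terms uniform in 0 < e <= 1. The constant 8 is the 2 of the smooth case times two
    factors 2, lost in comparing the variances and the gradients. *)
Lemma feature_variance (u m : 'cV[R]_q) (A : 'M[R]_q) :
  \int[P]_w (quadf u A (v m w) - \int[P]_w' quadf u A (v m w')) ^+ 2 <=
  8 * L ^+ 2 * \int[P]_w dotv (quadg u A (v m w)) (quadg u A (v m w)).
Proof.
have ls0 := lip_ge0 hs; have lp0 := lip_ge0 hp.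
have qv := quartic_feat X hY m _ hs hp.
have sF := sqintegrable_quadf u A qv.
(* Smoothing moves each coordinate by at most e C: [ls] accounts for sigma, the sum for the
   displacement of the preactivation, taken over all k to be uniform in k. *)
pose C := ls + ls * \sum_(k < q) \sum_i lp * `|X i k|.
have C0 : 0 <= C.
  by apply: addr_ge0 => //; apply: mulr_ge0 => //; apply: sumr_ge0 => k _; apply: sumr_ge0 => i _; apply: mulr_ge0.
pose H w := quadh u A (v m w) C.
have sH : sqintegrable P H.
  apply: sqintegrable_sum => k; apply: sqintegrableD; first exact: sqintegrable_cst.
  apply: sqintegrable_sum => l; apply: sqintegrableZ; apply: sqintegrableD; last exact: sqintegrable_cst.
  by apply: sqintegrableD; apply: quartic_sqintegrable; exact: quartic_norm.
pose G := \sum_k (\sum_l `|A k l + A l k|) ^+ 2.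
have G0 : 0 <= G by apply: sumr_ge0 => k _; exact: sqr_ge0.
have iW : rintegrable P (fun w => dotv (quadg u A (v m w)) (quadg u A (v m w))).
  by apply: rintegrable_dotv => k; apply: quartic_sqintegrable; exact: quartic_quadg.
set VF := \int[P]_w (_ - _) ^+ 2; set IW := \int[P]_w dotv _ _.
pose M := 8 * L ^+ 2 * (C ^+ 2 * G) + 2 * (C ^+ 2 * \int[P]_w H w ^+ 2).
have M0 : 0 <= M.
  apply: addr_ge0; first by rewrite mulr_ge0 // mulr_ge0 ?sqr_ge0.
  by rewrite mulr_ge0 // mulr_ge0 ?sqr_ge0 // Rint_ge0 // => w; exact: sqr_ge0.
suff S e : 0 < e -> e <= 1 -> VF <= 8 * L ^+ 2 * IW + e * M.
  apply/ler_addgt0Pr => e e0.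
  pose e1 := Num.min 1 (e / (M + 1)).
  have e10 : 0 < e1 by rewrite lt_min ltr01 divr_gt0 // ltr_pwDr.
  have e11 : e1 <= 1 by rewrite ge_min lexx.
  have e1e : e1 * M <= e.
    apply: (@le_trans _ _ (e / (M + 1) * M)); first by rewrite ler_wpM2r // ge_min lexx orbT.
    by rewrite mulrAC ler_pdivrMr ?ltr_pwDr //; nra.
  by apply: (le_trans (S e1 e10 e11)); rewrite lerD2l.
move=> e0 e1.
have [sg [sg' [ds cs as_ bs]]] := lipschitz_smoothing e0 hs.
have [ph [ph' [dp cp ap bp]]] := lipschitz_smoothing e0 hp.
pose ve w := feat X sg ph (tuple_of Y w) - m.
have V := feature_variance_smooth ds dp cs cp bs bp hX u A hY (erefl ve).
have qve := quartic_feat X hY m _ (derive_lip ds bs) (derive_lip dp bp).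
have sFe := sqintegrable_quadf u A qve.
have eC : 0 <= e * C by rewrite mulr_ge0 // ltW.
have near w k : `|ve w k 0 - v m w k 0| <= e * C.
  rewrite !mxE (_ : _ - _ - _ = sg (preact X ph (tuple_of Y w) k) - sigma (preact X phi (tuple_of Y w) k)); last by ring.
  set y := preact X ph _ k; set y' := preact X phi _ k.
  rewrite (_ : sg y - sigma y' = (sg y - sigma y) + (sigma y - sigma y')); last by ring.
  apply: (le_trans (ler_normD _ _)); rewrite mulrDr; apply: lerD; first by rewrite mulrC.
  apply: (le_trans (hs _ _)); rewrite mulrCA; apply: ler_wpM2l => //.
  apply: (@le_trans _ _ (e * \sum_i lp * `|X i k|)).
    rewrite -sumrB mulr_sumr; apply: (le_trans (ler_norm_sum _ _ _)); apply: ler_sum => i _.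
    by rewrite -mulrBl normrM mulrA ler_wpM2r // mulrC.
  apply: ler_wpM2l; first exact: ltW.
  rewrite [leRHS](bigD1 k) //= lerDl; apply: sumr_ge0 => j _; apply: sumr_ge0 => i _; exact: mulr_ge0.
have eCC : e * C <= C by rewrite ler_piMl.
have nF w : `|quadf u A (v m w) - quadf u A (ve w)| <= e * (C * H w).
  rewrite distrC; apply: (le_trans (quadf_perturb u A eC (near w))).
  rewrite -mulrA; apply: ler_wpM2l; first exact: ltW.
  apply: ler_wpM2l => //; apply: ler_sum => k _; rewrite lerD2l; apply: ler_sum => l _.
  by apply: ler_wpM2l => //; rewrite lerD2l.
pose me := \int[P]_w quadf u A (ve w); rewrite -/me in V.
have [_ i1] := sqintegrableB sFe (sqintegrable_cst P me).
have [_ i2] := sH.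
have [_ i3] := sqintegrableB sF (sqintegrable_cst P me).
have h1 : VF <= 2 * \int[P]_w (quadf u A (ve w) - me) ^+ 2 + 2 * (e * C) ^+ 2 * \int[P]_w H w ^+ 2.
  apply: (le_trans (Rint_variance_le me sF)).
  rewrite -(RintZ 2 i1) -(RintZ _ i2) -(RintD (rintegrableZ 2 i1) (rintegrableZ _ i2)).
  apply: Rint_le => [//||w].
    by apply: rintegrableD; apply: rintegrableZ.
  have := nF w; move: (quadf u A (v m w)) (quadf u A (ve w)) => a b; rewrite mulrA => hab.
  have : (a - b) ^+ 2 <= (e * C * H w) ^+ 2.
    rewrite -[leLHS]real_normK ?num_real // ler_sqr ?nnegrE //; exact: le_trans hab.
  rewrite [(e * C * H w) ^+ 2]exprMn; have := sqr_ge0 (a - b - (b - me)); rewrite !expr2; nra.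
have h2 : \int[P]_w dotv (quadg u A (ve w)) (quadg u A (ve w)) <= 2 * IW + 2 * (e * C) ^+ 2 * G.
  have -> : 2 * (e * C) ^+ 2 * G = \int[P]_w (2 * (e * C) ^+ 2 * G) by rewrite Rint_cst.
  rewrite -(RintZ 2 iW) -(RintD (rintegrableZ 2 iW) (rintegrable_cst P _)).
  apply: Rint_le => [||w].
  - by apply: rintegrable_dotv => k; apply: quartic_sqintegrable; exact: quartic_quadg.
  - by apply: rintegrableD; [exact: rintegrableZ|exact: rintegrable_cst].
  - exact: quadg_perturb eC (near w).
have L0 : 0 <= L ^+ 2 by exact: sqr_ge0.
have h3 : VF <= 2 * (2 * L ^+ 2 * (2 * IW + 2 * (e * C) ^+ 2 * G)) + 2 * (e * C) ^+ 2 * \int[P]_w H w ^+ 2.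
  apply: (le_trans h1); rewrite lerD2r ler_pM2l //; apply: (le_trans V).
  by apply: ler_wpM2l => //; rewrite mulr_ge0.
apply: (le_trans h3).
have -> : 2 * (2 * L ^+ 2 * (2 * IW + 2 * (e * C) ^+ 2 * G)) + 2 * (e * C) ^+ 2 * \int[P]_w H w ^+ 2 =
   8 * L ^+ 2 * IW + e ^+ 2 * M by rewrite /M; ring.
rewrite lerD2l; apply: ler_wpM2r => //; rewrite expr2 -[leRHS]mulr1 ler_wpM2l //; exact: ltW.
Qed.

Definition mean_feat : 'cV[R]_q := \col_k \int[P]_w feat X sigma phi (tuple_of Y w) k 0.

Definition cov_feat : 'M[R]_q :=
  \matrix_(k, l) \int[P]_w (v mean_feat w k 0 * v mean_feat w l 0).

Local Notation m := mean_feat.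
Local Notation Phi0 := cov_feat.
Local Notation b := (8 * L ^+ 2).

Let qv k := quartic_feat X hY mean_feat k hs hp.
Let sv k := quartic_sqintegrable (qv k).

Lemma bound_ge0 : 0 <= b. Proof. by rewrite mulr_ge0 ?sqr_ge0. Qed.

Lemma mean_centered k : \int[P]_w v m w k 0 = 0.
Proof.
have i0 : rintegrable P (fun w => feat X sigma phi (tuple_of Y w) k 0).
  have := quartic_sqintegrable (quartic_feat X hY 0 k hs hp).
  by under eq_fun do rewrite subr0; exact: sqintegrable_int.
under eq_Rintegral do rewrite mxE [X in _ + X]mxE.
by rewrite (RintB i0 (rintegrable_cst P _)) Rint_cst /mean_feat mxE subrr.
Qed.

Lemma cov_dotv (u w : 'cV[R]_q) :
  dotv u (Phi0 *m w) = \int[P]_t (dotv u (v m t) * dotv w (v m t)).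
Proof.
have i0 k l : rintegrable P (fun t => v m t k 0 * v m t l 0) by exact: sqintegrableM.
transitivity (\sum_k \sum_l \int[P]_t (u k 0 * w l 0 * (v m t k 0 * v m t l 0))).
  rewrite dotvE; apply: eq_bigr => k _; rewrite mxE mulr_sumr; apply: eq_bigr => l _.
  by rewrite (RintZ _ (i0 k l)) mxE; ring.
under eq_bigr do rewrite -(Rint_sum _ (fun l => rintegrableZ _ (i0 _ l))).
rewrite -Rint_sum; last by move=> k; apply: rintegrable_sum => l; exact: rintegrableZ.
apply: eq_Rintegral => t _; rewrite !dotvE big_distrl /=; apply: eq_bigr => k _.
by rewrite big_distrr /=; apply: eq_bigr => l _; ring.
Qed.

Lemma cov_psd : psdmx Phi0.
Proof.
split=> [|u]; first by apply/matrixP => k l; rewrite !mxE; apply: eq_Rintegral => t _; rewrite mulrC.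
by rewrite -mulmxA -/(dotv _ _) cov_dotv Rint_ge0 // => t; rewrite -expr2 sqr_ge0.
Qed.

(** A linear form has constant gradient [u], so the variance bound for A = 0 is exactly a bound on
    the quadratic form of the covariance. *)
Lemma cov_bound (u : 'cV[R]_q) : dotv u (Phi0 *m u) <= b * dotv u u.
Proof.
have := feature_variance u m 0.
have E w : quadf u 0 (v m w) = dotv u (v m w).
  rewrite /quadf dotvE; apply: eq_bigr => k _; rewrite big1 ?mulr0 ?addr0 // => l _.
  by rewrite mxE mul0r.
have G w : quadg u 0 (v m w) = u by rewrite /quadg trmx0 addr0 mul0mx addr0.
have iv k : rintegrable P (fun w => v m w k 0) := sqintegrable_int (sv k).
have E0 : \int[P]_w quadf u 0 (v m w) = 0.
  under eq_Rintegral do rewrite E dotvE.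
  rewrite (Rint_sum _ (fun k => rintegrableZ (u k 0) (iv k))) big1 // => k _.
  by rewrite (RintZ _ (iv k)) mean_centered mulr0.
rewrite E0; under eq_Rintegral do rewrite E subr0.
under [X in _ <= _ * X -> _]eq_Rintegral do rewrite G.
by rewrite Rint_cst cov_dotv; under [X in _ -> X <= _]eq_Rintegral do rewrite -expr2.
Qed.

Lemma cov_mbound : mbound Phi0 b.
Proof. exact: psdmx_mbound cov_psd bound_ge0 cov_bound. Qed.

(** The gradient (A + A^T) v has mean square equal to the sum of the covariance forms at the rows of
    A + A^T, at most b times the squared Frobenius norm, itself at most 4 nu^2 q. So the standard
    deviation is of order sqrt q against a mean that may be of order q. *)
Lemma quadratic_form_variance (A : 'M[R]_q) (nu : R) : mbound A nu ->
  \int[P]_w (dotv (v m w) (A *m v m w) - \tr (A *m Phi0)) ^+ 2 <= 4 * b ^+ 2 * nu ^+ 2 * q%:R.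
Proof.
move=> hA; have := feature_variance 0 m A; have hb := bound_ge0.
have E w : quadf 0 A (v m w) = dotv (v m w) (A *m v m w).
  rewrite /quadf dotvE; apply: eq_bigr => k _.
  have -> : (A *m v m w) k 0 = \sum_l A k l * v m w l 0 by rewrite mxE.
  have -> : (0 : 'cV[R]_q) k 0 = 0 by rewrite mxE.
  by rewrite mul0r add0r.
have i0 k l : rintegrable P (fun t => v m t k 0 * v m t l 0) by exact: sqintegrableM.
have -> : \int[P]_w quadf 0 A (v m w) = \tr (A *m Phi0).
  transitivity (\sum_k \sum_l \int[P]_t (A k l * (v m t l 0 * v m t k 0))); last first.
    by apply: eq_bigr => k _; rewrite mxE; apply: eq_bigr => l _; rewrite (RintZ _ (i0 l k)) mxE.
  under [RHS]eq_bigr do rewrite -(Rint_sum _ (fun l => rintegrableZ _ (i0 l _))).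
  rewrite -Rint_sum; last by move=> k; apply: rintegrable_sum => l; exact: rintegrableZ.
  apply: eq_Rintegral => t _; rewrite E dotvE; apply: eq_bigr => k _.
  have -> : (A *m v m t) k 0 = \sum_l A k l * v m t l 0 by rewrite mxE.
  by rewrite mulr_sumr; apply: eq_bigr => l _; ring.
under [X in X <= _ -> _]eq_Rintegral do rewrite E.
move=> /le_trans; apply.
rewrite (_ : 4 * b ^+ 2 * nu ^+ 2 * q%:R = b * (b * (4 * nu ^+ 2 * q%:R))); last by ring.
apply: ler_wpM2l => //.
pose B := A + A^T.
have hAT := mbound_tr hA; have nu0 : 0 <= nu by case: hA.
have FB : \sum_k \sum_l B k l ^+ 2 <= 4 * nu ^+ 2 * q%:R.
  have f1 := mbound_frobenius hA; have f2 := mbound_frobenius hAT.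
  apply: (@le_trans _ _ (\sum_k \sum_l (2 * A k l ^+ 2 + 2 * A^T k l ^+ 2))).
    apply: ler_sum => k _; apply: ler_sum => l _; rewrite !mxE.
    by have := sqr_ge0 (A k l - A l k); rewrite !expr2; nra.
  under eq_bigr do rewrite big_split /= -!mulr_sumr.
  by rewrite big_split /= -!mulr_sumr; lra.
pose r k : 'cV[R]_q := (row k B)^T.
have Er w k : quadg 0 A (v m w) k 0 = dotv (r k) (v m w).
  rewrite quadgE dotvE (_ : (0 : 'cV[R]_q) k 0 = 0) ?add0r; last by rewrite mxE.
  apply: eq_bigr => l _; congr (_ * _).
  by rewrite /r /B mxE [RHS]mxE [RHS]mxE; congr (_ + _); rewrite mxE.
have ir k : rintegrable P (fun t => dotv (r k) (v m t) * dotv (r k) (v m t)).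
  have sd : sqintegrable P (fun t => dotv (r k) (v m t)).
    by under eq_fun do rewrite dotvE; apply: sqintegrable_sum => l; exact: sqintegrableZ.
  exact: sqintegrableM.
have -> : \int[P]_w dotv (quadg 0 A (v m w)) (quadg 0 A (v m w)) =
    \sum_k \int[P]_w (dotv (r k) (v m w) * dotv (r k) (v m w)).
  rewrite -Rint_sum //; apply: eq_Rintegral => t _; rewrite dotvE.
  by apply: eq_bigr => k _; rewrite Er.
apply: (@le_trans _ _ (b * \sum_k \sum_l B k l ^+ 2)); last by rewrite ler_wpM2l.
rewrite mulr_sumr; apply: ler_sum => k _; rewrite -cov_dotv; apply: (le_trans (cov_bound _)).
rewrite dotvE le_eqVlt; apply/orP; left; apply/eqP; congr (_ * _).
by apply: eq_bigr => l _; rewrite !mxE expr2.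
Qed.

End feature_variance.

(** * Leave-one-out analysis of the resolvent *)

Section measurable_matrices.
Context {R : realType} d (T : measurableType d).

Definition mmx m n (A : T -> 'M[R]_(m, n)) := forall i j, measurable_fun setT (fun w => A w i j).

(** Inversion jumps at 0, where its value is 0 by convention; the continuous functions x / (x^2 +
    1/(k+1)) converge to it everywhere, including there. *)
Lemma measurable_invr : measurable_fun [set: R] (fun x : R => x^-1).
Proof.
pose f (k : nat) (x : R) := x / (x ^+ 2 + k.+1%:R^-1).
have pos k (x : R) : 0 < x ^+ 2 + k.+1%:R^-1 by rewrite ltr_wpDl ?sqr_ge0.
apply: (@measurable_fun_cvg _ _ _ setT f) => [k|x _].
  apply: continuous_measurable_fun => x; apply: cvgM; first exact: cvg_id.
  apply: cvgV; first by rewrite gt_eqF.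
  by apply: cvgD; [exact: exprn_continuous|exact: cvg_cst].
have [->|x0] := eqVneq x 0.
  by rewrite invr0; under eq_fun do rewrite /f mul0r; exact: cvg_cst.
rewrite (_ : x^-1 = x / (x ^+ 2 + 0)); last by rewrite addr0 expr2; field.
apply: cvgM; first exact: cvg_cst.
apply: cvgV; first by rewrite addr0 expf_neq0.
by apply: cvgD; [exact: cvg_cst|exact: cvg_harmonic].
Qed.

Lemma mmx_cst m n (A : 'M[R]_(m, n)) : mmx (fun=> A).
Proof. by move=> i j; exact: measurable_cst. Qed.

Lemma mmxD m n (A B : T -> 'M[R]_(m, n)) : mmx A -> mmx B -> mmx (fun w => A w + B w).
Proof. by move=> hA hB i j; under eq_fun do rewrite mxE; exact: measurable_funD. Qed.

Lemma mmxB m n (A B : T -> 'M[R]_(m, n)) : mmx A -> mmx B -> mmx (fun w => A w - B w).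
Proof.
move=> hA hB i j; rewrite (_ : (fun w => _) = (fun w => A w i j - B w i j)).
  exact: measurable_funB.
by apply/funext => w; rewrite !mxE.
Qed.

Lemma mmxZ m n (c : R) (A : T -> 'M[R]_(m, n)) : mmx A -> mmx (fun w => c *: A w).
Proof. by move=> hA i j; under eq_fun do rewrite mxE; exact: measurable_funM. Qed.

Lemma mmxM m n p (A : T -> 'M[R]_(m, n)) (B : T -> 'M[R]_(n, p)) : mmx A -> mmx B ->
  mmx (fun w => A w *m B w).
Proof.
by move=> hA hB i j; under eq_fun do rewrite mxE; apply: measurable_sum => k; exact: measurable_funM.
Qed.

Lemma mmx_tr m n (A : T -> 'M[R]_(m, n)) : mmx A -> mmx (fun w => (A w)^T).
Proof. by move=> hA i j; under eq_fun do rewrite mxE; exact: hA. Qed.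

Lemma measurable_mxtrace n (A : T -> 'M[R]_n) : mmx A -> measurable_fun setT (fun w => \tr (A w)).
Proof. by move=> hA; apply: measurable_sum => i; exact: hA. Qed.

Lemma measurable_det n (A : T -> 'M[R]_n) : mmx A -> measurable_fun setT (fun w => \det (A w)).
Proof.
move=> hA; apply: measurable_sum => s; apply: measurable_funM; first exact: measurable_cst.
by apply: measurable_prod => i _; exact: hA.
Qed.

Lemma mmx_invmx n (A : T -> 'M[R]_n) : mmx A -> (forall w, A w \in unitmx) ->
  mmx (fun w => invmx (A w)).
Proof.
move=> hA uA i j; rewrite (_ : (fun w => _) = (fun w => (\det (A w))^-1 * ((-1) ^+ (j + i) * \det (row' j (col' i (A w)))))).
  apply: measurable_funM; first exact: (measurableT_comp measurable_invr (measurable_det hA)).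
  apply: measurable_funM => //; apply: measurable_det => k l.
  by under eq_fun do rewrite !mxE; exact: hA.
by apply/funext => w; rewrite /invmx uA !mxE.
Qed.

Lemma mmx_res n (A : T -> 'M[R]_n) (s : R) : mmx A -> (forall w, psdmx (A w)) -> 0 < s ->
  mmx (fun w => res (A w) s).
Proof.
move=> hA pA s0; apply: mmx_invmx => [|w]; last exact: res_unit.
by apply: mmxD => //; exact: mmx_cst.
Qed.

Lemma measurable_dotv n (u v : T -> 'cV[R]_n) : mmx u -> mmx v ->
  measurable_fun setT (fun w => dotv (u w) (v w)).
Proof.
move=> hu hv; under eq_fun do rewrite dotvE.
by apply: measurable_sum => i; exact: measurable_funM.
Qed.

End measurable_matrices.

(** * Moments of functions that depend little on each block *)

Section bounded_differences.
Context {R : realType} d (T : measurableType d) (P : probability T R).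
Variables (I : finType) (Y : I -> T -> R) (n : nat) (b : I -> 'I_n).
Hypothesis hY : iid_normal P Y.
Variables (F : family R I -> R) (f : 'I_n -> family R I -> R) (M de : R).
Hypotheses (mF : measurable_fun setT F) (mf : forall k, measurable_fun setT (f k)).
Hypotheses (FM : forall x, `|F x| <= M) (fM : forall k x, `|f k x| <= M).
Hypothesis Ff : forall k x, `|F x - f k x| <= de.
Hypothesis indep : forall k x y, (forall i, b i != k -> x i = y i) -> f k x = f k y.

Let m := \int[P]_w F (tuple_of Y w).

Let mY : measurable_fun setT (tuple_of Y).
Proof. by apply: measurable_family => i; have [mm _] := hY; exact: mm. Qed.

Let sqB (g : family R I -> R) (K : R) : measurable_fun setT g -> (forall x, `|g x| <= K) ->
  sqintegrable P (fun w => g (tuple_of Y w)).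
Proof. by move=> mg gK; apply: (@sqintegrable_bounded _ _ _ _ _ K) => //; exact: measurableT_comp. Qed.

Lemma bounded_difference_variance :
  \int[P]_w (F (tuple_of Y w) - m) ^+ 2 <= 2 * n%:R * de ^+ 2.
Proof.
apply: (le_trans (efron_stein hY mF (sqB mF FM) mf (fun k => sqB (mf k) (fM k)) indep)).
rewrite -mulrA ler_pM2l // mulr_natl -[X in _ *+ X]card_ord -sumr_const; apply: ler_sum => k _.
have [_ i1] := sqintegrableB (sqB mF FM) (sqB (mf k) (fM k)).
rewrite -[leRHS](Rint_cst P); apply: Rint_le => //; first exact: rintegrable_cst.
move=> w; rewrite -[leLHS]real_normK ?num_real // ler_sqr ?nnegrE //.
exact: le_trans (Ff k (tuple_of Y w)).
Qed.

(** Efron-Stein for (F - m)^2: replacing F by f_k changes it by (F - f_k)(2 (F - m) - (F - f_k)),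
    whose mean square is at most de^2 (8 Var F + 2 de^2). With Var F <= 2 n de^2 the variance of (F
    - m)^2 is at most 36 n^2 de^4, and its squared mean adds 4 n^2 de^4. *)
Lemma bounded_difference_moment4 : (0 < n)%N ->
  \int[P]_w ((F (tuple_of Y w) - m) ^+ 2) ^+ 2 <= 40 * n%:R ^+ 2 * de ^+ 4.
Proof.
move=> n0; pose G x := (F x - m) ^+ 2; pose g k x := (f k x - m) ^+ 2.
have mG : measurable_fun setT G by apply: measurable_funX; exact: measurable_funB.
have mg k : measurable_fun setT (g k) by apply: measurable_funX; exact: measurable_funB.
have bd (h : family R I -> R) : (forall x, `|h x| <= M) -> forall x, `|(h x - m) ^+ 2| <= (M + `|m|) ^+ 2.
  move=> hM x; have hx := hM x; rewrite normrX ler_sqr ?nnegrE ?addr_ge0 //; last exact: le_trans hx.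
  by apply: (le_trans (ler_normB _ _)); rewrite lerD2r.
have sG := sqB mG (bd _ FM); have sg k := sqB (mg k) (bd _ (fM k)).
have ES := efron_stein hY mG sG mg sg (fun k x y h => congr1 (fun t => (t - m) ^+ 2) (indep h)).
have V := bounded_difference_variance.
set VF := \int[P]_w _ in V.
have V0 : 0 <= VF by apply: Rint_ge0 => w; exact: sqr_ge0.
have iG := sqintegrable_int sG.
have de0 : 0 <= de by apply: le_trans (Ff (Ordinal n0) (fun=> 0)).
have each k : \int[P]_w (G (tuple_of Y w) - g k (tuple_of Y w)) ^+ 2 <= de ^+ 2 * (8 * VF + 2 * de ^+ 2).
  have [_ i1] := sqintegrableB sG (sg k).
  have -> : de ^+ 2 * (8 * VF + 2 * de ^+ 2) = \int[P]_w ((8 * de ^+ 2) * G (tuple_of Y w) + 2 * (de ^+ 2) ^+ 2).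
    by rewrite (RintD (rintegrableZ _ iG) (rintegrable_cst P _)) (RintZ _ iG) Rint_cst -/VF; ring.
  apply: Rint_le => // [|w].
    by apply: rintegrableD; [exact: rintegrableZ|exact: rintegrable_cst].
  have := Ff k (tuple_of Y w); rewrite /G /g; move: (F _) (f k _) => p r h.
  have h2 : (p - r) ^+ 2 <= de ^+ 2 by rewrite -[leLHS]real_normK ?num_real // ler_sqr ?nnegrE.
  rewrite (_ : ((p - m) ^+ 2 - (r - m) ^+ 2) ^+ 2 = (p - r) ^+ 2 * ((2 * (p - m) - (p - r)) ^+ 2)); last by ring.
  have h3 : (2 * (p - m) - (p - r)) ^+ 2 <= 8 * (p - m) ^+ 2 + 2 * de ^+ 2.
    have := sqr_ge0 (2 * (p - m) + (p - r)); rewrite !expr2 in h2 *; nra.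
  have h4 : (p - r) ^+ 2 * (2 * (p - m) - (p - r)) ^+ 2 <= de ^+ 2 * (8 * (p - m) ^+ 2 + 2 * de ^+ 2).
    by apply: ler_pM => //; exact: sqr_ge0.
  apply: (le_trans h4); rewrite le_eqVlt; apply/orP; left; apply/eqP; ring.
have ES2 : \int[P]_w (G (tuple_of Y w) - VF) ^+ 2 <= 2 * (n%:R * (de ^+ 2 * (8 * VF + 2 * de ^+ 2))).
  apply: (le_trans ES); rewrite ler_pM2l // [leRHS]mulr_natl -[X in _ *+ X]card_ord -sumr_const.
  by apply: ler_sum => k _; exact: each.
have E : \int[P]_w (G (tuple_of Y w)) ^+ 2 = \int[P]_w (G (tuple_of Y w) - VF) ^+ 2 + VF ^+ 2.
  have [_ i2] := sG.
  have Ew w : (G (tuple_of Y w) - VF) ^+ 2 = (G (tuple_of Y w) ^+ 2 + (- 2 * VF) * G (tuple_of Y w)) + VF ^+ 2 by ring.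
  under [in RHS]eq_Rintegral do rewrite Ew.
  rewrite (RintD (rintegrableD i2 (rintegrableZ _ iG)) (rintegrable_cst P _)).
  rewrite (RintD i2 (rintegrableZ _ iG)) (RintZ _ iG) Rint_cst -/VF; ring.
rewrite -/(G _) E; have n1 : 1 <= n%:R :> R by rewrite ler1n.
set N := n%:R in n1 V ES2 *.
have V2 : VF ^+ 2 <= (2 * N * de ^+ 2) ^+ 2 by rewrite ler_sqr ?nnegrE // (le_trans V0).
have d2 : 0 <= de ^+ 2 by exact: sqr_ge0.
have h5 : 2 * (N * (de ^+ 2 * (8 * VF + 2 * de ^+ 2))) <= 2 * (N * (de ^+ 2 * (8 * (2 * N * de ^+ 2) + 2 * (N * de ^+ 2)))).
  rewrite ler_pM2l // ler_wpM2l ?(le_trans _ n1) // ler_wpM2l // lerD // ?ler_pM2l //.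
  by rewrite ler_peMl.
apply: (le_trans (lerD (le_trans ES2 h5) V2)); rewrite le_eqVlt; apply/orP; left; apply/eqP; ring.
Qed.

End bounded_differences.

(** * Leave-one-out identities for Gram matrices *)

Section gram.
Context {R : realType} (n q : nat).
Implicit Types (S : 'M[R]_(n, q)) (N B : 'M[R]_q).

Definition gram S : 'M[R]_q := q%:R^-1 *: (S^T *m S).

(** The row is set to 0 rather than removed: the Gram matrix is the same and the dimensions are
    kept. *)
Definition drop_row i S : 'M[R]_(n, q) := \matrix_(j, k) if j == i then 0 else S j k.

Lemma gram_psd S : psdmx (gram S).
Proof.
split; first by rewrite /gram linearZ /= trmx_mul trmxK.
move=> v; rewrite -mulmxA -/(dotv _ _) /gram -scalemxAl dotvZr -mulmxA dotv_mulmx trmxK.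
by rewrite mulr_ge0 ?invr_ge0 // dotv_ge0.
Qed.

Lemma gram_drop_row i S : gram S = gram (drop_row i S) + q%:R^-1 *: ((row i S)^T *m ((row i S)^T)^T).
Proof.
rewrite /gram -scalerDr; congr (_ *: _); apply/matrixP => k l; rewrite !mxE big_ord1 (bigD1 i) //= addrC.
congr (_ + _); last by rewrite !mxE.
rewrite [RHS](bigD1 i) //= !mxE eqxx mul0r add0r.
by apply: eq_bigr => j ji; rewrite !mxE (negPf ji).
Qed.

Lemma gram_sum S : gram S = q%:R^-1 *: \sum_i ((row i S)^T *m row i S).
Proof.
congr (_ *: _); apply/matrixP => k l; rewrite !mxE summxE; apply: eq_bigr => i _.
by rewrite mxE [RHS]mxE big_ord1 !mxE.
Qed.

Variable s : R.
Hypothesis s0 : 0 < s.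

(** The Sherman-Morrison scalar of row i: a quadratic form in that row with a matrix built from the
    others, hence concentrated. *)
Definition loo_x i S := q%:R^-1 * dotv (row i S)^T (res (gram (drop_row i S)) s *m (row i S)^T).

Lemma loo_x_ge0 i S : 0 <= loo_x i S.
Proof. by apply: (rank_one_ge0 _ (gram_psd _)) => //; rewrite invr_ge0. Qed.

Lemma res_gram_row i S :
  res (gram S) s *m (row i S)^T = (1 + loo_x i S)^-1 *: (res (gram (drop_row i S)) s *m (row i S)^T).
Proof.
rewrite {1}(gram_drop_row i S).
by apply: (res_rank_one _ (gram_psd _)) => //; rewrite invr_ge0.
Qed.

Lemma trace_drop_row i S N (nu : R) : mbound N nu ->
  `|\tr (N *m res (gram S) s) - \tr (N *m res (gram (drop_row i S)) s)| <= nu / s.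
Proof.
move=> hN; rewrite distrC {1}(gram_drop_row i S).
by apply: (trace_res_rank_one _ (gram_psd _)) => //; rewrite invr_ge0.
Qed.

Lemma trace_res_bound (Y : 'M[R]_q) N (nu : R) : (0 < q)%N -> psdmx Y -> mbound N nu ->
  `|q%:R^-1 * \tr (N *m res Y s)| <= nu / s.
Proof.
move=> q0 hY hN; have q1 : 0 < q%:R :> R by rewrite ltr0n.
rewrite normrM ger0_norm ?invr_ge0 //; have := mbound_trace (mbound_mul hN (res_mbound hY s0)).
by rewrite ler_pdivrMl // mulrC.
Qed.

Lemma res_difference (Y Y' : 'M[R]_q) : psdmx Y -> psdmx Y' ->
  res Y s - res Y' s = res Y s *m (Y' - Y) *m res Y' s.
Proof.
move=> hY hY'; have -> : Y' - Y = (Y' + s%:M) - (Y + s%:M) by rewrite opprD addrACA subrr addr0.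
by rewrite mulmxBr mulmxBl -mulmxA mul_res // mulmx1 res_mul // mul1mx.
Qed.

Lemma psdmxZ (a : R) (Y : 'M[R]_q) : 0 <= a -> psdmx Y -> psdmx (a *: Y).
Proof.
move=> a0 hY; split; first by rewrite linearZ /=; case: hY => ->.
by move=> v; rewrite -mulmxA -/(dotv _ _) -scalemxAl dotvZr mulr_ge0 // psdmx_dotv.
Qed.

(** The resolvent identity compares the random resolvent with the deterministic candidate [Qb]. The
    term of [Qb] is shared equally among the n rows, the Gram matrix is split into its rows, and
    [res_gram_row] makes each resolvent independent of the row it meets. If the leave-one-out scalar
    is close to [al] and the quadratic form close to its trace, the two parts of each term nearly
    cancel. *)
Lemma trace_expansion S (Phi B : 'M[R]_q) (al : R) : (0 < q)%N -> 0 <= al -> psdmx Phi ->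
  let Qb := res ((n%:R / q%:R / (1 + al)) *: Phi) s in let M := Qb *m B in
  q%:R^-1 * \tr (B *m res (gram S) s) - q%:R^-1 * \tr (B *m Qb) =
  q%:R^-1 * \sum_i (q%:R^-1 * \tr (M *m res (gram S) s *m Phi) / (1 + al) -
    q%:R^-1 * dotv (row i S)^T (M *m res (gram (drop_row i S)) s *m (row i S)^T) / (1 + loo_x i S)).
Proof.
move=> q0 al0 hPhi Qb M; have hc : 0 <= n%:R / q%:R / (1 + al) :> R by rewrite !divr_ge0 // addr_ge0.
rewrite -mulrBr -linearB /= -mulmxBr res_difference //; [|exact: gram_psd|exact: psdmxZ].
rewrite -/Qb mulmxBr mulmxBl mulmxBr linearB /= sumrB sumr_const card_ord; congr (_ * (_ - _)).
  rewrite -scalemxAr -scalemxAl -scalemxAr mxtraceZ mulmxA mxtrace_mulC mulmxA mulmxA -/M mulrAC -mulr_natl.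
  by ring.
set Q := res (gram S) s.
have -> : \tr (B *m (Q *m gram S *m Qb)) =
    \sum_i q%:R^-1 * dotv (row i S)^T (M *m (Q *m (row i S)^T)).
  rewrite gram_sum -scalemxAr -scalemxAl -scalemxAr mxtraceZ -mulr_sumr; congr (_ * _).
  rewrite mulmx_sumr mulmx_suml mulmx_sumr raddf_sum; apply: eq_bigr => i _.
  transitivity (\tr (B *m (Q *m ((row i S)^T *m row i S) *m Qb))); first by [].
  rewrite mulmxA mxtrace_mulC -[in RHS](mxtrace_col_row _ (row i S)^T) trmxK.
  by rewrite /M !mulmxA.
apply: eq_bigr => i _; rewrite /Q res_gram_row -scalemxAr dotvZr mulmxA; ring.
Qed.

End gram.

Lemma le_integral_cst d (T : measurableType d) (R : realType) (P : probability T R)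
    (f : T -> \bar R) (c : R) : measurable_fun setT f -> (forall x, 0 <= f x <= c%:E)%E ->
  (\int[P]_x f x <= c%:E)%E.
Proof.
move=> mf fc; have c0 : (0 <= c%:E)%E by have /andP[h1 h2] := fc point; exact: le_trans h2.
apply: (@le_trans _ _ (\int[P]_x (cst c%:E x))%E).
  by apply: ge0_le_integral => // x _; have /andP[] := fc x.
by rewrite integral_cst // -[leRHS]mule1; apply: lee_wpmul2l => //; exact: probability_le1.
Qed.

(** The spectral decomposition writes A as a nonnegative combination of matrices x x^T + y y^T with
    x, y real; against each, the trace is a sum of two values of the quadratic form of B. *)
Lemma trace_mul_psd (R : realType) n (A B : 'M[R]_n) : psdmx A -> psdmx B -> 0 <= \tr (A *m B).
Proof.
move=> hA hB; have [V [e [VV e0 AE]]] := psdmx_spectral hA.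
have toC_tr m (M : 'M[R]_m) : \tr (map_mx (real_complex R) M) = real_complex R (\tr M).
  by rewrite /mxtrace rmorph_sum; apply: eq_bigr => i _; rewrite mxE.
pose x i : 'cV[R]_n := \col_j complex.Re (V i j); pose y i : 'cV[R]_n := \col_j complex.Im (V i j).
have AS : A = \sum_i e i *: (x i *m (x i)^T + y i *m (y i)^T).
  apply/matrixP => k l; have := congr1 (fun M : matrix _ n n => complex.Re (M k l)) AE.
  rewrite mxE /= => ->; rewrite summxE mxE raddf_sum /=; apply: eq_bigr => j _.
  rewrite mxE (bigD1 j) //= big1 ?addr0; last by move=> i ij; rewrite !mxE (negPf ij) mulr0n mulr0.
  rewrite !mxE !big_ord1 !mxE eqxx mulr1n.
  by case: (V j k) => a b; case: (V j l) => a' b' /=; ring.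
rewrite AS mulmx_suml raddf_sum /=; apply: sumr_ge0 => i _.
rewrite -scalemxAl mxtraceZ mulr_ge0 // mulmxDl mxtraceD.
by rewrite -!mulmxA !(mxtrace_mulC (_ i)) -!mulmxA addr_ge0 // trace_mx11 -/(dotv _ _) psdmx_dotv.
Qed.

(** * Concentration at one row and the mean of the resolvent *)

Section leave_one_out.
Context {R : realType} (n p q : nat) (X : 'M[R]_(p, q)).
Variables (sigma phi : R -> R) (ls lp K s : R).
Hypotheses (hs : lip ls sigma) (hp : lip lp phi) (hX : mbound X K) (s0 : 0 < s).
Hypotheses (q0 : (0 < q)%N).
Context d (T : measurableType d) (P : probability T R) (Y : 'I_n * 'I_p -> T -> R).
Context d' (T' : measurableType d') (P' : probability T' R) (g : 'I_p -> T' -> R).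
Hypotheses (hY : iid_normal P Y) (hg : iid_normal P' g).

Local Notation I := ('I_n * 'I_p)%type.
Local Notation m := (mean_feat X P' g sigma phi).
Local Notation Phi0 := (cov_feat X P' g sigma phi).
Local Notation b := (8 * (ls * lp * K) ^+ 2).

Definition row_of (x : family R I) (i : 'I_n) : family R 'I_p := fun j => x (i, j).

Definition smx (x : family R I) : 'M[R]_(n, q) :=
  \matrix_(i, k) (feat X sigma phi (row_of x i) - m) k 0.

Definition set_row (x : family R I) (i : 'I_n) (y : family R 'I_p) : family R I :=
  fun k => if k.1 == i then y k.2 else x k.

Lemma row_smx x i : (row i (smx x))^T = feat X sigma phi (row_of x i) - m.
Proof. by apply/colP => k; rewrite !mxE. Qed.

Lemma row_set_row x i y : row_of (set_row x i y) i = y.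
Proof. by apply/funext => j; rewrite /row_of /set_row eqxx. Qed.

Lemma drop_row_agree x y i : (forall k, k.1 != i -> x k = y k) ->
  drop_row i (smx x) = drop_row i (smx y).
Proof.
move=> xy; apply/matrixP => j k; rewrite !mxE; case: eqP => // /eqP ji.
congr (sigma _ - _); apply: eq_bigr => l _; congr (phi _ * _).
by rewrite /row_of xy.
Qed.

Lemma drop_row_set_row x i y : drop_row i (smx (set_row x i y)) = drop_row i (smx x).
Proof. by apply: drop_row_agree => k ki; rewrite /set_row (negPf ki). Qed.

Lemma mmx_feat d0 (T0 : measurableType d0) (y : T0 -> family R 'I_p) (c : 'cV[R]_q) : measurable_fun setT y ->
  mmx (fun w => feat X sigma phi (y w) - c).
Proof.
move=> my; apply: mmxB => [k j|]; last exact: mmx_cst.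
rewrite ord1; apply: (measurableT_comp (measurable_feat X k (lipschitz_continuous hs) (lipschitz_continuous hp)) my).
Qed.

Lemma measurable_row_of i : measurable_fun [set: family R I] (fun x => row_of x i).
Proof. by apply: measurable_family => j; exact: measurable_coord. Qed.

Lemma mmx_smx : mmx (fun x : family R I => smx x).
Proof.
move=> i k; rewrite (_ : (fun w => _) = (fun x : family R I => (feat X sigma phi (row_of x i) - m) k 0)); last first.
  by apply/funext => x; rewrite mxE.
exact: (mmx_feat m (measurable_row_of i) k 0).
Qed.

Lemma mmx_drop i : mmx (fun x : family R I => drop_row i (smx x)).
Proof.
move=> j k; case: (eqVneq j i) => ji.
  rewrite (_ : (fun x => _) = fun=> 0); first exact: measurable_cst.
  by apply/funext => x; rewrite mxE ji eqxx.
rewrite (_ : (fun x => _) = fun x => smx x j k); first exact: mmx_smx.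
by apply/funext => x; rewrite mxE (negPf ji).
Qed.

Lemma mmx_gram (S : family R I -> 'M[R]_(n, q)) : mmx S -> mmx (fun x => gram (S x)).
Proof. by move=> hS; apply: mmxZ; apply: mmxM => //; exact: mmx_tr. Qed.

Lemma mmx_res_gram (S : family R I -> 'M[R]_(n, q)) : mmx S -> mmx (fun x => res (gram (S x)) s).
Proof. by move=> hS; apply: mmx_res => //; [exact: mmx_gram|move=> w; exact: gram_psd]. Qed.

Definition tres (N : 'M[R]_q) (x : family R I) := q%:R^-1 * \tr (N *m res (gram (smx x)) s).
Definition tres_drop (N : 'M[R]_q) i (x : family R I) :=
  q%:R^-1 * \tr (N *m res (gram (drop_row i (smx x))) s).

Lemma measurable_tres N : measurable_fun setT (tres N).
Proof.
apply: measurable_funM => //; apply: measurable_mxtrace; apply: mmxM; first exact: mmx_cst.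
by apply: mmx_res_gram; exact: mmx_smx.
Qed.

Lemma measurable_tres_drop N i : measurable_fun setT (tres_drop N i).
Proof.
apply: measurable_funM => //; apply: measurable_mxtrace; apply: mmxM; first exact: mmx_cst.
by apply: mmx_res_gram; exact: mmx_drop.
Qed.

Lemma tres_bound N nu x : mbound N nu -> `|tres N x| <= nu / s.
Proof. by move=> hN; apply: trace_res_bound => //; exact: gram_psd. Qed.

Lemma tres_drop_bound N nu i x : mbound N nu -> `|tres_drop N i x| <= nu / s.
Proof. by move=> hN; apply: trace_res_bound => //; exact: gram_psd. Qed.

Lemma tres_diff N nu i x : mbound N nu -> `|tres N x - tres_drop N i x| <= nu / s / q%:R.
Proof.
move=> hN; rewrite /tres /tres_drop -mulrBr normrM ger0_norm ?invr_ge0 // mulrC ler_wpM2r ?invr_ge0 //.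
exact: trace_drop_row.
Qed.

Lemma tres_drop_agree N i x y : (forall k, k.1 != i -> x k = y k) -> tres_drop N i x = tres_drop N i y.
Proof. by move=> xy; rewrite /tres_drop (drop_row_agree xy). Qed.

Lemma tres_variance N nu : mbound N nu ->
  \int[P]_w (tres N (tuple_of Y w) - \int[P]_w' tres N (tuple_of Y w')) ^+ 2 <=
  2 * n%:R * (nu / s / q%:R) ^+ 2.
Proof.
move=> hN; apply: (bounded_difference_variance (b := fst) hY (measurable_tres N) (measurable_tres_drop N)
  (fun x => tres_bound x hN) (fun k x => tres_drop_bound k x hN) (fun k x => tres_diff k x hN)).
move=> k x y h; apply: tres_drop_agree => -[i j] ik; exact: h.
Qed.

Lemma tres_moment4 N nu : (0 < n)%N -> mbound N nu ->
  \int[P]_w ((tres N (tuple_of Y w) - \int[P]_w' tres N (tuple_of Y w')) ^+ 2) ^+ 2 <=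
  40 * n%:R ^+ 2 * (nu / s / q%:R) ^+ 4.
Proof.
move=> n0 hN; apply: (bounded_difference_moment4 (b := fst) hY (measurable_tres N) (measurable_tres_drop N)
  (fun x => tres_bound x hN) (fun k x => tres_drop_bound k x hN) (fun k x => tres_diff k x hN)) n0.
move=> k x y h; apply: tres_drop_agree => -[i j] ik; exact: h.
Qed.

(** Row i is replaced by an independent vector on the second space. With the other rows frozen, the
    estimates for one feature vector apply to the inner integral. *)
Lemma resample_row (i : 'I_n) (G : family R I -> \bar R) : measurable_fun setT G ->
  (forall x, 0 <= G x)%E ->
  measurable_fun setT (fun w => \int[P']_w' G (set_row (tuple_of Y w) i (tuple_of g w')))%E /\
  (\int[P]_w G (tuple_of Y w) = \int[P]_w \int[P']_w' G (set_row (tuple_of Y w) i (tuple_of g w')))%E.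
Proof.
move=> mG G0.
pose h (k : I) : I + 'I_p := if k.1 == i then inr k.2 else inl k.
have hi : injective h.
  move=> [a1 a2] [b1 b2]; rewrite /h /=; case: eqP => [->|_]; case: eqP => [->|_] //; last by case=> -> ->.
  by case=> ->.
have hZ := iid_normal_inj hi (iid_normal_mix hY hg).
pose Gz (z : T * T') := G (set_row (tuple_of Y z.1) i (tuple_of g z.2)).
have GzE z : G (tuple_of (fun k => mix Y g (h k)) z) = Gz z.
  by congr G; apply/funext => k; rewrite /tuple_of /set_row /h; case: eqP.
have mGz : measurable_fun setT Gz.
  rewrite -(funext GzE); apply: (measurableT_comp mG); apply: measurable_family => j.
  by have [mm _] := hZ; exact: mm.
have Gz0 z : (0 <= Gz z)%E by exact: G0.
split; first exact: (@measurable_fun_fubini_tonelli_F _ _ _ _ R P' Gz mGz).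
rewrite (law_ge0 hY hZ mG G0).
transitivity (\int[(P \x P')%E]_z Gz z)%E; first by apply: eq_integral => z _; exact: GzE.
exact: (@fubini_tonelli1 _ _ _ _ R P P' Gz mGz Gz0).
Qed.

(** Row i tested against a matrix independent of it, minus the conditional mean of this quadratic
    form, normalised so that its second moment is of order 1/q. *)
Definition qdev (M : 'M[R]_q) i (x : family R I) : R :=
  let A := M *m res (gram (drop_row i (smx x))) s in
  q%:R^-1 * (dotv (row i (smx x))^T (A *m (row i (smx x))^T) - \tr (A *m Phi0)).

Lemma measurable_qdev M i : measurable_fun setT (qdev M i).
Proof.
have mA : mmx (fun x : family R I => M *m res (gram (drop_row i (smx x))) s).
  by apply: mmxM; [exact: mmx_cst|apply: mmx_res_gram; exact: mmx_drop].
have mr : mmx (fun x : family R I => (row i (smx x))^T).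
  move=> k l; rewrite (_ : (fun w => _) = (fun x : family R I => smx x i k)); first exact: mmx_smx.
  by apply/funext => x; rewrite mxE mxE.
apply: measurable_funM => //; apply: measurable_funB.
  by apply: measurable_dotv => //; exact: mmxM.
by apply: measurable_mxtrace; apply: mmxM => //; exact: mmx_cst.
Qed.

Let kap nu := 4 * b ^+ 2 * (nu / s) ^+ 2 / q%:R.

(** Stated in extended reals since square integrability of [qdev] is deduced from it. *)
Lemma qdev_ereal (M : 'M[R]_q) nu i : mbound M nu ->
  (\int[P]_w ((qdev M i (tuple_of Y w)) ^+ 2)%:E <= (kap nu)%:E)%E.
Proof.
move=> hM; have q1 : 0 < q%:R :> R by rewrite ltr0n.
pose G x := ((qdev M i x) ^+ 2)%:E.
have mG : measurable_fun setT G by apply/measurable_EFinP; apply: measurable_funX; exact: measurable_qdev.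
have G0 x : (0 <= G x)%E by rewrite lee_fin sqr_ge0.
have [mI EI] : measurable_fun setT (fun w => \int[P']_w' G (set_row (tuple_of Y w) i (tuple_of g w')))%E /\
    (\int[P]_w G (tuple_of Y w) = \int[P]_w \int[P']_w' G (set_row (tuple_of Y w) i (tuple_of g w')))%E.
  by have [] := resample_row i mG G0.
rewrite -/(G _) EI; apply: le_integral_cst => // w; apply/andP; split; first exact: integral_ge0.
set x := tuple_of Y w.
pose A := M *m res (gram (drop_row i (smx x))) s.
have hA : mbound A (nu / s) by apply: mbound_mul => //; apply: res_mbound => //; exact: gram_psd.
have V := quadratic_form_variance hg hs hp hX hA.
pose v w' := feat X sigma phi (tuple_of g w') - m.
have E w' : G (set_row x i (tuple_of g w')) = ((q%:R^-1) ^+ 2 * (dotv (v w') (A *m v w') - \tr (A *m Phi0)) ^+ 2)%:E.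
  by rewrite /G /qdev drop_row_set_row row_smx row_set_row exprMn.
under eq_integral do rewrite E.
have qv k : quartic P' (fun w' => v w' k 0) by exact: quartic_feat.
have sd : sqintegrable P' (fun w' => dotv (v w') (A *m v w') - \tr (A *m Phi0)).
  apply: sqintegrableB; last exact: sqintegrable_cst.
  under eq_fun do rewrite dotvE; apply: sqintegrable_sum => k.
  apply: quarticM => //; under eq_fun do rewrite mxE.
  by apply: quartic_sum => l; exact: quarticZ.
have [_ i1] := sd.
rewrite -(EFin_Rint (rintegrableZ _ i1)) lee_fin (RintZ _ i1).
apply: (@le_trans _ _ (q%:R^-1 ^+ 2 * (4 * b ^+ 2 * (nu / s) ^+ 2 * q%:R))); first by rewrite ler_wpM2l ?sqr_ge0.
by rewrite /kap le_eqVlt; apply/orP; left; apply/eqP; field; rewrite !gt_eqF.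
Qed.

Let mY : measurable_fun setT (tuple_of Y).
Proof. by apply: measurable_family => i; have [mm _] := hY; exact: mm. Qed.

Lemma sqintegrable_qdev M nu i : mbound M nu -> sqintegrable P (fun w => qdev M i (tuple_of Y w)).
Proof.
move=> hM; split; first exact: (measurableT_comp (measurable_qdev M i) mY).
apply/integrableP; split.
  by apply/measurable_EFinP; apply: measurable_funX; exact: (measurableT_comp (measurable_qdev M i) mY).
under eq_integral do rewrite /= ger0_norm ?sqr_ge0 //.
by apply: le_lt_trans (qdev_ereal i hM) _; exact: ltry.
Qed.

Lemma qdev_le M nu i : mbound M nu -> \int[P]_w (qdev M i (tuple_of Y w)) ^+ 2 <= kap nu.
Proof.
by move=> hM; have [_ i1] := sqintegrable_qdev i hM; rewrite -lee_fin (EFin_Rint i1); exact: qdev_ereal.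
Qed.

Local Notation Q x := (res (gram (smx x)) s).
Local Notation Qd i x := (res (gram (drop_row i (smx x))) s).
Local Notation c := (n%:R / q%:R : R).
Local Notation al := (\int[P]_w tres Phi0 (tuple_of Y w)).

Let b0 : 0 <= b := bound_ge0 ls lp K.
Let hPhi := cov_mbound hg hs hp hX.
Let pPhi := cov_psd X hg hs hp.
Let q1 : 0 < q%:R :> R. Proof. by rewrite ltr0n. Qed.

Lemma trace_psd_mul_res x : 0 <= tres Phi0 x.
Proof.
rewrite mulr_ge0 ?invr_ge0 //; apply: (trace_mul_psd pPhi); split; first exact: (res_sym _ (gram_psd _)).
move=> v; rewrite -mulmxA -/(dotv _ _); apply: le_trans (res_dotv (gram_psd _) s0 v).
by rewrite mulr_ge0 ?(ltW s0) // dotv_ge0.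
Qed.

Lemma sqintegrable_tres N nu : mbound N nu -> sqintegrable P (fun w => tres N (tuple_of Y w)).
Proof.
move=> hN; apply: (@sqintegrable_bounded _ _ _ _ _ (nu / s)) => [|w].
  exact: (measurableT_comp (measurable_tres N) mY).
exact: tres_bound.
Qed.

Lemma alpha_ge0 : 0 <= al.
Proof. by apply: Rint_ge0 => w; exact: trace_psd_mul_res. Qed.

Lemma alpha_le : al <= b / s.
Proof.
rewrite -[leRHS](Rint_cst P); apply: Rint_le; [exact: sqintegrable_int (sqintegrable_tres hPhi)|exact: rintegrable_cst|].
by move=> w; apply: le_trans (ler_norm _) _; exact: tres_bound.
Qed.

Lemma loo_x_qdev i x : loo_x s i (smx x) = qdev 1%:M i x + tres_drop Phi0 i x.
Proof.
rewrite /loo_x /qdev /tres_drop mul1mx mulrBr [\tr (Phi0 *m _)]mxtrace_mulC; ring.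
Qed.

Let kapx := 3 * (kap 1 + (b / s / q%:R) ^+ 2 + 2 * n%:R * (b / s / q%:R) ^+ 2).

Lemma sqintegrable_loo_x i : sqintegrable P (fun w => loo_x s i (smx (tuple_of Y w)) - al).
Proof.
apply: sqintegrableB; last exact: sqintegrable_cst.
under eq_fun do rewrite loo_x_qdev; apply: sqintegrableD; first exact: (sqintegrable_qdev i (mbound1 q)).
apply: (@sqintegrable_bounded _ _ _ _ _ (b / s)) => [|w].
  exact: (measurableT_comp (measurable_tres_drop Phi0 i) mY).
exact: tres_drop_bound.
Qed.

(** The deviation from [al] is the sum of [qdev] for M = 1, the effect of dropping the row on the
    trace, and the fluctuation of that trace; the factor 3 bounds the square of a sum of three. *)
Lemma loo_x_variance i : \int[P]_w (loo_x s i (smx (tuple_of Y w)) - al) ^+ 2 <= kapx.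
Proof.
have [_ i1] := sqintegrable_qdev i (mbound1 q).
have [_ i2] := sqintegrableB (sqintegrable_tres hPhi) (sqintegrable_cst P al).
have [_ i3] := sqintegrable_loo_x i.
have j1 := rintegrableZ 3 i1; have j2 := rintegrableZ 3 i2.
apply: (@le_trans _ _ (\int[P]_w ((3 * qdev 1%:M i (tuple_of Y w) ^+ 2 +
   3 * (tres Phi0 (tuple_of Y w) - al) ^+ 2) + 3 * (b / s / q%:R) ^+ 2))).
  apply: Rint_le => // [|w].
    by apply: rintegrableD; [exact: rintegrableD|exact: rintegrable_cst].
  have := tres_diff i (tuple_of Y w) hPhi; rewrite loo_x_qdev.
  move: (qdev _ _ _) (tres _ _) (tres_drop _ _ _) => y t r h.
  have h2 : (t - r) ^+ 2 <= (b / s / q%:R) ^+ 2.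
    by rewrite -[leLHS]real_normK ?num_real // ler_sqr ?nnegrE // (le_trans _ h).
  apply: (@le_trans _ _ (3 * y ^+ 2 + 3 * (t - al) ^+ 2 + 3 * (t - r) ^+ 2)); last by rewrite lerD2l ler_pM2l.
  have := sqr_ge0 (y - (t - al)); have := sqr_ge0 (y + (t - r)); have := sqr_ge0 ((t - al) + (t - r)).
  rewrite !expr2; nra.
rewrite (RintD (rintegrableD j1 j2) (rintegrable_cst P _)) (RintD j1 j2) (RintZ _ i1) (RintZ _ i2) Rint_cst.
have := qdev_le i (mbound1 q); have := tres_variance hPhi; rewrite /kapx; lra.
Qed.

Variables (B : 'M[R]_q) (nu : R).
Hypothesis hB : mbound B nu.

Local Notation Qb := (res ((c / (1 + al)) *: Phi0) s).
Local Notation M := (Qb *m B).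

Let hM : mbound M (s^-1 * nu).
Proof.
apply: mbound_mul hB; apply: res_mbound => //; apply: psdmxZ => //.
by rewrite !divr_ge0 // addr_ge0 // alpha_ge0.
Qed.

Let U := s^-1 * nu / s * b.
Let kapy := kap (s^-1 * nu).

(** One summand per source of error in [term]: the trace after dropping a row; the mean of |qdev|;
    that of U |loo_x - al|, with [U] a bound for the conditional mean; and the product |qdev| |loo_x
    - al|, bounded by half the sum of squares. *)
Definition loo_error : R := s^-1 * nu * b / s / q%:R + Num.sqrt kapy + U * Num.sqrt kapx + (kapy + kapx) / 2.

Let term i x := q%:R^-1 * \tr (M *m Q x *m Phi0) / (1 + al) -
    q%:R^-1 * dotv (row i (smx x))^T (M *m Qd i x *m (row i (smx x))^T) / (1 + loo_x s i (smx x)).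

Lemma loo_term_le i x : `|term i x| <= s^-1 * nu * b / s / q%:R + `|qdev M i x| +
  U * `|loo_x s i (smx x) - al| + ((qdev M i x) ^+ 2 + (loo_x s i (smx x) - al) ^+ 2) / 2.
Proof.
rewrite /term.
set u := q%:R^-1 * \tr _; set y := q%:R^-1 * dotv _ _; set xi := loo_x _ _ _.
pose ui := q%:R^-1 * \tr (M *m Qd i x *m Phi0).
have al0 := alpha_ge0; have xi0 : 0 <= xi by exact: loo_x_ge0.
have E1 : y = qdev M i x + ui by rewrite /qdev mulrBr subrK.
have h1 : `|u - ui| <= s^-1 * nu * b / s / q%:R.
  have := tres_diff i x (mbound_mul hPhi hM); rewrite [b * _]mulrC /tres /tres_drop.
  by rewrite -!(mulmxA Phi0) !(mxtrace_mulC Phi0).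
have h2 : `|ui| <= U.
  rewrite normrM ger0_norm ?invr_ge0 // ler_pdivrMl // [q%:R * _]mulrC.
  by apply: mbound_trace; apply: mbound_mul hPhi; apply: mbound_mul hM _; apply: res_mbound => //; exact: gram_psd.
have D1 : 0 < 1 + al by rewrite ltr_pwDl.
have D2 : 0 < 1 + xi by rewrite ltr_pwDl.
have -> : u / (1 + al) - y / (1 + xi) = (u - y) / (1 + al) + y * (xi - al) / ((1 + al) * (1 + xi)).
  by field; rewrite !gt_eqF.
have f1 : `|(u - y) / (1 + al)| <= `|u - ui| + `|qdev M i x|.
  rewrite normrM [`|_^-1|]ger0_norm ?invr_ge0 ?(ltW D1) //.
  apply: (@le_trans _ _ `|u - y|).
    by rewrite ler_piMr // invf_le1 // lerDl.
  rewrite (_ : u - y = (u - ui) - qdev M i x); first exact: ler_normB.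
  by rewrite E1; ring.
have f2 : `|y * (xi - al) / ((1 + al) * (1 + xi))| <= `|y| * `|xi - al|.
  rewrite normrM [`|_^-1|]ger0_norm; last by rewrite invr_ge0 mulr_ge0 // ltW.
  rewrite -normrM ler_piMr // invf_le1 ?mulr_gt0 //; nra.
have f3 : `|y| <= `|qdev M i x| + U by rewrite E1; apply: (le_trans (ler_normD _ _)); rewrite lerD2l.
have f4 : `|y| * `|xi - al| <= (`|qdev M i x| + U) * `|xi - al| by rewrite ler_wpM2r.
apply: (le_trans (ler_normD _ _)).
have := sqr_ge0 (`|qdev M i x| - `|xi - al|).
rewrite -[(qdev M i x) ^+ 2]real_normK ?num_real // -[(xi - al) ^+ 2]real_normK ?num_real // !expr2.
by nra.
Qed.

Lemma measurable_loo_term i : measurable_fun setT (fun w => term i (tuple_of Y w)).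
Proof.
have mQd : mmx (fun x : family R I => M *m Qd i x).
  by apply: mmxM; [exact: mmx_cst|apply: mmx_res_gram; exact: mmx_drop].
have mr : mmx (fun x : family R I => (row i (smx x))^T).
  move=> k l; rewrite (_ : (fun w => _) = (fun x : family R I => smx x i k)); first exact: mmx_smx.
  by apply/funext => x; rewrite mxE mxE.
have mt : measurable_fun setT (term i).
  apply: measurable_funB; apply: measurable_funM.
  - apply: measurable_funM => //; apply: measurable_mxtrace; apply: mmxM; last exact: mmx_cst.
    by apply: mmxM; [exact: mmx_cst|apply: mmx_res_gram; exact: mmx_smx].
  - exact: measurable_cst.
  - by apply: measurable_funM => //; apply: measurable_dotv => //; exact: mmxM.
  - apply: (measurableT_comp measurable_invr); apply: measurable_funD => //.
    apply: measurable_funM => //; apply: measurable_dotv => //; apply: mmxM => //.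
    by apply: mmx_res_gram; exact: mmx_drop.
exact: (measurableT_comp mt mY).
Qed.

(** Used with B = Phi0, when it says that [al] nearly solves the fixed-point equation, and with B =
    1, when it evaluates the mean normalised trace. *)
Lemma loo_mean_estimate :
  `|\int[P]_w tres B (tuple_of Y w) - q%:R^-1 * \tr (B *m Qb)| <= c * loo_error.
Proof.
have sB := sqintegrable_tres hB.
have iB := sqintegrable_int sB.
have sq1 i := sqintegrable_qdev i hM; have sq2 i := sqintegrable_loo_x i.
pose bd i w := ((s^-1 * nu * b / s / q%:R + `|qdev M i (tuple_of Y w)|) +
  U * `|loo_x s i (smx (tuple_of Y w)) - al|) + 2^-1 * ((qdev M i (tuple_of Y w)) ^+ 2 + (loo_x s i (smx (tuple_of Y w)) - al) ^+ 2).
have j1 i := rintegrable_norm (sqintegrable_int (sq1 i)).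
have j2 i := rintegrable_norm (sqintegrable_int (sq2 i)).
have j3 i : rintegrable P (fun w => (qdev M i (tuple_of Y w)) ^+ 2) by have [] := sq1 i.
have j4 i : rintegrable P (fun w => (loo_x s i (smx (tuple_of Y w)) - al) ^+ 2) by have [] := sq2 i.
have k1 i := rintegrableD (rintegrable_cst P (s^-1 * nu * b / s / q%:R)) (j1 i).
have k2 i := rintegrableD (k1 i) (rintegrableZ U (j2 i)).
have k3 i := rintegrableD (j3 i) (j4 i).
have k4 i := rintegrableD (k2 i) (rintegrableZ 2^-1 (k3 i)).
have tb i w : `|term i (tuple_of Y w)| <= bd i w.
  by apply: (le_trans (loo_term_le i _)); rewrite /bd [_ / 2]mulrC.
have it i : rintegrable P (fun w => term i (tuple_of Y w)).
  by apply: (rintegrable_le (measurable_loo_term i) _ (k4 i)) => w; exact: tb.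
have -> : \int[P]_w tres B (tuple_of Y w) - q%:R^-1 * \tr (B *m Qb) =
   \int[P]_w (q%:R^-1 * \sum_i term i (tuple_of Y w)).
  rewrite -[q%:R^-1 * \tr _](Rint_cst P) -(RintB iB (rintegrable_cst P _)).
  by apply: eq_Rintegral => w _; exact: (trace_expansion s0 _ B q0 alpha_ge0 pPhi).
rewrite (RintZ _ (rintegrable_sum _ it)) (Rint_sum _ it).
rewrite normrM ger0_norm ?invr_ge0 // [leRHS]mulrAC mulrC ler_wpM2r ?invr_ge0 //.
apply: (le_trans (ler_norm_sum _ _ _)).
rewrite mulr_natl -[X in _ *+ X]card_ord -sumr_const; apply: ler_sum => i _.
apply: (le_trans (Rint_norm (it i))).
apply: (le_trans (Rint_le (rintegrable_norm (it i)) (k4 i) (tb i))).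
rewrite (RintD (k2 i) (rintegrableZ _ (k3 i))) (RintD (k1 i) (rintegrableZ _ (j2 i))).
rewrite (RintD (rintegrable_cst P _) (j1 i)) (RintZ _ (j2 i)) (RintZ _ (k3 i)) (RintD (j3 i) (j4 i)) Rint_cst.
have e1 := Rint_norm_le_sqrt (sq1 i) (qdev_le i hM).
have e2 := Rint_norm_le_sqrt (sq2 i) (loo_x_variance i).
have e3 := qdev_le i hM; have e4 := loo_x_variance i.
have U0 : 0 <= U by rewrite mulr_ge0 // divr_ge0 ?(ltW s0) // mulr_ge0 ?invr_ge0 ?(ltW s0) //; case: hB.
have e5 := ler_wpM2l U0 e2.
rewrite /loo_error; apply: lerD; last by rewrite [leRHS]mulrC ler_pM2l ?invr_gt0 //; exact: lerD.
by apply: lerD => //; rewrite lerD2l.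
Qed.

End leave_one_out.

(** * Stability of the fixed point and almost sure convergence *)

(** All that the sequel needs from a diagonalisation: the unitary matrix is eliminated, and traces
    become sums over eigenvalues at real and complex points alike. *)
Definition spectral_data (R : realType) n (A : 'M[R]_n) (e : 'I_n -> R) :=
  [/\ forall i, 0 <= e i, char_poly A = \prod_i ('X - (e i)%:P), A != 0 -> exists i, 0 < e i &
   forall a z : R[i], (forall i, a * real_complex R (e i) - z != 0) ->
   \tr (invmx (a *: map_mx (real_complex R) A - z%:M)) = \sum_i (a * real_complex R (e i) - z)^-1 /\
   \tr (map_mx (real_complex R) A *m invmx (a *: map_mx (real_complex R) A - z%:M)) =
     \sum_i real_complex R (e i) * (a * real_complex R (e i) - z)^-1].

Lemma spectral_dataP (R : realType) n (A : 'M[R]_n) : psdmx A -> exists e, spectral_data A e.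
Proof.
move=> hA; have [V [e [VV e0 AE]]] := psdmx_spectral hA; exists e; split => //.
- exact: spectral_char_poly VV AE.
- by move=> A0; exact: (spectral_neq0 AE A0 e0).
- by move=> a z nz; rewrite (spectral_trace_resolvent VV AE nz) (spectral_trace_mul_resolvent VV AE nz).
Qed.

Lemma spectral_res (R : realType) n (A : 'M[R]_n) e (a s : R) : spectral_data A e -> 0 <= a -> 0 < s ->
  \tr (res (a *: A) s) = \sum_i (a * e i + s)^-1 /\
  \tr (A *m res (a *: A) s) = \sum_i e i / (a * e i + s).
Proof.
move=> [e0 _ _ H] a0 s0; pose toC := real_complex R.
have E : map_mx toC (res (a *: A) s) = invmx (toC a *: map_mx toC A - (toC (- s))%:M).
  rewrite /res map_invmx map_mxD map_mxZ map_scalar_mx; congr (invmx (_ + _)).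
  by apply/matrixP => i j; rewrite !mxE /toC rmorphN mulNrn opprK.
have toC_tr (M : 'M[R]_n) : \tr (map_mx toC M) = toC (\tr M).
  by rewrite /toC /mxtrace rmorph_sum; apply: eq_bigr => i _; rewrite mxE.
have D i : toC a * toC (e i) - toC (- s) = toC (a * e i + s) by rewrite /toC rmorphN opprK rmorphD rmorphM.
have nz i : toC a * toC (e i) - toC (- s) != 0.
  by rewrite D /toC fmorph_eq0 gt_eqF // ltr_wpDl // mulr_ge0.
have [h1 h2] := H _ _ nz.
split; apply: (@complexI R); rewrite -[in LHS]/toC -toC_tr ?map_mxM E ?h1 ?h2 rmorph_sum; apply: eq_bigr => i _.
  by rewrite D fmorphV.
by rewrite D rmorphM fmorphV.
Qed.

Section stability.
Context {R : realType} (q : nat) (e : 'I_q -> R) (c s : R).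
Hypotheses (e0 : forall i, 0 <= e i) (c0 : 0 <= c) (s0 : 0 < s) (q0 : (0 < q)%N).

(** At z = -s, [fixf] is the map with fixed point delta, and [fixg] at that point is the Stieltjes
    transform of mubar. *)
Definition fixf (a : R) := q%:R^-1 * \sum_i e i / (c / (1 + a) * e i + s).
Definition fixg (a : R) := q%:R^-1 * \sum_i (c / (1 + a) * e i + s)^-1.

Let den a i : 0 <= a -> s <= c / (1 + a) * e i + s.
Proof. by move=> a0; rewrite lerDr mulr_ge0 // divr_ge0 // addr_ge0. Qed.

Let den0 a i : 0 <= a -> 0 < c / (1 + a) * e i + s.
Proof. by move=> a0; apply: lt_le_trans (den i a0). Qed.

Lemma fixf_ge0 a : 0 <= a -> 0 <= fixf a.
Proof.
move=> a0; rewrite mulr_ge0 ?invr_ge0 //; apply: sumr_ge0 => i _.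
by rewrite divr_ge0 // ltW // den0.
Qed.

Let r d i := c * e i / (1 + d) / (c / (1 + d) * e i + s).

Let r01 d i : 0 <= d -> 0 <= r d i <= 1.
Proof.
move=> d0; have D1 : 0 < 1 + d by rewrite ltr_pwDl.
apply/andP; split; first by rewrite !divr_ge0 ?mulr_ge0 ?(ltW D1) ?(ltW (den0 i d0)).
by rewrite ler_pdivrMr ?den0 // mul1r mulrAC lerDl ltW.
Qed.

Let inv_sub a d i : 0 <= a -> 0 <= d ->
  (c / (1 + a) * e i + s)^-1 - (c / (1 + d) * e i + s)^-1 =
  (a - d) * ((c / (1 + a) * e i + s)^-1 / (1 + a) * r d i).
Proof.
move=> a0 d0; rewrite /r; have h1 := den0 i a0; have h2 := den0 i d0.
have D1 : 0 < 1 + a by rewrite ltr_pwDl.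
have D2 : 0 < 1 + d by rewrite ltr_pwDl.
have n1 : c * e i + s * (1 + a) != 0.
  by rewrite gt_eqF // ltr_wpDl ?mulr_ge0 ?mulr_gt0.
have n2 : c * e i + s * (1 + d) != 0.
  by rewrite gt_eqF // ltr_wpDl ?mulr_ge0 ?mulr_gt0.
have E1 : c / (1 + a) * e i + s = (c * e i + s * (1 + a)) / (1 + a) by field; rewrite gt_eqF.
have E2 : c / (1 + d) * e i + s = (c * e i + s * (1 + d)) / (1 + d) by field; rewrite gt_eqF.
by rewrite E1 E2; field; rewrite n1 n2 !gt_eqF.
Qed.

Let q1 : 0 < q%:R :> R. Proof. by rewrite ltr0n. Qed.

(** The normalised trace of c/(1 + a) Phi + s times its inverse is 1. This converts bounds on
    resolvent traces into bounds on [fixf], and at the fixed point it expresses the tail quantity 1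
    - s m(-s). *)
Lemma fix_identity a : 0 <= a -> c / (1 + a) * fixf a = 1 - s * fixg a.
Proof.
move=> a0; apply/eqP; rewrite -subr_eq0 opprB addrA subr_eq0; apply/eqP.
rewrite /fixf /fixg !mulrA ![_ * q%:R^-1]mulrC -!mulrA -mulrDr !mulr_sumr -big_split /=.
rewrite (eq_bigr (fun=> 1)) => [|i _].
  by rewrite sumr_const card_ord mulVf // gt_eqF.
transitivity ((c / (1 + a) * e i + s) / (c / (1 + a) * e i + s)); first by ring.
by rewrite divff // gt_eqF // den0.
Qed.

Lemma fixf_le a : 0 <= a -> fixf a <= q%:R^-1 * \sum_i e i / s.
Proof.
move=> a0; apply: ler_wpM2l; first by rewrite invr_ge0.
by apply: ler_sum => i _; apply: ler_wpM2l => //; rewrite lef_pV2 ?posrE ?den0 // den.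
Qed.

(** The difference quotient [ka] contains the factor [r d i], at most 1; what remains is fixf a / (1
    + a), below 1 near a fixed point. This is the source of stability. *)
Lemma fixf_sub a d : 0 <= a -> 0 <= d ->
  exists ka, [/\ fixf a - fixf d = (a - d) * ka, 0 <= ka & ka <= fixf a / (1 + a)].
Proof.
move=> a0 d0.
have D1 : 0 < 1 + a by rewrite ltr_pwDl.
pose ka := q%:R^-1 * \sum_i e i * ((c / (1 + a) * e i + s)^-1 / (1 + a) * r d i).
have fsub : fixf a - fixf d = (a - d) * ka.
  rewrite /fixf /ka -mulrBr -sumrB [RHS]mulrCA; congr (_ * _); rewrite mulr_sumr.
  by apply: eq_bigr => i _; rewrite -mulrBr inv_sub //; ring.
have ka0 : 0 <= ka.
  rewrite mulr_ge0 ?invr_ge0 //; apply: sumr_ge0 => i _; have /andP[r0 _] := r01 i d0.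
  apply: mulr_ge0 => //; apply: mulr_ge0 => //; apply: divr_ge0; last exact: ltW.
  by rewrite invr_ge0 ltW // den0.
have kaf : ka <= fixf a / (1 + a).
  rewrite /ka /fixf -mulrA; apply: ler_wpM2l; first by rewrite invr_ge0.
  rewrite mulr_suml; apply: ler_sum => i _; have /andP[_ r1] := r01 i d0.
  rewrite mulrA [leRHS]mulrAC -mulrA -[leRHS]mulrA; apply: ler_wpM2l => //.
  by rewrite -[leRHS]mulr1 mulrC [leRHS]mulrC [_ * (1 + a)^-1]mulrC mulrCA [leRHS]mulrCA ler_wpM2l ?invr_ge0 ?(ltW D1) // [leLHS]mulrC [leRHS]mulrC ler_wpM2l // invr_ge0 ltW // den0.
by exists ka.
Qed.

Lemma fixf_lip a d : 0 <= a -> 0 <= d ->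
  `|fixf a - fixf d| <= (q%:R^-1 * \sum_i e i / s) * `|a - d|.
Proof.
move=> a0 d0; have [ka [-> ka0 kaf]] := fixf_sub a0 d0.
rewrite normrM mulrC ler_wpM2r // ger0_norm //; apply: (le_trans kaf); apply: le_trans (fixf_le a0).
by rewrite ler_piMr ?fixf_ge0 // invf_le1 ?lerDl // ltr_pwDl.
Qed.

Lemma fixf_mono a d : 0 <= a -> a <= d -> fixf a <= fixf d.
Proof.
move=> a0 ad; have d0 := le_trans a0 ad; have [ka [E ka0 _]] := fixf_sub a0 d0.
by rewrite -subr_le0 E mulr_le0_ge0 // subr_le0.
Qed.

Lemma fixg_lip a d : 0 <= a -> 0 <= d -> `|fixg a - fixg d| <= s^-1 * `|a - d|.
Proof.
move=> a0 d0; have D1 : 0 < 1 + a by rewrite ltr_pwDl.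
rewrite mulrC.
rewrite /fixg -mulrBr -sumrB normrM ger0_norm ?invr_ge0 // ler_pdivrMl //.
apply: (le_trans (ler_norm_sum _ _ _)).
rewrite mulr_natl -[X in _ *+ X]card_ord -sumr_const; apply: ler_sum => i _.
rewrite inv_sub // normrM; apply: ler_wpM2l => //; have /andP[r0 r1] := r01 i d0.
rewrite ger0_norm; last first.
  by apply: mulr_ge0 => //; apply: divr_ge0; [rewrite invr_ge0 ltW // den0|exact: ltW].
have x1 : (c / (1 + a) * e i + s)^-1 <= s^-1 by rewrite lef_pV2 ?posrE ?den0 // den.
have x0 : 0 <= (c / (1 + a) * e i + s)^-1 by rewrite invr_ge0 ltW // den0.
have y1 : (1 + a)^-1 <= 1 by rewrite invf_le1 // lerDl.
have y0 : 0 <= (1 + a)^-1 by rewrite invr_ge0 ltW.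
apply: (le_trans _ x1); rewrite -[leRHS]mulr1 -mulrA; apply: ler_wpM2l => //.
by rewrite -[leRHS]mulr1; apply: ler_pM.
Qed.

(** The slope satisfies ka (1 + a) <= fixf a <= a + err, hence 1 - ka >= (1 - err)/(1 + a), while |a
    - d| <= err + ka |a - d|. *)
Lemma fix_stability (a d err : R) : 0 <= a -> 0 <= d -> d = fixf d -> `|a - fixf a| <= err -> err < 1 ->
  `|a - d| <= err * (1 + a) / (1 - err).
Proof.
move=> a0 d0 dE ha e1.
have D1 : 0 < 1 + a by rewrite ltr_pwDl.
have [ka [fsub ka0 kaf]] := fixf_sub a0 d0.
have kk : ka * (1 + a) <= a + err.
  by move: kaf; rewrite ler_pdivlMr //; move: ha; rewrite ler_norml => /andP[]; lra.
rewrite ler_pdivlMr ?subr_gt0 //.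
have h : `|a - d| <= err + ka * `|a - d|.
  have E : `|a - d| = `|(a - fixf a) + (a - d) * ka|.
    by rewrite -fsub -dE; congr (`|_|); ring.
  rewrite {1}E; apply: (le_trans (ler_normD _ _)); rewrite normrM [`|ka|]ger0_norm // [_ * ka]mulrC.
  by rewrite lerD2r.
have := normr_ge0 (a - d); set x := `|a - d| in h *; nra.
Qed.

End stability.

(** * Removing the common mean of the rows *)

Section gram_shift.
Context {R : realType} (n q : nat) (s : R).
Hypotheses (n0 : (0 < n)%N) (s0 : 0 < s).
Local Notation ones := (const_mx 1 : 'cV[R]_n).

Let pr : 'M[R]_n := 1%:M - n%:R^-1 *: (ones *m ones^T).

Let ones_dot : ones^T *m ones = (n%:R)%:M :> 'M[R]_1.
Proof.
apply/matrixP => i j; rewrite !ord1 !mxE (eq_bigr (fun=> 1)) => [|k _]; last by rewrite !mxE mulr1.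
by rewrite sumr_const card_ord eqxx mulr1n.
Qed.

Let pr_ones : pr *m ones = 0.
Proof.
rewrite mulmxBl mul1mx -scalemxAl -mulmxA ones_dot mul_mx_scalar scalerA mulVf ?scale1r ?subrr //.
by rewrite pnatr_eq0 -lt0n.
Qed.

Let pr_sym : pr^T = pr.
Proof. by rewrite linearB linearZ /= trmx1 trmx_mul trmxK. Qed.

Let pr_idem : pr^T *m pr = pr.
Proof.
rewrite pr_sym {2}/pr mulmxBr mulmx1 -scalemxAr mulmxA pr_ones mul0mx scaler0 subr0.
by [].
Qed.

Let gram_pr (S : 'M[R]_(n, q)) :
  gram S = gram (pr *m S) + (q%:R^-1 / n%:R) *: ((S^T *m ones) *m (S^T *m ones)^T).
Proof.
have E : (pr *m S)^T *m (pr *m S) = S^T *m (pr *m S).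
  by rewrite [(pr *m S)^T]trmx_mul -mulmxA (mulmxA pr^T) pr_idem.
rewrite /gram E -scalerA -scalerDr; congr (_ *: _).
rewrite /pr mulmxBl mul1mx mulmxBr -scalemxAl -scalemxAr trmx_mul trmxK !mulmxA.
by rewrite subrK.
Qed.

(** The projection [pr] onto the orthogonal complement of the constant vector forgets a common shift
    of the rows, and gram S exceeds gram (pr S) by a positive rank-one term. Two rank-one
    comparisons with the same projected matrix give 2/s. *)
Lemma trace_res_shift (S : 'M[R]_(n, q)) (mu : 'cV[R]_q) :
  `|\tr (res (gram S) s) - \tr (res (gram (S + ones *m mu^T)) s)| <= 2 / s.
Proof.
have t0 : 0 <= q%:R^-1 / n%:R :> R by rewrite divr_ge0 ?invr_ge0.
have step (S' : 'M[R]_(n, q)) : `|\tr (res (gram (pr *m S')) s) - \tr (res (gram S') s)| <= 1 / s.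
  have := trace_res_rank_one (S'^T *m ones) (gram_psd (pr *m S')) s0 t0 (mbound1 q).
  by rewrite -gram_pr !mul1mx.
have E : pr *m (S + ones *m mu^T) = pr *m S by rewrite mulmxDr mulmxA pr_ones mul0mx addr0.
have h1 := step S; have h2 := step (S + ones *m mu^T); rewrite E in h2.
set k := \tr (res (gram (pr *m S)) s) in h1 h2.
rewrite (_ : _ - _ = (k - \tr (res (gram (S + ones *m mu^T)) s)) - (k - \tr (res (gram S) s))); last by ring.
by apply: (le_trans (ler_normB _ _)); rewrite (_ : 2 / s = 1 / s + 1 / s); [exact: lerD|ring].
Qed.

End gram_shift.

Section almost_sure.
Context {R : realType} d (T : measurableType d) (P : probability T R).

(** The series of the squares has finite expectation, hence converges almost surely, and its terms
    tend to 0. *)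
Lemma almost_sure_cvg0 (f : nat -> T -> R) (C : R) : (forall k, measurable_fun setT (f k)) ->
  (forall k, sqintegrable P (f k)) ->
  (forall k, \int[P]_w f k w ^+ 2 <= C / (k.+1%:R) ^+ 2) ->
  {ae P, forall w, f k w @[k --> \oo] --> (0 : R)}.
Proof.
move=> mf sf fC.
have C0 : 0 <= C.
  by have := fC 0%N; rewrite expr1n divr1; apply: le_trans; apply: Rint_ge0 => w; exact: sqr_ge0.
pose F w := (\sum_(0 <= k <oo) (f k w ^+ 2)%:E)%E.
have mf2 k : measurable_fun setT (fun w => (f k w ^+ 2)%:E) by apply/measurable_EFinP; exact: measurable_funX.
have f20 k w : (0 <= (f k w ^+ 2)%:E)%E by rewrite lee_fin sqr_ge0.
have FI : (\int[P]_w F w = \sum_(0 <= k <oo) \int[P]_w (f k w ^+ 2)%:E)%E.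
  by apply: integral_nneseries.
have bd (k : nat) : \sum_(0 <= i < k) C / (i.+1%:R) ^+ 2 <= C * 2.
  suff : \sum_(0 <= i < k) (i.+1%:R ^+ 2)^-1 <= 2 - (k%:R)^-1 :> R.
    move=> h; rewrite -mulr_sumr; apply: ler_wpM2l => //; apply: (le_trans h).
    by rewrite lerBlDr lerDl invr_ge0.
  elim: k => [|[|k] IH]; first by rewrite big_geq // invr0; lra.
    by rewrite big_nat1 expr1n invr1; lra.
  rewrite big_nat_recr //=; apply: (le_trans (lerD IH (lexx _))).
  have h : (k.+2%:R : R) = k.+1%:R + 1 by rewrite natr1.
  rewrite h; set x := k.+1%:R; have x1 : 1 <= x by rewrite ler1n.
  have x0 : 0 < x by lra.
  have i2 : ((x + 1) ^+ 2)^-1 <= x^-1 - (x + 1)^-1.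
    rewrite (_ : x^-1 - (x + 1)^-1 = (x * (x + 1))^-1); last by field; rewrite !gt_eqF //; lra.
    by rewrite lef_pV2 ?posrE ?exprn_gt0 ?mulr_gt0 //; [rewrite expr2; nra|lra..].
  apply: (le_trans (lerD (lexx (2 - x^-1)) i2)).
  by rewrite le_eqVlt; apply/orP; left; apply/eqP; ring.
have Ffin : (\int[P]_w F w < +oo)%E.
  rewrite FI; apply: (@le_lt_trans _ _ (C * 2)%:E); last exact: ltry.
  apply: lime_le; first by apply: is_cvg_nneseries => k _ _; apply: integral_ge0.
  apply: nearW => k; have [_ i2] := sf 0%N.
  apply: (@le_trans _ _ (\sum_(0 <= i < k) (C / (i.+1%:R) ^+ 2)%:E)%E); last by rewrite sumEFin lee_fin.
  apply: lee_sum => i _; have [_ ii] := sf i; rewrite -(EFin_Rint ii) lee_fin; exact: fC.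
have F0 w : (0 <= F w)%E by apply: nneseries_ge0.
have mF : measurable_fun setT F by apply: ge0_emeasurable_sum => // k _; exact: mf2.
have iF : P.-integrable setT F.
  apply/integrableP; split => //; rewrite (eq_integral F) // => w _; exact: gee0_abs.
have := integrable_ae measurableT iF; apply: filterS => w /(_ I) Fw.
have [M FM] : exists M : R, F w = M%:E by exists (fine (F w)); rewrite fineK.
have ub k : \sum_(0 <= i < k) f i w ^+ 2 <= M.
  rewrite -lee_fin -sumEFin -FM; apply: nneseries_lim_ge => i _ _; exact: f20.
have cs : cvgn (series (fun k => f k w ^+ 2)).
  apply: nondecreasing_is_cvgn.
    by apply/nondecreasing_seqP => k; rewrite /series /= big_nat_recr //= lerDl sqr_ge0.
  by exists M => _ [k _ <-]; exact: ub.
have c2 := cvg_series_cvg_0 cs.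
apply/cvgrPdist_le => e e0; have /cvgrPdist_le/(_ (e ^+ 2)) := c2.
rewrite exprn_gt0 // => /(_ isT); apply: filterS => k.
rewrite !sub0r !normrN normrX ler_sqr // nnegrE ltW //.
Qed.

End almost_sure.

(** * The deterministic equivalent measure *)

Lemma sum_enum_val (I : finType) (V : nmodType) (f : I -> V) :
  \sum_(i < #|I|) f (enum_val i) = \sum_t f t.
Proof.
rewrite [RHS](reindex (enum_val : 'I_#|I| -> I)) //=.
by exists enum_rank => x _; [exact: enum_valK|exact: enum_rankK].
Qed.

Lemma lip_cvg (R : realType) (u : nat -> R) (l : R) (h : R -> R) (B : R) : 0 <= B ->
  u k @[k --> \oo] --> l -> (forall k, `|h (u k) - h l| <= B * `|u k - l|) ->
  h (u k) @[k --> \oo] --> h l.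
Proof.
move=> B0 ul hB; apply/cvgrPdist_le => e e0; have /cvgrPdist_le/(_ (e / (B + 1))) := ul.
have B1 : 0 < B + 1 by rewrite ltr_pwDr.
rewrite divr_gt0 // => /(_ isT); apply: filterS => k; rewrite distrC => h1.
rewrite distrC; apply: (le_trans (hB k)).
have h2 : B * `|u k - l| <= B * (e / (B + 1)) by rewrite ler_wpM2l.
apply: (le_trans h2); rewrite mulrA ler_pdivrMr //; nra.
Qed.

Section limiting_measure.
Context {R : realType} (n q : nat) (Phi : 'M[R]_q) (e : 'I_q -> R).
Hypotheses (q0 : (0 < q)%N) (he : spectral_data Phi e).
Local Notation C := R[i].
Local Notation toC := (real_complex R).
Local Notation Re := (@complex.Re R).
Local Notation Im := (@complex.Im R).
Local Notation normc := Normc.normc.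
Local Notation c := (n%:R / q%:R : R).
Implicit Types z delta : C.

Let kk i := c * e i.
Let wt i := q%:R^-1 * e i.

Let e0 i : 0 <= e i. Proof. by case: he. Qed.
Let q1 : 0 < q%:R :> R. Proof. by rewrite ltr0n. Qed.
Let kk0 i : 0 <= kk i. Proof. by rewrite mulr_ge0 ?divr_ge0. Qed.
Let wt0 i : 0 <= wt i. Proof. by rewrite mulr_ge0 ?invr_ge0. Qed.
Let uni (i : 'I_q) : R := q%:R^-1.
Let uni0 i : 0 <= uni i. Proof. by rewrite invr_ge0. Qed.

Lemma qbar_traces z delta : 0 < Im z -> 0 <= Im delta ->
  q%:R^-1 * \tr (map_mx toC Phi *m Qbar n Phi z delta) = res_sum kk z wt delta /\
  q%:R^-1 * \tr (Qbar n Phi z delta) = res_sum kk z uni delta.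
Proof.
move=> y0 d0; have [_ _ _ H] := he.
have qC : (q%:R : C)^-1 = toC (q%:R^-1) by rewrite fmorphV rmorph_nat.
have E i : n%:R / q%:R / (1 + delta) * toC (e i) - z = toC (kk i) / (1 + delta) - z.
  by congr (_ - _); rewrite /kk !rmorphM fmorphV !rmorph_nat mulrAC.
have nz i : n%:R / q%:R / (1 + delta) * toC (e i) - z != 0.
  by rewrite E; apply: (res_den_neq0 kk0 y0).
have [h1 h2] := H _ _ nz; rewrite /Qbar h1 h2 !mulr_sumr; split; apply: eq_bigr => i _.
  have -> : toC (wt i) = toC (q%:R^-1) * toC (e i) by rewrite -rmorphM.
  by rewrite E qC /res_fun mulrA.
by rewrite E qC.
Qed.

Lemma is_delta_exists z : 0 < Im z -> exists delta, [/\ is_delta n Phi z delta,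
  half_plane_dom z delta & normc (res_iter kk z wt m - delta) @[m --> \oo] --> (0 : R)].
Proof.
move=> y0; have [delta [Dd W dE cv]] := res_iter_cvg kk0 y0 wt0; exists delta; split => //.
have [d0 _] := Dd; have [h1 _] := qbar_traces y0 d0.
split; last by rewrite h1.
move=> P0; apply: W; have [_ _ H _] := he; have [i ei] := H P0.
rewrite (bigD1 i) //=; apply: ltr_pwDl; first by rewrite mulr_gt0 ?invr_gt0.
by apply: sumr_ge0 => j _; exact: wt0.
Qed.

Lemma is_delta_inj z delta delta' : 0 < Im z ->
  is_delta n Phi z delta -> is_delta n Phi z delta' -> delta = delta'.
Proof.
move=> y0 [d1 d2] [d1' d2']; have [P0|P0] := eqVneq Phi 0.
  by rewrite d2 d2' P0 map_mx0 !mul0mx !mxtrace0.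
have i1 := d1 P0; have i2 := d1' P0.
have [h1 _] := qbar_traces y0 (ltW i1); have [h2 _] := qbar_traces y0 (ltW i2).
apply: (res_sum_unique kk0 y0 wt0 _ i1 i2); [|by rewrite -h1|by rewrite -h2].
have [_ _ H _] := he; have [i ei] := H P0.
rewrite (bigD1 i) //=; apply: ltr_pwDl; first by rewrite mulr_gt0 ?invr_gt0.
by apply: sumr_ge0 => j _; exact: wt0.
Qed.

Lemma is_delta_unique z : 0 < Im z -> exists! delta, is_delta n Phi z delta.
Proof.
move=> y0; have [delta [h _ _]] := is_delta_exists y0; exists delta; split => // delta' h'.
exact: is_delta_inj h h'.
Qed.

Let atomic (x : C -> C) := exists N (a l : 'I_N -> R), [/\ forall j, 0 <= a j,
  forall j, 0 <= l j & forall z, off_axis z -> x z = \sum_j toC (a j) / (toC (l j) - z)].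

(** The q measures of [atomic_step] are merged into one, with pairs of indices as atoms. The
    weighted mean is the same whatever [a] and [l] are, which makes the iterates tight. *)
Lemma atomic_res_sum N (a l : 'I_N -> R) (v : 'I_q -> R) : (forall j, 0 <= a j) -> (forall j, 0 <= l j) ->
  (forall i, 0 <= v i) ->
  exists N' (b m : 'I_N' -> R), [/\ forall j, 0 <= b j, forall j, 0 <= m j,
    \sum_j b j = \sum_i v i, \sum_j b j * m j = \sum_i v i * kk i &
    forall z, off_axis z -> res_sum kk z v (\sum_j toC (a j) / (toC (l j) - z)) =
      \sum_j toC (b j) / (toC (m j) - z)].
Proof.
move=> a0 l0 v0.
have /choice[b /choice[m h]] : forall i : 'I_q, exists b : 'I_N.+1 -> R, exists m : 'I_N.+1 -> R,
   [/\ forall j, 0 <= b j, forall j, 0 <= m j, \sum_j b j = 1, \sum_j b j * m j = kk i &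
    forall z, off_axis z -> \sum_j toC (b j) / (toC (m j) - z) =
      (toC (kk i) / (1 + \sum_j toC (a j) / (toC (l j) - z)) - z)^-1].
  move=> i; have [b [m [b0 m0 bs bm H]]] := atomic_step a0 l0 (kk0 i); exists b, m; split => // z hz.
  by have [_] := H z hz.
pose I := ('I_q * 'I_N.+1)%type.
exists #|{: I}|, (fun x => let t := enum_val x : I in v t.1 * b t.1 t.2),
  (fun x => let t := enum_val x : I in m t.1 t.2); split => /=.
- by move=> j; case: (h (enum_val j : I).1) => b0 *; exact: mulr_ge0.
- by move=> j; case: (h (enum_val j : I).1).
- rewrite (sum_enum_val (fun t : I => v t.1 * b t.1 t.2)) -(pair_bigA _ (fun i j => v i * b i j)) /=.
  by apply: eq_bigr => i _; have [_ _ bs _ _] := h i; rewrite -mulr_sumr bs mulr1.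
- rewrite (sum_enum_val (fun t : I => v t.1 * b t.1 t.2 * m t.1 t.2)).
  rewrite -(pair_bigA _ (fun i j => v i * b i j * m i j)) /=.
  apply: eq_bigr => i _; have [_ _ _ bm _] := h i; rewrite -bm mulr_sumr.
  by apply: eq_bigr => j _; rewrite mulrA.
- move=> z hz; rewrite (sum_enum_val (fun t : I => toC (v t.1 * b t.1 t.2) / (toC (m t.1 t.2) - z))).
  rewrite -(pair_bigA _ (fun i j => toC (v i * b i j) / (toC (m i j) - z))) /=.
  apply: eq_bigr => i _; have [_ _ _ _ H] := h i; rewrite /res_fun -H // mulr_sumr.
  by apply: eq_bigr => j _; rewrite rmorphM mulrA.
Qed.

Lemma atomic_res_iter k : atomic (fun z => res_iter kk z wt k).
Proof.
elim: k => [|k [N [a [l [a0 l0 H]]]]].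
  exists 0%N, (fun=> 0), (fun=> 0); split => // z _; by rewrite big_ord0.
have [N' [b [m [b0 m0 _ _ H']]]] := atomic_res_sum a0 l0 wt0.
exists N', b, m; split => // z hz; rewrite -H' // -H //.
Qed.

Lemma sum_uni : \sum_i uni i = 1.
Proof. by rewrite /uni sumr_const card_ord -(mulr_natr (q%:R^-1) q) mulVf // gt_eqF. Qed.

Lemma atomic_measures : exists (N : nat -> nat) (b m : forall k, 'I_(N k) -> R),
  [/\ forall k j, 0 <= b k j, forall k j, 0 <= m k j, forall k, \sum_j b k j = 1,
    forall k, \sum_j b k j * m k j <= \sum_i uni i * kk i &
    forall k z, off_axis z -> res_sum kk z uni (res_iter kk z wt k) =
      \sum_j toC (b k j) / (toC (m k j) - z)].
Proof.
have H k : exists t : {N & (('I_N -> R) * ('I_N -> R))%type},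
  [/\ forall j, 0 <= (projT2 t).1 j, forall j, 0 <= (projT2 t).2 j, \sum_j (projT2 t).1 j = 1,
    \sum_j (projT2 t).1 j * (projT2 t).2 j <= \sum_i uni i * kk i &
    forall z, off_axis z -> res_sum kk z uni (res_iter kk z wt k) =
      \sum_j toC ((projT2 t).1 j) / (toC ((projT2 t).2 j) - z)].
  have [N [a [l [a0 l0 E]]]] := atomic_res_iter k.
  have [N' [b [m [b0 m0 bs bm E']]]] := atomic_res_sum a0 l0 uni0.
  exists (existT _ N' (b, m)); split => //=; first by rewrite bs sum_uni.
    by rewrite bm.
  by move=> z hz; rewrite E // E'.
have [t ht] := choice H.
exists (fun k => projT1 (t k)), (fun k => (projT2 (t k)).1), (fun k => (projT2 (t k)).2).
by split=> k *; have [h1 h2 h3 h4 h5] := ht k; auto.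
Qed.

Lemma inv_sub_normc z (s t : R) : 0 < Im z ->
  normc ((toC s - z)^-1 - (toC t - z)^-1) <= (Im z)^-1 ^+ 2 * `|s - t|.
Proof.
move=> y0; have nz (u : R) : toC u - z != 0.
  by apply/eqP => h; have := congr1 Im h; rewrite raddfB /= sub0r => /eqP; rewrite oppr_eq0 gt_eqF.
have nb (u : R) : normc (toC u - z)^-1 <= (Im z)^-1.
  rewrite Normc.normcV lef_pV2 ?posrE ?normc_gt0 //; apply: le_trans (Im_le_normc _).
  by rewrite raddfB /= sub0r normrN ler_norm.
have -> : (toC s - z)^-1 - (toC t - z)^-1 = toC (t - s) * ((toC s - z)^-1 * (toC t - z)^-1).
  by rewrite rmorphB; field; rewrite !nz.
rewrite !Normc.normcM normc_toC distrC mulrC ler_wpM2r // expr2; apply: ler_pM => //; exact: normc_ge0.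
Qed.

Lemma inv_normc z (t : R) : 0 < Im z -> normc (toC t - z)^-1 <= (Im z)^-1.
Proof.
move=> y0; have nz : toC t - z != 0.
  by apply/eqP => h; have := congr1 Im h; rewrite raddfB /= sub0r => /eqP; rewrite oppr_eq0 gt_eqF.
rewrite Normc.normcV lef_pV2 ?posrE ?normc_gt0 //; apply: le_trans (Im_le_normc _).
by rewrite raddfB /= sub0r normrN ler_norm.
Qed.

Lemma res_sum_cvg z delta v : 0 < Im z -> half_plane_dom z delta ->
  normc (res_iter kk z wt m - delta) @[m --> \oo] --> (0 : R) ->
  normc (res_sum kk z v (res_iter kk z wt m) - res_sum kk z v delta) @[m --> \oo] --> (0 : R).
Proof.
move=> y0 Dd cv; have [B B0 hB] := res_sum_lip kk0 y0 v.
apply: (@squeeze_cvgr _ _ _ _ (fun=> 0) (fun m => B * normc (res_iter kk z wt m - delta))).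
- apply: nearW => m; rewrite normc_ge0 hB //; exact: D_res_iter.
- exact: cvg_cst.
- by rewrite -[X in _ --> X](mulr0 B); apply: cvgM => //; exact: cvg_cst.
Qed.

Lemma res_fun_real (s x : R) i :
  res_fun kk (toC (- s)) i (toC x) = toC ((c / (1 + x) * e i + s)^-1).
Proof.
rewrite /res_fun fmorphV; congr (_^-1).
rewrite -[1 in LHS](rmorph1 (real_complex R)) -rmorphD -fmorphV -rmorphM -rmorphB; congr (real_complex R _).
by rewrite opprK /kk mulrAC.
Qed.

Lemma res_iter_real (s : R) k : 0 < s ->
  res_iter kk (toC (- s)) wt k = toC (iter k (fixf e c s) 0) /\ 0 <= iter k (fixf e c s) 0.
Proof.
move=> s0; have c0 : 0 <= c by rewrite divr_ge0.
elim: k => [|k [IH IH0]]; first by split.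
split; last exact: fixf_ge0.
rewrite /res_iter iterS -/(res_iter kk (toC (- s)) wt k) IH iterS.
set x := iter k _ 0; rewrite /res_sum /fixf mulr_sumr rmorph_sum.
apply: eq_bigr => i _; rewrite res_fun_real -rmorphM; congr (real_complex R _).
by rewrite /wt mulrA.
Qed.

Lemma res_sum_real (s : R) k : 0 < s ->
  res_sum kk (toC (- s)) uni (res_iter kk (toC (- s)) wt k) = toC (fixg e c s (iter k (fixf e c s) 0)).
Proof.
move=> s0; have [-> _] := res_iter_real k s0; set x := iter k _ 0.
rewrite /res_sum /fixg mulr_sumr rmorph_sum.
by apply: eq_bigr => i _; rewrite res_fun_real -rmorphM.
Qed.

(** On the negative axis the iteration from 0 is increasing and bounded, so it converges without the
    contraction argument, which is specific to Im z > 0. *)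
Lemma fixed_point_real (s : R) : 0 < s -> exists de : R, [/\ 0 <= de, de = fixf e c s de &
  iter k (fixf e c s) 0 @[k --> \oo] --> de].
Proof.
move=> s0; have c0 : 0 <= c by rewrite divr_ge0.
pose x k := iter k (fixf e c s) 0.
have x0 k : 0 <= x k by have [] := res_iter_real k s0.
have xm k : x k <= x k.+1.
  elim: k => [|k IH]; first exact: x0.
  exact: (fixf_mono e0 c0 s0 (x0 k) IH).
have Z0 : 0 <= q%:R^-1 * \sum_i e i / s.
  by rewrite mulr_ge0 ?invr_ge0 //; apply: sumr_ge0 => i _; rewrite divr_ge0 // ltW.
have xb k : x k <= q%:R^-1 * \sum_i e i / s.
  by case: k => [//|k]; exact: (fixf_le e0 c0 s0 (x0 k)).
have cx : cvgn x.
  apply: nondecreasing_is_cvgn; first by apply/nondecreasing_seqP.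
  by exists (q%:R^-1 * \sum_i e i / s) => _ [k _ <-].
have de0 : 0 <= limn x by apply: limr_ge => //; apply: nearW.
exists (limn x); split => //.
have h1 : x k.+1 @[k --> \oo] --> limn x by have := cx; rewrite -(cvg_shiftS x).
have h2 : fixf e c s (x k) @[k --> \oo] --> fixf e c s (limn x).
  apply: (@lip_cvg _ _ _ _ _ Z0 cx) => k; exact: (fixf_lip e0 c0 s0 (x0 k) de0).
exact: cvg_unique h1 h2.
Qed.

(** The same atomic measures are read at two kinds of points: in the upper half-plane they identify
    the Helly limit through [is_mubar], at -s they give its resolvent integrals. [helly_integral]
    asks the sums to converge along all of [\oo], which the convergence of the iterates provides. *)
Lemma mubar_exists : exists mu : probability R R, [/\ is_mubar n Phi mu,
  mu `]-oo, 0[%classic = 0%E &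
  forall s : R, 0 < s -> exists de : R, [/\ 0 <= de, de = fixf e c s de &
    \int[mu]_t resolvent s t = fixg e c s de]].
Proof.
have [N [b [m [b0 m0 bs bm H]]]] := atomic_measures.
exists (helly_measure b0 m0 bs bm); split; [|exact: helly_neg|].
  { move=> z y0; have [delta [hd Dd cv]] := is_delta_exists y0; exists delta => //.
  have [d0 _] := Dd; have [_ ->] := qbar_traces y0 d0.
  have rc := res_sum_cvg uni y0 Dd cv.
  (* Done once for a real-linear [p], then used for the real and the imaginary part. *)
  have part (p : C -> R) : (forall x u, p (x - u) = p x - p u) ->
      (forall k (F : 'I_k -> C), p (\sum_i F i) = \sum_i p (F i)) -> (forall x, `|p x| <= normc x) -> (forall (a : R) x, p (toC a * x) = a * p x) ->
      \int[helly_measure b0 m0 bs bm]_t p ((toC t - z)^-1) = p (res_sum kk z uni delta).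
    move=> pB pS pn pM.
    have lp t u : `|p ((toC t - z)^-1) - p ((toC u - z)^-1)| <= (Im z)^-1 ^+ 2 * `|t - u|.
      by rewrite -pB; apply: (le_trans (pn _)); exact: inv_sub_normc.
    apply: (@helly_integral _ _ _ _ _ b0 m0 bs bm _ ((Im z)^-1 ^+ 2) (Im z)^-1) => //.
    - by apply: continuous_measurable_fun; exact: lipschitz_continuous lp.
    - by move=> t; apply: (le_trans (pn _)); exact: inv_normc.
    - exact: sqr_ge0.
    - have E k : \sum_j b k j * p ((toC (m k j) - z)^-1) = p (res_sum kk z uni (res_iter kk z wt k)).
        by rewrite H; [rewrite pS; apply: eq_bigr => j _; rewrite pM|exact: off_axis_Im].
      rewrite (funext E); apply/cvgrPdist_le => ep ep0; have /cvgrPdist_le/(_ ep ep0) := rc.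
      apply: filterS => k; rewrite sub0r normrN ger0_norm ?normc_ge0 // => h.
      by rewrite distrC -pB; apply: (le_trans (pn _)).
  rewrite /stieltjes; apply/eqP; rewrite eq_complex; apply/andP; split; apply/eqP => /=.
    have PR := part (@complex.Re R); apply: PR.
    - by move=> [? ?] [? ?].
    - by move=> k F; exact: raddf_sum.
    - exact: Re_le_normc.
    - by move=> a [u v]; rewrite /= mul0r subr0.
  have PI := part (@complex.Im R); apply: PI.
  - by move=> [? ?] [? ?].
  - by move=> k F; exact: Im_sum.
  - exact: Im_le_normc.
  - exact: Im_toCM. }
move=> s s0; have c0 : 0 <= c by rewrite divr_ge0.
have [de [de0 dE cv]] := fixed_point_real s0; exists de; split => //.
have oa : off_axis (toC (- s)).
  by move=> t t0; rewrite -rmorphB fmorph_eq0 opprK gt_eqF // ltr_wpDl.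
have rb (t : R) : 0 < s + `|t| by rewrite ltr_pwDl.
have lp (t u : R) : `|resolvent s t - resolvent s u| <= s^-1 ^+ 2 * `|t - u|.
  rewrite /resolvent.
  have -> : (s + `|t|)^-1 - (s + `|u|)^-1 = (`|u| - `|t|) * ((s + `|t|)^-1 * (s + `|u|)^-1).
    by field; rewrite !gt_eqF.
  rewrite normrM mulrC; apply: ler_pM => //; last by rewrite distrC; exact: ler_dist_dist.
  have h (v : R) : `|(s + `|v|)^-1| <= s^-1.
    by rewrite (@ger0_norm _ (s + `|v|)^-1) ?invr_ge0 ?(ltW (rb v)) // lef_pV2 ?posrE // lerDl.
  by rewrite normrM expr2; apply: ler_pM.
apply: (@helly_integral _ _ _ _ _ b0 m0 bs bm _ (s^-1 ^+ 2) s^-1) => //.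
- by apply: continuous_measurable_fun; exact: lipschitz_continuous lp.
- by move=> t; rewrite /resolvent ger0_norm ?invr_ge0 ?(ltW (rb t)) // lef_pV2 ?posrE // lerDl.
- exact: sqr_ge0.
- have E k : \sum_j b k j * resolvent s (m k j) = fixg e c s (iter k (fixf e c s) 0).
    apply: (@complexI R); rewrite -/toC -res_sum_real // H // rmorph_sum; apply: eq_bigr => j _.
    by rewrite rmorphM /resolvent ger0_norm // fmorphV rmorphD rmorphN opprK addrC.
  rewrite (funext E); apply: (@lip_cvg _ _ _ _ s^-1) cv _; first by rewrite invr_ge0 ltW.
  by move=> k; apply: (fixg_lip e0 c0 s0 q0) => //; have [] := res_iter_real k s0.
Qed.

(** Uniqueness of delta makes the transforms equal, and their imaginary parts are Poisson
    integrals. *)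
Lemma mubar_unique (mu nu : {finite_measure set R -> \bar R}) : is_mubar n Phi mu -> is_mubar n Phi nu ->
  forall A, measurable A -> mu A = nu A.
Proof.
move=> hmu hnu; apply: poisson_unique => x y y0.
have [d1 i1 s1] := hmu (Complex x y) y0; have [d2 i2 s2] := hnu (Complex x y) y0.
have E : stieltjes mu (Complex x y) = stieltjes nu (Complex x y) by rewrite s1 s2 (@is_delta_inj (Complex x y) _ _ y0 i1 i2).
have P t : complex.Im ((Complex t 0 - Complex x y)^-1) = poisson y x t.
  by rewrite ImV normc_sq /= sub0r opprK sqrrN.
have EI : \int[mu]_t complex.Im ((Complex t 0 - Complex x y)^-1) =
   \int[nu]_t complex.Im ((Complex t 0 - Complex x y)^-1) := congr1 Im E.
transitivity (\int[mu]_t complex.Im ((Complex t 0 - Complex x y)^-1)).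
  by apply: eq_Rintegral => t _; rewrite P.
by rewrite EI; apply: eq_Rintegral => t _; rewrite P.
Qed.

End limiting_measure.

(** * Empirical measures and operator norms *)

Section eventual_bounds.
Context {R : realType}.
Implicit Types u : nat -> R.

Lemma limn_esup_lty u : (limn_esup (fun n => (u n)%:E) < +oo)%E ->
  exists M : R, \forall n \near \oo, u n <= M.
Proof.
move=> /ereal_inf_lt[_ [A FA <-] supA].
have [M MA] : exists M : R, (ereal_sup [set (u n)%:E | n in A] <= M%:E)%E.
  move: supA; case: (ereal_sup _) => [r _|//|_]; first by exists r.
  by exists 0; exact: leNye.
exists M; apply: filterS FA => n An; rewrite -lee_fin; apply: le_trans MA.
by apply: ereal_sup_ubound; exists n.
Qed.

Lemma limn_einf_gt0 u : (0 < limn_einf (fun n => (u n)%:E))%E ->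
  exists2 m : R, 0 < m & \forall n \near \oo, m <= u n.
Proof.
rewrite /limn_einf oppe_gt0 => /ereal_inf_lt[_ [A FA <-] supA].
have [M M0 MA] : exists2 M : R, M < 0 & (ereal_sup [set (- (u n)%:E)%E | n in A] <= M%:E)%E.
  move: supA; case: (ereal_sup _) => [r r0|//|_]; first by exists r => //; rewrite -lte_fin.
  by exists (-1); [rewrite ltrN10|exact: leNye].
exists (- M); first by rewrite oppr_gt0.
apply: filterS FA => n An; rewrite lerNl -lee_fin; apply: le_trans MA.
by apply: ereal_sup_ubound; exists n.
Qed.

End eventual_bounds.

Section operator_norm.
Context {R : realType} (m n : nat) (A : 'M[R]_(m, n)).

Lemma l2norm_dotv k (v : 'cV[R]_k) : l2norm v = Num.sqrt (dotv v v).
Proof. by rewrite /l2norm dotvE; congr Num.sqrt; apply: eq_bigr => i _; rewrite expr2. Qed.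

Let F := \sum_i \sum_j A i j ^+ 2.

Lemma frobenius_dotv v : dotv (A *m v) (A *m v) <= F * dotv v v.
Proof.
rewrite [dotv (A *m v) _]dotvE mulr_suml; apply: ler_sum => i _; rewrite -expr2 mxE dotvE.
under [X in _ <= _ * X]eq_bigr do rewrite -expr2.
exact: (cauchy_schwarz_sum (fun j => A i j) (fun j => v j 0)).
Qed.

(** [sup] is 0 on a set that is not bounded above; the Frobenius norm shows that this default is not
    met. *)
Lemma opnorm_has_sup : has_sup [set l2norm (A *m v) | v in [set v : 'cV[R]_n | l2norm v <= 1]].
Proof.
split; first by exists (l2norm (A *m 0)), 0 => //=; rewrite l2norm_dotv dotv0l sqrtr0.
exists (Num.sqrt F) => _ [v /= v1 <-]; rewrite l2norm_dotv ler_sqrt; last first.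
  by apply: sumr_ge0 => i _; apply: sumr_ge0 => j _; exact: sqr_ge0.
apply: (le_trans (frobenius_dotv v)); apply: ler_piMr.
  by apply: sumr_ge0 => i _; apply: sumr_ge0 => j _; exact: sqr_ge0.
rewrite -(sqr_sqrtr (dotv_ge0 v)) -l2norm_dotv expr_le1 // l2norm_dotv; exact: sqrtr_ge0.
Qed.

Lemma opnorm_mbound : mbound A (opnorm A).
Proof.
have ub v : l2norm v <= 1 -> l2norm (A *m v) <= opnorm A.
  by move=> v1; apply: sup_upper_bound; [exact: opnorm_has_sup|exists v].
have o0 : 0 <= opnorm A.
  by apply: (le_trans _ (ub 0 _)); rewrite l2norm_dotv ?sqrtr_ge0 // dotv0l sqrtr0.
split=> // v; have := dotv_ge0 v; rewrite le_eqVlt => /predU1P[v0|v0].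
  by rewrite (dotv_eq0 (esym v0)) mulmx0 !dotv0l mulr0.
pose t := Num.sqrt (dotv v v); have t0 : 0 < t by rewrite sqrtr_gt0.
have tt : t ^+ 2 = dotv v v by rewrite sqr_sqrtr // ltW.
have := ub (t^-1 *: v) _; rewrite !l2norm_dotv -scalemxAr !dotvZl !dotvZr.
have -> : t^-1 * (t^-1 * dotv v v) = 1 by rewrite -tt; field; rewrite gt_eqF.
rewrite sqrtr1 => /(_ (lexx _)) h.
have : t^-1 * (t^-1 * dotv (A *m v) (A *m v)) <= opnorm A ^+ 2.
  rewrite -[leLHS]sqr_sqrtr; last by rewrite !mulr_ge0 ?invr_ge0 ?(ltW t0) ?dotv_ge0.
  by rewrite ler_sqr ?nnegrE ?sqrtr_ge0.
by rewrite mulrA -expr2 exprVn mulrC ler_pdivrMr ?exprn_gt0 // tt.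
Qed.

End operator_norm.

Lemma iid_std_normalP d (T : measurableType d) (R : realType) (P : probability T R) (I : finType)
    (Y : I -> {RV P >-> R}) : iid_std_normal Y -> iid_normal P (fun i => (Y i : T -> R)).
Proof.
move=> [ind law]; split=> [i|A mA]; first exact: measurable_funPT.
have := ind [set: I]%SET A (fun i _ => mA i).
have -> : \bigcap_(i in [set` [set: I]%SET]) (Y i @^-1` A i) = [set w | forall i, A i (Y i w)].
  by apply/seteqP; split => [w h i|w h i _]; [apply: h; rewrite /= inE|exact: h].
move=> ->; apply: eq_big => [i|i _]; first by rewrite inE.
exact: (law i (A i) (mA i)).
Qed.

Section feature_identities.
Context {R : realType} d (T : measurableType d) (P : probability T R)
  d' (T' : measurableType d') (P' : probability T' R).
Variables (n p q : nat) (X : 'M[R]_(p, q)) (sigma phi : R -> R) (ls lp : R).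
Hypotheses (hs : lip ls sigma) (hp : lip lp phi).
Variables (G : 'I_n * 'I_p -> {RV P >-> R}) (g : 'I_p -> {RV P' >-> R}).
Hypotheses (hG : iid_std_normal G) (hg : iid_std_normal g).

Local Notation m := (mean_feat X P' g sigma phi).

Lemma feature_gram w :
  gram_mx (feature_mx sigma phi X G w) =
  gram (smx X sigma phi P' g (tuple_of (fun k => (G k : T -> R)) w) + const_mx 1 *m m^T).
Proof.
rewrite /gram_mx /gram; set S := (_ + _); suff -> : feature_mx sigma phi X G w = S by [].
apply/matrixP => i k; rewrite /S !mxE big_ord1 !mxE mul1r addrNK; congr sigma.
by rewrite /preact; apply: eq_bigr => j _; rewrite !mxE.
Qed.

Lemma feature_PhiE : feature_Phi sigma phi X g = cov_feat X P' g sigma phi + m *m m^T.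
Proof.
have hY := iid_std_normalP hg.
have sv k := quartic_sqintegrable (quartic_feat X hY m k hs hp).
have iv k := sqintegrable_int (sv k).
apply/matrixP => k l.
have Ek : (m *m m^T) k l = m k 0 * m l 0 by rewrite mxE big_ord1 [m^T _ _]mxE.
rewrite mxE [RHS]mxE Ek [cov_feat _ _ _ _ _ k l]mxE.
pose v (j : 'I_q) w : R := (feat X sigma phi (tuple_of (fun i => (g i : T' -> R)) w) - m) j 0.
have i1 : rintegrable P' (fun w => v k w * v l w) := sqintegrableM (sv k) (sv l).
have i2 : rintegrable P' (fun w => m l 0 * v k w) := rintegrableZ (m l 0) (iv k).
have i3 : rintegrable P' (fun w => m k 0 * v l w) := rintegrableZ (m k 0) (iv l).
have mc j : \int[P']_w v j w = 0 := mean_centered X hY hs hp j.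
have E j w : feature_row sigma phi X g w 0 j = v j w + m j 0.
  rewrite /v [in RHS]mxE [(- m) _ _]mxE subrK !mxE; congr sigma; rewrite /preact; apply: eq_bigr => i _.
  by rewrite !mxE.
transitivity (\int[P']_w ((v k w * v l w + m l 0 * v k w) + (m k 0 * v l w + m k 0 * m l 0))).
  rewrite unlock; congr fine; apply: eq_integral => w _; congr EFin.
  by rewrite mxE big_ord1 [((_)^T) _ _]mxE !E; ring.
rewrite (RintD (rintegrableD i1 i2) (rintegrableD i3 (rintegrable_cst P' _))) (RintD i1 i2).
rewrite (RintD i3 (rintegrable_cst P' _)) (RintZ (m l 0) (iv k)) (RintZ (m k 0) (iv l)) Rint_cst.
by rewrite !mc !mulr0 addr0 add0r.
Qed.

End feature_identities.

Section spectral_integral.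
Context {R : realType} (q : nat).
Hypothesis q0 : (0 < q)%N.

Lemma esd_integral (s : q.-tuple R) (f : R -> R) : bmeas f ->
  \int[esd s]_t f t = q%:R^-1 * \sum_(x <- s) f x.
Proof.
move=> [mf [M fM]].
have E : (\int[esd s]_t (f t)%:E = (q%:R^-1 * \sum_(x <- s) f x)%:E)%E; last by rewrite /Rintegral E.
have ge0 (h : R -> R) : measurable_fun setT h -> (forall t, 0 <= h t) ->
    (\int[esd s]_t (h t)%:E = (q%:R^-1 * \sum_(x <- s) h x)%:E)%E.
  move=> mh h0; have mh' : measurable_fun setT (EFin \o h) by exact/measurable_EFinP.
  rewrite /esd ge0_integral_mscale //; last by move=> t _; rewrite lee_fin.
  rewrite ge0_integral_measure_sum //; last by move=> t _; rewrite lee_fin.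
  rewrite EFinM; congr (_ * _)%E.
  rewrite -sumEFin (big_nth 0) size_tuple big_mkord; apply: eq_bigr => k _.
  by rewrite integral_dirac // diracT mul1e.
have M0 : 0 <= M by apply: le_trans (fM 0).
have g1 := ge0 (fun t => f t + M) _ _; have g2 := ge0 (fun=> M) _ (fun=> M0).
have i2 : (esd s).-integrable setT (fun=> M%:E).
  apply/integrableP; split; first exact: measurable_cst.
  by under eq_integral do rewrite /= ger0_norm //; rewrite g2 ?ltry //; exact: measurable_cst.
have i1 : (esd s).-integrable setT (fun t => (f t + M)%:E).
  apply/integrableP; split; first by apply/measurable_EFinP; exact: measurable_funD.
  have p t : 0 <= f t + M by have := fM t; rewrite ler_norml => /andP[h _]; lra.
  by under eq_integral do rewrite /= ger0_norm //; rewrite g1 ?ltry //; exact: measurable_funD.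
have -> : (\int[esd s]_t (f t)%:E = \int[esd s]_t ((f t + M)%:E - M%:E))%E.
  by apply: eq_integral => t _; rewrite -EFinB addrK.
rewrite (integralB measurableT i1 i2) g1 ?g2 //.
- rewrite -EFinB -mulrBr; congr (_ * _)%:E; rewrite -sumrB.
  by apply: eq_bigr => x _; rewrite addrK.
- exact: measurable_funD.
- by move=> t; have := fM t; rewrite ler_norml => /andP[h _]; lra.
Qed.

Lemma spectrum_sum (A : 'M[R]_q) (s : q.-tuple R) : psdmx A -> is_spectrum A s ->
  (forall x, x \in (s : seq R) -> 0 <= x) /\
  forall z : R, 0 < z -> \sum_(x <- s) (z + `|x|)^-1 = \tr (res A z).
Proof.
move=> hA hs; have [e he] := spectral_dataP hA; have [e0 chi _ _] := he.
have pe : perm_eq s [seq e i | i <- enum 'I_q].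
  by apply: prod_XsubC_eq; rewrite -hs chi big_map -big_enum.
have s0 x : x \in (s : seq R) -> 0 <= x.
  by rewrite (perm_mem pe) => /mapP[i _ ->].
split=> // z z0; rewrite (perm_big _ pe) /= big_map big_enum /=.
have [h _] := spectral_res he ler01 z0; rewrite scale1r in h; rewrite h.
by apply: eq_bigr => i _; rewrite mul1r addrC ger0_norm.
Qed.

Lemma prob_functional_esd (A : 'M[R]_q) (s : q.-tuple R) : psdmx A -> is_spectrum A s ->
  prob_functional (fun f => \int[esd s]_t f t).
Proof.
move=> hA hs; have [s0 _] := spectrum_sum hA hs; split.
- move=> c f g hf hg; rewrite !esd_integral //; last exact: bmeasD.
  by rewrite big_split /= -mulr_sumr; ring.
- move=> f g hf hg fg; rewrite !esd_integral // ler_wpM2l ?invr_ge0 //.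
  by rewrite !big_seq; apply: ler_sum => x xs; apply: fg; exact: s0.
- rewrite esd_integral; last exact: bmeas_cst.
  by rewrite (big_nth 0) big_mkord sumr_const card_ord size_tuple mulVf // pnatr_eq0 -lt0n.
Qed.

End spectral_integral.

(** * Comparison of the mean resolvent with its equivalent *)

Ltac nonneg := repeat first [exact: sqr_ge0 | exact: sqrtr_ge0 | assumption | exact: ler0n | exact: ler01
  | apply: addr_ge0 | apply: mulr_ge0 | rewrite invr_ge0 | apply: exprn_ge0].

Section equivalent.
Context {R : realType} (ls lp K s c2 : R).
Hypotheses (s0 : 0 < s).
Local Notation b := (8 * (ls * lp * K) ^+ 2).
Local Notation kx := (3 * (4 * b ^+ 2 * (1 / s) ^+ 2 + (b / s) ^+ 2 + 2 * c2 * (b / s) ^+ 2)).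

(** [loo_error] at q = 1, with n/q replaced by its bound [c2]; the factor r = q^(-1/2), the slowest
    rate among the summands, is taken out in [loo_error_le]. *)
Definition loo_const (nu : R) : R :=
  let ky := 4 * b ^+ 2 * (s^-1 * nu / s) ^+ 2 in
  s^-1 * nu * b / s + Num.sqrt ky + s^-1 * nu / s * b * Num.sqrt kx + (ky + kx) / 2.

Let b0 : 0 <= b := bound_ge0 ls lp K.

Lemma loo_error_le (n q : nat) (r nu : R) : (0 < q)%N -> 0 < r -> r <= 1 -> r ^+ 2 = q%:R^-1 ->
  n%:R / q%:R <= c2 -> 0 <= nu -> loo_error n q ls lp K s nu <= loo_const nu * r.
Proof.
move=> q0 r0 r1 rq cc nu0; rewrite /loo_error /loo_const.
have c20 : 0 <= c2 by apply: le_trans cc; rewrite divr_ge0.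
have si : 0 <= s^-1 by rewrite invr_ge0 ltW.
have rr : r ^+ 2 <= r by rewrite expr2 ler_piMr // ltW.
set ky := 4 * b ^+ 2 * (s^-1 * nu / s) ^+ 2.
have ky0 : 0 <= ky by rewrite /ky; nonneg.
have kx0 : 0 <= kx by nonneg.
have E1 : ky / q%:R = ky * r ^+ 2 by rewrite rq.
rewrite E1; set kapx := 3 * (_ + _ + _).
have E2 : kapx <= kx * r ^+ 2.
  rewrite /kapx -[leRHS]mulrA ler_pM2l // [leRHS]mulrDl [X in _ <= X + _]mulrDl; apply: lerD; first apply: lerD.
  - by rewrite rq.
  - rewrite exprMn; apply: ler_wpM2l; first exact: sqr_ge0.
    rewrite -rq -[leRHS]mulr1 expr2; apply: ler_wpM2l; first exact: sqr_ge0.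
    by apply: (le_trans rr).
  - rewrite (_ : 2 * n%:R * (b / s / q%:R) ^+ 2 = 2 * (n%:R / q%:R) * (b / s) ^+ 2 * q%:R^-1); last by rewrite exprMn expr2; ring.
    rewrite rq; apply: ler_wpM2r; first by rewrite invr_ge0.
    by apply: ler_wpM2r; [exact: sqr_ge0|rewrite ler_pM2l].
have S1 : Num.sqrt (ky * r ^+ 2) = Num.sqrt ky * r by rewrite sqrtrM // sqrtr_sqr gtr0_norm.
have S2 : Num.sqrt kapx <= Num.sqrt kx * r.
  apply: (@le_trans _ _ (Num.sqrt (kx * r ^+ 2))); first by rewrite ler_wsqrtr.
  by rewrite sqrtrM // sqrtr_sqr gtr0_norm.
rewrite S1 [leRHS]mulrDl [X in _ <= X + _]mulrDl [X in _ <= X + _ + _]mulrDl.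
apply: lerD; [apply: lerD; [apply: lerD|]|].
- by rewrite -rq; apply: ler_wpM2l => //; nonneg.
- by [].
- by rewrite -[leRHS]mulrA; apply: ler_wpM2l => //; nonneg.
- have : ky * r ^+ 2 <= ky * r by apply: ler_wpM2l.
  have : kx * r ^+ 2 <= kx * r by apply: ler_wpM2l.
  rewrite [leRHS]mulrAC mulrDl; move: E2; lra.
Qed.

Lemma loo_error_ge0 (n q : nat) (nu : R) : 0 <= nu -> 0 <= loo_error n q ls lp K s nu.
Proof.
move=> nu0; have si : 0 <= s^-1 by rewrite invr_ge0 ltW.
by rewrite /loo_error; nonneg.
Qed.

Variable c1 : R.
Hypothesis c10 : 0 < c1.

(** The defect of [al] in the equation for Phi: the leave-one-out error for the covariance, plus the
    cost (1 + b/s)/c1 of the rank-one passage from the covariance to Phi. *)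
Definition equiv_const : R := c2 * loo_const b + (1 + b / s) / c1.

Lemma loo_const_ge0 nu : 0 <= c2 -> 0 <= nu -> 0 <= loo_const nu.
Proof.
move=> c20 nu0; have si : 0 <= s^-1 by rewrite invr_ge0 ltW.
by rewrite /loo_const; nonneg.
Qed.

Lemma mean_equivalent (n p q : nat) (X : 'M[R]_(p, q)) (sigma phi : R -> R)
    d (T : measurableType d) (P : probability T R) (Y : 'I_n * 'I_p -> T -> R)
    d' (T' : measurableType d') (P' : probability T' R) (g : 'I_p -> T' -> R) (r : R)
    (Phi : 'M[R]_q) (e : 'I_q -> R) (de : R) :
  lip ls sigma -> lip lp phi -> mbound X K -> (0 < q)%N -> (0 < n)%N ->
  iid_normal P Y -> iid_normal P' g ->
  0 < r -> r <= 1 -> r ^+ 2 = q%:R^-1 -> c1 <= n%:R / q%:R -> n%:R / q%:R <= c2 ->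
  Phi = cov_feat X P' g sigma phi + mean_feat X P' g sigma phi *m (mean_feat X P' g sigma phi)^T ->
  spectral_data Phi e -> 0 <= de -> de = fixf e (n%:R / q%:R) s de -> equiv_const * r <= 2^-1 ->
  de <= b / s + 2 * (equiv_const * r) * (1 + b / s) /\
  `|\int[P]_w tres X sigma phi s P' g 1%:M (tuple_of Y w) - fixg e (n%:R / q%:R) s de| <=
    (c2 * loo_const 1 + s^-1 + s^-1 * (2 * equiv_const * (1 + b / s))) * r.
Proof.
move=> hs hp hX q0 n0 hY hg r0 r1 rq cc1 cc2 PhiE he de0 dE small.
set c := n%:R / q%:R in cc1 cc2 dE *.
have q1 : 0 < q%:R :> R by rewrite ltr0n.
have cpos : 0 < c by apply: lt_le_trans cc1.
have c0 := ltW cpos.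
have c20 : 0 <= c2 by apply: le_trans cc2.
have si : 0 <= s^-1 by rewrite invr_ge0 ltW.
have rr : r ^+ 2 <= r by rewrite expr2 ler_piMr // ltW.
set Phi0 := cov_feat X P' g sigma phi in PhiE; set m := mean_feat X P' g sigma phi in PhiE.
have pPhi0 : psdmx Phi0 := cov_psd X hg hs hp.
have [e' he'] := spectral_dataP pPhi0.
have e0 : forall i, 0 <= e i by case: he.
have e0' : forall i, 0 <= e' i by case: he'.
have M0 := cov_mbound hg hs hp hX.
pose al := \int[P]_w tres X sigma phi s P' g Phi0 (tuple_of Y w).
have al0 : 0 <= al by apply: alpha_ge0; eassumption.
have alb : al <= b / s := alpha_le hs hp hX s0 q0 hY hg.
have A1 : 0 < 1 + al by rewrite ltr_pwDl.
have a0 : 0 <= c / (1 + al) by rewrite divr_ge0 // ltW.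
have [tg0 tf0] := spectral_res he' a0 s0; have [tg _] := spectral_res he a0 s0.
have h1 : `|al - fixf e' c s al| <= c2 * loo_const b * r.
  have := loo_mean_estimate hs hp hX s0 q0 hY hg M0; rewrite -/Phi0 -/al -/c tf0 => /le_trans; apply.
  rewrite -[leRHS]mulrA; apply: ler_pM => //; last by apply: loo_error_le => //; exact: bound_ge0.
  by apply: loo_error_ge0 => //; exact: bound_ge0.
have h2 : `|\int[P]_w tres X sigma phi s P' g 1%:M (tuple_of Y w) - fixg e' c s al| <= c2 * loo_const 1 * r.
  have := loo_mean_estimate hs hp hX s0 q0 hY hg (mbound1 q); rewrite -/Phi0 -/al -/c mul1mx tg0 => /le_trans; apply.
  rewrite -[leRHS]mulrA; apply: ler_pM => //; last by apply: loo_error_le => //; exact: bound_ge0.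
  by apply: loo_error_ge0 => //; exact: bound_ge0.
have h3 : `|fixg e' c s al - fixg e c s al| <= s^-1 / q%:R.
  rewrite /fixg -tg0 -tg -mulrBr normrM ger0_norm ?invr_ge0 // mulrC ler_wpM2r ?invr_ge0 //.
  have := trace_res_rank_one m (psdmxZ a0 pPhi0) s0 a0 (mbound1 q).
  by rewrite !mul1mx -scalerDr -PhiE mul1r.
(* [fixf] involves the matrix also outside the resolvent, so the rank-one bound is not applied to it
   directly: [fix_identity] expresses it by [fixg], and solving for it divides by c, at least
   [c1]. *)
have h4 : `|fixf e' c s al - fixf e c s al| <= (1 + b / s) / c1 * r.
  have I1 := fix_identity e0' c0 s0 q0 al0; have I2 := fix_identity e0 c0 s0 q0 al0.
  have E : c * (fixf e' c s al - fixf e c s al) = (1 + al) * (s * (fixg e c s al - fixg e' c s al)).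
    have -> : s * (fixg e c s al - fixg e' c s al) = c / (1 + al) * fixf e' c s al - c / (1 + al) * fixf e c s al.
      by rewrite I1 I2; ring.
    by field; rewrite gt_eqF.
  have F : c * `|fixf e' c s al - fixf e c s al| <= (1 + b / s) * r.
    rewrite -[X in X * _](ger0_norm c0) -normrM E normrM [`|1 + al|]ger0_norm ?(ltW A1) // normrM [`|s|]ger0_norm ?(ltW s0) //.
    apply: ler_pM; [exact: ltW|by rewrite mulr_ge0 // ltW|by rewrite lerD2l|].
    rewrite distrC; apply: (@le_trans _ _ (s * (s^-1 / q%:R))); first by rewrite ler_pM2l.
    by rewrite mulrA mulfV ?gt_eqF // mul1r -rq.
  rewrite mulrAC ler_pdivlMr //; apply: le_trans F; rewrite mulrC; exact: ler_wpM2r.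
have h5 : `|al - fixf e c s al| <= equiv_const * r.
  rewrite (_ : al - fixf e c s al = (al - fixf e' c s al) + (fixf e' c s al - fixf e c s al)); last by ring.
  by apply: (le_trans (ler_normD _ _)); rewrite /equiv_const mulrDl; exact: lerD.
have E0 : 0 <= equiv_const * r by apply: le_trans h5.
have lt1 : equiv_const * r < 1 by apply: (le_lt_trans small); rewrite invf_lt1 // ltr1n.
have h6 : `|al - de| <= 2 * (equiv_const * r) * (1 + b / s).
  apply: (le_trans (fix_stability e0 c0 s0 al0 de0 dE h5 lt1)).
  rewrite ler_pdivrMr ?subr_gt0 //; set x := equiv_const * r in small E0 *.
  have h : x * (1 + al) <= x * (1 + b / s) by rewrite ler_wpM2l // lerD2l.
  apply: (le_trans h); have y0 : 0 <= x * (1 + b / s) by apply: le_trans h; rewrite mulr_ge0 // ltW.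
  rewrite (_ : 2 * x * (1 + b / s) * (1 - x) = (x * (1 + b / s)) * (2 * (1 - x))); last by ring.
  by rewrite ler_peMr //; lra.
split.
  by have := ler_norm (de - al); rewrite distrC; move: h6 alb; lra.
have h7 := fixg_lip e0 c0 s0 q0 al0 de0.
have h8 : s^-1 * `|al - de| <= s^-1 * (2 * (equiv_const * r) * (1 + b / s)) by apply: ler_wpM2l.
have h9 : s^-1 / q%:R <= s^-1 * r by rewrite -rq; apply: ler_wpM2l.
set t := \int[P]_w _ in h2 *.
rewrite (_ : t - fixg e c s de = (t - fixg e' c s al) + (fixg e' c s al - fixg e c s al) + (fixg e c s al - fixg e c s de)); last by ring.
apply: (le_trans (ler_normD _ _)); apply: (le_trans (lerD (ler_normD _ _) h7)).
apply: (le_trans (lerD (lerD h2 (le_trans h3 h9)) h8)).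
by rewrite le_eqVlt; apply/orP; left; apply/eqP; ring.
Qed.

End equivalent.

Lemma prob_functional_prob (R : realType) (mu : probability R R) : mu `]-oo, 0[%classic = 0%E ->
  prob_functional (fun f => \int[mu]_t f t).
Proof.
move=> neg.
have bi f : bmeas f -> rintegrable mu f by move=> [mf [M fM]]; exact: (@rintegrable_bounded _ _ _ mu f M mf fM).
split.
- move=> c f g hf hg; have i1 := bi _ hf; have i2 := bi _ hg.
  by rewrite (RintD i1 (rintegrableZ c i2)) (RintZ c i2).
- move=> f g hf hg fg; have i1 := bi _ hf; have i2 := bi _ hg.
  have [mf [M fM]] := hf; have [mg [M' gM']] := hg.
  have bI : bmeas (\1_(`]-oo, (0 : R)[%classic)).
    split; first exact: measurable_indic.
    by exists 1 => t; rewrite indicE ger0_norm // lern1 leq_b1.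
  have i3 := bi _ bI.
  have z : \int[mu]_t \1_(`]-oo, (0 : R)[%classic) t = 0.
    rewrite /Rintegral integral_indic // setIT; exact: (congr1 fine neg).
  apply: (@le_trans _ _ (\int[mu]_t (g t + (M + M') * \1_(`]-oo, (0 : R)[%classic) t))); last first.
    by rewrite (RintD i2 (rintegrableZ _ i3)) (RintZ _ i3) z mulr0 addr0.
  apply: Rint_le => //; first by apply: rintegrableD => //; exact: rintegrableZ.
  move=> t; rewrite indicE mem_setE in_itv /=; case: (ltP t 0) => t0; last by rewrite mulr0 addr0 fg.
  by rewrite mulr1; have := fM t; have := gM' t; rewrite !ler_norml => /andP[? ?] /andP[? ?]; lra.
- exact: Rint_cst.
Qed.

Lemma inv_sqrt_small (R : realType) (q : nat -> nat) (m eps : R) : 0 < m -> 0 < eps ->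
  (forall k, m * k.+1%:R <= (q k)%:R) -> \forall k \near \oo, (Num.sqrt (q k)%:R)^-1 <= eps.
Proof.
move=> m0 e0 hq; exists (Num.truncn (m * eps ^+ 2)^-1).+1 => // k /= hk.
have x0 : 0 < m * eps ^+ 2 by rewrite mulr_gt0 // exprn_gt0.
have h1 : (m * eps ^+ 2)^-1 < k.+1%:R.
  by apply: (lt_le_trans (truncnS_gt _)); rewrite ler_nat leqW.
have h2 : eps ^- 2 <= (q k)%:R.
  apply: le_trans (hq k); move: h1; rewrite invfM ltr_pdivrMl // => /ltW; exact: le_trans.
rewrite -[eps]invrK lef_pV2 ?posrE ?invr_gt0 //; last first.
  by rewrite sqrtr_gt0 (lt_le_trans _ h2) // invr_gt0 exprn_gt0.
rewrite -[leLHS]gtr0_norm ?invr_gt0 // -sqrtr_sqr exprVn ler_wsqrtr //.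
Qed.

(** * Assembly along the sequence of dimensions *)

Section sequences.
Context {R : realType} d (Omega : measurableType d) (P : probability Omega R)
  d' (Omega' : measurableType d') (P' : probability Omega' R).
Variables (sigma phi : R -> R) (ls lp : R).
Hypotheses (hs : lip ls sigma) (hp : lip lp phi).
Variables (p T : nat -> nat) (X : forall n, 'M[R]_(p n, T n)).
Variables (G : forall n, 'I_n * 'I_(p n) -> {RV P >-> R}) (hG : forall n, iid_std_normal (@G n)).
Variables (g : forall n, 'I_(p n) -> {RV P' >-> R}) (hg : forall n, iid_std_normal (@g n)).
Variables (lam : forall n, Omega -> (T n).-tuple R).
Hypothesis hlam : forall n (w : Omega),
    is_spectrum (gram_mx (feature_mx sigma phi (X n) (@G n) w)) (lam n w).

Local Notation Phi n := (feature_Phi sigma phi (X n) (@g n)).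
Local Notation gn n := (fun i => (@g n i : Omega' -> R)).
Local Notation Yn n := (fun i => (@G n i : Omega -> R)).
Local Notation m n := (mean_feat (X n) P' (gn n) sigma phi).

Lemma feature_Phi_psd n : psdmx (Phi n).
Proof.
rewrite (feature_PhiE (X n) hs hp (@hg n)) -[m n *m _]scale1r.
by apply: psdmx_rank_one => //; apply: (cov_psd _ (iid_std_normalP (@hg n)) hs hp).
Qed.

Lemma feature_gram_psd n w : psdmx (gram_mx (feature_mx sigma phi (X n) (@G n) w)).
Proof. exact: gram_psd. Qed.

Definition deterministic_measure n (mu : probability R R) : Prop :=
  exists e, [/\ spectral_data (Phi n) e, is_mubar n (Phi n) mu, mu `]-oo, 0[%classic = 0%E &
  forall s : R, 0 < s -> exists de : R, [/\ 0 <= de, de = fixf e (n%:R / (T n)%:R) s de &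
    \int[mu]_t resolvent s t = fixg e (n%:R / (T n)%:R) s de]].

Lemma deterministic_measure_exists n : (0 < T n)%N -> exists mu, deterministic_measure n mu.
Proof.
move=> T0; have [e he] := spectral_dataP (feature_Phi_psd n).
by have [mu [h1 h2 h3]] := mubar_exists n T0 he; exists mu, e.
Qed.

Variables (K c1 c2 eta : R) (N1 : nat).
Hypotheses (c10 : 0 < c1) (eta0 : 0 < eta).
Hypothesis n_gt0 : forall n, (N1 <= n)%N -> (0 < n)%N.
Hypothesis T_gt0 : forall n, (N1 <= n)%N -> (0 < T n)%N.
Hypothesis c1_le : forall n, (N1 <= n)%N -> c1 <= n%:R / (T n)%:R.
Hypothesis c2_ge : forall n, (N1 <= n)%N -> n%:R / (T n)%:R <= c2.
Hypothesis T_ge : forall n, (N1 <= n)%N -> eta * n%:R <= (T n)%:R.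
Hypothesis X_le : forall n, (N1 <= n)%N -> mbound (X n) K.
Variable mu : nat -> probability R R.
Hypothesis mu_det : forall n, (N1 <= n)%N -> deterministic_measure n (mu n).

(** Starting at [N1] makes all bounds available for every k, as the summability argument
    requires. *)
Local Notation nn k := (k + N1)%N.
Let N1n k : (N1 <= nn k)%N. Proof. exact: leq_addl. Qed.
Let r k : R := (Num.sqrt (T (nn k))%:R)^-1.

Let Tk k : 0 < (T (nn k))%:R :> R. Proof. by rewrite ltr0n T_gt0. Qed.
Let r_gt0 k : 0 < r k. Proof. by rewrite invr_gt0 sqrtr_gt0. Qed.
Let r_sq k : r k ^+ 2 = (T (nn k))%:R^-1. Proof. by rewrite exprVn sqr_sqrtr // ltW. Qed.
Let r_le1 k : r k <= 1.
Proof. by rewrite -(@expr_le1 _ 2) ?(ltW (r_gt0 k)) // r_sq invf_le1 // ler1n T_gt0. Qed.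

Let nk k : k.+1%:R <= (nn k)%:R :> R.
Proof. by rewrite ler_nat -addn1 leq_add2l; have := n_gt0 (leqnn N1). Qed.

Let r_small eps : 0 < eps -> \forall k \near \oo, r k <= eps.
Proof.
move=> e0; apply: (inv_sqrt_small eta0 e0) => k; apply: le_trans (T_ge (N1n k)).
by rewrite ler_pM2l.
Qed.

Let c20 : 0 <= c2.
Proof. by apply: le_trans (c2_ge (leqnn N1)); rewrite divr_ge0. Qed.

Section fixed_s.
Variable s : R.
Hypothesis s0 : 0 < s.
Local Notation b := (8 * (ls * lp * K) ^+ 2).
Local Notation E0 := (equiv_const ls lp K s c2 c1).

Let t k w := tres (X (nn k)) sigma phi s P' (gn (nn k)) 1%:M (tuple_of (Yn (nn k)) w).
Let Et k := \int[P]_w t k w.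
Let C := c2 * loo_const ls lp K s c2 1 + s^-1 + s^-1 * (2 * E0 * (1 + b / s)).

Let E00 : 0 <= E0.
Proof.
have b0 := bound_ge0 ls lp K.
apply: addr_ge0; first by apply: mulr_ge0 => //; exact: loo_const_ge0.
by rewrite divr_ge0 ?(ltW c10) // addr_ge0 // divr_ge0 // ltW.
Qed.

(** By [fix_identity], 1 - s m(-s) = c de/(1 + de) <= c2 de, and [de] is at most b/s up to a
    multiple of [r k]: this gives tightness as s grows. *)
Lemma deterministic_estimate k : E0 * r k <= 2^-1 ->
  1 - s * \int[mu (nn k)]_x resolvent s x <= c2 * (b / s + 2 * (E0 * r k) * (1 + b / s)) /\
  `|Et k - \int[mu (nn k)]_x resolvent s x| <= C * r k.
Proof.
move=> small; have [e [he _ _ H]] := mu_det (N1n k); have [de [de0 dE ->]] := H s s0.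
have [h1 h2] := mean_equivalent s0 c10 hs hp (X_le (N1n k)) (T_gt0 (N1n k)) (n_gt0 (N1n k))
  (iid_std_normalP (@hG (nn k))) (iid_std_normalP (@hg (nn k))) (r_gt0 k) (r_le1 k) (r_sq k) (c1_le (N1n k))
  (c2_ge (N1n k)) (feature_PhiE (X (nn k)) hs hp (@hg (nn k))) he de0 dE small.
split; last exact: h2.
have e0 : forall i, 0 <= e i by case: he.
have cn : 0 <= (nn k)%:R / (T (nn k))%:R :> R by rewrite divr_ge0.
have := fix_identity e0 cn s0 (T_gt0 (N1n k)) de0; rewrite -dE => <-.
apply: (@le_trans _ _ (c2 * de)); last by rewrite ler_wpM2l.
apply: ler_wpM2r => //; apply: le_trans (c2_ge (N1n k)).
by rewrite ler_piMr // invf_le1 ?ltr_pwDl // lerDl.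
Qed.

Lemma empirical_estimate k w :
  `|\int[esd (lam (nn k) w)]_x resolvent s x - t k w| <= 2 / s * r k.
Proof.
have T0 := T_gt0 (N1n k).
have [_ hsum] := spectrum_sum (feature_gram_psd (nn k) w) (@hlam (nn k) w).
rewrite (esd_integral _ (bmeas_resolvent s0)) hsum // (feature_gram (X (nn k)) sigma phi (@G (nn k)) (@g (nn k))).
rewrite /t /tres mul1mx -mulrBr normrM ger0_norm ?invr_ge0 // distrC -r_sq.
have h := trace_res_shift (n_gt0 (N1n k)) s0 (smx (X (nn k)) sigma phi P' (gn (nn k)) (tuple_of (Yn (nn k)) w)) (m (nn k)).
apply: (@le_trans _ _ (r k ^+ 2 * (2 / s))); first by rewrite ler_wpM2l // sqr_ge0.
rewrite mulrC ler_wpM2l ?divr_ge0 ?(ltW s0) // expr2 ler_piMr ?(ltW (r_gt0 k)) //.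
Qed.

Let mt k : measurable_fun setT (t k).
Proof.
have hY := iid_std_normalP (@hG (nn k)).
have mtr : measurable_fun setT (tres (n := nn k) (X (nn k)) sigma phi s P' (gn (nn k)) 1%:M).
  by apply: measurable_tres; first [eassumption|exact: T_gt0].
have mY : measurable_fun setT (tuple_of (Yn (nn k))).
  by apply: measurable_family => i; have [mm _] := hY; exact: mm.
exact: (measurableT_comp mtr mY).
Qed.

Let t_bd k w : `|t k w| <= 1 / s.
Proof. by apply: tres_bound => //; [exact: T_gt0|exact: mbound1]. Qed.

(** Squares are fed to [almost_sure_cvg0]: the variance bound decays like 1/k only, the fourth
    moment bound like 1/k^2. *)
Lemma random_fluctuation : {ae P, forall w, (t k w - Et k) ^+ 2 @[k --> \oo] --> (0 : R)}.
Proof.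
apply: (@almost_sure_cvg0 R _ _ P (fun k w => (t k w - Et k) ^+ 2) (40 * c2 ^+ 4 / s ^+ 4)).
- by move=> k; apply: measurable_funX; apply: measurable_funB; [exact: mt|exact: measurable_cst].
- move=> k; have mk := mt k.
  apply: (@sqintegrable_bounded _ _ _ _ _ ((1 / s + `|Et k|) ^+ 2)).
    by apply: measurable_funX; exact: measurable_funB.
  move=> w; rewrite normrX ler_sqr ?nnegrE ?addr_ge0 ?divr_ge0 ?(ltW s0) //.
  by apply: (le_trans (ler_normB _ _)); rewrite lerD2r.
- move=> k; have T0 := T_gt0 (N1n k).
  have := tres_moment4 (X (nn k)) hs hp s0 T0 P' (gn (nn k)) (iid_std_normalP (@hG (nn k))) (n_gt0 (N1n k)) (mbound1 _).
  move=> /le_trans; apply.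
  have n1 : 0 < (nn k)%:R :> R by rewrite ltr0n n_gt0.
  have -> : 40 * (nn k)%:R ^+ 2 * (1 / s / (T (nn k))%:R) ^+ 4 =
     (40 / s ^+ 4) * (((nn k)%:R / (T (nn k))%:R) ^+ 4 * (((nn k)%:R : R) ^+ 2)^-1).
    by move: ((nn k)%:R : R) n1 ((T (nn k))%:R : R) (Tk k) => x x0 y y0; field; rewrite !gt_eqF.
  have -> : 40 * c2 ^+ 4 / s ^+ 4 / k.+1%:R ^+ 2 = (40 / s ^+ 4) * (c2 ^+ 4 * ((k.+1%:R : R) ^+ 2)^-1).
    by ring.
  apply: ler_wpM2l; first by rewrite divr_ge0 // exprn_ge0 // ltW.
  apply: ler_pM; rewrite ?invr_ge0 ?sqr_ge0 ?exprn_ge0 ?divr_ge0 //.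
    by rewrite lerXn2r ?nnegrE ?divr_ge0 // c2_ge.
  by rewrite lef_pV2 ?posrE ?exprn_gt0 // lerXn2r ?nnegrE.
Qed.

Lemma resolvent_almost_sure : {ae P, forall w,
  (\int[esd (lam (nn k) w)]_x resolvent s x - \int[mu (nn k)]_x resolvent s x) @[k --> \oo] --> (0 : R)}.
Proof.
apply: filterS random_fluctuation => w hw; apply/cvgrPdist_le => eps e0.
have D0 : 0 <= 2 / s + `|C| by rewrite addr_ge0 // divr_ge0 // ltW.
have e20 : 0 < eps / 2 by rewrite divr_gt0.
have [r1 r2] : 0 < eps / 2 / (2 / s + `|C| + 1) /\ 0 < 2^-1 / (E0 + 1).
  by split; rewrite divr_gt0 // ltr_wpDl.
have /cvgrPdist_le/(_ ((eps / 2) ^+ 2)) := hw; rewrite exprn_gt0 // => /(_ isT) hD.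
near=> k; rewrite sub0r normrN.
have d1 : `|t k w - Et k| <= eps / 2.
  have : `|0 - (t k w - Et k) ^+ 2| <= (eps / 2) ^+ 2 by near: k.
  by rewrite sub0r normrN normrX ler_sqr // nnegrE ltW.
have d2 : r k <= eps / 2 / (2 / s + `|C| + 1) by near: k; exact: r_small.
have d3 : r k <= 2^-1 / (E0 + 1) by near: k; exact: r_small.
have small : E0 * r k <= 2^-1.
  move: d3; rewrite ler_pdivlMr ?ltr_wpDl // mulrDr mulr1 [r k * E0]mulrC; have := r_gt0 k; lra.
have [_ h2] := deterministic_estimate small; have h3 := empirical_estimate k w.
have h4 : C * r k <= `|C| * r k by rewrite ler_wpM2r ?ler_norm // ltW.
have h5 : (2 / s + `|C|) * r k <= eps / 2.
  move: d2; rewrite ler_pdivlMr ?ltr_wpDl // mulrDr mulr1 [r k * _]mulrC; have := r_gt0 k; lra.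
set A := \int[esd _]_x _ in h3 *; set B := \int[mu _]_x _ in h2 *.
rewrite (_ : A - B = (A - t k w) + (t k w - Et k) + (Et k - B)); last by ring.
apply: (le_trans (ler_normD _ _)); apply: (le_trans (lerD (ler_normD _ _) (le_trans h2 h4))).
move: h3 d1 h5; rewrite mulrDl; lra.
Unshelve. all: by end_near. Qed.

End fixed_s.

(** [i] makes c2 b/s at most eps/2; with s fixed, the remainder of the estimate is a multiple of
    [r k]. *)
Lemma deterministic_tight (eps : R) : 0 < eps -> exists i : nat, \forall k \near \oo,
  1 - (1 + i%:R) * \int[mu (nn k)]_x resolvent (1 + i%:R) x <= eps.
Proof.
move=> e0; set b := 8 * (ls * lp * K) ^+ 2; have b0 : 0 <= b := bound_ge0 ls lp K.
pose i := (Num.truncn (c2 * b / (eps / 2))).+1; exists i; set s : R := 1 + i%:R.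
have s1 : 1 <= s by rewrite lerDl.
have s0 : 0 < s by apply: lt_le_trans s1.
have hi : c2 * b / (eps / 2) < s by apply: (lt_le_trans (truncnS_gt _)); rewrite lerDr.
have cb : c2 * (b / s) <= eps / 2.
  rewrite mulrA ler_pdivrMr // [leRHS]mulrC -ler_pdivrMr ?divr_gt0 //; exact: ltW.
pose E0 := equiv_const ls lp K s c2 c1.
have E00 : 0 <= E0.
  apply: addr_ge0; first by apply: mulr_ge0 => //; exact: loo_const_ge0.
  by rewrite divr_ge0 ?(ltW c10) // addr_ge0 // divr_ge0 // ltW.
pose D := c2 * (2 * E0 * (1 + b / s)).
have D0 : 0 <= D by rewrite !mulr_ge0 // addr_ge0 // divr_ge0 // ltW.
near=> k.
have d2 : r k <= eps / 2 / (D + 1) by near: k; apply: r_small; rewrite !divr_gt0 // ltr_wpDl.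
have d3 : r k <= 2^-1 / (E0 + 1) by near: k; apply: r_small; rewrite divr_gt0 // ltr_wpDl.
have small : E0 * r k <= 2^-1.
  move: d3; rewrite ler_pdivlMr ?ltr_wpDl // mulrDr mulr1 [r k * E0]mulrC; have := r_gt0 k; lra.
have [h1 _] := deterministic_estimate s0 small; apply: (le_trans h1).
have h5 : D * r k <= eps / 2.
  move: d2; rewrite ler_pdivlMr ?ltr_wpDl // mulrDr mulr1 [r k * D]mulrC; have := r_gt0 k; lra.
rewrite mulrDr -/b -/E0 (_ : c2 * (2 * (E0 * r k) * (1 + b / s)) = D * r k); last by rewrite /D; ring.
lra.
Unshelve. all: by end_near. Qed.

Lemma empirical_cvg (f : R -> R) : continuous f -> bounded_fun f ->
  {ae P, forall w, (fun n : nat => \int[esd (lam n w)]_t f t - \int[mu n]_t f t) @ \oo --> (0 : R)}.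
Proof.
move=> cf [M [_ bf]].
have fM : exists M' : R, forall t, `|f t| <= M'.
  by exists (M + 1) => t; apply: (bf (M + 1)) => //; rewrite ltrDl.
(* Countably many points s suffice for the weak convergence, so a single null set serves for all of
   them. *)
have H : {ae P, forall w, forall i N : nat, (\int[esd (lam (nn k) w)]_x resolvent (1 + i%:R / N.+1%:R) x -
   \int[mu (nn k)]_x resolvent (1 + i%:R / N.+1%:R) x) @[k --> \oo] --> (0 : R)}.
  apply: ae_foralln => i; apply: ae_foralln => N; apply: resolvent_almost_sure.
  by rewrite ltr_pwDl // divr_ge0.
apply: filterS H => w hw.
rewrite -(cvg_shiftn N1).
apply: (@weak_convergence_of_resolvents R (fun k f => \int[esd (lam (nn k) w)]_x f x) (fun k f => \int[mu (nn k)]_x f x)) => //.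
- move=> k; exact: (prob_functional_esd (T_gt0 (N1n k)) (feature_gram_psd (nn k) w) (@hlam (nn k) w)).
- by move=> k; apply: prob_functional_prob; have [e [_ _ ? _]] := mu_det (N1n k).
- exact: deterministic_tight.
Qed.

End sequences.

Theorem theorem2
  (R : realType)
  (d : measure_display) (Omega : measurableType d) (P : probability Omega R)
  (d' : measure_display) (Omega' : measurableType d') (P' : probability Omega' R)
  (sigma phi : R -> R) (lsigma lphi : R)
  (lsigma_gt0 : 0 < lsigma) (lphi_gt0 : 0 < lphi)
  (sigma_lip : lsigma.-lipschitz sigma) (phi_lip : lphi.-lipschitz phi)
  (p T : nat -> nat) (X : forall n, 'M[R]_(p n, T n))
  (* entries of the n x p(n) Gaussian matrix *)
  (G : forall n, 'I_n * 'I_(p n) -> {RV P >-> R})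
  (G_iid : forall n, iid_std_normal (@G n))
  (* the N(0, I_p(n)) vector through which Phi is defined *)
  (g : forall n, 'I_(p n) -> {RV P' >-> R})
  (g_iid : forall n, iid_std_normal (@g n))
  (ratio_liminf :
    (0 < limn_einf (fun n : nat =>
       (Num.min ((p n)%:R / n%:R) ((T n)%:R / n%:R) : R)%:E))%E)
  (ratio_limsup :
    (limn_esup (fun n : nat =>
       (Num.max ((p n)%:R / n%:R) ((T n)%:R / n%:R) : R)%:E) < +oo)%E)
  (X_limsup : (limn_esup (fun n : nat => (opnorm (X n))%:E) < +oo)%E)
  (lam : forall n, Omega -> (T n).-tuple R)
  (lam_spectrum : forall n (w : Omega),
    is_spectrum (gram_mx (feature_mx sigma phi (X n) (@G n) w)) (lam n w)) :
  let Phi n : 'M[R]_(T n) := feature_Phi sigma phi (X n) (@g n) in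
  (forall n, (0 < T n)%N -> forall z : R[i], 0 < complex.Im z ->
     exists! delta : R[i], is_delta n (Phi n) z delta) /\
  exists mubar : nat -> probability R R,
    (forall n, (0 < T n)%N ->
       is_mubar n (Phi n) (mubar n) /\
       forall nu : {finite_measure set R -> \bar R},
         is_mubar n (Phi n) nu ->
         forall A : set R, measurable A -> nu A = mubar n A) /\
    forall f : R -> R, continuous f -> bounded_fun f ->
      {ae P, forall w,
         (fun n : nat => \int[esd (lam n w)]_t f t - \int[mubar n]_t f t)
           @ \oo --> (0 : R)}.
Proof.
move=> Phi.
have hs : lip lsigma sigma by move=> x y; exact: (sigma_lip (x, y) (conj I I)).
have hp : lip lphi phi by move=> x y; exact: (phi_lip (x, y) (conj I I)).
have psd n : psdmx (Phi n) by apply: feature_Phi_psd; eassumption.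
split=> [n T0 z y0|].
  by have [e he] := spectral_dataP (psd n); exact: (is_delta_unique n T0 he y0).
have /choice[mu hmu] : forall n, exists mu : probability R R, (0 < T n)%N ->
    @deterministic_measure R _ _ P' sigma phi p T X g n mu.
  (* For T n = 0 no property is required of the measure, and the Dirac mass at 0 is a default. *)
  move=> n; have [T0|T0] := posnP (T n); first by exists (\d_(0 : R) : probability R R).
  have [mu hmu] : exists mu, @deterministic_measure R _ _ P' sigma phi p T X g n mu.
    by apply: deterministic_measure_exists; eassumption.
  by exists mu.
exists mu; split.
  move=> n T0; have [e [he hm _ _]] := hmu n T0; split => // nu hnu A mA.
  exact: (mubar_unique T0 he hnu hm).
have [eta eta0 h1] := limn_einf_gt0 ratio_liminf.
have [M h2] := limn_esup_lty ratio_limsup.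
have [K h3] := limn_esup_lty X_limsup.
have [N1 _ hN] : \forall n \near \oo, [/\ eta <= Num.min ((p n)%:R / n%:R) ((T n)%:R / n%:R),
    Num.max ((p n)%:R / n%:R) ((T n)%:R / n%:R) <= M & opnorm (X n) <= K].
  by near=> n; split; near: n.
have lo n : (N1 <= n)%N -> eta <= (T n)%:R / n%:R.
  by move=> /hN[h _ _]; apply: (le_trans h); rewrite ge_min lexx orbT.
have hi n : (N1 <= n)%N -> (T n)%:R / n%:R <= M.
  by move=> /hN[_ h _]; apply: le_trans h; rewrite le_max lexx orbT.
(* At n = 0 the ratio is 0 by the convention on division, hence below [eta]. *)
have n0 n : (N1 <= n)%N -> (0 < n)%N.
  move=> /lo h; rewrite lt0n; apply/eqP => e; move: h; rewrite e invr0 mulr0 leNgt eta0 //.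
have n0R n : (N1 <= n)%N -> 0 < n%:R :> R by move=> /n0; rewrite ltr0n.
have T0R n : (N1 <= n)%N -> 0 < (T n)%:R :> R.
  by move=> h; have := lt_le_trans eta0 (lo n h); rewrite pmulr_lgt0 // invr_gt0 n0R.
have M0 : 0 < M by apply: lt_le_trans (hi N1 (leqnn _)); apply: lt_le_trans (lo N1 (leqnn _)).
have inv n : n%:R / (T n)%:R = ((T n)%:R / n%:R)^-1 :> R by rewrite invf_div.
move=> f cf bf.
(* T/n lies between [eta] and [M], while the estimates use n/T; hence the inverses. *)
apply: (@empirical_cvg R _ _ P _ _ P' sigma phi lsigma lphi hs hp p T X G G_iid g g_iid lam lam_spectrum
  K M^-1 eta^-1 eta N1 _ eta0 n0 _ _ _ _ _ mu _ f cf bf).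
- by rewrite invr_gt0.
- by move=> n h; have := T0R n h; rewrite ltr0n.
- by move=> n h; rewrite inv lef_pV2 ?posrE ?hi // divr_gt0 ?T0R ?n0R.
- by move=> n h; rewrite inv lef_pV2 ?posrE ?lo // divr_gt0 ?T0R ?n0R.
- by move=> n h; have := lo n h; rewrite ler_pdivlMr ?n0R.
- by move=> n h; have [_ _ hK] := hN n h; exact: mbound_le hK (opnorm_mbound (X n)).
- by move=> n h; apply: hmu; have := T0R n h; rewrite ltr0n.
Unshelve. all: by end_near. Qed.
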